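(* Let $1<p<\infty$ and $0<\alpha<\infty$. For the Cesàro operator $\mathsf{C}$ acting on the Fréchet space $A^p_{\alpha+}$ the following hold: (1) $\left\{\frac1m: m\in\mathbb{N},\ m<\frac{2+\alpha}{p}\right\}\subseteq\sigma_{pt}(\mathsf{C};A^p_{\alpha+})\subseteq\left\{\frac1m: m\in\mathbb{N},\ m\le\frac{2+\alpha}{p}\right\}$. (2) $\sigma(\mathsf{C};A^p_{\alpha+})=\{0\}\cup D_{\frac{2+\alpha}{p}}\cup\sigma_{pt}(\mathsf{C};A^p_{\alpha+})$. (3) $\sigma^*(\mathsf{C};A^p_{\alpha+})=\overline{\sigma(\mathsf{C};A^p_{\alpha+})}$.
   Context: $\mathbb{D}=\{z\in\mathbb{C}:|z|<1\}$, $H(\mathbb{D})$ is the space of all analytic functions on $\mathbb{D}$, and $\mathbb{N}=\{1,2,\dots\}$. For $1<p<\infty$ and $0<\mu<\infty$, the weighted Bergman space $A^p_\mu$ is the Banach space of all $f\in H(\mathbb{D})$ with $\|f\|_{p,\mu}:=\left(\int_{\mathbb{D}}|f(z)|^p(1-|z|)^\mu\,ds(z)\right)^{1/p}<\infty$, where $ds(z)=\frac1\pi\,dx\,dy$. For $0<\alpha<\infty$, $A^p_{\alpha+}:=\bigcap_{\mu>\alpha}A^p_\mu=\bigcap_{n\in\mathbb{N}}A^p_{\alpha+1/n}$, a Fréchet space with the topology generated by the increasing sequence of norms $\|\cdot\|_{p,\alpha+1/n}$, $n\in\mathbb{N}$. The Cesàro operator is $\mathsf{C}(f)(z)=\frac1z\int_0^z\frac{f(\zeta)}{1-\zeta}\,d\zeta$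 for $z\in\mathbb{D}\setminus\{0\}$, $\mathsf{C}(f)(0)=f(0)$, for $f\in H(\mathbb{D})$. It restricts to a continuous linear operator on $A^p_{\alpha+}$. For a locally convex Hausdorff space $X$, $\mathcal{L}(X)$ is the space of continuous linear operators from $X$ into itself. For $T\in\mathcal{L}(X)$: the resolvent set $\rho(T)$ is the set of $\lambda\in\mathbb{C}$ such that $R(\lambda,T):=(\lambda I-T)^{-1}$ exists in $\mathcal{L}(X)$; $\sigma(T;X):=\mathbb{C}\setminus\rho(T)$ is the spectrum; $\sigma_{pt}(T;X)$ is the set of $\lambda\in\mathbb{C}$ such that $\lambda I-T$ is not injective. $\rho^*(T)$ is the set of $\lambda\in\mathbb{C}$ for which there is $\delta>0$ such that $B(\lambda,\delta):=\{z\in\mathbb{C}:|z-\lambda|<\delta\}\subseteq\rho(T)$ and $\{R(\mu,T):\mu\in B(\lambda,\delta)\}$ is equicontinuous in $\mathcal{L}(X)$; $\sigma^*(T;X):=\mathbb{C}\setminus\rho^*(T)$ is the Waelbroeck spectrum. For $r>0$, $D_r:=\left\{\lambda\in\mathbb{C}:\left|\lambda-\frac1{2r}\right|<\frac1{2r}\right\}$. *)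

(* Defs.v *)
From HB Require Import structures.
From mathcomp Require Import all_boot all_order all_algebra.
From mathcomp Require Import complex.
From mathcomp Require Import all_classical all_reals all_analysis.
From mathcomp Require Import measurable_realfun.

Set Implicit Arguments.
Unset Strict Implicit.
Unset Printing Implicit Defensive.

Import Order.TTheory GRing.Theory Num.Theory.
Import numFieldNormedType.Exports.
Import Normc.

Local Open Scope classical_set_scope.
Local Open Scope ring_scope.
Local Open Scope complex_scope.

Section SeminormTopology.
Variables (R : realType) (V : lmodType R[i]) (q : nat -> V -> R).
Hypothesis qD : forall n x y, q n (x + y) <= q n x + q n y.
Hypothesis qZ : forall n (a : R[i]) x, q n (a *: x) = normc a * q n x.

(* Balls for the seminorms of index at most n: their finite intersections are
   built in, so the family [q] need not be increasing. *)
Definition seminorm_ball (x : V) (n : nat) (e : R) : set V :=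
  [set y | forall i, (i <= n)%N -> q i (y - x) < e].

Definition seminorm_nbhs (x : V) : set_system V :=
  [set A | exists n e, 0 < e /\ seminorm_ball x n e `<=` A].

Lemma seminorm0 n : q n 0 = 0.
Proof. by rewrite -(scale0r (0 : V)) qZ normc0 mul0r. Qed.

Lemma seminormN n x : q n (- x) = q n x.
Proof. by rewrite -scaleN1r qZ normcN normc1 mul1r. Qed.

Lemma seminorm_ge0 n x : 0 <= q n x.
Proof.
have := qD n x (- x); rewrite subrr seminorm0 seminormN -mulr2n.
by rewrite pmulrn_lge0.
Qed.

Lemma seminorm_ballxx x n e : 0 < e -> seminorm_ball x n e x.
Proof. by move=> e0 i _; rewrite subrr seminorm0. Qed.

Lemma seminorm_nbhs_filter x : ProperFilter (seminorm_nbhs x).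
Proof.
split.
  by move=> [n [e [e0 /(_ x)]]]; apply; exact: seminorm_ballxx.
split.
- by exists 0%N, 1.
- move=> A B [n [e [e0 xA]]] [m [d [d0 xB]]].
  exists (maxn n m), (Num.min e d); split; first by rewrite lt_min e0.
  move=> y xy; split; [apply: xA|apply: xB] => i leq_i.
    have := xy i; rewrite lt_min => /(_ _)/andP[] //.
    by rewrite leq_max leq_i.
  have := xy i; rewrite lt_min => /(_ _)/andP[] //.
  by rewrite leq_max leq_i orbT.
- by move=> A B AB [n [e [e0 xA]]]; exists n, e; split => // y /xA /AB.
Qed.

Lemma seminorm_nbhs_singleton x (A : set V) : seminorm_nbhs x A -> A x.
Proof. by move=> [n [e [e0 xA]]]; apply: xA; exact: seminorm_ballxx. Qed.

Lemma seminorm_ball_center x n (e : R) y : 0 < e -> seminorm_ball x n e y ->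
  exists2 d, 0 < d & seminorm_ball y n d `<=` seminorm_ball x n e.
Proof.
move=> e0 xy.
exists (\big[Num.min/e]_(i < n.+1) (e - q i (y - x))).
  apply: lt_bigmin => // i _; rewrite subr_gt0; apply: xy.
  by rewrite -ltnS.
move=> z yz i ni; rewrite -(subrK y z) -addrA.
apply: le_lt_trans (qD _ _ _) _; rewrite -ltrBrDr.
apply: lt_le_trans (yz i ni) _.
rewrite -ltnS in ni.
exact: (bigmin_le e (Ordinal ni) (fun k : 'I_n.+1 => e - q k (y - x))).
Qed.

Lemma seminorm_ball_open x n (e : R) y :
  0 < e -> seminorm_ball x n e y -> seminorm_nbhs y (seminorm_ball x n e).
Proof. by move=> e0 /(seminorm_ball_center e0)[d d0 ?]; exists n, d. Qed.

Lemma seminorm_nbhs_nbhs x (A : set V) :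
  seminorm_nbhs x A -> seminorm_nbhs x (seminorm_nbhs^~ A).
Proof.
move=> [n [e [e0 xA]]]; exists n, e; split => // y.
by move=> /(seminorm_ball_center e0)[d d0 yx]; exists n, d; split => // z /yx /xA.
Qed.

End SeminormTopology.

HB.factory Record Seminorms_isTvs (R : realType) (V : Type)
    & GRing.Lmodule R[i] V := {
  seminorm : nat -> V -> R ;
  seminormD : forall n x y, seminorm n (x + y) <= seminorm n x + seminorm n y ;
  seminormZ : forall n (a : R[i]) x, seminorm n (a *: x) = normc a * seminorm n x
}.

HB.builders Context (R : realType) (V : Type) & Seminorms_isTvs R V.

HB.instance Definition _ := hasNbhs.Build V (seminorm_nbhs seminorm).

HB.instance Definition _ := Nbhs_isNbhsTopological.Build V
  (seminorm_nbhs_filter seminormZ)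
  (seminorm_nbhs_singleton seminormZ)
  (seminorm_nbhs_nbhs seminormD).

Let q := seminorm.

Let add_continuous : continuous (fun x : V * V => x.1 + x.2).
Proof.
move=> [x y] A /= [n [e [e0 xyA]]].
exists (seminorm_ball q x n (e / 2), seminorm_ball q y n (e / 2)).
  by split; exists n, (e / 2); split => //; rewrite divr_gt0.
move=> [a b] /= [xa yb]; apply: xyA => i ni.
rewrite opprD addrACA (splitr e).
by apply: le_lt_trans (seminormD _ _ _) _; rewrite ltrD// ?xa ?yb.
Qed.

Let scale_continuous : continuous (fun z : R[i]^o * V => z.1 *: z.2).
Proof.
move=> [a x] A /= [n [e [e0 axA]]].
pose M : R := \sum_(i < n.+1) q i x + 1.
have qM i : (i <= n)%N -> q i x < M.
  move=> ni; rewrite /M (bigD1 (Ordinal (ni : (i < n.+1)%N)))//= -addrA.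
  rewrite ltrDl ltr_wpDl//; apply: sumr_ge0 => j _.
  exact: (seminorm_ge0 seminormD seminormZ).
have M0 : 0 < M.
  by apply: le_lt_trans (qM 0%N isT); exact: (seminorm_ge0 seminormD seminormZ).
pose d : R := Num.min 1 (e / 2 / M).
have d0 : 0 < d by rewrite lt_min ltr01 !divr_gt0.
pose N : R := normc a + 1.
have N0 : 0 < N.
  by rewrite /N; case: (a) => ? ? /=; rewrite ltr_wpDl// sqrtr_ge0.
exists (ball (a : R[i]^o) d%:C, seminorm_ball q x n (e / 2 / N)).
  split; first by apply: nbhsx_ballx; rewrite ltcR.
  by exists n, (e / 2 / N); split => //; rewrite !divr_gt0.
move=> [b y] /= [ab xy]; apply: axA => i ni.
have {}ab : normc (b - a) < d.
  by move: ab; rewrite -ball_normE /= distrC -[`|_|]/((normc (b - a))%:C) ltcR.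
have bN : normc b < N.
  rewrite -(subrK a b) addrC; apply: le_lt_trans (le_normcD _ _) _.
  by rewrite ltrD2l (lt_le_trans ab)// ge_min lexx.
have -> : b *: y - a *: x = b *: (y - x) + (b - a) *: x.
  by rewrite scalerBr scalerBl addrA subrK.
apply: le_lt_trans (seminormD _ _ _) _; rewrite !seminormZ (splitr e).
have nb0 : 0 <= normc b by case: (b) => ? ? /=; exact: sqrtr_ge0.
have q0 j z : 0 <= q j z by exact: (seminorm_ge0 seminormD seminormZ).
apply: ltr_leD.
  apply: le_lt_trans (_ : N * q i (y - x) < _).
    by rewrite ler_wpM2r ?q0// ltW.
  by rewrite mulrC -ltr_pdivlMr// xy.
apply: le_trans (_ : (e / 2 / M) * q i x <= _).
  by rewrite ler_wpM2r ?q0// (le_trans (ltW ab))// ge_min lexx orbT.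
by rewrite mulrAC ler_pdivrMr// ler_wpM2l// ltW// ?divr_gt0// qM.
Qed.

Local Open Scope convex_scope.

Let locally_convex :
  exists2 B : set_system V, (forall b, b \in B -> convex_set b) & basis B.
Proof.
exists [set B | exists x n e, 0 < e /\ B = seminorm_ball q x n e].
  move=> b; rewrite inE => -[x [n [e [e0 ->]]]].
  apply/convex_setW => y z; rewrite !inE => xy xz k k0 k1; rewrite inE.
  move=> i ni; pose l := complex.Re k%:num.
  have kE : k%:num = l%:C by rewrite RRe_real// num_real.
  move: k0 k1; rewrite kE ltcR -[1]/(1%:C) ltcR => l0 l1.
  have -> : (y <| k |> z : V) - x = l%:C *: (y - x) + (1 - l)%:C *: (z - x).
    have -> : (1 - l)%:C = 1 - l%:C :> R[i] by rewrite rmorphB rmorph1.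
    rewrite /conv/= kE /unstable.onem !scalerBr addrACA -opprD -scalerDl.
    by rewrite [l%:C + _]addrC subrK scale1r.
  apply: le_lt_trans (seminormD _ _ _) _; rewrite !seminormZ /=.
  rewrite !expr0n/= !addr0 !sqrtr_sqr !gtr0_norm ?subr_gt0//.
  rewrite -[ltRHS](subrK (l * e)) addrC -{1}[e]mul1r -mulrBl ltrD//.
    by rewrite ltr_pM2l ?subr_gt0// xz.
  by rewrite ltr_pM2l// xy.
split.
  move=> _ [x [n [e [e0 ->]]]]; rewrite openE => y.
  exact: (seminorm_ball_open seminormD).
move=> x A [n [e [e0 xA]]]; exists (seminorm_ball q x n e) => //; split.
  by exists x, n, e.
exact: (seminorm_ballxx seminormZ).
Qed.

(* [PreTopologicalLmod_isTvs] only provides the uniform structure. *)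
HB.instance Definition _ :=
  PreTopologicalLmod_isTvs.Build R[i] V
    add_continuous scale_continuous locally_convex.
HB.instance Definition _ :=
  PreTopologicalNmodule_isTopologicalNmodule.Build V add_continuous.
HB.instance Definition _ :=
  TopologicalNmodule_isTopologicalLmodule.Build R[i] V scale_continuous.
HB.instance Definition _ := Uniform_isTvs.Build R[i] V locally_convex.
HB.end.

Section Spectra.
Variables (R : realType) (X : tvsType R[i]).
Implicit Types (T S : X -> X) (l : R[i]).

Definition continuous_linear S : Prop := linear S /\ continuous S.

Definition is_resolvent T l S : Prop :=
  [/\ continuous_linear S,
      forall x, l *: S x - T (S x) = x &
      forall x, S (l *: x - T x) = x].

Definition resolvent_set T : set R[i]^o :=
  [set l | exists S, is_resolvent T l S].

Definition spectrum T : set R[i]^o := ~` resolvent_set T.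

Definition point_spectrum T : set R[i]^o :=
  [set l | ~ injective (fun x => l *: x - T x)].

(* The library's [equicontinuous] asks for a pointed codomain. *)
Definition equicontinuous_set (H : set (X -> X)) : Prop :=
  forall (x : X) (E : set (X * X)), entourage E ->
    \forall y \near x, forall S, H S -> E (S x, S y).

Definition waelbroeck_resolvent_set T : set R[i]^o :=
  [set l | exists d : R, [/\ 0 < d,
    ball l d%:C `<=` resolvent_set T &
    equicontinuous_set
      [set S | exists2 m, ball l d%:C m & is_resolvent T m S]]].

Definition waelbroeck_spectrum T : set R[i]^o := ~` waelbroeck_resolvent_set T.

End Spectra.

Section Bergman.
Variable R : realType.
Implicit Types (f g : R[i] -> R[i]^o) (p mu a : R) (z : R[i]).

Definition unit_disc : set R[i]^o := [set z | `|z| < 1].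

(* The values of a function outside the disc are immaterial: they are set to 0
   so that equality of functions is equality on the disc. *)
Definition analytic_disc : set (R[i] -> R[i]^o) :=
  [set f | (forall z, unit_disc z -> derivable (f : R[i]^o -> R[i]^o) z 1) /\
           (forall z, ~ unit_disc z -> f z = 0)].

Definition plane_disc : set (R * R) := [set w | unit_disc (w.1 +i* w.2)].

Definition bergman_density p mu f (w : R * R) : R :=
  let z := w.1 +i* w.2 in normc (f z) `^ p * (1 - normc z) `^ mu.

(* The area measure is normalized so that the disc has measure 1. *)
Definition bergman_norm p mu f : \bar R :=
  ((pi^-1)%:E * \int[lebesgue_measure \x lebesgue_measure]_(w in plane_disc)
                   (bergman_density p mu f w)%:E) `^ p^-1.

Definition bergman p mu : set (R[i] -> R[i]^o) :=
  [set f | analytic_disc f /\ (bergman_norm p mu f < +oo)%E].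

Definition bergman_plus p a : set (R[i] -> R[i]^o) :=
  \bigcap_(mu in [set mu | a < mu]) bergman p mu.

End Bergman.

Section Measurability.
Variable R : realType.
Implicit Types (f : R[i] -> R[i]^o).

Lemma plane_open_measurable (U : set (R * R)) : open U ->
  measurable (U : set (measurableTypeR R * measurableTypeR R)).
Proof.
move=> oU.
pose I (a b : rat) : set R := `](ratr a), (ratr b)[%classic.
pose B (a b c d : rat) : set (R * R) := I a b `*` I c d.
have mB a b c d : measurable
    (B a b c d : set (measurableTypeR R * measurableTypeR R)).
  by apply: measurableX; exact: measurable_itv.
have -> : U = \bigcup_(a : rat) \bigcup_(b : rat) \bigcup_(c : rat)
    \bigcup_(d : rat) (if `[< B a b c d `<=` U >] then B a b c d else set0).
  apply/seteqP; split => [[x y] Uxy|[x y]]; last first.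
    by move=> [a _ [b _ [c _ [d _]]]]; case: asboolP => // + xyB; apply.
  have : nbhs (x, y) U by exact: open_nbhs_nbhs.
  move=> [[A C] /= [/nbhs_ballP[e /= e0 xA] /nbhs_ballP[d /= d0 yC]] ACU].
  have [a aP] := @rat_in_itvoo R (x - e) x ltac:(by rewrite ltrBlDr ltrDl).
  have [b bP] := @rat_in_itvoo R x (x + e) ltac:(by rewrite ltrDl).
  have [c cP] := @rat_in_itvoo R (y - d) y ltac:(by rewrite ltrBlDr ltrDl).
  have [h hP] := @rat_in_itvoo R y (y + d) ltac:(by rewrite ltrDl).
  move: aP bP cP hP; rewrite !in_itv/= => /andP[a1 a2] /andP[b1 b2].
  move=> /andP[c1 c2] /andP[h1 h2].
  exists a => //; exists b => //; exists c => //; exists h => //.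
  suff BU : B a b c h `<=` U.
    by rewrite asboolT// /B /I; split; rewrite /= in_itv/= ?a2 ?b1 ?c2 ?h1.
  move=> [u v]; rewrite /B /I => -[] /=; rewrite !in_itv/= => /andP[u1 u2] /andP[v1 v2].
  apply: ACU; split => /=.
    apply: xA; rewrite /ball/= ltr_distlC.
    by rewrite (lt_trans a1 u1) (lt_trans u2 b2).
  apply: yC; rewrite /ball/= ltr_distlC.
  by rewrite (lt_trans c1 v1) (lt_trans v2 h2).
do 4! (apply: bigcupT_measurable_rat => ?).
by case: asboolP.
Qed.

Lemma plane_continuous_measurable (D : set (R * R)) (g : R * R -> R) :
  open D -> (forall w, D w -> {for w, continuous g}) ->
  measurable_fun (D : set (measurableTypeR R * measurableTypeR R)) g.
Proof.
move=> oD cg; apply: (measurability _ (RGenOInfty.measurableE R)).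
move=> /= _ [_ [r ->]] <-; apply: plane_open_measurable.
rewrite openE => w [Dw] /= rgw; apply: filterI; first exact: open_nbhs_nbhs.
apply: (cg w Dw); apply: open_nbhs_nbhs; split => //; exact: interval_open.
Qed.

Lemma continuous_complex : continuous (fun w : R * R => w.1 +i* w.2 : R[i]^o).
Proof.
move=> [x y] A /= /nbhs_ballP[e /= e0 eA].
have eE : e = (complex.Re e)%:C by rewrite RRe_real// gtr0_real.
move: e0; rewrite eE ltcR => e0.
have h0 : 0 < complex.Re e / 2 by rewrite divr_gt0.
exists (ball x (complex.Re e / 2), ball y (complex.Re e / 2)).
  by split; exact: nbhsx_ballx.
move=> [u v] /= [xu yv]; apply: eA; rewrite -ball_normE /= eE.
have -> : (x +i* y) - (u +i* v) = (x - u)%:C + (0 +i* (y - v)) :> R[i].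
  by simpc.
apply: le_lt_trans (ler_normD _ _) _.
rewrite -[`|(x - u)%:C|]/((normc _)%:C) -[`|0 +i* (y - v)|]/((normc _)%:C).
rewrite -rmorphD/= ltcR /= !expr0n/= addr0 add0r !sqrtr_sqr [ltRHS]splitr.
by rewrite ltrD.
Qed.

Lemma continuous_normc : continuous (@normc R : R[i]^o -> R).
Proof.
move=> z A /nbhs_ballP[e /= e0 eA]; apply/nbhs_ballP; exists e%:C.
  by rewrite /= ltcR.
move=> u; rewrite -ball_normE/= -[`|z - u|]/((normc (z - u))%:C) ltcR => zu.
apply: eA; rewrite -ball_normE/=; apply: le_lt_trans zu.
rewrite ler_norml lerNl opprB lerBlDr lerBlDr.
apply/andP; split.
  rewrite -[normc (z - u)]normcN opprB.
  by have := le_normcD (u - z) z; rewrite subrK.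
by have := le_normcD (z - u) u; rewrite subrK.
Qed.

Lemma plane_disc_open : open (@plane_disc R).
Proof.
have -> : @plane_disc R = (fun w => normc (w.1 +i* w.2)) @^-1` `]-oo, 1[%classic.
  apply/seteqP; split => w; rewrite /plane_disc/unit_disc/= in_itv/=.
    by rewrite -[`|_|]/((normc (w.1 +i* w.2))%:C) -[1]/(1%:C) ltcR.
  by rewrite -[`|_|]/((normc (w.1 +i* w.2))%:C) -[X in _ -> _ < X]/(1%:C) ltcR.
apply: open_comp; last exact: interval_open.
move=> w _; apply: (@continuous_comp _ R[i]^o); first exact: continuous_complex.
exact: continuous_normc.
Qed.

End Measurability.

Section BergmanNorm.
Variables (R : realType) (p mu : R).
Hypothesis p1 : 1 <= p.
Implicit Types (f g : R[i] -> R[i]^o).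

Let T2 := (measurableTypeR R * measurableTypeR R)%type.
Let leb2 := ((@lebesgue_measure R) \x (@lebesgue_measure R))%E.
Let D := @plane_disc R.
Let p0 : 0 < p. Proof. exact: lt_le_trans p1. Qed.
Let pn0 : p != 0. Proof. by rewrite gt_eqF. Qed.
Let mD : measurable (D : set T2).
Proof. exact: (plane_open_measurable (@plane_disc_open R)). Qed.

Let normc_ge0 (z : R[i]) : 0 <= normc z.
Proof. by case: z => ? ?; exact: sqrtr_ge0. Qed.

(* [bergman_normE]: the Bergman norm is the L^p norm of this function. *)
Definition bergman_root f : R * R -> R :=
  (fun w => pi^-1 `^ p^-1 *
    (normc (f (w.1 +i* w.2)) * (1 - normc (w.1 +i* w.2)) `^ (mu / p)))
  \_ (@plane_disc R).

Let measurable_norm : measurable_fun (D : set T2)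
  (fun w => normc (w.1 +i* w.2)).
Proof.
apply: plane_continuous_measurable; first exact: plane_disc_open.
move=> w _; apply: (@continuous_comp _ R[i]^o); first exact: continuous_complex.
exact: continuous_normc.
Qed.

Let measurable_normf f : analytic_disc f -> measurable_fun (D : set T2)
  (fun w => normc (f (w.1 +i* w.2))).
Proof.
move=> [df _]; apply: plane_continuous_measurable; first exact: plane_disc_open.
move=> w Dw.
apply: (@continuous_comp _ R[i]^o _ (fun w => f (w.1 +i* w.2))); last first.
  exact: continuous_normc.
apply: (@continuous_comp _ R[i]^o R[i]^o _ f); first exact: continuous_complex.
by apply: differentiable_continuous; apply/derivable1_diffP; exact: df.
Qed.

Let measurable_weight s : measurable_fun (D : set T2)
  (fun w => (1 - normc (w.1 +i* w.2)) `^ s).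
Proof.
apply: (@measurableT_comp _ _ _ _ _ _ (fun x => x `^ s)).
  exact: measurable_powR.
exact: measurable_funB.
Qed.

Lemma measurable_bergman_density f : analytic_disc f ->
  measurable_fun (D : set T2) (bergman_density p mu f).
Proof.
move=> af; apply: measurable_funM => //.
apply: (@measurableT_comp _ _ _ _ _ _ (fun x => x `^ p)).
  exact: measurable_powR.
exact: measurable_normf.
Qed.

Lemma measurable_bergman_root f : analytic_disc f ->
  measurable_fun [set: T2] (bergman_root f).
Proof.
move=> af; apply/(measurable_restrictT _ mD).
by apply: measurable_funM => //; apply: measurable_funM => //; exact: measurable_normf.
Qed.

Lemma bergman_density_ge0 f w : 0 <= bergman_density p mu f w.
Proof. by rewrite mulr_ge0 ?powR_ge0. Qed.

Lemma bergman_root_ge0 f w : 0 <= bergman_root f w.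
Proof.
rewrite /bergman_root !patchE; case: ifP => // _.
by rewrite !mulr_ge0 ?powR_ge0.
Qed.

Lemma bergman_normE f : analytic_disc f ->
  bergman_norm p mu f = 'N[leb2]_p%:E[EFin \o bergman_root f]%E.
Proof.
move=> af; rewrite unlock /Lnorm /bergman_norm; congr (_ `^ _)%E.
rewrite -ge0_integralZl_EFin//; last 3 first.
- by move=> w _; rewrite lee_fin bergman_density_ge0.
- by apply/measurable_EFinP; exact: measurable_bergman_density.
- by rewrite invr_ge0 pi_ge0.
rewrite integral_mkcond; apply: eq_integral => w _ /=.
rewrite ger0_norm ?bergman_root_ge0// /bergman_root /bergman_density !patchE.
case: ifP => _; last by rewrite powR0.
rewrite powRM ?powR_ge0 ?mulr_ge0 ?powR_ge0// powRM ?powR_ge0//.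
rewrite -!powRrM mulVf// powRr1 ?invr_ge0 ?pi_ge0//.
by rewrite divfK.
Qed.

Lemma bergman_rootD f g w :
  bergman_root (f + g) w <= bergman_root f w + bergman_root g w.
Proof.
rewrite /bergman_root !patchE; case: ifP => _; last by rewrite addr0.
rewrite -mulrDr ler_wpM2l ?powR_ge0// -mulrDl ler_wpM2r ?powR_ge0//.
exact: le_normcD.
Qed.

Lemma analytic_disc0 : analytic_disc (0 : R[i] -> R[i]^o).
Proof. by split => // z _; exact: derivable_cst. Qed.

Lemma analytic_discD f g :
  analytic_disc f -> analytic_disc g -> analytic_disc (f + g).
Proof.
move=> [df f0] [dg g0]; split => z zD; last by rewrite fctE f0// g0// addr0.
by apply: derivableD; [exact: df|exact: dg].
Qed.

Lemma analytic_discZ (c : R[i]) f : analytic_disc f -> analytic_disc (c *: f).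
Proof.
move=> [df f0]; split => z zD; last by rewrite /= fctE f0// scaler0.
by apply: derivableZ; exact: df.
Qed.

Lemma bergman_norm_ge0 f : (0 <= bergman_norm p mu f)%E.
Proof. exact: poweR_ge0. Qed.

Lemma bergman_normD f g : analytic_disc f -> analytic_disc g ->
  (bergman_norm p mu (f + g)%R <= bergman_norm p mu f + bergman_norm p mu g)%E.
Proof.
move=> af ag; rewrite !bergman_normE//; last exact: analytic_discD.
have mf := measurable_bergman_root af; have mg := measurable_bergman_root ag.
apply: le_trans (minkowski_EFin leb2 mf mg p1).
rewrite unlock /Lnorm gt0_ler_poweR ?invr_ge0 ?(ltW p0)//.
- by rewrite in_itv/= leey integral_ge0// => w _; exact: poweR_ge0.
- by rewrite in_itv/= leey integral_ge0// => w _; exact: poweR_ge0.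
apply: ge0_le_integral => //.
- by move=> w _; exact: poweR_ge0.
- apply/measurable_EFinP; apply: (@measurableT_comp _ _ _ _ _ _ (fun x => x `^ p)).
    exact: measurable_powR.
  apply: measurableT_comp => //; apply: measurable_bergman_root.
  exact: analytic_discD.
- apply/measurable_EFinP; apply: (@measurableT_comp _ _ _ _ _ _ (fun x => x `^ p)).
    exact: measurable_powR.
  by apply: measurableT_comp => //; exact: measurable_funD.
move=> w _ /=; rewrite lee_fin ge0_ler_powR ?nnegrE ?(ltW p0)//.
by rewrite !ger0_norm ?addr_ge0 ?bergman_root_ge0// bergman_rootD.
Qed.

Lemma bergman_normZ (c : R[i]) f : analytic_disc f ->
  bergman_norm p mu (c *: f) = ((normc c)%:E * bergman_norm p mu f)%E.
Proof.
move=> af; rewrite /bergman_norm.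
under eq_integral => w _.
  have -> : bergman_density p mu (c *: f) w =
      normc c `^ p * bergman_density p mu f w.
    by rewrite /bergman_density -[(c *: f) _]/(c * f _) normcM powRM// mulrA.
  rewrite EFinM; over.
rewrite ge0_integralZl_EFin//; last 3 first.
- by move=> w _; rewrite lee_fin bergman_density_ge0.
- by apply/measurable_EFinP; exact: measurable_bergman_density.
- by rewrite powR_ge0.
rewrite muleCA [LHS]poweRM ?lee_fin ?powR_ge0//.
  by rewrite poweR_EFin -powRrM mulfV// powRr1.
rewrite mule_ge0 ?lee_fin ?invr_ge0 ?pi_ge0// integral_ge0// => w _.
by rewrite lee_fin bergman_density_ge0.
Qed.

Lemma bergman_submod c f g : bergman p mu f -> bergman p mu g ->
  bergman p mu (c *: f + g).
Proof.
move=> [af nf] [ag ng]; have acf := analytic_discZ c af.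
split; first exact: analytic_discD.
apply: le_lt_trans (bergman_normD acf ag) _.
rewrite lte_add_pinfty// bergman_normZ//.
by rewrite lte_mul_pinfty// ?lee_fin.
Qed.

Lemma bergman0 : bergman p mu (0 : R[i] -> R[i]^o).
Proof.
split; first exact: analytic_disc0.
rewrite -(scale0r (0 : R[i] -> R[i]^o)) bergman_normZ; last exact: analytic_disc0.
by rewrite normc0 mul0e.
Qed.
End BergmanNorm.

(* The hypothesis [1 < p] is a parameter because the vector space and seminorm
   structures below need it. *)
Record bergman_space (R : realType) (p a : R) (p1 : 1 < p) := BergmanSpace {
  bergman_fun :> R[i] -> R[i]^o;
  bergman_funP : bergman_fun \in bergman_plus p a
}.

Section BergmanSpace.
Variables (R : realType) (p a : R) (p1 : 1 < p).
Local Notation bergman_space := (bergman_space a p1).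

HB.instance Definition _ := [isSub for @bergman_fun R p a p1].
HB.instance Definition _ := [Choice of bergman_space by <:].

Lemma bergman_plus_submod_closed :
  submod_closed (mem (bergman_plus p a) : {pred R[i] -> R[i]^o}).
Proof.
split; first by rewrite inE => mu _; exact: bergman0 (ltW p1).
move=> c f g; rewrite !inE => fA gA mu amu.
by apply: (bergman_submod (ltW p1)); [exact: fA|exact: gA].
Qed.

HB.instance Definition _ :=
  GRing.SubChoice_isSubLmodule.Build _ _ _ bergman_space
    bergman_plus_submod_closed.

(* The index n starts at 0: this is the norm of exponent a + 1/(n+1). *)
Definition bergman_seminorm (n : nat) (f : bergman_space) : R :=
  fine (bergman_norm p (a + n.+1%:R^-1) f).

Let mem_bergman n (f : bergman_space) : bergman p (a + n.+1%:R^-1) f.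
Proof.
have := bergman_funP f; rewrite inE; apply.
by rewrite /= ltrDl invr_gt0 ltr0n.
Qed.

Let fin_norm n (f : bergman_space) :
  bergman_norm p (a + n.+1%:R^-1) f \is a fin_num.
Proof.
by rewrite ge0_fin_numE ?bergman_norm_ge0//; have [] := mem_bergman n f.
Qed.

Lemma bergman_seminormD n (f g : bergman_space) :
  bergman_seminorm n (f + g) <= bergman_seminorm n f + bergman_seminorm n g.
Proof.
rewrite -lee_fin EFinD !fineK//; apply: (@bergman_normD R p _ (ltW p1) f g).
  by have [] := mem_bergman n f.
by have [] := mem_bergman n g.
Qed.

Lemma bergman_seminormZ n (c : R[i]) (f : bergman_space) :
  bergman_seminorm n (c *: f) = normc c * bergman_seminorm n f.
Proof.
apply: EFin_inj; rewrite EFinM !fineK//; apply: (@bergman_normZ R p _ (ltW p1) c f).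
by have [] := mem_bergman n f.
Qed.

HB.instance Definition _ := Seminorms_isTvs.Build R bergman_space
  bergman_seminormD bergman_seminormZ.

End BergmanSpace.

Section Cesaro.
Variable R : realType.
Implicit Types (F : R[i] -> R[i]) (z : R[i]).

Definition complex_integral01 (g : R -> R[i]) : R[i] :=
  (\int[lebesgue_measure]_(t in `[0, 1]) complex.Re (g t)) +i*
  (\int[lebesgue_measure]_(t in `[0, 1]) complex.Im (g t)).

(* The path integral of F along the segment from 0 to z. *)
Definition segment_integral F z : R[i] :=
  complex_integral01 (fun t => F (t%:C * z) * z).

Definition cesaro (f : R[i] -> R[i]^o) : R[i] -> R[i]^o := fun z =>
  if `|z| < 1 then
    if z == 0 then f 0
    else z^-1 * segment_integral (fun zeta => f zeta / (1 - zeta)) z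
  else 0.

(* Since [cesaro] maps the space into itself, the default value 0 of [insubd]
   is never used. *)
Definition cesaro_op (p a : R) (p1 : 1 < p) (f : bergman_space a p1) :
    bergman_space a p1 :=
  insubd (0 : bergman_space a p1) (cesaro f).

Definition tangent_disc (r : R) : set R[i]^o :=
  [set l : R[i] | `|l - ((2 * r)^-1)%:C| < ((2 * r)^-1)%:C].

End Cesaro.

(* Main.v *)
(* Put [s = 1 / l] and [r = (2 + a) / p]. The equation [l f - C f = g] means
   [l (z f)' - f / (1 - z) = (z g)'], which for [y = f (1 - z)^s] becomes the
   Euler equation [z y' = (s - 1) y + s (z g)' (1 - z)^s].

   Its homogeneous solutions are the multiples of [z^n (1 - z)^(-n-1)], for
   [s = n + 1]; they belong to the space exactly when [n + 1 <= r]. If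
   [Re s > r], there is a bounded [g] whose only analytic preimage is
   [(1 - z)^(-s) q] with [q 1 <> 0], which is too large near [1].

   If [Re s <= r] and [s] is not a natural number, then, up to finitely many
   Taylor coefficients, [g = z^N h] with [N] large, and the solution is
   [f = s g + s^2 z^N (1 - z)^(-s) int_0^1 t^(N-s) (1 - t z)^(s-1) h(t z) dt].
   Hölder's inequality in [t] and Tonelli's theorem bound [f] in the norm of
   exponent [mu] by [g] in the norm of exponent [mu' < mu]. The loss is harmless
   in the Fréchet space, and the constant is uniform for [l] at a positive
   distance from the spectrum, which gives equicontinuity of the resolvents
   off the closure of the spectrum. *)
Require Import Defs.
From HB Require Import structures.
From mathcomp Require Import all_boot all_order all_algebra.
From mathcomp Require Import complex.
From mathcomp Require Import all_classical all_reals all_analysis.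
From mathcomp Require Import measurable_realfun ring lra.
Set Implicit Arguments.
Unset Strict Implicit.
Unset Printing Implicit Defensive.
Import Order.TTheory GRing.Theory Num.Theory.
Import numFieldNormedType.Exports.
Import Normc.
Local Open Scope classical_set_scope.
Local Open Scope ring_scope.
Local Open Scope complex_scope.

(** * Complex differentiation *)

Section ComplexCalculus.
Variable R : realType.
Implicit Types (f g : R[i] -> R[i]) (z w l h : R[i]).

(** Contour integrals run over axis-parallel rectangles, where they are four real integrals over
    intervals. The integral of [1 / (z - z0)] around a square is carried along as a constant bounded
    below in modulus: every formula divides by it.

    Averaging Cauchy's formula over concentric squares bounds [|f z|^p (1 - |z|)^(2 + mu)] by the
    norm of exponent [mu]; letting [mu] decrease to [a] produces the critical order [(2 + a) / p] of
    growth.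

    The obstacle is the integral over [t]. At a fixed [t] the integrand has an [L^p] norm of order
    [(1 - t)^(e - 1)] with [p e = mu - mu']. This is integrable up to [t = 1] because [mu' < mu],
    and it is the origin of the loss of weight.

    Taylor coefficients are removed one at a time: the coefficient of order [k] is divided by
    [l - 1/(k+1)]. The constants therefore involve the distance from [l] to the points [1/(k+1)],
    and a lower bound on it is available away from the spectrum because each of these points is an
    eigenvalue or lies in the tangent disc. *)

Lemma normc_ge0 z : 0 <= normc z.
Proof. by case: z => ? ?; exact: sqrtr_ge0. Qed.

Lemma normc_eq0 z : (normc z == 0) = (z == 0).
Proof. by apply/eqP/eqP => [/eq0_normc|->]; rewrite ?normc0. Qed.

Lemma normc_gt0 z : (0 < normc z) = (z != 0).
Proof. by rewrite lt_def normc_ge0 normc_eq0 andbT. Qed.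

Lemma normr_normc z : `|z| = (normc z)%:C.
Proof. by []. Qed.

Lemma normcB z w : normc (z - w) = normc (w - z).
Proof. by rewrite -normcN opprB. Qed.

Lemma normcV z : normc z^-1 = (normc z)^-1.
Proof.
have [->|z0] := eqVneq z 0; first by rewrite invr0 normc0 invr0.
have nz : normc z != 0 by rewrite normc_eq0.
by apply: (mulfI nz); rewrite -normcM mulfV// mulfV// normc1.
Qed.

Lemma normcX z n : normc (z ^+ n) = normc z ^+ n.
Proof. by elim: n => [|n IH]; rewrite ?expr0 ?normc1// !exprS normcM IH. Qed.

Lemma normc_real (x : R) : normc x%:C = `|x|.
Proof. by rewrite /= expr0n/= addr0 sqrtr_sqr. Qed.

Lemma normcE z : normc z ^+ 2 = complex.Re z ^+ 2 + complex.Im z ^+ 2.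
Proof. by case: z => x y /=; rewrite sqr_sqrtr// addr_ge0// sqr_ge0. Qed.

Lemma normc_Re z : `|complex.Re z| <= normc z.
Proof.
rewrite -(ler_pXn2r (ltn0Sn 1)) ?nnegrE ?normr_ge0 ?normc_ge0//.
by rewrite normcE real_normK ?num_real// lerDl sqr_ge0.
Qed.

Lemma normc_Im z : `|complex.Im z| <= normc z.
Proof.
rewrite -(ler_pXn2r (ltn0Sn 1)) ?nnegrE ?normr_ge0 ?normc_ge0//.
by rewrite normcE real_normK ?num_real// lerDr sqr_ge0.
Qed.

Lemma le_normc_ReIm z : normc z <= `|complex.Re z| + `|complex.Im z|.
Proof.
rewrite -(ler_pXn2r (ltn0Sn 1)) ?nnegrE ?addr_ge0 ?normr_ge0 ?normc_ge0//.
rewrite normcE sqrrD !real_normK ?num_real// addrAC lerDl.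
by rewrite mulrn_wge0// mulr_ge0.
Qed.

Lemma le_normcB z w : normc z - normc w <= normc (z - w).
Proof. by rewrite lerBlDr; have := le_normcD (z - w) w; rewrite subrK. Qed.

Lemma cvgC_epsP (f : R[i] -> R[i]) z :
  {for z, continuous (f : R[i]^o -> R[i]^o)} <->
  forall e : R, 0 < e -> exists2 d : R, 0 < d &
    forall h, normc h < d -> normc (f (z + h) - f z) < e.
Proof.
split=> [cf e e0|H A /nbhs_ballP[e e0 eA]].
  have := cf (ball (f z : R[i]^o) e%:C).
  case; first by apply: nbhsx_ballx; rewrite ltcR.
  move=> d /= d0 dA.
  have dE : d = (complex.Re d)%:C by rewrite RRe_real// gtr0_real.
  exists (complex.Re d); first by rewrite -ltcR -dE.
  move=> h hd; have := dA (z + h).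
  rewrite /ball/= opprD addNKr normrN dE !normr_normc !ltcR => /(_ hd).
  by rewrite normcB.
have eE : e = (complex.Re e)%:C by rewrite RRe_real// gtr0_real.
have := H (complex.Re e); rewrite -ltcR -eE => /(_ e0)[d d0 dH].
apply/nbhs_ballP; exists d%:C; first by rewrite /= ltcR.
move=> w; rewrite -ball_normE/= normr_normc ltcR normcB => zw.
apply: eA; rewrite -ball_normE/= normr_normc eE ltcR normcB.
by have := dH (w - z) zw; rewrite [z + _]addrC subrK.
Qed.

(** The derivative without a quotient: the weak inequality includes [h = 0], so the rules of
    calculus need no case distinction there. *)
Definition cderiv f z l := forall e : R, 0 < e -> exists2 d : R, 0 < d &
  forall h, normc h < d -> normc (f (z + h) - f z - h * l) <= e * normc h.

Lemma cderiv_derivable f z :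
  derivable (f : R[i]^o -> R[i]^o) z 1 <-> exists l, cderiv f z l.
Proof.
split.
  move=> /cvg_ex[l /= fl]; exists l => e e0.
  have := fl (ball (l : R[i]^o) e%:C).
  case; first by apply: nbhsx_ballx; rewrite ltcR.
  move=> d /= d0 dA.
  have dE : d = (complex.Re d)%:C by rewrite RRe_real// gtr0_real.
  exists (complex.Re d); first by rewrite -ltcR -dE.
  move=> h hd; have [->|h0] := eqVneq h 0.
    by rewrite addr0 subrr mul0r subr0 normc0 mulr0.
  have := dA h; rewrite /ball/= add0r normrN dE normr_normc ltcR => /(_ hd h0).
  rewrite normr_normc ltcR => H.
  have -> : f (z + h) - f z - h * l =
      - h * (l - h^-1 * (f (h * 1 + z) - f z)).
    rewrite mulr1 [h + z]addrC; field; exact: h0.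
  by rewrite normcM normcN mulrC ler_wpM2r ?normc_ge0// ltW.
move=> [l H]; apply/cvg_ex; exists l => /= A /nbhs_ballP[e e0 eA].
have eE : e = (complex.Re e)%:C by rewrite RRe_real// gtr0_real.
have {e0} e0 : 0 < complex.Re e by rewrite -ltcR -eE.
have [] := H (complex.Re e / 2); first by rewrite divr_gt0.
move=> d d0 dH; exists d%:C; first by rewrite /= ltcR.
move=> h; rewrite /= sub0r normrN normr_normc ltcR => hd h0; apply: eA.
rewrite -ball_normE/= normr_normc eE ltcR normcB -[h *: _]/(h * 1) mulr1 [h + z]addrC.
have -> : h^-1 *: (f (z + h) - f z) - l = h^-1 * (f (z + h) - f z - h * l).
  rewrite -[_ *: _]/(_ * _); field; exact: h0.
rewrite normcM normcV mulrC ltr_pdivrMr ?normc_gt0//.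
apply: le_lt_trans (dH h hd) _.
by rewrite ltr_pM2r ?normc_gt0// ltr_pdivrMr// ltr_pMr// ltr1n.
Qed.

Lemma cderiv_continuous f z l : cderiv f z l ->
  {for z, continuous (f : R[i]^o -> R[i]^o)}.
Proof.
move=> H; apply/cvgC_epsP => e e0.
have [d d0 dH] := H 1 ltr01.
have K0 : 0 < 1 + normc l by rewrite ltr_wpDr ?normc_ge0.
exists (Num.min d (e / (1 + normc l))); first by rewrite lt_min d0 divr_gt0.
move=> h; rewrite lt_min => /andP[hd he].
rewrite -[_ - _](subrK (h * l)); apply: le_lt_trans (le_normcD _ _) _.
rewrite normcM; apply: le_lt_trans (lerD (dH h hd) (lexx _)) _.
by rewrite [_ * normc l]mulrC -mulrDl mulrC -ltr_pdivlMr.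
Qed.

Lemma cderiv_unique f z l l' : cderiv f z l -> cderiv f z l' -> l = l'.
Proof.
move=> H H'; apply/eqP; rewrite -subr_eq0 -normc_eq0; apply/eqP.
apply/eqP; rewrite eq_le normc_ge0 andbT; apply/ler_addgt0Pl => e e0.
have e2 : 0 < e / 2 by rewrite divr_gt0.
have [d d0 dH] := H _ e2; have [d' d'0 dH'] := H' _ e2.
pose h : R[i] := (Num.min d d' / 2)%:C.
have m0 : 0 < Num.min d d' by rewrite lt_min d0.
have hE : normc h = Num.min d d' / 2 by rewrite normc_real gtr0_norm// divr_gt0.
have h0 : 0 < normc h by rewrite hE divr_gt0.
have hm : normc h < Num.min d d' by rewrite hE ltr_pdivrMr// ltr_pMr// ltr1n.
move: hm; rewrite lt_min => /andP[hd hd'].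
rewrite addr0 -(ler_pM2l h0) -normcM.
have -> : h * (l - l') = (f (z + h) - f z - h * l') - (f (z + h) - f z - h * l).
  by ring.
apply: le_trans (le_normcD _ _) _; rewrite normcN.
apply: le_trans (lerD (dH' h hd') (dH h hd)) _.
by rewrite -mulrDl -splitr mulrC.
Qed.

Lemma cderiv_near f g z l (d : R) : 0 < d ->
  (forall h, normc h < d -> f (z + h) = g (z + h)) -> cderiv f z l -> cderiv g z l.
Proof.
move=> d0 fg H e e0; have [r r0 rH] := H e e0.
exists (Num.min d r); first by rewrite lt_min d0.
move=> h; rewrite lt_min => /andP[hd hr].
by rewrite -fg// -[X in g X]addr0 -fg ?normc0// addr0 rH.
Qed.

Lemma cderiv_cst c z : cderiv (fun=> c) z 0.
Proof.
move=> e e0; exists 1 => // h _.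
by rewrite subrr mulr0 subr0 normc0 mulr_ge0 ?normc_ge0// ltW.
Qed.

Lemma cderiv_id z : cderiv id z 1.
Proof.
move=> e e0; exists 1 => // h _.
have -> : z + h - z - h * 1 = 0 by ring.
by rewrite normc0 mulr_ge0 ?normc_ge0// ltW.
Qed.

Lemma cderivD f g z l l' : cderiv f z l -> cderiv g z l' ->
  cderiv (fun x => f x + g x) z (l + l').
Proof.
move=> H H' e e0; have e2 : 0 < e / 2 by rewrite divr_gt0.
have [d d0 dH] := H _ e2; have [d' d'0 dH'] := H' _ e2.
exists (Num.min d d'); first by rewrite lt_min d0.
move=> h; rewrite lt_min => /andP[hd hd'].
have -> : f (z + h) + g (z + h) - (f z + g z) - h * (l + l') =
  (f (z + h) - f z - h * l) + (g (z + h) - g z - h * l') by ring.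
apply: le_trans (le_normcD _ _) _.
by apply: le_trans (lerD (dH h hd) (dH' h hd')) _; rewrite -mulrDl -splitr.
Qed.

Lemma cderivM f g z l l' : cderiv f z l -> cderiv g z l' ->
  cderiv (fun x => f x * g x) z (l * g z + f z * l').
Proof.
move=> H H' e e0.
(* [K] bounds [l], [f z] and the nearby values of [g] at once, so that each of the three error terms
   below takes a third of [e]. *)
pose K := 1 + normc (f z) + normc (g z) + normc l.
have K1 : 1 <= K by rewrite /K -!addrA lerDl !addr_ge0 ?normc_ge0.
have K0 : 0 < K by apply: lt_le_trans K1.
have e3 : 0 < e / 3 / K by rewrite !divr_gt0.
have [d d0 dH] := H _ e3; have [d' d'0 dH'] := H' _ e3.
have /cvgC_epsP cg := cderiv_continuous H'.
have [|r r0 rH] := cg (Num.min 1 (e / 3 / K)); first by rewrite lt_min ltr01 e3.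
exists (Num.min d (Num.min d' r)); first by rewrite !lt_min d0 d'0 r0.
move=> h; rewrite !lt_min => /and3P[hd hd' hr].
have -> : f (z + h) * g (z + h) - f z * g z - h * (l * g z + f z * l') =
  (f (z + h) - f z - h * l) * g (z + h) + h * (l * (g (z + h) - g z)) +
  f z * (g (z + h) - g z - h * l') by ring.
have := rH h hr; rewrite lt_min => /andP[g1 ge].
have gK : normc (g (z + h)) <= K.
  rewrite -[g (z + h)](subrK (g z)); apply: le_trans (le_normcD _ _) _.
  by have := normc_ge0 l; have := normc_ge0 (f z); rewrite /K; lra.
have lK : normc l <= K by rewrite /K lerDr !addr_ge0 ?normc_ge0.
have fK : normc (f z) <= K.
  by rewrite /K -!addrA addrCA lerDl !addr_ge0 ?normc_ge0.
have eK : e = e / 3 / K * K + e / 3 / K * K + e / 3 / K * K.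
  by field; rewrite gt_eqF.
rewrite [X in _ <= X * _]eK [leRHS]mulrDl [X in _ <= X + _]mulrDl.
apply: le_trans (le_normcD _ _) (lerD _ _).
  apply: le_trans (le_normcD _ _) (lerD _ _).
    rewrite normcM mulrAC; apply: ler_pM => //; rewrite ?normc_ge0//.
    exact: dH.
  rewrite !normcM mulrC ler_wpM2r ?normc_ge0// mulrC.
  by apply: ler_pM => //; rewrite ?normc_ge0// ltW.
rewrite normcM mulrAC mulrC; apply: ler_pM => //; rewrite ?normc_ge0//.
exact: dH'.
Qed.

Lemma cderivZ c f z l : cderiv f z l -> cderiv (fun x => c * f x) z (c * l).
Proof.
move=> H; have := cderivM (cderiv_cst c z) H.
by rewrite mul0r add0r.
Qed.

Lemma cderivN f z l : cderiv f z l -> cderiv (fun x => - f x) z (- l).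
Proof.
move=> H e e0; have [d d0 dH] := H e e0; exists d => // h hd.
have -> : - f (z + h) - - f z - h * - l = - (f (z + h) - f z - h * l) by ring.
by rewrite normcN dH.
Qed.

Lemma cderivB f g z l l' : cderiv f z l -> cderiv g z l' ->
  cderiv (fun x => f x - g x) z (l - l').
Proof. by move=> H H'; apply: cderivD => //; exact: cderivN. Qed.

Lemma cderiv_comp f g z l l' : cderiv f z l -> cderiv g (f z) l' ->
  cderiv (fun x => g (f x)) z (l * l').
Proof.
move=> H H' e e0.
pose K := 1 + normc l + normc l'.
have K1 : 1 <= K by rewrite /K -!addrA lerDl !addr_ge0 ?normc_ge0.
have K0 : 0 < K by apply: lt_le_trans K1.
have e3 : 0 < e / 2 / K by rewrite !divr_gt0.
have m0 : 0 < Num.min 1 (e / 2 / K) by rewrite lt_min ltr01 e3.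
have [d d0 dH] := H _ m0; have [d' d'0 dH'] := H' _ e3.
have /cvgC_epsP cf := cderiv_continuous H.
have [r r0 rH] := cf _ d'0.
exists (Num.min d r); first by rewrite !lt_min d0 r0.
move=> h; rewrite !lt_min => /andP[hd hr].
set k := f (z + h) - f z.
have fE : f (z + h) = f z + k by rewrite /k; ring.
have -> : g (f (z + h)) - g (f z) - h * (l * l') =
  (g (f z + k) - g (f z) - k * l') + (k - h * l) * l' by rewrite fE; ring.
have kle : normc (k - h * l) <= Num.min 1 (e / 2 / K) * normc h by exact: dH.
have k1 : normc k <= K * normc h.
  rewrite -[k](subrK (h * l)); apply: le_trans (le_normcD _ _) _.
  rewrite normcM [normc h * _]mulrC.
  apply: le_trans (lerD kle (lexx _)) _.
  rewrite -mulrDl ler_wpM2r ?normc_ge0// /K.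
  have : Num.min 1 (e / 2 / K) <= 1 by rewrite ge_min lexx.
  by have := normc_ge0 l'; lra.
rewrite [X in _ <= X * _](_ : e = e / 2 / K * K + e / 2 / K * K); last first.
  by field; rewrite gt_eqF.
rewrite [leRHS]mulrDl; apply: le_trans (le_normcD _ _) (lerD _ _).
  apply: le_trans (dH' _ (rH h hr)) _.
  by rewrite -[leRHS]mulrA ler_wpM2l// ltW.
rewrite normcM mulrAC; apply: ler_pM; rewrite ?normc_ge0//.
  by apply: le_trans kle _; rewrite ler_wpM2r ?normc_ge0// ge_min lexx orbT.
by rewrite /K lerDr addr_ge0 ?normc_ge0.
Qed.

Lemma cderiv_inv z : z != 0 -> cderiv (fun x => x^-1) z (- z ^- 2).
Proof.
move=> z0 e e0.
have nz : 0 < normc z by rewrite normc_gt0.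
exists (Num.min (normc z / 2) (e * normc z ^+ 3 / 2)).
  by rewrite lt_min !divr_gt0// mulr_gt0// exprn_gt0.
move=> h; rewrite lt_min => /andP[h1 h2].
have zh : normc z / 2 <= normc (z + h).
  have := le_normcB z (- h); rewrite opprK normcN; apply: le_trans.
  lra.
have zh0 : z + h != 0.
  by rewrite -normc_gt0; apply: lt_le_trans zh; rewrite divr_gt0.
have -> : (z + h)^-1 - z^-1 - h * - z ^- 2 = h ^+ 2 * (z ^- 2 * (z + h)^-1).
  by field; rewrite z0 zh0.
rewrite normcM normcX [normc (_ * _)]normcM !normcV normcX expr2 mulrAC ler_wpM2r ?normc_ge0//.
apply: le_trans (_ : normc h * (normc z ^- 2 * (normc z / 2)^-1) <= _).
  rewrite ler_wpM2l ?normc_ge0// ler_wpM2l ?invr_ge0 ?exprn_ge0 ?normc_ge0//.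
  by rewrite lef_pV2 ?posrE// ?divr_gt0// normc_gt0.
have -> : normc z ^- 2 * (normc z / 2)^-1 = (normc z ^+ 3 / 2)^-1.
  by field; rewrite gt_eqF.
rewrite ler_pdivrMr ?divr_gt0 ?exprn_gt0//.
by rewrite mulrA ltW.
Qed.

Lemma cderivV f z l : f z != 0 -> cderiv f z l ->
  cderiv (fun x => (f x)^-1) z (- l / f z ^+ 2).
Proof.
move=> fz H; have := cderiv_comp H (cderiv_inv fz).
by rewrite mulrN mulNr.
Qed.

Lemma cderivX n z : cderiv (fun x => x ^+ n) z (n%:R * z ^+ n.-1).
Proof.
elim: n => [|n IH].
  rewrite mul0r; apply: (@cderiv_near (fun=> 1) _ _ _ 1) => //.
  exact: cderiv_cst.
have := cderivM (cderiv_id z) IH.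
rewrite mul1r /=; set a := _ + _.
have -> : a = n.+1%:R * z ^+ n.
  rewrite /a mulrCA; case: (n) => [|m] /=; first by rewrite !mul0r addr0 mul1r.
  by rewrite -exprS -[m.+2%:R]natr1 mulrDl mul1r addrC.
by apply: (@cderiv_near _ _ _ _ 1) => // h _; rewrite exprS.
Qed.

Lemma continuous_Re : continuous (@complex.Re R : R[i]^o -> R).
Proof.
move=> z A /nbhs_ballP[e /= e0 eA]; apply/nbhs_ballP; exists e%:C.
  by rewrite /= ltcR.
move=> u; rewrite -ball_normE/= normr_normc ltcR => zu.
apply: eA; rewrite -ball_normE/=; apply: le_lt_trans zu.
by have := normc_Re (z - u); rewrite raddfB.
Qed.

Lemma continuous_Im : continuous (@complex.Im R : R[i]^o -> R).
Proof.
move=> z A /nbhs_ballP[e /= e0 eA]; apply/nbhs_ballP; exists e%:C.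
  by rewrite /= ltcR.
move=> u; rewrite -ball_normE/= normr_normc ltcR => zu.
apply: eA; rewrite -ball_normE/=; apply: le_lt_trans zu.
by have := normc_Im (z - u); rewrite raddfB.
Qed.

(** Passage from complex to real derivatives: along a line the real and imaginary parts are
    differentiable, so the real fundamental theorem of calculus applies to complex primitives. *)
Lemma cderiv_line f (z0 v : R[i]) (t : R) l : cderiv f (z0 + t%:C * v) l ->
  is_derive t 1 (fun x : R => complex.Re (f (z0 + x%:C * v))) (complex.Re (v * l)) /\
  is_derive t 1 (fun x : R => complex.Im (f (z0 + x%:C * v))) (complex.Im (v * l)).
Proof.
move=> H.
(* [P] stands for the real or the imaginary part; additivity, real homogeneity and the bound by the
   modulus are all that the argument uses. *)
have key (P : R[i] -> R) : (forall x y, P (x - y) = P x - P y) ->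
    (forall (r : R) x, P (r%:C * x) = r * P x) ->
    (forall x, `|P x| <= normc x) ->
    is_derive t 1 (fun x : R => P (f (z0 + x%:C * v))) (P (v * l)).
  move=> PB PZ Pn.
  have cv : (fun h : R => h^-1 *: ((P \o (fun x : R => f (z0 + x%:C * v))) (h *: 1 + t) -
      P (f (z0 + t%:C * v)))) @ 0^' --> P (v * l).
    move=> A /nbhs_ballP[e /= e0 eA].
    pose K := normc v + 1.
    have K0 : 0 < K by rewrite ltr_wpDl ?normc_ge0.
    have [d d0 dH] := H (e / 2 / K) ltac:(by rewrite !divr_gt0).
    exists (d / K); first by rewrite /= divr_gt0.
    move=> h; rewrite /= sub0r normrN => hd h0; apply: eA.
    rewrite -ball_normE/= distrC.
    have hv : normc (h%:C * v) <= `|h| * K.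
      by rewrite normcM normc_real ler_wpM2l// lerDl.
    have hvd : normc (h%:C * v) < d.
      by apply: le_lt_trans hv _; rewrite -ltr_pdivlMr.
    have -> : z0 + (h *: 1 + t)%:C * v = z0 + t%:C * v + h%:C * v.
      by rewrite -[h *: 1]/(h * 1) mulr1 rmorphD/=; ring.
    rewrite -PB -[_ *: _]/(h^-1 * _).
    have -> : P (v * l) = h^-1 * P (h%:C * v * l).
      by rewrite -mulrA PZ mulrA mulVf// mul1r.
    rewrite -mulrBr -PB normrM normfV mulrC ltr_pdivrMr ?normr_gt0//.
    apply: le_lt_trans (Pn _) _; apply: le_lt_trans (dH _ hvd) _.
    apply: le_lt_trans (_ : e / 2 / K * (`|h| * K) < _).
      by rewrite ler_wpM2l// !divr_ge0// ltW.
    rewrite mulrCA mulfVK ?gt_eqF// mulrC ltr_pM2r ?normr_gt0//.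
    by rewrite ltr_pdivrMr// ltr_pMr// ltr1n.
  by apply: DeriveDef; [apply: cvgP cv|exact: cvg_lim cv].
split; apply: key.
- by move=> [? ?] [? ?].
- by move=> r [? ?]; simpc.
- exact: normc_Re.
- by move=> [? ?] [? ?].
- by move=> r [? ?]; simpc.
- exact: normc_Im.
Qed.

End ComplexCalculus.

(** * Integrals of complex-valued functions of a real variable *)

Section ComplexIntegral.
Variable R : realType.
Implicit Types (a b c M : R) (F G H : R -> R[i]) (z k : R[i]).
Local Notation leb := (@lebesgue_measure R).

Definition ccont a b G := {within `[a, b], continuous (G : R -> R[i]^o)}.

(** For [a = 0] and [b = 1] this is convertible to [complex_integral01], the integral in the
    definition of the Cesàro operator. *)
Definition cint a b G : R[i] :=
  (\int[leb]_(t in `[a, b]) complex.Re (G t)) +i*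
  (\int[leb]_(t in `[a, b]) complex.Im (G t)).

Lemma ccont_at a b G :
  (forall t, a <= t <= b -> {for t, continuous (G : R -> R[i]^o)}) -> ccont a b G.
Proof.
move=> cG; apply: continuous_in_subspaceT => t; rewrite inE /= in_itv/=; exact: cG.
Qed.

Lemma ccont_sub a b a' b' G : a <= a' -> b' <= b -> ccont a b G -> ccont a' b' G.
Proof.
move=> aa bb; apply: continuous_subspaceW => t; rewrite /= !in_itv/= => /andP[t1 t2].
by rewrite (le_trans aa t1) (le_trans t2 bb).
Qed.

Lemma ccont_cst a b k : ccont a b (fun=> k).
Proof. by move=> x; exact: cst_continuous. Qed.

Lemma ccontD a b F G : ccont a b F -> ccont a b G -> ccont a b (fun t => F t + G t).
Proof. by move=> cF cG x; exact: continuousD (cF x) (cG x). Qed.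

Lemma ccontN a b F : ccont a b F -> ccont a b (fun t => - F t).
Proof. by move=> cF x; exact: continuousN (cF x). Qed.

Lemma ccontM a b F G : ccont a b F -> ccont a b G -> ccont a b (fun t => F t * G t).
Proof. by move=> cF cG x; exact: continuousM (cF x) (cG x). Qed.

Lemma ccont_eq a b F G : (forall t, a <= t <= b -> F t = G t) ->
  ccont a b F -> ccont a b G.
Proof.
move=> FG; apply: subspace_eq_continuous => t; rewrite inE/= in_itv/=; exact: FG.
Qed.

Lemma ccont_comp a b (f : R[i] -> R[i]) F : ccont a b F ->
  (forall t, a <= t <= b -> {for F t, continuous (f : R[i]^o -> R[i]^o)}) ->
  ccont a b (fun t => f (F t)).
Proof.
move=> cF cf; apply/subspace_continuousP => t tab.
have /subspace_continuousP/(_ t tab) := cF.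
move=> /cvg_comp; apply; apply: cf; by move: tab; rewrite /= in_itv.
Qed.

Lemma continuous_real : continuous (fun x : R => x%:C : R[i]^o).
Proof.
move=> x A /= /nbhs_ballP[e /= e0 eA].
have eE : e = (complex.Re e)%:C by rewrite RRe_real// gtr0_real.
apply/nbhs_ballP; exists (complex.Re e); first by rewrite /= -ltcR -eE.
move=> y; rewrite /ball/= => xy; apply: eA.
by rewrite /ball/= -rmorphB/= normr_normc normc_real eE ltcR.
Qed.

Lemma continuous_line (z k : R[i]) : continuous (fun x : R => z + x%:C * k : R[i]^o).
Proof.
move=> x; apply: continuousD; first exact: cst_continuous.
apply: (@continuousM R[i] R _ _ x); last exact: cst_continuous.
exact: continuous_real.
Qed.

Lemma ccont_line a b (z k : R[i]) : ccont a b (fun x => z + x%:C * k).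
Proof. by apply: ccont_at => t _; exact: continuous_line. Qed.

Lemma ccont_Re a b G : ccont a b G ->
  {within `[a, b], continuous (fun t => complex.Re (G t))}.
Proof.
move=> /subspace_continuousP cG; apply/subspace_continuousP => t tab.
by apply: (cvg_comp _ _ (cG t tab)); exact: continuous_Re.
Qed.

Lemma ccont_Im a b G : ccont a b G ->
  {within `[a, b], continuous (fun t => complex.Im (G t))}.
Proof.
move=> /subspace_continuousP cG; apply/subspace_continuousP => t tab.
by apply: (cvg_comp _ _ (cG t tab)); exact: continuous_Im.
Qed.

Lemma ccont_normc a b G : ccont a b G ->
  {within `[a, b], continuous (fun t => normc (G t))}.
Proof.
move=> /subspace_continuousP cG; apply/subspace_continuousP => t tab.
by apply: (cvg_comp _ _ (cG t tab)); exact: continuous_normc.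
Qed.

Lemma within_integrable a b (g : R -> R) : {within `[a, b], continuous g} ->
  leb.-integrable `[a, b] (EFin \o g).
Proof. by apply: continuous_compact_integrable; exact: segment_compact. Qed.

Lemma within_RintegralD a b r s (f g : R -> R) :
  {within `[a, b], continuous f} -> {within `[a, b], continuous g} ->
  \int[leb]_(t in `[a, b]) (r * f t + s * g t) =
  r * \int[leb]_(t in `[a, b]) f t + s * \int[leb]_(t in `[a, b]) g t.
Proof.
move=> cf cg.
have cZ u (h : R -> R) : {within `[a, b], continuous h} ->
    {within `[a, b], continuous (fun t => u * h t)}.
  by move=> ch t; apply: continuousM; [exact: cst_continuous|exact: ch].
have mab : measurable (`[a, b]%classic : set (measurableTypeR R)).
  exact: measurable_itv.
have jf := within_integrable cf; have jg := within_integrable cg.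
rewrite -(@RintegralZl _ _ _ leb _ f r mab jf).
rewrite -(@RintegralZl _ _ _ leb _ g s mab jg).
exact: (@RintegralD _ _ _ leb _ _ _ mab (within_integrable (cZ r f cf))
  (within_integrable (cZ s g cg))).
Qed.

Lemma within_RintegralB a b r s (f g : R -> R) :
  {within `[a, b], continuous f} -> {within `[a, b], continuous g} ->
  \int[leb]_(t in `[a, b]) (r * f t - s * g t) =
  r * \int[leb]_(t in `[a, b]) f t - s * \int[leb]_(t in `[a, b]) g t.
Proof.
move=> cf cg; have := within_RintegralD r (- s) cf cg.
by rewrite [in RHS]mulNr => <-; apply: eq_Rintegral => t _; rewrite mulNr.
Qed.

Lemma within_le_Rintegral a b (f g : R -> R) :
  {within `[a, b], continuous f} -> {within `[a, b], continuous g} ->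
  (forall t, a <= t <= b -> f t <= g t) ->
  \int[leb]_(t in `[a, b]) f t <= \int[leb]_(t in `[a, b]) g t.
Proof.
move=> cf cg fg.
have mab : measurable (`[a, b]%classic : set (measurableTypeR R)).
  exact: measurable_itv.
apply: (@le_Rintegral _ _ _ leb _ f g mab (within_integrable cf)
  (within_integrable cg)) => t.
by rewrite /= in_itv/=; exact: fg.
Qed.

Lemma ccont_integrable_Re a b G : ccont a b G ->
  leb.-integrable `[a, b] (EFin \o (fun t => complex.Re (G t))).
Proof. by move=> /ccont_Re/within_integrable. Qed.

Lemma ccont_integrable_Im a b G : ccont a b G ->
  leb.-integrable `[a, b] (EFin \o (fun t => complex.Im (G t))).
Proof. by move=> /ccont_Im/within_integrable. Qed.

Lemma cint_eq a b F G : (forall t, a <= t <= b -> F t = G t) ->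
  cint a b F = cint a b G.
Proof.
move=> FG; congr (_ +i* _); apply: eq_Rintegral => t;
  by rewrite inE/= in_itv/= => /FG ->.
Qed.

Lemma cintD a b F G : ccont a b F -> ccont a b G ->
  cint a b (fun t => F t + G t) = cint a b F + cint a b G.
Proof.
move=> cF cG; rewrite /cint.
under eq_Rintegral do rewrite raddfD.
rewrite RintegralD//; [|exact: ccont_integrable_Re..].
under [X in _ +i* X = _]eq_Rintegral do rewrite raddfD.
by rewrite RintegralD//; exact: ccont_integrable_Im.
Qed.

Lemma cintZ a b k F : ccont a b F ->
  cint a b (fun t => k * F t) = k * cint a b F.
Proof.
move=> cF; case: k => x y; rewrite /cint.
have E t : complex.Re ((x +i* y) * F t) = x * complex.Re (F t) - y * complex.Im (F t).
  by case: (F t).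
have E' t : complex.Im ((x +i* y) * F t) = x * complex.Im (F t) + y * complex.Re (F t).
  by case: (F t).
under eq_Rintegral do rewrite E.
under [X in _ +i* X = _]eq_Rintegral do rewrite E'.
have cR := ccont_Re cF; have cI := ccont_Im cF.
by rewrite (within_RintegralB x y cR cI) (within_RintegralD x y cI cR).
Qed.

Lemma cintN a b F : ccont a b F -> cint a b (fun t => - F t) = - cint a b F.
Proof.
move=> cF; rewrite -mulN1r -cintZ//; apply: cint_eq => t _; by rewrite mulN1r.
Qed.

Lemma cintB a b F G : ccont a b F -> ccont a b G ->
  cint a b (fun t => F t - G t) = cint a b F - cint a b G.
Proof. by move=> cF cG; rewrite -(cintN cG); exact: cintD cF (ccontN cG). Qed.

Lemma cint_cst a b k : a <= b -> cint a b (fun=> k) = (b - a)%:C * k.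
Proof.
move=> ab; case: k => x y; rewrite /cint/= !Rintegral_cst//=.
have -> : fine (leb `[a, b]) = b - a.
  rewrite lebesgue_measure_itv/= lte_fin; case: ltP => // ba.
  by have -> : a = b by [apply/eqP; rewrite eq_le ab]; rewrite subrr.
by apply/eqP; rewrite eq_complex /= !mul0r subr0 addr0 ![_ * (b - a)]mulrC !eqxx.
Qed.

Lemma Re_cint a b F :
  complex.Re (cint a b F) = \int[leb]_(t in `[a, b]) complex.Re (F t).
Proof. by []. Qed.

Lemma Im_cint a b F :
  complex.Im (cint a b F) = \int[leb]_(t in `[a, b]) complex.Im (F t).
Proof. by []. Qed.

Lemma le_normc_cint a b F : ccont a b F ->
  normc (cint a b F) <= \int[leb]_(t in `[a, b]) normc (F t).
Proof.
move=> cF; set w := cint a b F.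
have [w0|w0] := eqVneq w 0.
  by rewrite w0 normc0; apply: Rintegral_ge0 => t _; exact: normc_ge0.
(* rotate the integral onto the positive real axis *)
pose u : R[i] := (normc w)%:C / w.
have nw : normc w != 0 by rewrite normc_eq0.
have u1 : normc u = 1.
  by rewrite normcM normcV normc_real ger0_norm ?normc_ge0// mulfV.
have -> : normc w = complex.Re (u * w) by rewrite /u mulfVK.
have cuF : ccont a b (fun t => u * F t) := ccontM (@ccont_cst a b u) cF.
rewrite -(cintZ u cF) Re_cint.
apply: (within_le_Rintegral (ccont_Re cuF) (ccont_normc cF)) => t _. apply: le_trans (ler_norm _) _; apply: le_trans (normc_Re _) _.
  by rewrite normcM u1 mul1r.
Qed.

Lemma normc_cint_bound a b F M : a <= b -> ccont a b F ->
  (forall t, a <= t <= b -> normc (F t) <= M) -> normc (cint a b F) <= (b - a) * M.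
Proof.
move=> ab cF FM; apply: le_trans (le_normc_cint cF) _.
have -> : (b - a) * M = \int[leb]_(t in `[a, b]) M.
  have := cint_cst M%:C ab; rewrite /cint/= => -[-> _].
  by rewrite mul0r subr0.
apply: (within_le_Rintegral (ccont_normc cF)) => // x; exact: cst_continuous.
Qed.

Lemma cint_split a b c F : a <= b -> b <= c -> ccont a c F ->
  cint a c F = cint a b F + cint b c F.
Proof.
move=> ab bc cF.
have key g : leb.-integrable `[a, c] (EFin \o g) ->
    \int[leb]_(t in `[a, c]) g t =
    \int[leb]_(t in `[a, b]) g t + \int[leb]_(t in `[b, c]) g t.
  move=> ig; have := Rintegral_itvB ig; move=> /(_ b).
  rewrite !bnd_simp => /(_ ab bc) H.
  have ibc : leb.-integrable `]b, c] (EFin \o g).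
    apply: integrableS ig => //; apply: subset_itvr; by rewrite bnd_simp.
  by rewrite -(Rintegral_itv_obnd_cbnd ibc) -H addrC subrK.
rewrite /cint (key _ (ccont_integrable_Re cF)) (key _ (ccont_integrable_Im cF)).
by [].
Qed.

Lemma within_FTC a b (f F : R -> R) : a < b -> {within `[a, b], continuous f} ->
  {within `[a, b], continuous F} ->
  (forall t, a < t < b -> is_derive t 1 F (f t)) ->
  \int[leb]_(t in `[a, b]) f t = F b - F a.
Proof.
move=> ab cf cF dF.
have /(continuous_within_itvP _ ab)[_ cFa cFb] := cF.
rewrite /Rintegral (@continuous_FTC2 _ f F)//.
  split => //; move=> t; rewrite in_itv/= => /dF ?; exact: ex_derive.
move=> t; rewrite in_itv/= => /dF dFt; rewrite derive1E; exact: derive_val.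
Qed.

Lemma cint_FTC a b F G : a <= b -> ccont a b G -> ccont a b F ->
  (forall t, a < t < b ->
    is_derive t 1 (fun t => complex.Re (F t)) (complex.Re (G t)) /\
    is_derive t 1 (fun t => complex.Im (F t)) (complex.Im (G t))) ->
  cint a b G = F b - F a.
Proof.
rewrite le_eqVlt => /predU1P[-> _ _ _|ab cG cF dF].
  by rewrite subrr /cint set_itv1 !Rintegral_set1.
have dR t : a < t < b -> is_derive t 1 (fun t => complex.Re (F t)) (complex.Re (G t)).
  by move=> /dF[].
have dI t : a < t < b -> is_derive t 1 (fun t => complex.Im (F t)) (complex.Im (G t)).
  by move=> /dF[].
rewrite /cint (within_FTC ab (ccont_Re cG) (ccont_Re cF) dR).
rewrite (within_FTC ab (ccont_Im cG) (ccont_Im cF) dI).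
by case: (F b) (F a) => ? ? [].
Qed.

Lemma ccont_norm_bounded a b F : ccont a b F ->
  exists2 M, 0 < M & forall t, a <= t <= b -> normc (F t) <= M.
Proof.
move=> /ccont_normc cF; have [ab|ba] := leP a b; last first.
  by exists 1 => // t /andP[t1 t2]; have := le_lt_trans (le_trans t1 t2) ba; rewrite ltxx.
have [c _ cM] := EVT_max ab cF.
exists (normc (F c) + 1); first by rewrite ltr_wpDl ?normc_ge0.
by move=> t tab; apply: le_trans (cM t tab) _; rewrite lerDl.
Qed.

End ComplexIntegral.

(** * Rectangles and Goursat's lemma *)

Arguments normc {R} x : simpl never.
Arguments cint {R} a b G : simpl never.
Arguments GRing.mul : simpl never.

Section Rectangles.
Variable R : realType.
Implicit Types (a b c d x y M : R) (F G P : R[i] -> R[i]) (z w k h : R[i]).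
Local Notation ii := (0 +i* 1 : R[i]).

Lemma Pt_h x y : x +i* y = 0 +i* y + x%:C * 1.
Proof. by simpc. Qed.

Lemma Pt_v x y : x +i* y = x%:C + y%:C * ii.
Proof. by simpc. Qed.

Definition in_rect a b c d x y := (a <= x <= b) && (c <= y <= d).

Definition on_bd a b c d x y :=
  in_rect a b c d x y && [|| x == a, x == b, y == c | y == d].

Definition rcont F a b c d := forall x y, in_rect a b c d x y ->
  {for x +i* y, continuous (F : R[i]^o -> R[i]^o)}.

Definition bcont F a b c d := forall x y, on_bd a b c d x y ->
  {for x +i* y, continuous (F : R[i]^o -> R[i]^o)}.

(** The contour integral over the boundary of the rectangle, counterclockwise: bottom minus top,
    plus [i] times right minus left. *)
Definition rint F a b c d : R[i] :=
  cint a b (fun x => F (x +i* c)) - cint a b (fun x => F (x +i* d)) +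
  ii * (cint c d (fun y => F (b +i* y)) - cint c d (fun y => F (a +i* y))).

Lemma rcont_bcont F a b c d : rcont F a b c d -> bcont F a b c d.
Proof. by move=> cF x y /andP[/cF]. Qed.

Lemma ccont_h F a b y : (forall x, a <= x <= b ->
    {for x +i* y, continuous (F : R[i]^o -> R[i]^o)}) ->
  ccont a b (fun x => F (x +i* y)).
Proof.
move=> cF; apply: (@ccont_comp _ a b F (fun x => x +i* y)) => //.
apply: (@ccont_eq _ a b (fun x => (0 +i* y) + x%:C * 1)); last exact: ccont_line.
by move=> t _; rewrite -Pt_h.
Qed.

Lemma ccont_v F c d x : (forall y, c <= y <= d ->
    {for x +i* y, continuous (F : R[i]^o -> R[i]^o)}) ->
  ccont c d (fun y => F (x +i* y)).
Proof.
move=> cF; apply: (@ccont_comp _ c d F (fun y => x +i* y)) => //.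
apply: (@ccont_eq _ c d (fun y => x%:C + y%:C * ii)); last exact: ccont_line.
by move=> t _; rewrite -Pt_v.
Qed.

Section Boundary.
Variables (a b c d : R).
Hypotheses (ab : a <= b) (cd : c <= d).

Lemma on_bd_c x : a <= x <= b -> on_bd a b c d x c.
Proof. by rewrite /on_bd/in_rect lexx cd eqxx !orbT !andbT. Qed.

Lemma on_bd_d x : a <= x <= b -> on_bd a b c d x d.
Proof. by rewrite /on_bd/in_rect lexx cd eqxx !orbT !andbT. Qed.

Lemma on_bd_a y : c <= y <= d -> on_bd a b c d a y.
Proof. by rewrite /on_bd/in_rect lexx ab eqxx /= andbT. Qed.

Lemma on_bd_b y : c <= y <= d -> on_bd a b c d b y.
Proof. by rewrite /on_bd/in_rect lexx ab eqxx /= orbT andbT. Qed.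

Lemma bcont_sides F : bcont F a b c d ->
  [/\ ccont a b (fun x => F (x +i* c)), ccont a b (fun x => F (x +i* d)),
      ccont c d (fun y => F (b +i* y)) & ccont c d (fun y => F (a +i* y))].
Proof.
move=> cF; split.
- by apply: ccont_h => x /on_bd_c/cF.
- by apply: ccont_h => x /on_bd_d/cF.
- by apply: ccont_v => x /on_bd_b/cF.
- by apply: ccont_v => x /on_bd_a/cF.
Qed.

Lemma rint_eq F G : (forall x y, on_bd a b c d x y -> F (x +i* y) = G (x +i* y)) ->
  rint F a b c d = rint G a b c d.
Proof.
move=> FG; rewrite /rint.
congr (_ - _ + _ * (_ - _)); apply: cint_eq => t.
- by move=> /on_bd_c/FG.
- by move=> /on_bd_d/FG.
- by move=> /on_bd_b/FG.
- by move=> /on_bd_a/FG.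
Qed.

Lemma rintD F G : bcont F a b c d -> bcont G a b c d ->
  rint (fun z => F z + G z) a b c d = rint F a b c d + rint G a b c d.
Proof.
move=> /bcont_sides[F1 F2 F3 F4] /bcont_sides[G1 G2 G3 G4].
rewrite /rint (cintD F1 G1) (cintD F2 G2) (cintD F3 G3) (cintD F4 G4).
ring.
Qed.

Lemma rintZ k F : bcont F a b c d ->
  rint (fun z => k * F z) a b c d = k * rint F a b c d.
Proof.
move=> /bcont_sides[F1 F2 F3 F4].
rewrite /rint (cintZ k F1) (cintZ k F2) (cintZ k F3) (cintZ k F4).
ring.
Qed.

Lemma normc_ii : normc ii = 1 :> R.
Proof. by rewrite /normc expr0n/= add0r expr1n sqrtr1. Qed.

Lemma le_normc_rint (n1 n2 n3 n4 : R) F :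
  normc (cint a b (fun x => F (x +i* c))) <= n1 ->
  normc (cint a b (fun x => F (x +i* d))) <= n2 ->
  normc (cint c d (fun y => F (b +i* y))) <= n3 ->
  normc (cint c d (fun y => F (a +i* y))) <= n4 ->
  normc (rint F a b c d) <= n1 + n2 + n3 + n4.
Proof.
move=> H1 H2 H3 H4; rewrite /rint.
apply: le_trans (le_normcD _ _) _; rewrite -addrA lerD//.
  by apply: le_trans (le_normcD _ _) _; rewrite normcN lerD.
rewrite normcM normc_ii mul1r.
by apply: le_trans (le_normcD _ _) _; rewrite normcN lerD.
Qed.

Lemma rint_bound F M : bcont F a b c d ->
  (forall x y, on_bd a b c d x y -> normc (F (x +i* y)) <= M) ->
  normc (rint F a b c d) <= 2 * ((b - a) + (d - c)) * M.
Proof.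
move=> /bcont_sides[F1 F2 F3 F4] FM.
have -> : 2 * ((b - a) + (d - c)) * M =
  (b - a) * M + (b - a) * M + (d - c) * M + (d - c) * M by ring.
apply: le_normc_rint; apply: normc_cint_bound => // t.
- by move=> /on_bd_c/FM.
- by move=> /on_bd_d/FM.
- by move=> /on_bd_b/FM.
- by move=> /on_bd_a/FM.
Qed.

(** Each side contributes the difference of [P] at its endpoints, and the four differences cancel
    around the contour. *)
Lemma rint_primitive F P : bcont F a b c d ->
  (forall x y, on_bd a b c d x y -> cderiv P (x +i* y) (F (x +i* y))) ->
  rint F a b c d = 0.
Proof.
move=> cF dP; have [F1 F2 F3 F4] := bcont_sides cF.
have cP : bcont P a b c d by move=> x y /dP/cderiv_continuous.
have [P1 P2 P3 P4] := bcont_sides cP.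
have H y : ccont a b (fun x => F (x +i* y)) -> ccont a b (fun x => P (x +i* y)) ->
    (forall x, a <= x <= b -> on_bd a b c d x y) ->
    cint a b (fun x => F (x +i* y)) = P (b +i* y) - P (a +i* y).
  move=> cF' cP' bd; apply: (cint_FTC ab cF' cP') => t /andP[t1 t2].
  have /dP : on_bd a b c d t y by apply: bd; rewrite !ltW.
  rewrite {1}Pt_h => /cderiv_line; rewrite mul1r.
  by under eq_fun do rewrite -Pt_h; under [X in _ /\ is_derive _ _ X _]eq_fun do rewrite -Pt_h.
have V x : ccont c d (fun y => ii * F (x +i* y)) -> ccont c d (fun y => P (x +i* y)) ->
    (forall y, c <= y <= d -> on_bd a b c d x y) ->
    cint c d (fun y => ii * F (x +i* y)) = P (x +i* d) - P (x +i* c).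
  move=> cF' cP' bd; apply: (cint_FTC cd cF' cP') => t /andP[t1 t2].
  have /dP : on_bd a b c d x t by apply: bd; rewrite !ltW.
  rewrite {1}Pt_v => /cderiv_line.
  by under eq_fun do rewrite -Pt_v; under [X in _ /\ is_derive _ _ X _]eq_fun do rewrite -Pt_v.
rewrite /rint (H c)//; last exact: on_bd_c.
rewrite (H d)//; last exact: on_bd_d.
rewrite mulrBr -(cintZ ii F3) -(cintZ ii F4).
have F3' : ccont c d (fun y => ii * F (b +i* y)) := ccontM (@ccont_cst _ c d ii) F3.
have F4' : ccont c d (fun y => ii * F (a +i* y)) := ccontM (@ccont_cst _ c d ii) F4.
rewrite (V b F3' P3 on_bd_b) (V a F4' P4 on_bd_a); ring.
Qed.

End Boundary.

Lemma rcont_sub F a b c d a' b' c' d' : a <= a' -> b' <= b -> c <= c' -> d' <= d ->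
  rcont F a b c d -> rcont F a' b' c' d'.
Proof.
move=> aa bb cc dd cF x y /andP[/andP[x1 x2] /andP[y1 y2]]; apply: cF.
by rewrite /in_rect (le_trans aa x1) (le_trans x2 bb) (le_trans cc y1) (le_trans y2 dd).
Qed.

Lemma rint_splitx F a b c d m : a <= m -> m <= b -> c <= d -> rcont F a b c d ->
  rint F a b c d = rint F a m c d + rint F m b c d.
Proof.
move=> am mb cd cF; have ab := le_trans am mb.
have [F1 F2 F3 F4] := bcont_sides ab cd (rcont_bcont cF).
rewrite /rint (cint_split am mb F1) (cint_split am mb F2); ring.
Qed.

Lemma rint_splity F a b c d m : c <= m -> m <= d -> a <= b -> rcont F a b c d ->
  rint F a b c d = rint F a b c m + rint F a b m d.
Proof.
move=> cm md ab cF; have cd := le_trans cm md.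
have [F1 F2 F3 F4] := bcont_sides ab cd (rcont_bcont cF).
rewrite /rint (cint_split cm md F3) (cint_split cm md F4); ring.
Qed.

(** The integral is the sum of those over the four quarters, so one quarter carries at least a
    fourth of it. The two booleans select the left or right half and the lower or upper half. *)
Lemma halving_step F a c (l r e : R) : 0 <= l -> 0 <= r ->
  rcont F a (a + l) c (c + r) -> e <= normc (rint F a (a + l) c (c + r)) ->
  exists q : bool * bool, let a' := a + q.1%:R * (l / 2) in
    let c' := c + q.2%:R * (r / 2) in
    e / 4 <= normc (rint F a' (a' + l / 2) c' (c' + r / 2)).
Proof.
move=> l0 r0 cF eF.
have lE : a + l / 2 + l / 2 = a + l by field.
have rE : c + r / 2 + r / 2 = c + r by field.
have a1 : a <= a + l / 2 by rewrite lerDl divr_ge0.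
have a2 : a + l / 2 <= a + l by rewrite -lE lerDl divr_ge0.
have c1 : c <= c + r / 2 by rewrite lerDl divr_ge0.
have c2 : c + r / 2 <= c + r by rewrite -rE lerDl divr_ge0.
apply: contrapT => /forallNP H.
have {}H (q1 q2 : bool) : normc (rint F (a + q1%:R * (l / 2)) (a + q1%:R * (l / 2) + l / 2)
    (c + q2%:R * (r / 2)) (c + q2%:R * (r / 2) + r / 2)) < e / 4.
  by rewrite ltNge; apply/negP => ?; apply: (H (q1, q2)).
have := H false false; have := H false true; have := H true false; have := H true true.
rewrite /= !mul0r !mul1r !addr0 lE rE => H1 H2 H3 H4.
move: eF; rewrite (rint_splitx a1 a2 (le_trans c1 c2) cF).
rewrite (rint_splity c1 c2 a1); last exact: (rcont_sub _ _ _ _ cF).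
rewrite (rint_splity c1 c2 a2); last exact: (rcont_sub _ _ _ _ cF).
apply/negP; rewrite -ltNge.
apply: le_lt_trans (le_normcD _ _) _.
apply: le_lt_trans (lerD (le_normcD _ _) (le_normcD _ _)) _.
by clear - H1 H2 H3 H4; lra.
Qed.

(** Repeated halving produces nested rectangles whose integrals decrease at most like [4^-n]. At
    their common point [F] is affine up to a small multiple of the distance; perimeter and distance
    are both of order [2^-n], so this remainder is too small for the integrals. *)
Theorem goursat F a b c d : a <= b -> c <= d ->
  (forall x y, in_rect a b c d x y -> exists l, cderiv F (x +i* y) l) ->
  rint F a b c d = 0.
Proof.
move=> ab cd dF; apply/eqP; rewrite -normc_eq0; apply/eqP.
apply/eqP; rewrite eq_le normc_ge0 andbT leNgt; apply/negP => e0.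
set e := normc _ in e0.
pose l := b - a; pose r := d - c.
have l0 : 0 <= l by rewrite subr_ge0.
have r0 : 0 <= r by rewrite subr_ge0.
pose L n := l / 2 ^+ n; pose W n := r / 2 ^+ n.
have L0 n : 0 <= L n by rewrite divr_ge0// exprn_ge0.
have W0 n : 0 <= W n by rewrite divr_ge0// exprn_ge0.
have LS n : L n.+1 = L n / 2 by rewrite /L exprSr invfM mulrA.
have WS n : W n.+1 = W n / 2 by rewrite /W exprSr invfM mulrA.
(* [q] is the lower left corner of the rectangle of generation [n]. *)
pose good n (q : R * R) := [/\ a <= q.1, q.1 + L n <= b, c <= q.2,
  q.2 + W n <= d & e / 4 ^+ n <= normc (rint F q.1 (q.1 + L n) q.2 (q.2 + W n))].
have cF : rcont F a b c d by move=> x y /dF[k /cderiv_continuous].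
have step n q : good n q -> exists q', good n.+1 q' /\
    (q.1 <= q'.1 <= q.1 + L n.+1 /\ q.2 <= q'.2 <= q.2 + W n.+1).
  move=> [q1 q2 q3 q4 q5].
  have [|[u v] /= uv] := halving_step (L0 n) (W0 n) _ q5.
    exact: (rcont_sub _ _ _ _ cF).
  exists (q.1 + u%:R * (L n / 2), q.2 + v%:R * (W n / 2)).
  have Ln2 : 0 <= L n / 2 by rewrite divr_ge0.
  have Wn2 : 0 <= W n / 2 by rewrite divr_ge0.
  have LE : L n = L n / 2 + L n / 2 by rewrite -splitr.
  have WE : W n = W n / 2 + W n / 2 by rewrite -splitr.
  rewrite LS WS; split.
    split => /=; rewrite ?LS ?WS.
    - by rewrite ler_wpDr// mulr_ge0.
    - by case: u uv => _; rewrite ?mul1r ?mul0r; lra.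
    - by rewrite ler_wpDr// mulr_ge0.
    - by case: v uv => _; rewrite ?mul1r ?mul0r; lra.
    - have -> : e / 4 ^+ n.+1 = e / 4 ^+ n / 4 by rewrite exprSr invfM mulrA.
      exact: uv.
  by case: u v {uv} => [] []; rewrite /= ?mul1r ?mul0r;
    clear - Ln2 Wn2 LE WE; split; apply/andP; split; lra.
have good0 : good 0%N (a, c).
  rewrite /good /L /W !expr0 !divr1 /= /l /r.
  by rewrite ![_ + (_ - _)]addrC !subrK; split.
have [s [s0 sP]] : exists s : nat -> R * R, s 0%N = (a, c) /\ forall n, good n (s n) /\
    ((s n).1 <= (s n.+1).1 <= (s n).1 + L n.+1 /\
     (s n).2 <= (s n.+1).2 <= (s n).2 + W n.+1).
  pose nxt (n : nat) (q : R * R) := if pselect (good n q) is left H then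
    projT1 (cid (step n q H)) else q.
  pose s := fix s n := if n is m.+1 then nxt m (s m) else (a, c).
  have sg n : good n (s n).
    elim: n => [|n IH] /=; [exact: good0|rewrite /nxt]; case: pselect => // H.
    by case: cid => q /= [].
  exists s; split => // n; split; first exact: sg.
  rewrite /= /nxt; case: pselect => [H|/(_ (sg n))//].
  by case: cid => q /= [].
(* Nested intervals of halving lengths: the supremum of the left ends belongs to all of them. It is
   applied to each coordinate. *)
have lim (u : nat -> R) (A : nat -> R) : (forall n, A n.+1 = A n / 2) ->
    (forall n, u n <= u n.+1 <= u n + A n.+1) ->
    exists x, forall n, u n <= x <= u n + A n.
  move=> AS uP.
  have mon m n : (m <= n)%N -> u m <= u n /\ u n + A n <= u m + A m.
    elim: n => [|n IH]; first by rewrite leqn0 => /eqP ->.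
    rewrite leq_eqVlt => /predU1P[->//|]; rewrite ltnS => /IH[H1 H2].
    have /andP[u1 u2] := uP n; split; first exact: le_trans H1 u1.
    apply: le_trans H2; rewrite AS in u2 *; lra.
  have AA n : 0 <= A n.
    by have /andP[u1 u2] := uP n; rewrite AS in u2; lra.
  have ub m n : u m <= u n + A n.
    have [mn|/ltnW nm] := leqP m n.
      by have [H1 _] := mon _ _ mn; have := AA n; lra.
    by have [_ H2] := mon _ _ nm; have := AA m; lra.
  exists (sup (range u)) => n; apply/andP; split.
    apply: ub_le_sup; last by exists n.
    by exists (u 0%N + A 0%N) => _ [m _ <-].
  apply: ge_sup; first by exists (u 0%N), 0%N.
  by move=> _ [m _ <-].
have [x0 x0P] := lim (fun n => (s n).1) L LS (fun n => (sP n).2.1).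
have [y0 y0P] := lim (fun n => (s n).2) W WS (fun n => (sP n).2.2).
have [k dk] : exists k, cderiv F (x0 +i* y0) k.
  apply: dF; have := x0P 0%N; have := y0P 0%N; rewrite s0 /L /W !expr0 !divr1 /=.
  by rewrite /l /r ![_ + (_ - _)]addrC !subrK /in_rect => -> ->.
(* With the precision [e / (2 * K)], perimeter times remainder is [e / 4 ^+ n] times
   [(l + r) ^+ 2 / K], which is less than 1. *)
pose K := 2 * (l + r) ^+ 2 + 1.
have K0 : 0 < K by rewrite ltr_wpDl// mulr_ge0// sqr_ge0.
have [D D0 DH] := dk (e / (2 * K)) ltac:(by rewrite divr_gt0// mulr_gt0).
have [n nD] : exists n, (l + r) / 2 ^+ n < D.
  exists (Num.truncn ((l + r) / D)).+1.
  rewrite ltr_pdivrMr ?exprn_gt0// mulrC -ltr_pdivrMr//.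
  apply: lt_le_trans (truncnS_gt _) _.
  by rewrite -natrX ler_nat ltnW// ltn_expl.
have [[g1 g2 g3 g4 g5] _] := sP n.
set A := (s n).1 in g1 g2 g5; set B := (s n).2 in g3 g4 g5.
pose z0 := x0 +i* y0.
(* The affine part has a quadratic primitive, so its integral vanishes and [F] may be replaced by
   the remainder [H]. *)
pose G z := F z0 + (z - z0) * k.
pose H z := F z - G z.
have AL : A <= A + L n by rewrite lerDl.
have BW : B <= B + W n by rewrite lerDl.
have dG z : cderiv (fun w => F z0 * w + k * ((w - z0) ^+ 2 / 2)) z (G z).
  have := cderivD (cderivZ (F z0) (cderiv_id z)) (cderivZ (k / 2)
    (cderiv_comp (cderivB (cderiv_id z) (cderiv_cst z0 z)) (cderivX 2 _))).
  have -> : F z0 * 1 + k / 2 * ((1 - 0) * (2%:R * (z - z0) ^+ 2.-1)) = G z.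
    by rewrite /G /= expr1; field.
  by apply: (@cderiv_near _ _ _ _ _ 1) => // h _; field.
have dG' z : cderiv G z k.
  have := cderivD (cderiv_cst (F z0) z) (cderivM
     (cderivB (cderiv_id z) (cderiv_cst z0 z)) (cderiv_cst k z)).
  by congr (cderiv _ _ _); ring.
have cG : bcont G A (A + L n) B (B + W n).
  by move=> x y _; exact: cderiv_continuous (dG' _).
have cFn : bcont F A (A + L n) B (B + W n).
  by apply: rcont_bcont; exact: (rcont_sub _ _ _ _ cF).
have cG' : bcont (fun z => -1 * G z) A (A + L n) B (B + W n).
  by move=> x y _; exact: cderiv_continuous (cderivZ _ (dG' _)).
have rG : rint F A (A + L n) B (B + W n) = rint H A (A + L n) B (B + W n).
  have -> : H = fun z => F z + -1 * G z by apply/funext => z; rewrite /H mulN1r.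
  rewrite (rintD AL BW cFn cG') (rintZ AL BW _ cG).
  by rewrite (rint_primitive AL BW cG (fun x y _ => dG (x +i* y))) mulr0 addr0.
have LW : L n + W n = (l + r) / 2 ^+ n by rewrite /L /W -mulrDl.
have cH : bcont H A (A + L n) B (B + W n).
  by move=> x y xy; apply: continuousB; [exact: cFn|exact: cG xy].
have bH x y : on_bd A (A + L n) B (B + W n) x y ->
    normc (H (x +i* y)) <= e / (2 * K) * (L n + W n).
  move=> /andP[/andP[/andP[xA xA'] /andP[yB yB']] _].
  have /andP[x1 x2] := x0P n; have /andP[y1 y2] := y0P n.
  rewrite -/A in x1 x2; rewrite -/B in y1 y2.
  have hn : normc ((x - x0) +i* (y - y0)) <= L n + W n.
    apply: le_trans (le_normc_ReIm _) _ => /=.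
    by apply: lerD; rewrite ler_norml; clear - xA xA' yB yB' x1 x2 y1 y2;
      apply/andP; split; lra.
  have hE : (x - x0) +i* (y - y0) = (x +i* y) - z0 by rewrite /z0; simpc.
  have := DH ((x - x0) +i* (y - y0)); rewrite hE.
  have -> : x0 +i* y0 + (x +i* y - z0) = x +i* y by rewrite /z0; ring.
  rewrite -hE => /(_ _) H1; apply: le_trans (_ : e / (2 * K) * normc ((x - x0) +i* (y - y0)) <= _).
    have -> : H (x +i* y) = F (x +i* y) - F (x0 +i* y0) - ((x - x0) +i* (y - y0)) * k.
      by rewrite /H /G hE /z0; ring.
    by apply: H1; apply: le_lt_trans hn _; rewrite LW.
  by rewrite ler_wpM2l// divr_ge0 ?mulr_ge0// ltW.
have := rint_bound AL BW cH bH; rewrite -rG => bF.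
have := le_trans g5 bF; rewrite [A + _]addrC [B + _]addrC !addrK.
apply/negP; rewrite -ltNge LW.
have -> : (4 : R) ^+ n = 2 ^+ n * 2 ^+ n by rewrite -exprMn; congr (_ ^+ _); ring.
have E2 : 2 ^+ n != 0 :> R by rewrite expf_neq0.
have -> : 2 * ((l + r) / 2 ^+ n) * (e / (2 * K) * ((l + r) / 2 ^+ n)) =
    e / (2 ^+ n * 2 ^+ n) * ((2 * (l + r) ^+ 2) / (2 * K)).
  by field; rewrite E2 gt_eqF.
rewrite gtr_pMr ?divr_gt0 ?mulr_gt0 ?exprn_gt0//.
rewrite ltr_pdivrMr ?mulr_gt0// mul1r /K.
have : 0 <= (l + r) ^+ 2 by exact: sqr_ge0.
lra.
Qed.

End Rectangles.

(** * Cauchy's formula on squares *)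

Section Cauchy.
Variable R : realType.
Implicit Types (a b c d x y M : R) (F G P f g : R[i] -> R[i]) (z w k h : R[i]).

Lemma continuousCM f g z : {for z, continuous (f : R[i]^o -> R[i]^o)} ->
  {for z, continuous (g : R[i]^o -> R[i]^o)} ->
  {for z, continuous ((fun u => f u * g u) : R[i]^o -> R[i]^o)}.
Proof. exact: continuousM. Qed.

Lemma cderiv_invB n z w : z != w ->
  cderiv (fun u => (u - w) ^- n) z (- n%:R * (z - w) ^- n.+1).
Proof.
move=> zw; have zw0 : z - w != 0 by rewrite subr_eq0.
have A := cderivB (cderiv_id z) (cderiv_cst w z).
have B := cderiv_comp A (cderivX n (z - w)).
have := @cderivV R (fun u => (u - w) ^+ n) z _ (expf_neq0 n zw0) B.
congr (cderiv _ _ _); rewrite subr0 mul1r; case: n {B} => [|n] /=.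
  by rewrite !mul0r oppr0 !mul0r.
by rewrite !exprS; field; rewrite zw0 expf_neq0.
Qed.

Lemma continuous_invB n z w : z != w ->
  {for z, continuous ((fun u => (u - w) ^- n) : R[i]^o -> R[i]^o)}.
Proof. by move=> zw; exact: cderiv_continuous (cderiv_invB n zw). Qed.

Lemma cderiv_inv_shift z w : z != w ->
  cderiv (fun u => (u - w)^-1) z (- (z - w) ^- 2).
Proof.
move=> zw; have zw0 : z - w != 0 by rewrite subr_eq0.
have A := cderivB (cderiv_id z) (cderiv_cst w z).
by have := cderiv_comp A (cderiv_inv zw0); rewrite subr0 mul1r.
Qed.

Lemma continuous_inv_shift z w : z != w ->
  {for z, continuous ((fun u => (u - w)^-1) : R[i]^o -> R[i]^o)}.
Proof. by move=> zw; exact: cderiv_continuous (cderiv_inv_shift zw). Qed.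

(** Continuity at the exceptional point is enough: by Goursat's lemma the integral equals the one
    over any small square around the point, which is at most the perimeter times a local bound on
    [F]. *)
Lemma rint_excise F a b c d x y : a < x -> x < b -> c < y -> y < d ->
  rcont F a b c d ->
  (forall x' y', in_rect a b c d x' y' -> (x' +i* y' != x +i* y) ->
    exists l, cderiv F (x' +i* y') l) ->
  rint F a b c d = 0.
Proof.
move=> ax xb cy yd cF dF.
apply/eqP; rewrite -normc_eq0 eq_le normc_ge0 andbT leNgt; apply/negP => D0.
have inxy : in_rect a b c d x y by rewrite /in_rect !ltW.
have /cvgC_epsP/(_ 1 ltr01)[r r0 rF] := cF x y inxy.
pose M := normc (F (x +i* y)) + 1.
have M0 : 0 < M by rewrite ltr_wpDl ?normc_ge0.
(* The half-side [e] keeps the square inside the rectangle and, by [r / 3], inside the disc where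
   [F] is bounded by [M]. The last term makes [8 * e * M] at most half of the integral assumed
   nonzero. *)
pose e := Num.min (Num.min (x - a) (b - x)) (Num.min (Num.min (y - c) (d - y))
  (Num.min (r / 3) (normc (rint F a b c d) / (16 * M)))).
have e0 : 0 < e by rewrite !lt_min !subr_gt0 ax xb cy yd !divr_gt0// mulr_gt0.
have : e <= e by [].
rewrite {2}/e !le_min => /andP[/andP[ea eb] /andP[/andP[ec ed] /andP[er eM]]].
have a1 : a <= x - e by lra.
have b1 : x + e <= b by lra.
have c1 : c <= y - e by lra.
have d1 : y + e <= d by lra.
have x1 : x - e <= x + e by lra.
have y1 : y - e <= y + e by lra.
have cd : c <= d by lra.
have xb' : x - e <= b by lra.
have ax' : a <= x + e by lra.
have yd' : y - e <= d by lra.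
have cy' : c <= y + e by lra.
have Z a' b' c' d' : a <= a' -> a' <= b' -> b' <= b -> c <= c' -> c' <= d' -> d' <= d ->
    (forall u v, in_rect a' b' c' d' u v -> u != x \/ v != y) ->
    rint F a' b' c' d' = 0.
  move=> h1 h2 h3 h4 h5 h6 ne; apply: goursat => // u v uv; apply: dF.
    move: uv => /andP[/andP[u1 u2] /andP[v1 v2]].
    by rewrite /in_rect (le_trans h1 u1) (le_trans u2 h3) (le_trans h4 v1) (le_trans v2 h6).
  have [nu|nv] := ne u v uv.
    by apply/eqP => -[/eqP]; rewrite (negPf nu).
  by apply/eqP => -[_ /eqP]; rewrite (negPf nv).
have E : rint F a b c d = rint F (x - e) (x + e) (y - e) (y + e).
  rewrite (rint_splitx a1 xb' cd cF).
  rewrite (Z a (x - e))//; last first.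
    by move=> u v /andP[/andP[_ u2] _]; left; rewrite lt_eqF//; lra.
  rewrite add0r (rint_splitx x1 b1 cd); last exact: (rcont_sub _ _ _ _ cF).
  rewrite (Z (x + e) b)//; last first.
    by move=> u v /andP[/andP[u2 _] _]; left; rewrite gt_eqF//; lra.
  rewrite addr0 (@rint_splity _ F (x - e) (x + e) c d (y - e))//; last first.
    exact: (rcont_sub _ _ _ _ cF).
  rewrite (Z (x - e) (x + e) c (y - e))//; last first.
    by move=> u v /andP[_ /andP[_ v2]]; right; rewrite lt_eqF//; lra.
  rewrite add0r (@rint_splity _ F (x - e) (x + e) (y - e) d (y + e))//; last first.
    exact: (rcont_sub _ _ _ _ cF).
  rewrite (Z (x - e) (x + e) (y + e) d)//; last first.
    by move=> u v /andP[_ /andP[v2 _]]; right; rewrite gt_eqF//; lra.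
  by rewrite addr0.
have cFe : bcont F (x - e) (x + e) (y - e) (y + e).
  by apply: rcont_bcont; exact: (rcont_sub _ _ _ _ cF).
have bF u v : on_bd (x - e) (x + e) (y - e) (y + e) u v -> normc (F (u +i* v)) <= M.
  move=> /andP[/andP[/andP[u1 u2] /andP[v1 v2]] _].
  have hE : u +i* v = x +i* y + ((u - x) +i* (v - y)).
    by apply/eqP; rewrite eq_complex /= ![_ + (_ - _)]addrC !subrK !eqxx.
  have := rF ((u - x) +i* (v - y)); rewrite -hE => H.
  have {}H : normc (F (u +i* v) - F (x +i* y)) < 1.
    apply: H; apply: le_lt_trans (le_normc_ReIm _) _ => /=.
    have : `|u - x| <= e by rewrite ler_distl u1.
    have : `|v - y| <= e by rewrite ler_distl v1.
    lra.
  by have := le_normcB (F (u +i* v)) (F (x +i* y)); rewrite /M; lra.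
have := rint_bound x1 y1 cFe bF; rewrite -E.
have -> : 2 * (x + e - (x - e) + (y + e - (y - e))) * M = 8 * (e * M) by ring.
apply/negP; rewrite -ltNge.
have : e * M <= normc (rint F a b c d) / 16.
  apply: le_trans (_ : normc (rint F a b c d) / (16 * M) * M <= _).
    by rewrite ler_wpM2r// ltW.
  by rewrite invfM mulrA mulfVK// gt_eqF.
lra.
Qed.

(** The difference quotient of [f] at [w], completed by the derivative at [w], is continuous there
    and differentiable elsewhere; its integral vanishes by [rint_excise]. The winding integral is
    left unevaluated on the right. *)
Theorem cauchy_formula f a b c d x y : a < x -> x < b -> c < y -> y < d ->
  (forall x' y', in_rect a b c d x' y' -> exists l, cderiv f (x' +i* y') l) ->
  rint (fun z => f z * (z - (x +i* y))^-1) a b c d =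
  f (x +i* y) * rint (fun z => (z - (x +i* y))^-1) a b c d.
Proof.
move=> ax xb cy yd df; set w := x +i* y.
have ab : a <= b by lra.
have cd : c <= d by lra.
have [l lf] : exists l, cderiv f w l by apply: df; rewrite /in_rect !ltW.
pose q z := if z == w then l else (f z - f w) * (z - w)^-1.
have bdw u v : on_bd a b c d u v -> u +i* v != w.
  move=> /andP[_ uv]; apply/eqP => -[E1 E2]; move: uv; rewrite E1 E2.
  by rewrite gt_eqF// lt_eqF// gt_eqF// lt_eqF.
have dq u v : in_rect a b c d u v -> u +i* v != w -> exists l, cderiv q (u +i* v) l.
  move=> uv nw; have [m fm] := df u v uv.
  have nz : 0 < normc (u +i* v - w) by rewrite normc_gt0 subr_eq0.
  have := cderivM (cderivB fm (cderiv_cst (f w) _)) (cderiv_inv_shift nw).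
  move=> H; eexists; apply: (cderiv_near nz _ H) => h hn.
  rewrite /q; case: eqP => // E.
  move: hn; have -> : u +i* v - w = - h by rewrite -E; ring.
  by rewrite normcN ltxx.
have cq : rcont q a b c d.
  move=> u v uv; have [E|nw] := eqVneq (u +i* v) w; last first.
    by have [m /cderiv_continuous] := dq u v uv nw.
  rewrite E; apply/cvgC_epsP => e e0.
  have [r r0 rH] := lf (e / 2) ltac:(by rewrite divr_gt0).
  exists r => // h hr; rewrite /q eqxx.
  have [->|h0] := eqVneq h 0; first by rewrite addr0 eqxx subrr normc0.
  have -> : (w + h == w) = false.
    by apply/negbTE; rewrite -subr_eq0 addrAC subrr add0r.
  have -> : (f (w + h) - f w) * (w + h - w)^-1 - l = (f (w + h) - f w - h * l) / h.
    by have -> : w + h - w = h by [ring]; field; exact: h0.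
  rewrite normcM normcV ltr_pdivrMr ?normc_gt0//.
  apply: le_lt_trans (rH h hr) _.
  by rewrite ltr_pM2r ?normc_gt0// ltr_pdivrMr// ltr_pMr// ltr1n.
have := rint_excise ax xb cy yd cq dq => q0.
have cf : bcont f a b c d.
  by move=> u v /andP[/df[m /cderiv_continuous]].
have ci : bcont (fun z => (z - w)^-1) a b c d.
  by move=> u v /bdw uw; exact: continuous_inv_shift uw.
have cfi : bcont (fun z => f z * (z - w)^-1) a b c d.
  by move=> u v uv; apply: continuousCM; [exact: cf|exact: ci].
have cwi : bcont (fun z => - f w * (z - w)^-1) a b c d.
  by move=> u v uv; apply: continuousCM; [exact: cst_continuous|exact: ci].
apply/eqP; rewrite -subr_eq0 -mulNr -(rintZ ab cd (- f w) ci) -(rintD ab cd cfi cwi).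
rewrite -[X in _ == X]q0; apply/eqP; apply: rint_eq => // u v /bdw uw.
by rewrite /q (negPf uw) mulrBl mulNr.
Qed.

(** * Cauchy estimates on a square *)

Section Square.
Variables (x0 y0 d : R).
Hypothesis d0 : 0 < d.
Let z0 := x0 +i* y0.
Local Notation sq F := (rint F (x0 - d) (x0 + d) (y0 - d) (y0 + d)).
Local Notation bd := (on_bd (x0 - d) (x0 + d) (y0 - d) (y0 + d)).
Local Notation bc F := (bcont F (x0 - d) (x0 + d) (y0 - d) (y0 + d)).

Let xx : x0 - d <= x0 + d. Proof. have := d0; lra. Qed.
Let yy : y0 - d <= y0 + d. Proof. have := d0; lra. Qed.

Lemma sq_bd x y : bd x y -> d <= normc (x +i* y - z0) <= 2 * d.
Proof.
move=> /andP[/andP[/andP[x1 x2] /andP[y1 y2]] B].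
have -> : x +i* y - z0 = (x - x0) +i* (y - y0) by rewrite /z0; simpc.
have xd : `|x - x0| <= d by rewrite ler_distl x1.
have yd : `|y - y0| <= d by rewrite ler_distl y1.
apply/andP; split; last first.
  by apply: le_trans (le_normc_ReIm _) _ => /=; lra.
have nd : `|d| = d by rewrite gtr0_norm.
case/or4P: B => /eqP ->.
- apply: le_trans (normc_Re _) => /=.
  by rewrite addrAC subrr add0r normrN nd.
- apply: le_trans (normc_Re _) => /=.
  by rewrite addrAC subrr add0r nd.
- apply: le_trans (normc_Im _) => /=.
  by rewrite addrAC subrr add0r normrN nd.
- apply: le_trans (normc_Im _) => /=.
  by rewrite addrAC subrr add0r nd.
Qed.

Lemma sq_bd_neq x y : bd x y -> x +i* y != z0.
Proof.
move=> /sq_bd/andP[B _]; rewrite -subr_eq0 -normc_gt0; exact: lt_le_trans B.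
Qed.

Lemma sq_bd_far h x y : normc h <= d / 2 -> bd x y ->
  d / 2 <= normc (x +i* y - (z0 + h)).
Proof.
move=> hd /sq_bd/andP[B _]; rewrite opprD addrA.
by have := le_normcB (x +i* y - z0) h; lra.
Qed.

Lemma bcont_pole n : bc (fun z => (z - z0) ^- n).
Proof. by move=> x y /sq_bd_neq; exact: continuous_invB. Qed.

Lemma bcont_pole1 : bc (fun z => (z - z0)^-1).
Proof. by move=> x y /sq_bd_neq; exact: continuous_inv_shift. Qed.

Lemma bcont_far h : normc h <= d / 2 -> bc (fun z => (z - (z0 + h))^-1).
Proof.
move=> hd x y /(sq_bd_far hd) B.
have ne : x +i* y != z0 + h.
  by rewrite -subr_eq0 -normc_gt0; apply: lt_le_trans B; rewrite divr_gt0.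
exact: continuous_inv_shift ne.
Qed.

Lemma bcontM F G : bc F -> bc G -> bc (fun z => F z * G z).
Proof. by move=> cF cG x y xy; apply: continuousCM; [exact: cF|exact: cG]. Qed.

Lemma sq_pole n : sq (fun z => (z - z0) ^- n.+2) = 0.
Proof.
apply: (rint_primitive xx yy (@bcont_pole n.+2)
  (P := fun z => - (n.+1%:R)^-1 * (z - z0) ^- n.+1)) => x y /sq_bd_neq xy.
have := cderivZ (- (n.+1%:R)^-1) (cderiv_invB n.+1 xy).
have -> // : - (n.+1%:R)^-1 * (- n.+1%:R * (x +i* y - z0) ^- n.+2) =
  (x +i* y - z0) ^- n.+2.
by rewrite mulrA mulrNN mulVf ?mul1r// pnatr_eq0.
Qed.

Lemma Rintegral_lower (g : R -> R) u : {within `[u - d, u + d], continuous g} ->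
  (forall t, u - d <= t <= u + d -> (2 * d)^-1 <= g t) ->
  1 <= \int[lebesgue_measure]_(t in `[u - d, u + d]) g t.
Proof.
move=> cg gd.
have ud : u - d <= u + d by have := d0; lra.
have := cint_cst ((2 * d)^-1)%:C ud => -[]; rewrite mul0r subr0 => E _.
have -> : 1 = (u + d - (u - d)) * (2 * d)^-1.
  by field; rewrite gt_eqF.
rewrite -E; apply: within_le_Rintegral => // x; exact: cst_continuous.
Qed.

(** Each of the four sides contributes at least 1 to the imaginary part, because
    [d / (t^2 + d^2) >= 1 / (2 d)] for [|t| <= d]. *)
Lemma sq_winding : 4 <= normc (sq (fun z => (z - z0)^-1)).
Proof.
apply: le_trans (normc_Im _); apply: le_trans (ler_norm _).
have [F1 F2 F3 F4] := bcont_sides xx yy bcont_pole1.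
rewrite /rint; set I1 := cint _ _ _; set I2 := cint _ _ _.
set I3 := cint _ _ _; set I4 := cint _ _ _.
have -> : complex.Im (I1 - I2 + (0 +i* 1) * (I3 - I4)) =
  complex.Im I1 + complex.Im (- I2) + complex.Re I3 + complex.Re (- I4).
  by case: (I1) (I2) (I3) (I4) => [? ?] [? ?] [? ?] [? ?] /=; ring.
rewrite /I2 /I4 -(cintN F2) -(cintN F4) !Im_cint !Re_cint.
have invc (u v : R) : (u +i* v)^-1 = (u / (u ^+ 2 + v ^+ 2)) +i* (- v / (u ^+ 2 + v ^+ 2)).
  by rewrite mulNr.
have low t : -d <= t <= d -> (2 * d)^-1 <= d / (t ^+ 2 + d ^+ 2).
  move=> td; have t2 : t ^+ 2 <= d ^+ 2.
    by rewrite -[t ^+ 2]real_normK ?num_real// ler_pXn2r ?nnegrE ?ler_norml ?normr_ge0// ltW.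
  have dd : 0 < d ^+ 2 by rewrite exprn_gt0.
  have tt : 0 <= t ^+ 2 by exact: sqr_ge0.
  rewrite ler_pdivlMr; last by lra.
  rewrite mulrC ler_pdivrMr ?mulr_gt0//.
  have -> : d * (2 * d) = d ^+ 2 + d ^+ 2 by ring.
  lra.
have B1 : 1 <= \int[lebesgue_measure]_(t in `[x0 - d, x0 + d])
    complex.Im ((t +i* (y0 - d) - z0)^-1).
  apply: Rintegral_lower; first exact: ccont_Im F1.
  move=> t td; have -> : t +i* (y0 - d) - z0 = (t - x0) +i* (- d).
    by apply/eqP; rewrite eq_complex /= eqxx andTb; apply/eqP; ring.
  rewrite invc /= opprK sqrrN; apply: low; lra.
have B2 : 1 <= \int[lebesgue_measure]_(t in `[x0 - d, x0 + d])
    complex.Im (- (t +i* (y0 + d) - z0)^-1).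
  apply: Rintegral_lower; first exact: ccont_Im (ccontN F2).
  move=> t td; have -> : t +i* (y0 + d) - z0 = (t - x0) +i* d.
    by apply/eqP; rewrite eq_complex /= eqxx andTb; apply/eqP; ring.
  rewrite invc /= mulNr opprK; apply: low; lra.
have B3 : 1 <= \int[lebesgue_measure]_(t in `[y0 - d, y0 + d])
    complex.Re (((x0 + d) +i* t - z0)^-1).
  apply: Rintegral_lower; first exact: ccont_Re F3.
  move=> t td; have -> : (x0 + d) +i* t - z0 = d +i* (t - y0).
    by apply/eqP; rewrite eq_complex /= eqxx andbT; apply/eqP; ring.
  rewrite invc /= [d ^+ 2 + _]addrC; apply: low; lra.
have B4 : 1 <= \int[lebesgue_measure]_(t in `[y0 - d, y0 + d])
    complex.Re (- ((x0 - d) +i* t - z0)^-1).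
  apply: Rintegral_lower; first exact: ccont_Re (ccontN F4).
  move=> t td; have -> : (x0 - d) +i* t - z0 = (- d) +i* (t - y0).
    by apply/eqP; rewrite eq_complex /= eqxx andbT; apply/eqP; ring.
  rewrite invc /= mulNr opprK sqrrN [d ^+ 2 + _]addrC; apply: low; lra.
move: B1 B2 B3 B4; lra.
Qed.

(** The finite geometric expansion [1/(u - h) = 1/u + h/u^2 + h^2/u^3 + h^3/(u^3 (u - h))] with
    [u = z - z0], integrated against [g]. *)
Lemma sq_kernel g h : normc h <= d / 2 -> bc g ->
  sq (fun z => g z * (z - (z0 + h))^-1) =
  sq (fun z => g z * (z - z0)^-1) + h * sq (fun z => g z * (z - z0) ^- 2) +
  h ^+ 2 * sq (fun z => g z * (z - z0) ^- 3) +
  h ^+ 3 * sq (fun z => g z * ((z - z0) ^- 3 * (z - (z0 + h))^-1)).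
Proof.
move=> hd cg.
have c1 : bc (fun z => g z * (z - z0)^-1) := bcontM cg bcont_pole1.
have c2 := bcontM cg (@bcont_pole 2); have c3 := bcontM cg (@bcont_pole 3).
have c4 := bcontM cg (bcontM (@bcont_pole 3) (bcont_far hd)).
have bcZ k F : bc F -> bc (fun z => k * F z).
  by move=> cF; apply: (bcontM _ cF) => x y _; exact: cst_continuous.
have bcD F G : bc F -> bc G -> bc (fun z => F z + G z).
  by move=> cF cG x y xy; apply: continuousD; [exact: cF|exact: cG].
rewrite -(rintZ xx yy h c2) -(rintZ xx yy (h ^+ 2) c3) -(rintZ xx yy (h ^+ 3) c4).
rewrite -(rintD xx yy c1 (bcZ h _ c2)).
rewrite -(rintD xx yy (bcD _ _ c1 (bcZ h _ c2)) (bcZ (h ^+ 2) _ c3)).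
rewrite -(rintD xx yy (bcD _ _ (bcD _ _ c1 (bcZ h _ c2)) (bcZ (h ^+ 2) _ c3))
  (bcZ (h ^+ 3) _ c4)).
apply: rint_eq => // x y xy.
have n1 : x +i* y - z0 != 0 by rewrite subr_eq0 sq_bd_neq.
have n2 : x +i* y - z0 - h != 0.
  rewrite -normc_gt0 -addrA -opprD; apply: lt_le_trans (sq_bd_far hd xy).
  by rewrite divr_gt0.
rewrite [z0 + h]addrC opprD [- h - z0]addrC !addrA; field; by rewrite n1 n2.
Qed.

Lemma sq_pole_bound g M : bc g -> (forall x y, bd x y -> normc (g (x +i* y)) <= M) ->
  normc (sq g) <= 8 * d * M.
Proof.
move=> cg gM; have := rint_bound xx yy cg gM.
by have -> : 2 * (x0 + d - (x0 - d) + (y0 + d - (y0 - d))) * M = 8 * d * M by ring.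
Qed.

Variables (f : R[i] -> R[i]).
Hypothesis df : forall x y, in_rect (x0 - d) (x0 + d) (y0 - d) (y0 + d) x y ->
  exists l, cderiv f (x +i* y) l.

Let cf : bc f.
Proof. by move=> x y /andP[/df[l /cderiv_continuous]]. Qed.

Lemma sq_cauchy h : normc h <= d / 2 ->
  sq (fun z => f z * (z - (z0 + h))^-1) = f (z0 + h) * sq (fun z => (z - (z0 + h))^-1).
Proof.
case: h => h1 h2 hd; have dd := d0.
have /ler_normlP[r1 r2] : `|h1| <= d / 2 by apply: le_trans (normc_Re _) hd.
have /ler_normlP[i1 i2] : `|h2| <= d / 2 by apply: le_trans (normc_Im _) hd.
have -> : z0 + (h1 +i* h2) = (x0 + h1) +i* (y0 + h2) by [].
by apply: cauchy_formula => //; lra.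
Qed.

Let c0 := sq (fun z => (z - z0)^-1).

Lemma sq_center : sq (fun z => f z * (z - z0)^-1) = f z0 * c0.
Proof.
by have := @sq_cauchy 0; rewrite addr0; apply; rewrite normc0 divr_ge0// ltW.
Qed.

(** In [sq_kernel] with [g = 1] the poles of order 2 and 3 integrate to 0, so the winding integral
    moves only at order [h^3]. The constant 16 is the perimeter [8 d] times [d^-3] times
    [(d / 2)^-1], up to the power of [d]. *)
Lemma sq_winding_far h : normc h <= d / 2 ->
  exists2 r : R[i], sq (fun z => (z - (z0 + h))^-1) = c0 + h ^+ 3 * r &
    normc r <= 16 / d ^+ 3.
Proof.
move=> hd; have c1 : bc (fun=> 1) by move=> x y _; exact: cst_continuous.
have := sq_kernel hd c1.
have e F : sq (fun z => 1 * F z) = sq F by apply: rint_eq => // x y _; rewrite mul1r.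
rewrite !e !(sq_pole 0) !(sq_pole 1) !mulr0 !addr0 => ->; eexists; first by [].
have -> : 16 / d ^+ 3 = 8 * d * (d ^- 3 * (d / 2)^-1) by field; rewrite gt_eqF.
apply: sq_pole_bound; first exact: bcontM (@bcont_pole 3) (bcont_far hd).
move=> x y xy; have /andP[B _] := sq_bd xy.
rewrite normcM !normcV normcX; apply: ler_pM; rewrite ?invr_ge0 ?exprn_ge0 ?normc_ge0//.
  rewrite lef_pV2 ?posrE ?exprn_gt0//; last exact: lt_le_trans B.
  by rewrite ler_pXn2r// ?nnegrE ?normc_ge0// ltW.
rewrite lef_pV2 ?posrE ?divr_gt0//; first exact: sq_bd_far.
by apply: lt_le_trans (sq_bd_far hd xy); rewrite divr_gt0.
Qed.

(** The correction is at most [(d / 2)^3 * 16 / d^3 = 2], half of the lower bound at the centre. *)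
Lemma sq_bound_far h : normc h <= d / 2 -> 2 <= normc (sq (fun z => (z - (z0 + h))^-1)).
Proof.
move=> hd; have [r -> rB] := sq_winding_far hd.
have := le_normcB c0 (- (h ^+ 3 * r)); rewrite opprK normcN => H; apply: le_trans H.
have w := sq_winding.
suff : normc (h ^+ 3 * r) <= 2 by rewrite -/c0 in w *; lra.
rewrite normcM normcX; apply: le_trans (_ : (d / 2) ^+ 3 * (16 / d ^+ 3) <= _).
  apply: ler_pM; rewrite ?exprn_ge0 ?normc_ge0//.
  by rewrite ler_pXn2r ?nnegrE ?normc_ge0// divr_ge0// ltW.
by have -> : (d / 2) ^+ 3 * (16 / d ^+ 3) = 2 by field; rewrite gt_eqF.
Qed.

(** A maximum principle with a constant: the perimeter [8 d] times [M / (d / 2)] gives [16 M], and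
    the winding integral is at least 2 in modulus. It serves to recover a function near 0 from its
    values on a surrounding contour. *)
Lemma sq_max h M : normc h <= d / 2 ->
  (forall x y, bd x y -> normc (f (x +i* y)) <= M) -> normc (f (z0 + h)) <= 8 * M.
Proof.
move=> hd fM; have B2 := sq_bound_far hd.
have H : normc (f (z0 + h) * sq (fun z => (z - (z0 + h))^-1)) <= 8 * d * (M / (d / 2)).
  rewrite -sq_cauchy//; apply: sq_pole_bound; first exact: bcontM cf (bcont_far hd).
  move=> x y xy; rewrite normcM normcV; apply: ler_pM; rewrite ?invr_ge0 ?normc_ge0 ?fM//.
  rewrite lef_pV2 ?posrE ?divr_gt0//; first exact: sq_bd_far.
  by apply: lt_le_trans (sq_bd_far hd xy); rewrite divr_gt0.
have E : 8 * d * (M / (d / 2)) = 16 * M by field; rewrite gt_eqF.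
rewrite E normcM in H.
have := normc_ge0 (f (z0 + h)).
nra.
Qed.

(** Cauchy's formula at the centre: on the boundary [d / |z - z0| <= 1], and the winding integral is
    at least 4 in modulus. *)
Lemma sq_mean (n1 n2 n3 n4 : R) :
  \int[lebesgue_measure]_(x in `[x0 - d, x0 + d]) normc (f (x +i* (y0 - d))) <= n1 ->
  \int[lebesgue_measure]_(x in `[x0 - d, x0 + d]) normc (f (x +i* (y0 + d))) <= n2 ->
  \int[lebesgue_measure]_(y in `[y0 - d, y0 + d]) normc (f ((x0 + d) +i* y)) <= n3 ->
  \int[lebesgue_measure]_(y in `[y0 - d, y0 + d]) normc (f ((x0 - d) +i* y)) <= n4 ->
  4 * d * normc (f z0) <= n1 + n2 + n3 + n4.
Proof.
move=> N1 N2 N3 N4.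
pose g z := d%:C * (f z * (z - z0)^-1).
have cfz : bc (fun z => f z * (z - z0)^-1) := bcontM cf bcont_pole1.
have cg : bc g.
  by apply: (bcontM _ cfz) => x y _; exact: cst_continuous.
have [G1 G2 G3 G4] := bcont_sides xx yy cg.
have [F1 F2 F3 F4] := bcont_sides xx yy cf.
have gf x y : bd x y -> normc (g (x +i* y)) <= normc (f (x +i* y)).
  move=> xy; have /andP[B _] := sq_bd xy.
  have nz : 0 < normc (x +i* y - z0) by apply: lt_le_trans B.
  rewrite /g !normcM normcV normc_real gtr0_norm// mulrCA ler_piMr ?normc_ge0//.
  by rewrite ler_pdivrMr// mul1r.
have -> : 4 * d * normc (f z0) = 4 * (d * normc (f z0)) by rewrite mulrA.
apply: le_trans (_ : normc (sq g) <= _).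
  rewrite /g rintZ// sq_center !normcM normc_real gtr0_norm//.
  rewrite [d * (_ * _)]mulrA mulrC.
  by rewrite ler_wpM2l ?sq_winding// mulr_ge0 ?normc_ge0// ltW.
apply: le_normc_rint; apply: le_trans (le_normc_cint _) _ => //.
- apply: le_trans N1; apply: (within_le_Rintegral (ccont_normc G1) (ccont_normc F1)).
  by move=> t tx; apply: gf; exact: on_bd_c.
- apply: le_trans N2; apply: (within_le_Rintegral (ccont_normc G2) (ccont_normc F2)).
  by move=> t tx; apply: gf; exact: on_bd_d.
- apply: le_trans N3; apply: (within_le_Rintegral (ccont_normc G3) (ccont_normc F3)).
  by move=> t tx; apply: gf; exact: on_bd_b.
- apply: le_trans N4; apply: (within_le_Rintegral (ccont_normc G4) (ccont_normc F4)).
  by move=> t tx; apply: gf; exact: on_bd_a.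
Qed.

(** The expansion of the Cauchy kernel divided by the winding integral at the centre. The bounds
    depend on [M] and [d] alone, hence are uniform in the centre; the displacement of the winding
    integral is of order [h^3] and joins the remainder. *)
Lemma sq_taylor M : (forall x y, in_rect (x0 - d) (x0 + d) (y0 - d) (y0 + d) x y ->
    normc (f (x +i* y)) <= M) ->
  exists l1 l2, normc l2 <= 2 * M / d ^+ 2 /\
    forall h, normc h <= d / 2 ->
    normc (f (z0 + h) - f z0 - h * l1 - h ^+ 2 * l2) <= 8 * M / d ^+ 3 * normc h ^+ 3.
Proof.
move=> fM.
have w := sq_winding; rewrite -/c0 in w.
have c00 : c0 != 0 by rewrite -normc_gt0; apply: lt_le_trans w; lra.
have fMb x y : bd x y -> normc (f (x +i* y)) <= M by move=> /andP[/fM].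
have M0 : 0 <= M.
  apply: le_trans (normc_ge0 (f z0)) _; apply: fM.
  by have dd := d0; rewrite /in_rect; apply/andP; split; lra.
pose N1 := sq (fun z => f z * (z - z0) ^- 2).
pose N2 := sq (fun z => f z * (z - z0) ^- 3).
have N2B : normc N2 <= 8 * d * (M * d ^- 3).
  apply: sq_pole_bound; first exact: bcontM cf (@bcont_pole 3).
  move=> x y xy; have /andP[B _] := sq_bd xy.
  rewrite normcM normcV normcX; apply: ler_pM; rewrite ?invr_ge0 ?exprn_ge0 ?normc_ge0 ?fMb//.
  rewrite lef_pV2 ?posrE ?exprn_gt0//; last exact: lt_le_trans B.
  by rewrite ler_pXn2r// ?nnegrE ?normc_ge0// ltW.
exists (N1 / c0), (N2 / c0); split.
  rewrite normcM normcV ler_pdivrMr; last by apply: lt_le_trans w; lra.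
  apply: le_trans N2B _.
  have -> : 8 * d * (M * d ^- 3) = 2 * M / d ^+ 2 * 4 by field; rewrite gt_eqF.
  by rewrite ler_wpM2l// divr_ge0 ?mulr_ge0 ?exprn_ge0// ltW.
move=> h hd.
have [r rE rB] := sq_winding_far hd.
have := sq_cauchy hd; rewrite rE (sq_kernel hd cf) sq_center -/N1 -/N2.
set s := sq _ => E.
have sB : normc s <= 8 * d * (M * (d ^- 3 * (d / 2)^-1)).
  apply: sq_pole_bound; first exact: bcontM cf (bcontM (@bcont_pole 3) (bcont_far hd)).
  move=> x y xy; have /andP[B _] := sq_bd xy.
  rewrite !normcM !normcV normcX; apply: ler_pM;
    rewrite ?mulr_ge0 ?invr_ge0 ?exprn_ge0 ?normc_ge0 ?fMb//.
  apply: ler_pM; rewrite ?invr_ge0 ?exprn_ge0 ?normc_ge0//.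
    rewrite lef_pV2 ?posrE ?exprn_gt0//; last exact: lt_le_trans B.
    by rewrite ler_pXn2r// ?nnegrE ?normc_ge0// ltW.
  rewrite lef_pV2 ?posrE ?divr_gt0//; first exact: sq_bd_far.
  by apply: lt_le_trans (sq_bd_far hd xy); rewrite divr_gt0.
have -> : f (z0 + h) - f z0 - h * (N1 / c0) - h ^+ 2 * (N2 / c0) =
    h ^+ 3 * (s - f (z0 + h) * r) / c0.
  apply: (mulIf c00); rewrite mulfVK// !mulrBl -!mulrA !mulVf// !mulr1.
  have -> : f (z0 + h) * c0 = f (z0 + h) * (c0 + h ^+ 3 * r) - f (z0 + h) * (h ^+ 3 * r).
    by ring.
  by rewrite -E; ring.
have fh : normc (f (z0 + h)) <= M.
  case: (h) hd => h1 h2 hd; have dd := d0.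
  have /ler_normlP[r1 r2] : `|h1| <= d / 2 by apply: le_trans (normc_Re _) hd.
  have /ler_normlP[i1 i2] : `|h2| <= d / 2 by apply: le_trans (normc_Im _) hd.
  apply: (fM (x0 + h1) (y0 + h2)).
  by rewrite /in_rect; clear - r1 r2 i1 i2 dd; apply/andP; split; lra.
rewrite normcM [normc (h ^+ 3 * _)]normcM normcX normcV.
rewrite ler_pdivrMr; last by apply: lt_le_trans w; lra.
rewrite [8 * M / _ * _]mulrC -[leRHS]mulrA ler_wpM2l ?exprn_ge0 ?normc_ge0//.
apply: le_trans (le_normcD _ _) _; rewrite normcN normcM.
apply: le_trans (_ : 8 * d * (M * (d ^- 3 * (d / 2)^-1)) + M * (16 / d ^+ 3) <= _).
  by apply: lerD => //; apply: ler_pM; rewrite ?normc_ge0.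
have -> : 8 * d * (M * (d ^- 3 * (d / 2)^-1)) + M * (16 / d ^+ 3) = 8 * M / d ^+ 3 * 4.
  by field; rewrite gt_eqF.
by rewrite ler_wpM2l// divr_ge0 ?mulr_ge0 ?exprn_ge0// ltW.
Qed.

End Square.
End Cauchy.

(** * Analytic functions on the disc and Euler equations *)

Section Holomorphic.
Variable R : realType.
Implicit Types (a b c d x y M t : R) (F G f g H : R[i] -> R[i]) (K P : R -> R[i]).
Implicit Types (z w k h l : R[i]).

Definition hol f := forall z, normc z < 1 -> exists l, cderiv f z l.

(** A total derivative function, with the default value 0 where [f] has no derivative. *)
Definition cD f z := xget 0 [set l | cderiv f z l].

Lemma cDP f z l : cderiv f z l -> cD f z = l.
Proof.
move=> fl; apply: xget_unique => // l' /= fl'; exact: cderiv_unique fl' fl.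
Qed.

Lemma hol_cD f z : hol f -> normc z < 1 -> cderiv f z (cD f z).
Proof. by move=> hf /hf[l fl]; rewrite (cDP fl). Qed.

Lemma hol_continuous f z : hol f -> normc z < 1 ->
  {for z, continuous (f : R[i]^o -> R[i]^o)}.
Proof. by move=> hf /hf[l /cderiv_continuous]. Qed.

Lemma hol_cst k : hol (fun=> k).
Proof. by move=> z _; exists 0; exact: cderiv_cst. Qed.

Lemma hol_id : hol id.
Proof. by move=> z _; exists 1; exact: cderiv_id. Qed.

Lemma holD f g : hol f -> hol g -> hol (fun z => f z + g z).
Proof. by move=> hf hg z z1; eexists; apply: cderivD; exact: hol_cD. Qed.

Lemma holM f g : hol f -> hol g -> hol (fun z => f z * g z).
Proof. by move=> hf hg z z1; eexists; apply: cderivM; exact: hol_cD. Qed.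

Lemma holN f : hol f -> hol (fun z => - f z).
Proof. by move=> hf z z1; eexists; apply: cderivN; exact: hol_cD. Qed.

Lemma holB f g : hol f -> hol g -> hol (fun z => f z - g z).
Proof. by move=> hf hg; apply: holD => //; exact: holN. Qed.

Lemma holX n : hol (fun z => z ^+ n).
Proof. by move=> z z1; eexists; exact: cderivX. Qed.

Lemma compact_disc (r : R) : compact [set w : R * R | normc (w.1 +i* w.2) <= r].
Proof.
apply: (@subclosed_compact _ _ (`[-r, r] `*` `[-r, r])).
- have -> : [set w : R * R | normc (w.1 +i* w.2) <= r] =
      (fun w : R * R => normc (w.1 +i* w.2)) @^-1` [set x | x <= r] by [].
  apply: preimage_closed; last exact: closed_le.
  move=> w _; apply: (@continuous_comp _ R[i]^o); first exact: continuous_complex.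
  exact: continuous_normc.
- by apply: compact_setX; exact: segment_compact.
- move=> [x y] /= xy; split; rewrite /= in_itv/= -ler_norml.
    exact: le_trans (normc_Re (x +i* y)) xy.
  exact: le_trans (normc_Im (x +i* y)) xy.
Qed.

Lemma hol_bounded f (r : R) : hol f -> r < 1 ->
  exists2 M, 0 < M & forall z, normc z <= r -> normc (f z) <= M.
Proof.
move=> hf r1; have [r0|r0] := ltP r 0.
  by exists 1 => // z; rewrite leNgt (lt_le_trans r0 (normc_ge0 z)).
have ne : [set w : R * R | normc (w.1 +i* w.2) <= r] !=set0.
  by exists (0, 0); rewrite /= normc0.
have cf : {within [set w : R * R | normc (w.1 +i* w.2) <= r],
    continuous (fun w : R * R => normc (f (w.1 +i* w.2)))}.
  apply: continuous_in_subspaceT => w; rewrite inE /= => wr.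
  have c1 := @continuous_complex R w.
  have c2 := hol_continuous hf (le_lt_trans wr r1).
  have c3 := @continuous_normc R (f (w.1 +i* w.2)).
  exact: (cvg_comp _ _ (cvg_comp _ _ c1 c2) c3).
have [c _ cM] := compact_EVT_max ne (compact_disc (r := r)) cf.
exists (normc (f (c.1 +i* c.2)) + 1); first by rewrite ltr_wpDl ?normc_ge0.
move=> [x y] xyr; have := cM (x, y); rewrite inE => /(_ xyr) /= H.
by apply: le_trans H _; rewrite lerDl.
Qed.

(** A second-order expansion with constants uniform on a smaller closed disc. Uniformity is what
    differentiation under the integral sign, continuity of the derivative and division by [z] rely
    on. *)
Lemma hol_taylor2 f (r : R) : hol f -> r < 1 ->
  exists M d, [/\ 0 < M, 0 < d, d <= 1 &
    forall z, normc z <= r -> exists l, normc l <= M /\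
      forall h, normc h <= d ->
      normc (f (z + h) - f z - h * cD f z - h ^+ 2 * l) <= M * normc h ^+ 3].
Proof.
move=> hf r1; have [r0|r0] := ltP r 0.
  exists 1, 1; split => // z; by rewrite leNgt (lt_le_trans r0 (normc_ge0 z)).
(* Points of the square of half-side [d] around a point of modulus at most [r] have modulus at most
   [r + 2 * d = (1 + r) / 2], still less than 1. *)
have [d d0 dE] : exists2 d : R, 0 < d & d = (1 - r) / 4.
  by eexists; last by []; rewrite divr_gt0// subr_gt0.
have r2 : (1 + r) / 2 < 1 by lra.
have [M M0 fM] := hol_bounded hf r2.
pose M' := 2 * M / d ^+ 2 + 8 * M / d ^+ 3.
have M1 : 0 < 2 * M / d ^+ 2 by rewrite divr_gt0 ?mulr_gt0 ?exprn_gt0.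
have M2 : 0 < 8 * M / d ^+ 3 by rewrite divr_gt0 ?mulr_gt0 ?exprn_gt0.
exists M', (d / 2); split; [exact: addr_gt0|by rewrite divr_gt0|by lra|].
case=> x0 y0 zr.
have inr x y : in_rect (x0 - d) (x0 + d) (y0 - d) (y0 + d) x y ->
    normc (x +i* y) <= (1 + r) / 2.
  move=> /andP[/andP[x1 x2] /andP[y1 y2]].
  have -> : x +i* y = (x0 +i* y0) + ((x - x0) +i* (y - y0)).
    by apply/eqP; rewrite eq_complex /= ![_ + (_ - _)]addrC !subrK !eqxx.
  apply: le_trans (le_normcD _ _) _.
  apply: le_trans (lerD zr (le_normc_ReIm _)) _ => /=.
  have : `|x - x0| <= d by rewrite ler_norml; apply/andP; split; lra.
  have : `|y - y0| <= d by rewrite ler_norml; apply/andP; split; lra.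
  lra.
have df x y : in_rect (x0 - d) (x0 + d) (y0 - d) (y0 + d) x y ->
    exists l, cderiv f (x +i* y) l.
  by move=> /inr xyr; apply: hf; apply: le_lt_trans xyr _; lra.
have [l1 [l2 [l2B T]]] := sq_taylor d0 df (fun x y xy => fM _ (inr x y xy)).
have l1E : cD f (x0 +i* y0) = l1.
  apply: cDP => e e0.
  pose K := normc l2 + 8 * M / d ^+ 3 + 1.
  have K0 : 0 < K by rewrite ltr_wpDl// addr_ge0 ?normc_ge0// ltW.
  exists (Num.min (d / 2) (Num.min 1 (e / K))).
    by rewrite !lt_min ltr01 !divr_gt0.
  move=> h; rewrite !lt_min => /and3P[hd h1 he].
  have := T h (ltW hd); set X := _ - _ => XB.
  have -> : f (x0 +i* y0 + h) - f (x0 +i* y0) - h * l1 = X + h ^+ 2 * l2.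
    by rewrite /X subrK.
  apply: le_trans (le_normcD _ _) _.
  apply: le_trans (lerD XB (lexx _)) _; rewrite normcM normcX.
  rewrite /K in K0 he; set Q := 8 * M / _ in M2 K0 he *.
  have -> : Q * normc h ^+ 3 + normc h ^+ 2 * normc l2 =
    normc h * (normc h * Q + normc l2) * normc h by ring.
  rewrite ler_wpM2r ?normc_ge0//.
  apply: le_trans (_ : normc h * (normc l2 + Q + 1) <= _); last first.
    by rewrite -ler_pdivlMr// ltW.
  rewrite ler_wpM2l ?normc_ge0//.
  have : normc h * Q <= Q by rewrite ler_piMl// ltW.
  lra.
exists l2; split; first by apply: le_trans l2B _; rewrite lerDl ltW.
move=> h hd; rewrite l1E; apply: le_trans (T h hd) _.
by rewrite ler_wpM2r ?exprn_ge0 ?normc_ge0// lerDr ltW.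
Qed.

Lemma hol_taylor1 f (r : R) : hol f -> r < 1 ->
  exists M d, [/\ 0 < M, 0 < d & forall z, normc z <= r ->
      forall h, normc h <= d ->
      normc (f (z + h) - f z - h * cD f z) <= M * normc h ^+ 2].
Proof.
move=> hf r1; have [M [d [M0 d0 d1 T]]] := hol_taylor2 hf r1.
exists (2 * M), d; split => //; first by rewrite mulr_gt0.
move=> z zr h hd; have [l [lM /(_ h hd) TB]] := T z zr.
rewrite -[X in normc X](subrK (h ^+ 2 * l)); apply: le_trans (le_normcD _ _) _.
rewrite normcM normcX.
have h1 : normc h <= 1 by apply: le_trans hd d1.
have h0 := normc_ge0 h.
have h3 : normc h ^+ 3 <= normc h ^+ 2.
  by rewrite exprSr ler_piMr ?exprn_ge0.
have h2 : 0 <= normc h ^+ 2 by rewrite exprn_ge0.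
apply: le_trans (lerD TB (lexx _)) _.
apply: le_trans (_ : M * normc h ^+ 2 + normc h ^+ 2 * M <= _).
  by apply: lerD; [rewrite ler_wpM2l// ltW|rewrite ler_wpM2l].
by rewrite le_eqVlt; apply/orP; left; apply/eqP; ring.
Qed.

(** The first-order expansions from [z] to [z + h] and back are added: the values of [f] cancel, and
    [h] times the difference of the derivatives is of order [h^2]. *)
Lemma cD_continuous f z : hol f -> normc z < 1 ->
  {for z, continuous (cD f : R[i]^o -> R[i]^o)}.
Proof.
move=> hf z1.
have r2 : (1 + normc z) / 2 < 1 by lra.
have [M [d [M0 d0 T]]] := hol_taylor1 hf r2.
apply/cvgC_epsP => e e0.
exists (Num.min d (Num.min ((1 - normc z) / 2) (e / (2 * M)))).
  by rewrite !lt_min d0 !divr_gt0 ?mulr_gt0 ?subr_gt0.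
move=> h; rewrite !lt_min => /and3P[hd hz he].
have zh : normc (z + h) <= (1 + normc z) / 2.
  by apply: le_trans (le_normcD _ _) _; lra.
have [->|h0] := eqVneq h 0; first by rewrite addr0 subrr normc0.
have zz : normc z <= (1 + normc z) / 2 by lra.
have T1 := T z zz h (ltW hd).
have T2 := T (z + h) zh (- h); rewrite normcN addrK in T2.
have {}T2 := T2 (ltW hd).
have nh : 0 < normc h by rewrite normc_gt0.
rewrite -(ltr_pM2l nh) -normcM.
have -> : h * (cD f (z + h) - cD f z) =
  (f (z + h) - f z - h * cD f z) + (f z - f (z + h) - - h * cD f (z + h)) by ring.
apply: le_lt_trans (le_normcD _ _) _.
apply: le_lt_trans (lerD T1 T2) _.
have -> : M * normc h ^+ 2 + M * normc h ^+ 2 = normc h * (normc h * (2 * M)) by ring.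
by rewrite ltr_pM2l// -ltr_pdivlMr// mulr_gt0.
Qed.

(** The quotient is completed at 0 by the derivative of [f]; its own derivative there is the second
    Taylor coefficient. *)
Lemma hol_div f : hol f ->
  exists2 g, hol g & forall z, normc z < 1 -> f z = f 0 + z * g z.
Proof.
move=> hf; pose g z := if z == 0 then cD f 0 else (f z - f 0) / z.
exists g; last first.
  move=> z _; rewrite /g; case: eqP => [->|/eqP z0]; first by rewrite mul0r addr0.
  by rewrite mulrCA mulfV// mulr1 addrC subrK.
move=> z z1; have [->|z0] := eqVneq z 0; last first.
  have [l fl] := hf z z1.
  have := cderivM (cderivB fl (cderiv_cst (f 0) _)) (cderiv_inv z0).
  have nz : 0 < normc z by rewrite normc_gt0.
  move=> H; eexists; apply: (cderiv_near nz _ H) => h hz.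
  rewrite /g; case: eqP => // E.
  by move: hz; rewrite (_ : h = - z) ?normcN ?ltxx//; apply/eqP; rewrite -addr_eq0 addrC E.
have [M [d [M0 d0 d1 T]]] := hol_taylor2 hf (ltr01 : 0 < 1 :> R).
have [|l [lM {}T]] := T 0; first by rewrite normc0.
exists l => e e0; exists (Num.min d (e / M)); first by rewrite lt_min d0 divr_gt0.
move=> h; rewrite lt_min => /andP[hd he].
have [->|h0] := eqVneq h 0; first by rewrite addr0 subrr mul0r subrr normc0 mulr0.
have := T h (ltW hd); rewrite !add0r /g eqxx (negPf h0) => TB.
have -> : (f h - f 0) / h - cD f 0 - h * l =
    (f h - f 0 - h * cD f 0 - h ^+ 2 * l) / h by field.
have nh : 0 < normc h by rewrite normc_gt0.
rewrite normcM normcV ler_pdivrMr//; apply: le_trans TB _.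
have -> : M * normc h ^+ 3 = normc h * M * normc h * normc h by ring.
rewrite !ler_pM2r// -ler_pdivlMr//; exact: ltW.
Qed.

(** * Integrals along rays and Euler's equation [z y' + c y = H] *)

Definition rderiv (G : R -> R[i]) t l :=
  is_derive t 1 (fun x => complex.Re (G x)) (complex.Re l) /\
  is_derive t 1 (fun x => complex.Im (G x)) (complex.Im l).

Lemma rderivM (F G : R -> R[i]) t k l : rderiv F t k -> rderiv G t l ->
  rderiv (fun x => F x * G x) t (k * G t + F t * l).
Proof.
have ReM (u v : R[i]) : complex.Re (u * v) =
    complex.Re u * complex.Re v - complex.Im u * complex.Im v by case: u v => [? ?] [].
have ImM (u v : R[i]) : complex.Im (u * v) =
    complex.Re u * complex.Im v + complex.Im u * complex.Re v by case: u v => [? ?] [].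
have ReD (u v : R[i]) : complex.Re (u + v) = complex.Re u + complex.Re v.
  by case: u v => [? ?] [].
have ImD (u v : R[i]) : complex.Im (u + v) = complex.Im u + complex.Im v.
  by case: u v => [? ?] [].
move=> [F1 F2] [G1 G2]; split.
  under eq_fun do rewrite ReM.
  have D := is_deriveB (is_deriveM F1 G1) (is_deriveM F2 G2).
  apply: (is_derive_eq D); rewrite ReD !ReM.
  rewrite -![_ *: _]/(_ * _); ring.
under eq_fun do rewrite ImM.
have D := is_deriveD (is_deriveM F1 G2) (is_deriveM F2 G1).
apply: (is_derive_eq D); rewrite ImD !ImM.
rewrite -![_ *: _]/(_ * _); ring.
Qed.

Lemma rderiv_ray f z t : hol f -> t * normc z < 1 -> 0 <= t ->
  rderiv (fun x => f (x%:C * z)) t (z * cD f (t%:C * z)).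
Proof.
move=> hf tz t0; have n : normc (t%:C * z) < 1.
  by rewrite normcM normc_real ger0_norm.
have := hol_cD hf n; rewrite -{1}[t%:C * z]add0r => /cderiv_line[A B].
by split; [move: A|move: B]; under eq_fun do rewrite add0r.
Qed.

Lemma ray_disc t z : 0 <= t <= 1 -> normc z < 1 -> normc (t%:C * z) < 1.
Proof.
move=> /andP[t0 t1] z1; rewrite normcM normc_real ger0_norm//.
by apply: le_lt_trans z1; rewrite ler_piMl ?normc_ge0.
Qed.

Lemma ccont_ray f z : (forall w, normc w < 1 ->
    {for w, continuous (f : R[i]^o -> R[i]^o)}) -> normc z < 1 ->
  ccont 0 1 (fun t => f (t%:C * z)).
Proof.
move=> cf z1; apply: (@ccont_comp _ 0 1 f (fun t => t%:C * z)).
  apply: (@ccont_eq _ 0 1 (fun t => 0 + t%:C * z)); last exact: ccont_line.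
  by move=> t _; rewrite add0r.
by move=> t t01; apply: cf; exact: ray_disc.
Qed.

Lemma hol_const f z : hol f -> (forall w, normc w < 1 -> cD f w = 0) ->
  normc z < 1 -> f z = f 0.
Proof.
move=> hf df z1; apply/eqP; rewrite -subr_eq0; apply/eqP.
have := @cint_FTC _ 0 1 (fun t => f (t%:C * z)) (fun=> 0) ler01 (@ccont_cst _ 0 1 0)
  (ccont_ray (fun w => hol_continuous hf) z1).
rewrite mul1r mul0r => <-; first by rewrite cint_cst// mulr0.
move=> t /andP[t0 t1].
have := rderiv_ray hf _ (ltW t0) (z := z).
rewrite df; last by apply: ray_disc; rewrite ?(ltW t0) ?(ltW t1).
rewrite mulr0; apply; apply: le_lt_trans z1.
by rewrite ler_piMl ?normc_ge0// ltW.
Qed.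

(** With [K t = t^(c-1)] this inverts [z y' + c y]; with [K = 1] and [H w = f w / (1 - w)] it is the
    Cesàro operator. *)
Definition radial K H z := cint 0 1 (fun t => K t * H (t%:C * z)).

(** Differentiation under the integral sign: the first-order remainder of [H] is bounded by
    [M |h|^2] uniformly along the ray, and [K] is bounded. *)
Lemma cderiv_radial K H z : ccont 0 1 K -> hol H -> normc z < 1 ->
  cderiv (radial K H) z (cint 0 1 (fun t => K t * (t%:C * cD H (t%:C * z)))).
Proof.
move=> cK hH z1 e e0.
have [M [d [M0 d0 T]]] := hol_taylor1 hH z1.
have [B B0 KB] := ccont_norm_bounded cK.
exists (Num.min d (Num.min (1 - normc z) (e / (B * M)))).
  by rewrite !lt_min d0 subr_gt0 z1 divr_gt0 ?mulr_gt0.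
move=> h; rewrite !lt_min => /and3P[hd hz he].
have zh : normc (z + h) < 1 by apply: le_lt_trans (le_normcD _ _) _; lra.
have cH w := @hol_continuous H w hH.
have c1 : ccont 0 1 (fun t => K t * H (t%:C * (z + h))) := ccontM cK (ccont_ray cH zh).
have c2 : ccont 0 1 (fun t => K t * H (t%:C * z)) := ccontM cK (ccont_ray cH z1).
have ct : ccont 0 1 (fun t => t%:C : R[i]).
  by apply: ccont_at => t _; exact: continuous_real.
have c3 : ccont 0 1 (fun t => K t * (t%:C * cD H (t%:C * z))).
  exact: (ccontM cK (ccontM ct (ccont_ray (fun w => @cD_continuous H w hH) z1))).
have c3h := ccontM (@ccont_cst _ 0 1 h) c3.
rewrite /radial -(cintB c1 c2) -(cintZ h c3) -(cintB (ccontD c1 (ccontN c2)) c3h).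
apply: le_trans (normc_cint_bound (M := B * (M * normc h ^+ 2)) ler01 _ _) _.
- exact: (ccontD (ccontD c1 (ccontN c2)) (ccontN c3h)).
- move=> t t01; have /andP[t0 t1] := t01.
  have -> : K t * H (t%:C * (z + h)) - K t * H (t%:C * z) -
      h * (K t * (t%:C * cD H (t%:C * z))) =
    K t * (H (t%:C * z + t%:C * h) - H (t%:C * z) - t%:C * h * cD H (t%:C * z)).
    by rewrite mulrDr; ring.
  have th : normc (t%:C * h) <= normc h.
    by rewrite normcM normc_real ger0_norm// ler_piMl ?normc_ge0.
  rewrite normcM; apply: ler_pM; rewrite ?normc_ge0 ?KB//.
  apply: le_trans (T _ _ _ _) _.
  + by rewrite normcM normc_real ger0_norm// ler_piMl ?normc_ge0.
  + by apply: le_trans th _; exact: ltW.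
  + by rewrite ler_wpM2l ?(ltW M0)// ler_pXn2r ?nnegrE ?normc_ge0.
have -> : (1 - 0) * (B * (M * normc h ^+ 2)) = (normc h * (B * M)) * normc h by ring.
by rewrite ler_wpM2r ?normc_ge0// -ler_pdivlMr ?mulr_gt0// ltW.
Qed.

Lemma hol_radial K H : ccont 0 1 K -> hol H -> hol (radial K H).
Proof. by move=> cK hH z z1; eexists; exact: cderiv_radial. Qed.

(** The kernel [t^(c-1)], described by [(t K)' = c K] and [K 1 = 1]. Continuity at 0 is part of the
    description, which is why the instances below have [c = 1] or a real part of [c] above 1. *)
Definition euler_kernel (c : R[i]) K := [/\ ccont 0 1 K, K 1 = 1 &
  forall t, 0 < t < 1 -> rderiv (fun x => x%:C * K x) t (c * K t)].

(** The integrand is the derivative of [t K(t) H(t z)] in [t], which is 0 at [t = 0] and [H z] at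
    [t = 1]. *)
Lemma radial_euler (c : R[i]) K H z : euler_kernel c K -> hol H -> normc z < 1 ->
  radial K (fun w => w * cD H w + c * H w) z = H z.
Proof.
move=> [cK K1 dK] hH z1; rewrite /radial.
have ct : ccont 0 1 (fun t => t%:C : R[i]).
  by apply: ccont_at => t _; exact: continuous_real.
have cH := ccont_ray (fun w => hol_continuous hH) z1.
have cD' := ccont_ray (fun w => cD_continuous hH) z1.
have cz : ccont 0 1 (fun t => t%:C * z) := ccontM ct (@ccont_cst _ 0 1 z).
have c1 : ccont 0 1 (fun t => K t * (t%:C * z * cD H (t%:C * z) + c * H (t%:C * z))).
  exact: (ccontM cK (ccontD (ccontM cz cD') (ccontM (@ccont_cst _ 0 1 c) cH))).
have c2 : ccont 0 1 (fun t => t%:C * K t * H (t%:C * z)).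
  exact: (ccontM (ccontM ct cK) cH).
rewrite (cint_FTC ler01 c1 c2); first by rewrite K1 !mul1r !mul0r subr0.
move=> t t01; have /andP[t0 t1] := t01.
have tz : t * normc z < 1 by apply: le_lt_trans z1; rewrite ler_piMl ?normc_ge0// ltW.
have := rderivM (dK t t01) (rderiv_ray hH tz (ltW t0)).
have -> // : c * K t * H (t%:C * z) + t%:C * K t * (z * cD H (t%:C * z)) =
  K t * (t%:C * z * cD H (t%:C * z) + c * H (t%:C * z)) by ring.
Qed.

(** Differentiation under the integral turns the left side into the integral of [radial_euler]: the
    radial integral commutes with [z d/dz], so the left inverse is also a right inverse. *)
Lemma radial_solves (c : R[i]) K H z : euler_kernel c K -> hol H -> normc z < 1 ->
  z * cD (radial K H) z + c * radial K H z = H z.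
Proof.
move=> eK hH z1; have [cK K1 dK] := eK.
have ct : ccont 0 1 (fun t => t%:C : R[i]).
  by apply: ccont_at => t _; exact: continuous_real.
have cH := ccont_ray (fun w => hol_continuous hH) z1.
have cD' := ccont_ray (fun w => cD_continuous hH) z1.
have c1 := ccontM cK (ccontM ct cD'); have c2 := ccontM cK cH.
rewrite (cDP (cderiv_radial cK hH z1)) -(cintZ z c1) /radial -(cintZ c c2).
rewrite -(cintD (ccontM (@ccont_cst _ 0 1 z) c1) (ccontM (@ccont_cst _ 0 1 c) c2)).
rewrite -[RHS](radial_euler eK hH z1); apply: cint_eq => t _; ring.
Qed.

Lemma euler_kernel1 : euler_kernel 1 (fun=> 1).
Proof.
split; [exact: ccont_cst|by []|move=> t _].
rewrite mulr1; split.
  have -> : (fun x : R => complex.Re (x%:C * 1)) = id.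
    by apply/funext => x; rewrite mulr1.
  exact: is_derive_id.
have -> : (fun x : R => complex.Im (x%:C * 1)) = cst 0.
  by apply/funext => x; rewrite mulr1.
exact: is_derive_cst.
Qed.

End Holomorphic.

(** * Powers of [1 - z] *)

Section ComplexPowers.
Variable R : realType.
Implicit Types (a b x y t : R) (z w k h l s c : R[i]).

Lemma is_derive_eps (f : R -> R) x (l : R) : is_derive x 1 f l ->
  forall e : R, 0 < e -> exists2 d : R, 0 < d &
    forall h : R, `|h| < d -> `|f (x + h) - f x - h * l| <= e * `|h|.
Proof.
move=> D e e0; have /cvg_ex[l' /= fl'] : derivable f x 1 by exact: ex_derive.
have {l' fl'} fl : (fun h : R => h^-1 *: (f (h *: 1 + x) - f x)) @ 0^' --> l.
  have <- : l' = l.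
    by rewrite -(@derive_val _ _ _ _ _ _ _ D); apply/esym/cvg_lim.
  exact: fl'.
have [d /= d0 dA] := fl (ball l e) (nbhsx_ballx l e e0).
exists d => // h hd; have [->|h0] := eqVneq h 0.
  by rewrite addr0 subrr mul0r subr0 normr0 mulr0.
have := dA h; rewrite /ball/= sub0r normrN => /(_ hd h0).
rewrite -![_ *: _]/(_ * _) mulr1 => H.
have -> : f (x + h) - f x - h * l = - h * (l - h^-1 * (f (h + x) - f x)).
  by rewrite [h + x]addrC; field.
by rewrite normrM normrN mulrC ler_wpM2r// ltW.
Qed.

Definition expC z : R[i] :=
  (expR (complex.Re z) * cos (complex.Im z)) +i*
  (expR (complex.Re z) * sin (complex.Im z)).

Lemma expCD z w : expC (z + w) = expC z * expC w.
Proof.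
case: z w => [a b] [c d]; apply/eqP.
rewrite eq_complex /expC /= expRD cosD sinD; apply/andP; split; apply/eqP; ring.
Qed.

Lemma expC0 : expC 0 = 1.
Proof. by rewrite /expC /= expR0 cos0 sin0 mulr1 mulr0. Qed.

Lemma normc_expC z : normc (expC z) = expR (complex.Re z).
Proof.
apply/eqP; rewrite -(eqrXn2 (ltn0Sn 1)) ?normc_ge0 ?expR_ge0//; apply/eqP.
rewrite normcE /expC /= !exprMn -mulrDr cos2Dsin2 mulr1//.
Qed.

Lemma expC_neq0 z : expC z != 0.
Proof. by rewrite -normc_gt0 normc_expC expR_gt0. Qed.

Lemma expCN z : expC (- z) = (expC z)^-1.
Proof.
apply: (mulfI (expC_neq0 z)); rewrite -expCD subrr expC0 mulfV//.
exact: expC_neq0.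
Qed.

(** Differentiability at 0 comes from the real derivatives of [expR], [cos] and [sin]; the addition
    formula then carries it to every point. *)
Lemma cderiv_expC0 : cderiv expC 0 1.
Proof.
move=> e e0.
pose e' := Num.min 1 (e / 8).
have e'0 : 0 < e' by rewrite lt_min ltr01 divr_gt0.
have e'1 : e' <= 1 by rewrite ge_min lexx.
have e'e : e' <= e / 8 by rewrite ge_min lexx orbT.
have [d1 d10 H1] := is_derive_eps (is_derive_expR (0 : R)) e'0.
have [d2 d20 H2] := is_derive_eps (is_derive_cos (0 : R)) e'0.
have [d3 d30 H3] := is_derive_eps (is_derive_sin (0 : R)) e'0.
exists (Num.min (e' / 2) (Num.min d1 (Num.min d2 d3))).
  by rewrite !lt_min d10 d20 d30 divr_gt0.
case=> a b; rewrite !lt_min => /and4P[n0 n1 n2 n3].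
have na := normc_Re (a +i* b); have nb := normc_Im (a +i* b).
rewrite /= in na nb; set n := normc _ in na nb n0 n1 n2 n3 *.
have := H1 a (le_lt_trans na n1); have := H2 b (le_lt_trans nb n2).
have := H3 b (le_lt_trans nb n3).
rewrite !add0r expR0 cos0 sin0 oppr0 mulr0 !mulr1 !subr0 addr0 => S C E.
rewrite expC0.
have -> : expC (a +i* b) - 1 - (a +i* b) =
  (expR a * cos b - 1 - a) +i* (expR a * sin b - b).
  by apply/eqP; rewrite eq_complex /expC /= oppr0 addr0 !eqxx.
apply: le_trans (le_normc_ReIm _) _ => /=.
have -> : expR a * cos b - 1 - a = expR a * (cos b - 1) + (expR a - 1 - a) by ring.
have -> : expR a * sin b - b = expR a * (sin b - b) + (expR a - 1) * b by ring.
have aE : `|expR a - 1| <= 2 * n.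
  have -> : expR a - 1 = (expR a - 1 - a) + a by ring.
  apply: le_trans (ler_normD _ _) _.
  have : e' * `|a| <= 1 * `|a| by rewrite ler_wpM2r.
  lra.
have n00 : 0 <= n := normc_ge0 _.
have E2 : `|expR a| <= 2.
  have -> : expR a = (expR a - 1) + 1 by ring.
  apply: le_trans (ler_normD _ _) _; rewrite normr1; lra.
have en (k : R) : k <= n -> e' * k <= e / 8 * n.
  by move=> kn; apply: le_trans (_ : e' * n <= _); [rewrite ler_wpM2l// ltW|rewrite ler_wpM2r].
have Ea := le_trans E (en _ na).
have Cb := le_trans C (en _ nb).
have Sb := le_trans S (en _ nb).
have T1 : `|expR a * (cos b - 1)| <= 2 * (e / 8 * n).
  by rewrite normrM ler_pM.
have T2 : `|expR a * (sin b - b)| <= 2 * (e / 8 * n).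
  by rewrite normrM ler_pM.
have T3 : `|(expR a - 1) * b| <= 2 * n * (e / 8 / 2).
  rewrite normrM ler_pM//; apply: le_trans nb _; lra.
apply: le_trans (lerD (ler_normD _ _) (ler_normD _ _)) _.
have -> : e * n = 8 * (e / 8 * n) by field.
have E4 : 2 * n * (e / 8 / 2) = e / 8 * n by field.
rewrite E4 in T3.
have : 0 <= e / 8 * n by rewrite mulr_ge0// divr_ge0// ltW.
lra.
Qed.

Lemma cderiv_expC z : cderiv expC z (expC z).
Proof.
move=> e e0; have ez : 0 < e / normc (expC z).
  by rewrite divr_gt0// normc_gt0 expC_neq0.
have [d d0 H] := cderiv_expC0 ez; exists d => // h hd.
rewrite expCD; have -> : expC z * expC h - expC z - h * expC z =
  expC z * (expC (0 + h) - expC 0 - h * 1) by rewrite add0r expC0; ring.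
rewrite normcM mulrC -ler_pdivlMr ?normc_gt0 ?expC_neq0//.
by rewrite mulrAC; exact: H.
Qed.

Lemma normc_lt1_1B z : normc z < 1 -> 1 - z != 0.
Proof.
move=> z1; rewrite subr_eq0; apply/eqP => E; move: z1.
by rewrite -E normc1 ltxx.
Qed.

Lemma Re_1B_gt0 z : normc z < 1 -> 0 < complex.Re (1 - z).
Proof.
move=> z1; case: z z1 => a b z1 /=; rewrite subr_gt0.
by apply: le_lt_trans z1; apply: le_trans (ler_norm _) (normc_Re (a +i* b)).
Qed.

Lemma cderiv_inv1B z : normc z < 1 ->
  cderiv (fun u => (1 - u)^-1) z ((1 - z) ^- 2).
Proof.
move=> z1; have D := cderivB (cderiv_cst 1 z) (cderiv_id z).
have := @cderivV R (fun u => 1 - u) z _ (normc_lt1_1B z1) D.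
by rewrite sub0r opprK mul1r.
Qed.

Lemma hol_inv1B : hol (fun z => (1 - z)^-1 : R[i]).
Proof. by move=> z /cderiv_inv1B; exists ((1 - z) ^- 2). Qed.

(* The principal branch of [log (1 - z)]. *)
Definition log1B z : R[i] := - (z * radial (fun=> 1) (fun w => (1 - w)^-1) z).

Lemma cderiv_log1B z : normc z < 1 -> cderiv log1B z (- (1 - z)^-1).
Proof.
move=> z1; have hr := hol_radial (@ccont_cst _ 0 1 1) hol_inv1B.
have := cderivN (cderivM (cderiv_id z) (hol_cD hr z1)).
rewrite mul1r addrC; have := radial_solves (euler_kernel1 R) hol_inv1B z1.
by rewrite mul1r => ->.
Qed.

Lemma hol_log1B : hol log1B.
Proof. by move=> z /cderiv_log1B; exists (- (1 - z)^-1). Qed.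

Lemma log1B0 : log1B 0 = 0.
Proof. by rewrite /log1B mul0r oppr0. Qed.

(** The quotient of the two sides has derivative 0 on the disc and value 1 at the origin. *)
Lemma expC_log1B z : normc z < 1 -> expC (log1B z) = 1 - z.
Proof.
move=> z1; pose D w := expC (log1B w) * (1 - w)^-1.
have dD w : normc w < 1 -> cderiv D w 0.
  move=> w1; have := cderivM (cderiv_comp (cderiv_log1B w1) (cderiv_expC _))
    (cderiv_inv1B w1).
  have n := normc_lt1_1B w1.
  by congr (cderiv _ _ _); field.
have hD : hol D by move=> w /dD; exists 0.
have cD0 w : normc w < 1 -> cD D w = 0 by move=> /dD/cDP.
have := hol_const hD cD0 z1.
rewrite /D log1B0 expC0 subr0 invr1 mulr1 => E.
by rewrite -[LHS](mulfVK (normc_lt1_1B z1)) E mul1r.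
Qed.

Lemma expR_Re_log1B z : normc z < 1 -> expR (complex.Re (log1B z)) = normc (1 - z).
Proof. by move=> z1; rewrite -normc_expC expC_log1B. Qed.

(** The imaginary part is 0 at the origin. If it exceeded [pi / 2] in modulus, it would equal
    [pi / 2] in modulus at some point of the ray, where the cosine vanishes; but [1 - t z] has
    positive real part. *)
Lemma Im_log1B z : normc z < 1 -> `|complex.Im (log1B z)| <= pi / 2.
Proof.
move=> z1; rewrite leNgt; apply/negP => H.
pose g t := `|complex.Im (log1B (t%:C * z))|.
have cL := ccont_ray (fun w => hol_continuous hol_log1B) z1.
have cg : {within `[0, 1], continuous g}.
  move=> t; apply: continuous_comp; first exact: (ccont_Im cL).
  exact: norm_continuous.
have pi2 : 0 < pi / 2 :> R by rewrite divr_gt0 ?pi_gt0.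
have g0 : g 0 = 0 by rewrite /g mul0r log1B0 normr0.
have g1 : g 1 = `|complex.Im (log1B z)| by rewrite /g mul1r.
have [|t t01 gt] := @IVT _ g 0 1 (pi / 2) ler01 cg.
  by rewrite g0 g1 ge_min le_max ltW//= (ltW H) orbT.
rewrite in_itv/= in t01.
have tz := ray_disc t01 z1.
have := Re_1B_gt0 tz; rewrite -expC_log1B// /expC /=.
have -> : cos (complex.Im (log1B (t%:C * z))) = 0.
  have [|] := ger0P (complex.Im (log1B (t%:C * z))) => s.
    by move: gt; rewrite /g ger0_norm// => ->; exact: cos_pihalf.
  move: gt; rewrite /g ltr0_norm// => E.
  by rewrite -cosN E cos_pihalf.
by rewrite mulr0 ltxx.
Qed.

(* The principal branch of [(1 - z) ^ s]. *)
Definition pow1B s z : R[i] := expC (s * log1B z).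

Lemma pow1BD s k z : pow1B (s + k) z = pow1B s z * pow1B k z.
Proof. by rewrite /pow1B mulrDl expCD. Qed.

Lemma pow1BN s z : pow1B (- s) z = (pow1B s z)^-1.
Proof. by rewrite /pow1B mulNr expCN. Qed.

Lemma pow1B_neq0 s z : pow1B s z != 0.
Proof. exact: expC_neq0. Qed.

Lemma pow1B_at0 s : pow1B s 0 = 1.
Proof. by rewrite /pow1B log1B0 mulr0 expC0. Qed.

Lemma pow1B1 z : normc z < 1 -> pow1B 1 z = 1 - z.
Proof. by move=> z1; rewrite /pow1B mul1r expC_log1B. Qed.

Lemma pow1BnD n s z : normc z < 1 -> pow1B (n%:R + s) z = (1 - z) ^+ n * pow1B s z.
Proof.
move=> z1; elim: n => [|n IH]; first by rewrite add0r expr0 mul1r.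
by rewrite -natr1 -addrA addrCA pow1BD IH pow1B1// exprS mulrA.
Qed.

Lemma cderiv_pow1B s z : normc z < 1 ->
  cderiv (pow1B s) z (- s * (1 - z)^-1 * pow1B s z).
Proof.
move=> z1; have := cderiv_comp (cderivZ s (cderiv_log1B z1)) (cderiv_expC _).
by rewrite mulrN -mulNr.
Qed.

Lemma hol_pow1B s : hol (pow1B s).
Proof. by move=> z z1; eexists; exact: cderiv_pow1B. Qed.

(** Besides [|1 - z|] to the real part of [s], the modulus has a factor [exp u] produced by the
    argument of [1 - z]. This argument is at most [pi / 2] in modulus, so the factor is controlled
    by the imaginary part of [s], uniformly on the disc. *)
Lemma normc_pow1B s z : normc z < 1 -> exists2 u : R, `|u| <= `|complex.Im s| * (pi / 2) &
  normc (pow1B s z) = expR u * normc (1 - z) `^ complex.Re s.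
Proof.
move=> z1; exists (- (complex.Im s * complex.Im (log1B z))).
  by rewrite normrN normrM ler_wpM2l// Im_log1B.
rewrite normc_expC -expR_Re_log1B// /powR gt_eqF ?expR_gt0// expRK -expRD.
by case: s (log1B z) => [a b] [c d] /=; congr expR; ring.
Qed.

Lemma normc_pow1B_ge s z : normc z < 1 ->
  expR (- (`|complex.Im s| * (pi / 2))) * normc (1 - z) `^ complex.Re s <=
  normc (pow1B s z).
Proof.
move=> z1; have [u uB ->] := normc_pow1B s z1.
rewrite ler_wpM2r ?powR_ge0// ler_expR lerNl.
by apply: le_trans uB; rewrite -normrN ler_norm.
Qed.

Lemma normc_pow1B_le s z : normc z < 1 ->
  normc (pow1B s z) <=
  expR (`|complex.Im s| * (pi / 2)) * normc (1 - z) `^ complex.Re s.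
Proof.
move=> z1; have [u uB ->] := normc_pow1B s z1.
rewrite ler_wpM2r ?powR_ge0// ler_expR.
by apply: le_trans uB; rewrite ler_norm.
Qed.

(** The function [t^(c-1)], extended by 0 to [t <= 0], which makes it continuous at 0 when the real
    part of [c] exceeds 1. *)
Definition pow_kernel c t : R[i] :=
  if 0 < t then expC ((c - 1) * (ln t)%:C) else 0.

Lemma normc_pow_kernel c t : 0 < t ->
  normc (pow_kernel c t) = t `^ (complex.Re c - 1).
Proof.
move=> t0; rewrite /pow_kernel t0 normc_expC /powR gt_eqF//.
by case: c => a b /=; rewrite mulr0 subr0.
Qed.

Lemma rderiv_continuous (G : R -> R[i]) t l : rderiv G t l ->
  {for t, continuous (G : R -> R[i]^o)}.
Proof.
move=> [dR dI].
have cR : {for t, continuous (fun x => complex.Re (G x))}.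
  by apply: differentiable_continuous; apply/derivable1_diffP; exact: ex_derive.
have cI : {for t, continuous (fun x => complex.Im (G x))}.
  by apply: differentiable_continuous; apply/derivable1_diffP; exact: ex_derive.
move=> A /nbhs_ballP[e /= e0 eA].
have eE : e = (complex.Re e)%:C by rewrite RRe_real// gtr0_real.
have {e0} e0 : 0 < complex.Re e / 2 by rewrite divr_gt0// -ltcR -eE.
have /nbhs_ballP[d1 /= d10 H1] := cR _ (nbhsx_ballx _ _ e0).
have /nbhs_ballP[d2 /= d20 H2] := cI _ (nbhsx_ballx _ _ e0).
apply/nbhs_ballP; exists (Num.min d1 d2); first by rewrite /= lt_min d10.
move=> x; rewrite /ball/= lt_min => /andP[x1 x2]; apply: eA.
rewrite -ball_normE/= normr_normc eE ltcR.
apply: le_lt_trans (le_normc_ReIm _) _; rewrite [ltRHS]splitr.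
have -> : complex.Re (G t - G x) = complex.Re (G t) - complex.Re (G x).
  by case: (G t) (G x) => [? ?] [].
have -> : complex.Im (G t - G x) = complex.Im (G t) - complex.Im (G x).
  by case: (G t) (G x) => [? ?] [].
by apply: ltrD; [exact: H1|exact: H2].
Qed.

Lemma rderiv_pow_kernel c t : 0 < t ->
  rderiv (pow_kernel c) t ((c - 1) * (t^-1)%:C * pow_kernel c t).
Proof.
move=> t0; set s := c - 1.
have dA (a : R) : is_derive t 1 (fun x : R => a * ln x) (a * t^-1).
  exact: (is_deriveZ a (is_derive1_ln t0)).
have E x : expC (s * (ln x)%:C) =
    (expR (complex.Re s * ln x) * cos (complex.Im s * ln x)) +i*
    (expR (complex.Re s * ln x) * sin (complex.Im s * ln x)).
  by rewrite /expC; case: s => a b /=; rewrite !mulr0 subr0 add0r.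
have K : \forall x \near t, expC (s * (ln x)%:C) = pow_kernel c x.
  apply/nbhs_ballP; exists t => // x; rewrite /ball/= ltr_distlC subrr => /andP[x0 _].
  by rewrite /pow_kernel x0.
have dE := is_derive1_comp (is_derive_expR _) (dA (complex.Re s)).
have dC := is_derive1_comp (is_derive_cos _) (dA (complex.Im s)).
have dS := is_derive1_comp (is_derive_sin _) (dA (complex.Im s)).
have Et : pow_kernel c t = expC (s * (ln t)%:C) by rewrite /pow_kernel t0.
rewrite Et; split.
  apply: (@near_eq_is_derive _ _ _ (fun x : R => complex.Re (expC (s * (ln x)%:C)))) => //.
  - by apply: filterS K => x ->.
  - under eq_fun do rewrite E /=.
    apply: (is_derive_eq (is_deriveM dE dC)).
    rewrite E /= -![_ *: _]/(_ * _); case: s {E K dE dC dS Et dA} => a b /=.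
    by rewrite !mulr0 !subr0 add0r; ring.
apply: (@near_eq_is_derive _ _ _ (fun x : R => complex.Im (expC (s * (ln x)%:C)))) => //.
- by apply: filterS K => x ->.
- under eq_fun do rewrite E /=.
  apply: (is_derive_eq (is_deriveM dE dS)).
  rewrite E /= -![_ *: _]/(_ * _); case: s {E K dE dC dS Et dA} => a b /=.
  by rewrite !mulr0 !subr0 add0r; ring.
Qed.

Lemma pow_kernel_continuous c t : 1 < complex.Re c -> 0 <= t ->
  {for t, continuous (pow_kernel c : R -> R[i]^o)}.
Proof.
move=> c1; rewrite le_eqVlt => /predU1P[<-|t0]; last first.
  exact: rderiv_continuous (rderiv_pow_kernel c t0).
have a0 : 0 < complex.Re c - 1 by rewrite subr_gt0.
move=> A /nbhs_ballP[e /= e0 eA].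
have eE : e = (complex.Re e)%:C by rewrite RRe_real// gtr0_real.
have {e0} e0 : 0 < complex.Re e by rewrite -ltcR -eE.
apply/nbhs_ballP; exists (complex.Re e `^ (complex.Re c - 1)^-1) => /=.
  by rewrite powR_gt0.
move=> x; rewrite /ball/= sub0r normrN => xe; apply: eA.
rewrite -ball_normE/= normr_normc eE ltcR {1}/pow_kernel ltxx sub0r normcN.
have [x0|x0] := ltP 0 x; last by rewrite /pow_kernel (ltNge 0 x) x0 normc0.
rewrite normc_pow_kernel//; rewrite gtr0_norm// in xe.
have := @gt0_ltr_powR R (complex.Re c - 1) a0 x (complex.Re e `^ (complex.Re c - 1)^-1).
rewrite !nnegrE ltW// powR_ge0 => /(_ isT isT xe).
by rewrite -powRrM mulVf ?gt_eqF// powRr1// ltW.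
Qed.

Lemma euler_pow_kernel c : 1 < complex.Re c -> euler_kernel c (pow_kernel c).
Proof.
move=> c1; split.
- by apply: ccont_at => t /andP[t0 _]; exact: pow_kernel_continuous.
- by rewrite /pow_kernel ltr01 ln1 mulr0 expC0.
move=> t /andP[t0 _].
have d1 : rderiv (fun x : R => x%:C : R[i]) t 1.
  by split => /=; [exact: is_derive_id|exact: is_derive_cst].
have := rderivM d1 (rderiv_pow_kernel c t0).
congr (rderiv _ _ _).
have -> : t%:C * ((c - 1) * t^-1%:C * pow_kernel c t) =
    t%:C * t^-1%:C * ((c - 1) * pow_kernel c t) by ring.
by rewrite -rmorphM/= mulfV ?gt_eqF// mul1r; ring.
Qed.

End ComplexPowers.

(** * Lebesgue measure *)

Section LebesgueScaling.
Variable R : realType.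
Implicit Types (a b c r t : R).
Local Notation T1 := (measurableTypeR R).
Local Notation leb := (@lebesgue_measure R).
Local Notation leb2 := ((@lebesgue_measure R) \x (@lebesgue_measure R))%E.
Local Open Scope ereal_scope.

Lemma measurable_affine a b : measurable_fun [set: T1] (fun x : T1 => (a * x + b)%R : T1).
Proof. by apply: measurable_funD => //; exact: measurable_funM. Qed.

(** By uniqueness of Lebesgue measure: [|a|] times the image measure gives half-open intervals their
    length. For [a < 0] the preimage of such an interval is closed at the other end. *)
Lemma lebesgue_measure_affine a b (A : set T1) : a != 0%R -> measurable A ->
  pushforward leb (fun x : T1 => (a * x + b)%R : T1) A = (`|a|^-1)%:E * leb A.
Proof.
move=> a0 mA; have na : (0 < `|a|)%R by rewrite normr_gt0.
pose phi (x : T1) : T1 := (a * x + b)%R.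
pose k : {nonneg R} := NngNum (normr_ge0 a).
have E : leb A = mscale k (pushforward leb phi) A.
  move=> mphi; apply: lebesgue_measure_unique => //= _ [[u v]] _ <-.
  rewrite /mscale /= /pushforward lebesgue_measure_itv/= lte_fin.
  have [a1|a1] := ltP 0%R a.
    have -> : phi @^-1` `]u, v] = `]((u - b) / a)%R, ((v - b) / a)%R]%classic.
      apply/seteqP; split => x; rewrite /= !in_itv/=;
      by rewrite ltr_pdivrMr// ler_pdivlMr// ltrBlDr lerBrDr [(x * a)%R]mulrC.
    rewrite lebesgue_measure_itv/= lte_fin ltr_pM2r ?invr_gt0// ltrD2r.
    case: ifPn => _; last by rewrite mule0.
    rewrite -!EFinD -EFinM gtr0_norm//; congr EFin.
    by field; rewrite gt_eqF.
  have {}a1 : (a < 0)%R by rewrite lt_def eq_sym a0.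
  have -> : phi @^-1` `]u, v] = `[((v - b) / a)%R, ((u - b) / a)%R[%classic.
    apply/seteqP; split => x; rewrite /= !in_itv/=;
    by rewrite ler_ndivrMr// ltr_ndivlMr// ltrBlDr lerBrDr [(x * a)%R]mulrC andbC.
  rewrite lebesgue_measure_itv/= lte_fin ltr_nM2r ?invr_lt0// ltrD2r.
  case: ifPn => _; last by rewrite mule0.
  rewrite -!EFinD -EFinM ltr0_norm//; congr EFin.
  by field; rewrite lt_eqF.
rewrite (E (measurable_affine a b)) /mscale/= muleA -EFinM mulVf ?gt_eqF// mul1e//.
Qed.

Lemma ge0_integral_affine a b (f : T1 -> \bar R) : a != 0%R ->
  measurable_fun [set: T1] f -> (forall x, 0 <= f x) ->
  \int[leb]_x f (a * x + b)%R = (`|a|^-1)%:E * \int[leb]_x f x.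
Proof.
move=> a0 mf f0.
have := ge0_integral_pushforward (measurable_affine a b) leb measurableT mf
  (fun x _ => f0 x).
rewrite preimage_setT => <-.
have k0 : (0 <= `|a|^-1)%R by rewrite invr_ge0.
pose k : {nonneg R} := NngNum k0.
rewrite (_ : (`|a|^-1)%:E = k%:num%:E)// -ge0_integral_mscale//.
apply: eq_measure_integral; first exact: measurable_affine.
move=> mphi A mA _.
by have := lebesgue_measure_affine b a0 mA; apply.
Qed.

Lemma ge0_integral_isometry e b (f : T1 -> \bar R) : `|e|%R = 1%R ->
  measurable_fun [set: T1] f -> (forall x, 0 <= f x) ->
  \int[leb]_x f (e * x + b)%R = \int[leb]_x f x.
Proof.
move=> e1 mf f0; rewrite ge0_integral_affine// ?e1 ?invr1 ?mul1e//.
by rewrite -normr_gt0 e1.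
Qed.

Lemma ge0_integral_dilation t (G : T1 * T1 -> \bar R) : (0 < t)%R ->
  measurable_fun [set: T1 * T1] G -> (forall w, 0 <= G w) ->
  \int[leb2]_w G ((t * w.1)%R, (t * w.2)%R) = (t ^- 2)%:E * \int[leb2]_w G w.
Proof.
move=> t0 mG G0; have tn : t != 0%R by rewrite gt_eqF.
have ms : measurable_fun [set: T1 * T1]
    (fun w : T1 * T1 => ((t * w.1)%R, (t * w.2)%R) : T1 * T1).
  by apply/measurable_fun_pairP; split; apply: measurable_funM.
rewrite fubini_tonelli1//; last exact: measurableT_comp mG ms.
rewrite [X in _ = _ * X]fubini_tonelli1//.
rewrite /fubini_F /=.
transitivity (\int[leb]_x ((t^-1)%:E * \int[leb]_y G ((t * x)%R, y))).
  apply: eq_integral => x _.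
  have := @ge0_integral_affine t 0%R (fun y => G ((t * x)%R, y)) tn.
  rewrite gtr0_norm// => <- //; last first.
    exact: measurableT_comp mG (measurable_pair1 _).
  by apply: eq_integral => y _; rewrite addr0.
have mF := measurable_fun_fubini_tonelli_F (m2 := leb) G mG G0.
rewrite ge0_integralZl; last 4 first.
- exact: measurableT.
- apply: (measurableT_comp mF); exact: measurable_funM.
- by move=> x _; exact: integral_ge0.
- by rewrite lee_fin invr_ge0 ltW.
have := @ge0_integral_affine t 0%R (fubini_F leb G) tn mF.
rewrite (gtr0_norm t0) => H.
have -> : \int[leb]_x (\int[leb]_y G ((t * x)%R, y)) =
    \int[leb]_x fubini_F leb G (t * x + 0)%R.
  by apply: eq_integral => x _; rewrite addr0.
rewrite H; last by move=> x; exact: integral_ge0.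
by rewrite muleA -EFinM -invfM -expr2.
Qed.

End LebesgueScaling.

(** * Integrable powers on bounded intervals *)

Section PowerIntegral.
Variable R : realType.
Implicit Types (a b c r t k : R).
Local Notation T1 := (measurableTypeR R).
Local Notation leb := (@lebesgue_measure R).
Local Notation leb2 := ((@lebesgue_measure R) \x (@lebesgue_measure R))%E.

Lemma Rintegral_powR k e : 0 < e -> e < 1 -> k < 1 ->
  \int[leb]_(x in `[e, 1]) x `^ (- k) <= (1 - k)^-1.
Proof.
move=> e0 e1 k1; have k0 : 0 < 1 - k by rewrite subr_gt0.
have cp (s : R) : {within `[e, 1], continuous (fun x : R => x `^ s)}.
  apply: continuous_in_subspaceT => x; rewrite inE/= in_itv/= => /andP[ex _].
  apply: differentiable_continuous; apply/derivable1_diffP.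
  have := is_derive1_powR s (lt_le_trans e0 ex) => ?; exact: ex_derive.
have dF' t : 0 < t ->
    is_derive t 1 (fun x : R => (1 - k)^-1 * x `^ (1 - k)) (t `^ (- k)).
  move=> t0; have D := is_deriveZ (1 - k)^-1 (is_derive1_powR (1 - k) t0).
  apply: (is_derive_eq D).
  rewrite -[_ *: _]/(_ * _) mulrA mulVf ?gt_eqF// mul1r.
  by congr (_ `^ _); ring.
have cF : {within `[e, 1], continuous (fun x : R => (1 - k)^-1 * x `^ (1 - k))}.
  apply: continuous_in_subspaceT => x; rewrite inE/= in_itv/= => /andP[ex _].
  apply: differentiable_continuous; apply/derivable1_diffP.
  have := dF' x (lt_le_trans e0 ex) => ?; exact: ex_derive.
have dF t : e < t < 1 ->
    is_derive t 1 (fun x : R => (1 - k)^-1 * x `^ (1 - k)) (t `^ (- k)).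
  by move=> /andP[et _]; exact: dF' (lt_trans e0 et).
rewrite (within_FTC e1 (cp _) cF dF) powR1 mulr1 gerBl mulr_ge0 ?powR_ge0//.
by rewrite invr_ge0 ltW.
Qed.

Local Open Scope ereal_scope.

Lemma integral_powR_unit k : (k < 1)%R ->
  \int[leb]_(x in `]0%R, 1%R]) (x `^ (- k))%:E <= ((1 - k)^-1)%:E.
Proof.
move=> k1.
have k0 : (0 < 1 - k)%R by rewrite subr_gt0.
(* Monotone convergence along intervals exhausting []0, 1]]; [n.+2] keeps the left endpoint strictly
   below 1. *)
pose F (n : nat) : set T1 := [set` `[((n.+2%:R : R)^-1)%R, 1%R]].
have FE : \bigcup_n F n = `]0%R, 1%R]%classic :> set T1.
  apply/seteqP; split => x.
    move=> [n _]; rewrite /F /= !in_itv/= => /andP[nx ->]; rewrite andbT.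
    by apply: lt_le_trans nx; rewrite invr_gt0.
  rewrite /= in_itv/= => /andP[x0 x1]; exists (Num.truncn (x^-1)) => //.
  rewrite /F /= in_itv/= x1 andbT -[leRHS]invrK lef_pV2 ?posrE ?invr_gt0//.
  by apply: ltW; apply: lt_le_trans (truncnS_gt _) _; rewrite ler_nat.
have mp s (A : set T1) : measurable_fun A (fun x : R => (x `^ s)%:E).
  by apply/measurable_EFinP; apply: measurable_funTS; exact: measurable_powR.
have ndF : nondecreasing_seq F.
  move=> m n mn; apply/subsetPset => x; rewrite /F /= !in_itv/= => /andP[mx ->].
  by rewrite andbT; apply: le_trans mx; rewrite lef_pV2 ?posrE// ler_nat !ltnS.
have mF i : measurable (F i) by exact: measurable_itv.
have c := @ge0_nondecreasing_set_cvg_integral _ _ _ F (fun x => (x `^ (- k))%:E) leb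
  ndF mF (fun i => mp (- k)%R (F i)) (fun i x _ => powR_ge0 x (- k)%R).
rewrite -FE -(cvg_lim _ c)//; apply: lime_le.
  by apply/cvg_ex; eexists; exact: c.
apply: nearW => n.
have n0 : (0 < n.+2%:R^-1 :> R)%R by rewrite invr_gt0.
have n1 : (n.+2%:R^-1 < 1 :> R)%R by rewrite invf_lt1// ltr1n.
have := Rintegral_powR n0 n1 k1; rewrite -lee_fin /Rintegral fineK//.
apply: integrable_fin_num; first exact: measurable_itv.
apply: within_integrable; apply: continuous_in_subspaceT => x.
rewrite inE/= in_itv/= => /andP[nx _].
apply: differentiable_continuous; apply/derivable1_diffP.
have := is_derive1_powR (- k)%R (lt_le_trans n0 nx) => ?; exact: ex_derive.
Qed.

Lemma integral_abs_powR_unit k : (k < 1)%R ->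
  \int[leb]_x (`|x| `^ (- k) * \1_(`]-1, 1[%classic : set R) x)%:E <=
  (2 * (1 - k)^-1 + 2)%:E.
Proof.
move=> k1.
pose g (x : T1) : \bar R := (x `^ (- k) * \1_(`]0, 1]%classic : set R) x)%:E.
(* [h] covers the point 0, which the half-open interval in [g] leaves out; its integral is the
   additional 2 of the bound. *)
pose h (x : T1) : \bar R := (\1_(`[-1, 1]%classic : set R) x)%:E.
have mg : measurable_fun [set: T1] g.
  apply/measurable_EFinP; apply: measurable_funM; first exact: measurable_powR.
  by apply: measurable_indic; exact: measurable_itv.
have mh : measurable_fun [set: T1] h.
  by apply/measurable_EFinP; apply: measurable_indic; exact: measurable_itv.
have g0 x : 0 <= g x by rewrite lee_fin mulr_ge0 ?powR_ge0.
have h0 x : 0 <= h x by rewrite lee_fin.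
have mgN : measurable_fun [set: T1] (fun x => g (- x)%R).
  by apply: measurableT_comp mg _; exact: oppr_measurable.
have Ig : \int[leb]_x g x <= ((1 - k)^-1)%:E.
  apply: le_trans (integral_powR_unit k1).
  rewrite [X in _ <= X]integral_mkcond; apply: ge0_le_integral => //.
  - apply/(measurable_restrictT _ (measurable_itv `]0%R, 1%R])).
    by apply/measurable_EFinP; apply: measurable_funTS; exact: measurable_powR.
  - move=> x _; rewrite /g patchE indicE; case: ifP => _; rewrite ?mulr1 ?mulr0//.
have IgN : \int[leb]_x g (- x)%R = \int[leb]_x g x.
  have n10 : (-1 != 0 :> R)%R by rewrite oppr_eq0 oner_eq0.
  have := @ge0_integral_affine R (-1)%R 0%R g n10 mg g0.
  rewrite normrN1 invr1 mul1e => <-.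
  by apply: eq_integral => x _; rewrite mulN1r addr0.
have Ih : \int[leb]_x h x = 2%:E.
  have mI : measurable (`[(-1)%R, 1%R]%classic : set T1) by exact: measurable_itv.
  have := @integral_indic _ T1 R leb setT measurableT _ mI; rewrite setIT => ->.
  apply: etrans (lebesgue_measure_itv `[(-1)%R, 1%R]) _.
  by rewrite /= lte_fin gtrN// -EFinD opprK.
apply: (@le_trans _ _ (\int[leb]_x (g x + g (- x)%R + h x))).
  apply: ge0_le_integral => //.
  - apply/measurable_EFinP; apply: measurable_funM.
      by apply: (measurableT_comp (measurable_powR _)); exact: normr_measurable.
    by apply: measurable_indic; exact: measurable_itv.
  - by apply: emeasurable_funD => //; exact: emeasurable_funD.
  move=> x _; rewrite /g /h -!EFinD lee_fin !indicE !mem_setE !in_itv/=.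
  have [x0|x0|x0] := ltgtP x 0%R.
  - rewrite ltr0_norm// mulr0 add0r; apply: ler_wpDr => //.
    rewrite ler_wpM2l ?powR_ge0// ler_nat oppr_gt0 x0 /= lerNl.
    by case: ltP => //= /ltW ->; rewrite leq_b1.
  - rewrite gtr0_norm// -addrA; apply: ler_wpDr.
      by rewrite addr_ge0// mulr_ge0 ?powR_ge0.
    rewrite ler_wpM2l ?powR_ge0// ler_nat /=.
    by case: (ltP x 1%R) => [/ltW ->|_]; rewrite ?andbF// leq_b1.
  - rewrite x0 normr0 oppr0 ltxx !mulr0 !add0r /=.
    rewrite lerN10 ler01 ltrN10 ltr01 mulr1 /powR eqxx.
    by case: eqP => _; rewrite ?lexx ?ler01.
rewrite ge0_integralD//; last 2 first.
- by move=> x _; exact: adde_ge0.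
- exact: emeasurable_funD.
rewrite ge0_integralD// IgN Ih.
have -> : (2 * (1 - k)^-1 + 2)%:E =
    (1 - k)^-1%:E + (1 - k)^-1%:E + 2%:E :> \bar R.
  by rewrite -!EFinD; congr EFin; ring.
by apply: leeD; [exact: leeD|].
Qed.

Lemma integral_abs_powR k r c : (k < 1)%R -> (0 < r)%R ->
  \int[leb]_x (`|x - c| `^ (- k) * \1_(`]c - r, c + r[%classic : set R) x)%:E <=
  ((2 * (1 - k)^-1 + 2) * r `^ (1 - k))%:E.
Proof.
move=> k1 r0.
pose h (x : T1) : \bar R := (`|x| `^ (- k) * \1_(`]-1, 1[%classic : set R) x)%:E.
have mh : measurable_fun [set: T1] h.
  apply/measurable_EFinP; apply: measurable_funM.
    by apply: (measurableT_comp (measurable_powR _)); exact: normr_measurable.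
  by apply: measurable_indic; exact: measurable_itv.
have h0 x : 0 <= h x by rewrite lee_fin mulr_ge0 ?powR_ge0.
have rn : (r^-1 != 0)%R by rewrite invr_eq0 gt_eqF.
have ri : (0 < r^-1)%R by rewrite invr_gt0.
have := @ge0_integral_affine R r^-1 (- c / r)%R h rn mh h0.
rewrite gtr0_norm// invrK => H.
have E x : (`|x - c| `^ (- k) * \1_(`]c - r, c + r[%classic : set R) x)%:E =
    (r `^ (- k))%:E * h (r^-1 * x + (- c / r))%R.
  rewrite /h -EFinM; congr EFin; rewrite mulrA; congr (_ * _)%R.
    rewrite -powRM ?normr_ge0 ?ltW//; congr (_ `^ _)%R.
    rewrite -{1}[r]gtr0_norm// -normrM; congr `|_|%R.
    by field; rewrite gt_eqF.
  rewrite !indicE !mem_setE !in_itv/=; congr (nat_of_bool _)%:R%R.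
  have -> : (r^-1 * x + - c / r = (x - c) / r)%R by field; rewrite gt_eqF.
  rewrite ltr_pdivlMr// ltr_pdivrMr// mulN1r mul1r.
  by apply/idP/idP => /andP[? ?]; apply/andP; split; lra.
under eq_integral do rewrite E.
rewrite ge0_integralZl//; last 2 first.
- by apply: (measurableT_comp mh); exact: measurable_affine.
- by rewrite lee_fin powR_ge0.
rewrite H powRB; last by rewrite gt_eqF// implybT.
rewrite (powRr1 (ltW r0)) powRN.
apply: (@le_trans _ _ ((r `^ k)^-1%:E * (r%:E * (2 * (1 - k)^-1 + 2)%:E))).
  rewrite lee_wpmul2l ?lee_fin ?invr_ge0 ?powR_ge0//.
  by rewrite lee_wpmul2l ?lee_fin ?(ltW r0)//; exact: integral_abs_powR_unit.
by rewrite -!EFinM lee_fin le_eqVlt; apply/orP; left; apply/eqP; ring.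
Qed.

End PowerIntegral.

(** * Area mean values and pointwise bounds *)

Section WeightedHoelder.
Local Open Scope ereal_scope.
Context d (T : measurableType d) (R : realType) (mu : {measure set T -> \bar R}).

(** Hölder's inequality for the factors [u w^(-1/q)] and [w^(1/q)] with [1/q = (p - 1)/p], raised to
    the power [p]. Positivity of [w] makes the two powers cancel in the product. *)
Lemma hoelder_weight (D : set T) (u w : T -> R) (p : R) : (1 < p)%R ->
  measurable D -> measurable_fun D u -> measurable_fun D w ->
  (forall x, D x -> 0 <= u x)%R -> (forall x, D x -> 0 < w x)%R ->
  (\int[mu]_(x in D) (u x)%:E) `^ p <=
  (\int[mu]_(x in D) (w x)%:E) `^ (p - 1) *
  \int[mu]_(x in D) (u x `^ p * w x `^ (1 - p))%:E.
Proof.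
move=> p1 mD mu' mw u0 w0.
have p0 : (0 < p)%R by apply: lt_trans p1.
have pn : (p != 0)%R by rewrite gt_eqF.
have p10 : (0 < p - 1)%R by rewrite subr_gt0.
pose q := (p / (p - 1))%R.
have q0 : (0 < q)%R by rewrite divr_gt0.
have qn : (q != 0)%R by rewrite gt_eqF.
have qE : (q^-1 = (p - 1) / p)%R by rewrite /q invf_div.
have pq : (p^-1 + q^-1 = 1)%R by rewrite qE; field.
pose f := (fun x => u x * w x `^ (- q^-1))%R \_ D.
pose g := (fun x => w x `^ q^-1)%R \_ D.
have mpow (h : T -> R) s : measurable_fun D h -> measurable_fun D (fun x => h x `^ s)%R.
  by move=> mh; apply: (measurableT_comp (measurable_powR _)).
have mf : measurable_fun [set: T] f.
  by apply/(measurable_restrictT _ mD); apply: measurable_funM => //; exact: mpow.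
have mg : measurable_fun [set: T] g by apply/(measurable_restrictT _ mD); exact: mpow.
have H := hoelder mu mf mg p0 q0 pq.
have N1 : 'N[mu]_1[EFin \o (f \* g)%R] = \int[mu]_(x in D) (u x)%:E.
  rewrite Lnorm1 [RHS]integral_mkcond; apply: eq_integral => x _ /=.
  rewrite /f /g !patchE; case: ifPn => [/set_mem Dx|_]; last first.
    by rewrite mul0r normr0.
  rewrite -mulrA powRN mulVf ?mulr1 ?gt_eqF ?powR_gt0 ?w0//.
  by rewrite ger0_norm ?u0.
have Np : 'N[mu]_p%:E[EFin \o f] `^ p =
    \int[mu]_(x in D) (u x `^ p * w x `^ (1 - p))%:E.
  rewrite unlock /Lnorm -poweRrM mulVf// poweRe1; last first.
    by apply: integral_ge0 => x _; exact: poweR_ge0.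
  rewrite [RHS]integral_mkcond; apply: eq_integral => x _ /=.
  rewrite /f !patchE; case: ifPn => [/set_mem Dx|_]; last first.
    by rewrite normr0 powR0.
  rewrite ger0_norm ?mulr_ge0 ?powR_ge0 ?u0// powRM ?powR_ge0 ?u0//.
  rewrite -powRrM; congr (EFin (_ * _ `^ _)%R).
  by rewrite qE; field.
have Nq : 'N[mu]_q%:E[EFin \o g] `^ p =
    (\int[mu]_(x in D) (w x)%:E) `^ (p - 1).
  rewrite unlock /Lnorm -poweRrM qE mulfVK//; congr (_ `^ _).
  rewrite [RHS]integral_mkcond; apply: eq_integral => x _ /=.
  rewrite /g !patchE; case: ifPn => [/set_mem Dx|_]; last first.
    by rewrite normr0 powR0.
  by rewrite ger0_norm ?powR_ge0// -powRrM mulVf// powRr1// ltW// w0.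
rewrite -N1 -Np -Nq muleC -poweRM ?Lnorm_ge0//.
apply: gt0_ler_poweR => //; first exact: ltW.
- by rewrite in_itv/= leey Lnorm_ge0.
- by rewrite in_itv/= leey mule_ge0 ?Lnorm_ge0.
Qed.

End WeightedHoelder.

Section AreaMean.
Variable R : realType.
Implicit Types (f : R[i] -> R[i]^o) (p mu : R).
Local Notation T1 := (measurableTypeR R).
Local Notation T2 := (T1 * T1)%type.
Local Notation leb := (@lebesgue_measure R).
Local Notation leb2 := ((@lebesgue_measure R) \x (@lebesgue_measure R))%E.

Lemma unit_discE (z : R[i]) : unit_disc z = (normc z < 1) :> Prop.
Proof. by rewrite /unit_disc/= normr_normc -[X in _ < X]/(1%:C) ltcR. Qed.

Lemma plane_discE : @plane_disc R = [set w | normc (w.1 +i* w.2) < 1].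
Proof.
by apply/funext => w; rewrite /plane_disc/= unit_discE.
Qed.

Lemma measurable_plane_disc : measurable (@plane_disc R : set T2).
Proof. exact: (plane_open_measurable (@plane_disc_open R)). Qed.

Lemma analytic_disc_hol f : analytic_disc f -> hol (f : R[i] -> R[i]).
Proof.
move=> [df _] z z1; apply/cderiv_derivable; apply: df.
by rewrite unit_discE.
Qed.

Lemma analytic_disc0r f z : analytic_disc f -> 1 <= normc z -> f z = 0.
Proof.
move=> [_ f0] z1; apply: f0; rewrite unit_discE.
by apply/negP; rewrite -leNgt.
Qed.

Lemma hol_analytic_disc (g : R[i] -> R[i]) : hol g ->
  analytic_disc ((fun z => if normc z < 1 then g z else 0) : R[i] -> R[i]^o).
Proof.
move=> hg; split => z; rewrite unit_discE => z1.
  apply/cderiv_derivable; have [l gl] := hg z z1; exists l.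
  have d0 : 0 < 1 - normc z by rewrite subr_gt0.
  apply: (cderiv_near d0 _ gl) => h hz.
  by rewrite ifT//; apply: le_lt_trans (le_normcD _ _) _; rewrite addrC -ltrBrDr.
by rewrite ifF//; apply/negbTE/negP.
Qed.

Lemma measurable_normc_plane : measurable_fun [set: T2]
  (fun w : T2 => normc (w.1 +i* w.2)).
Proof.
apply: (@plane_continuous_measurable R setT); first exact: openT.
move=> w _; apply: (@continuous_comp _ R[i]^o); first exact: continuous_complex.
exact: continuous_normc.
Qed.

Lemma measurable_normc_fun f : analytic_disc f -> measurable_fun [set: T2]
  (fun w : T2 => normc (f (w.1 +i* w.2))).
Proof.
move=> af.
have -> : (fun w : T2 => normc (f (w.1 +i* w.2))) =
    (fun w : T2 => normc (f (w.1 +i* w.2))) \_ (@plane_disc R).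
  apply/funext => w; rewrite patchE; case: ifPn => // /negP wD.
  rewrite (analytic_disc0r af) ?normc0// leNgt; apply/negP => w1; apply: wD.
  by rewrite inE plane_discE.
apply/(measurable_restrictT _ measurable_plane_disc).
apply: plane_continuous_measurable; first exact: plane_disc_open.
move=> w; rewrite plane_discE /= => w1.
have c1 := @continuous_complex R w.
have c2 := hol_continuous (analytic_disc_hol af) w1.
have c3 := @continuous_normc R (f (w.1 +i* w.2)).
exact: (cvg_comp _ _ (cvg_comp _ _ c1 c2) c3).
Qed.

Lemma measurable_density f p mu : analytic_disc f ->
  measurable_fun [set: T2] (bergman_density p mu f).
Proof.
move=> af; apply: measurable_funM.
  by apply: (measurableT_comp (measurable_powR _)); exact: measurable_normc_fun.
apply: (measurableT_comp (measurable_powR _)).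
by apply: measurable_funB => //; exact: measurable_normc_plane.
Qed.

Lemma normc_rect (x0 y0 d x y : R) :
  in_rect (x0 - d) (x0 + d) (y0 - d) (y0 + d) x y ->
  normc (x +i* y) <= normc (x0 +i* y0) + 2 * d.
Proof.
move=> /andP[/andP[x1 x2] /andP[y1 y2]].
have -> : x +i* y = (x0 +i* y0) + ((x - x0) +i* (y - y0)).
  by apply/eqP; rewrite eq_complex /= ![_ + (_ - _)]addrC !subrK !eqxx.
apply: le_trans (le_normcD _ _) _.
apply: le_trans (lerD (lexx _) (le_normc_ReIm _)) _ => /=.
have : `|x - x0| <= d by rewrite ler_distl x1.
have : `|y - y0| <= d by rewrite ler_distl y1.
lra.
Qed.

Local Open Scope ereal_scope.

Definition bergman_mass p mu f : \bar R :=
  \int[leb2]_(w in @plane_disc R) (bergman_density p mu f w)%:E.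

Lemma bergman_massT p mu f : p != 0%R -> analytic_disc f ->
  bergman_mass p mu f = \int[leb2]_w (bergman_density p mu f w)%:E.
Proof.
move=> p0 af; rewrite /bergman_mass integral_mkcond; apply: eq_integral => w _ /=.
rewrite patchE; case: ifPn => // /negP wD.
rewrite /bergman_density (analytic_disc0r af); first by rewrite normc0 powR0// mul0r.
rewrite leNgt; apply/negP => w1; apply: wD.
by rewrite inE plane_discE.
Qed.

Lemma density_ge0 p mu f w : (0 <= bergman_density p mu f w)%R.
Proof. by rewrite mulr_ge0 ?powR_ge0. Qed.

Lemma bergman_mass_ge0 p mu f : 0 <= bergman_mass p mu f.
Proof. by apply: integral_ge0 => w _; rewrite lee_fin density_ge0. Qed.

(** [sq_mean] is integrated over half-sides [r] between [d / 2] and [d]. Each of the four moving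
    sides sweeps a part of the square, hence the factor 4; on the left [4 r >= 2 d] over a length
    [d / 2] gives [d ^+ 2]. *)
Lemma area_mean f x0 y0 d : analytic_disc f -> (0 < d)%R ->
  (normc (x0 +i* y0) + 2 * d < 1)%R ->
  (d ^+ 2 * normc (f (x0 +i* y0)))%:E <=
  4%:E * \int[leb2]_(w in `[(x0 - d)%R, (x0 + d)%R]%classic `*`
      `[(y0 - d)%R, (y0 + d)%R]%classic)
    (normc (f (w.1 +i* w.2)))%:E.
Proof.
move=> af d0 zd; set N := normc (f (x0 +i* y0)).
set S : set T2 := _ `*` _.
have mS : measurable S by apply: measurableX; exact: measurable_itv.
pose F (w : T2) : \bar R := ((fun w => (normc (f (w.1 +i* w.2)))%:E) \_ S) w.
have mF : measurable_fun [set: T2] F.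
  apply/(measurable_restrictT _ mS); apply: measurable_funTS.
  by apply/measurable_EFinP; exact: measurable_normc_fun.
have F0 w : 0 <= F w.
  by rewrite /F patchE; case: ifP => // _; rewrite lee_fin normc_ge0.
have inS x y : (x0 - d <= x <= x0 + d)%R -> (y0 - d <= y <= y0 + d)%R ->
    F (x, y) = (normc (f (x +i* y)))%:E.
  by move=> xd yd; rewrite /F patchE ifT// inE; split; rewrite /= in_itv.
have inD x y : in_rect (x0 - d) (x0 + d) (y0 - d) (y0 + d) x y -> (normc (x +i* y) < 1)%R.
  by move=> xy; exact: le_lt_trans (normc_rect xy) zd.
(* Integrals over whole horizontal and vertical lines; [F] vanishes outside the square, and
   Tonelli's theorem integrates both back to the integral over the plane. *)
pose a y := \int[leb]_x F (x, y).
pose b x := \int[leb]_y F (x, y).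
have ma : measurable_fun [set: T1] a := measurable_fun_fubini_tonelli_G (m1 := leb) F mF F0.
have mb : measurable_fun [set: T1] b := measurable_fun_fubini_tonelli_F (m2 := leb) F mF F0.
have a0 y : 0 <= a y by exact: integral_ge0.
have b0 y : 0 <= b y by exact: integral_ge0.
have hf := analytic_disc_hol af.
have side (g : R -> R) (G : R -> \bar R) u v s e :
    (forall t, u <= t <= v -> s <= t <= e)%R ->
    (forall t, s <= t <= e -> G t = (g t)%:E)%R -> (forall t, 0 <= G t) ->
    measurable_fun [set: T1] G ->
    {within `[u, v], continuous g}%classic ->
    (\int[leb]_(t in `[u, v]) g t)%R%:E <= \int[leb]_t G t.
  move=> uv Gg G0 mG cg; rewrite /Rintegral fineK; last first.
    by apply: integrable_fin_num; [exact: measurable_itv|exact: within_integrable].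
  rewrite (@eq_integral _ _ _ leb _ G); last first.
    by move=> t; rewrite inE/= in_itv/= => /uv/Gg.
  by apply: ge0_subset_integral => //; exact: measurable_itv.
have main r : (d / 2 <= r <= d)%R ->
    (4 * r * N)%:E <= a (-1 * r + y0)%R + a (1 * r + y0)%R + b (1 * r + x0)%R + b (-1 * r + x0)%R.
  move=> /andP[r1 r2]; have r0 : (0 < r)%R by lra.
  have xs t : (x0 - r <= t <= x0 + r)%R -> (x0 - d <= t <= x0 + d)%R.
    by move=> /andP[t1 t2]; apply/andP; split; lra.
  have ys t : (y0 - r <= t <= y0 + r)%R -> (y0 - d <= t <= y0 + d)%R.
    by move=> /andP[t1 t2]; apply/andP; split; lra.
  have sub x y : in_rect (x0 - r) (x0 + r) (y0 - r) (y0 + r) x y ->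
      in_rect (x0 - d) (x0 + d) (y0 - d) (y0 + d) x y.
    by move=> /andP[/xs x1 /ys y1]; rewrite /in_rect x1.
  have df x y : in_rect (x0 - r) (x0 + r) (y0 - r) (y0 + r) x y ->
      exists l, cderiv f (x +i* y) l.
    by move=> /sub/inD/hf.
  have cf : bcont f (x0 - r) (x0 + r) (y0 - r) (y0 + r).
    by move=> x y /andP[/df[l /cderiv_continuous]].
  have xx : (x0 - r <= x0 + r)%R by lra.
  have yy : (y0 - r <= y0 + r)%R by lra.
  have [F1 F2 F3 F4] := bcont_sides xx yy cf.
  have := sq_mean r0 df (lexx _) (lexx _) (lexx _) (lexx _).
  rewrite -lee_fin => H; apply: le_trans H _; rewrite !EFinD.
  have m1 (s : R) : measurable_fun [set: T1] (fun x => F (x, s)).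
    exact: measurableT_comp mF (measurable_pair2 _).
  have m2 (s : R) : measurable_fun [set: T1] (fun y => F (s, y)).
    exact: measurableT_comp mF (measurable_pair1 _).
  have yr1 : (y0 - d <= y0 - r <= y0 + d)%R by clear - d0 r0 r2; apply/andP; split; lra.
  have yr2 : (y0 - d <= y0 + r <= y0 + d)%R by clear - d0 r0 r2; apply/andP; split; lra.
  have xr1 : (x0 - d <= x0 - r <= x0 + d)%R by clear - d0 r0 r2; apply/andP; split; lra.
  have xr2 : (x0 - d <= x0 + r <= x0 + d)%R by clear - d0 r0 r2; apply/andP; split; lra.
  rewrite !mulN1r !mul1r ![(- r + _)%R]addrC ![(r + _)%R]addrC.
  apply: leeD; [apply: leeD; [apply: leeD|]|].
  - by apply: (side _ (fun x => F (x, (y0 - r)%R)) _ _ _ _ xs) => //; [move=> t ts; exact: inS|exact: ccont_normc F1].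
  - by apply: (side _ (fun x => F (x, (y0 + r)%R)) _ _ _ _ xs) => //; [move=> t ts; exact: inS|exact: ccont_normc F2].
  - by apply: (side _ (fun y => F ((x0 + r)%R, y)) _ _ _ _ ys) => //; [move=> t ts; exact: inS|exact: ccont_normc F3].
  - by apply: (side _ (fun y => F ((x0 - r)%R, y)) _ _ _ _ ys) => //; [move=> t ts; exact: inS|exact: ccont_normc F4].
have N0 : (0 <= N)%R by exact: normc_ge0.
have d2 : (d / 2 <= d)%R by lra.
have L : \int[leb]_(r in `[(d / 2)%R, d]) (2 * d * N)%:E = (d ^+ 2 * N)%:E.
  rewrite integral_cst; last exact: measurable_itv.
  rewrite /= lebesgue_measure_itv/= lte_fin ifT; last by lra.
  by rewrite -EFinD -EFinM; congr EFin; field.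
have mI : measurable (`[(d / 2)%R, d]%classic : set T1) by exact: measurable_itv.
rewrite -L.
pose h r := a (-1 * r + y0)%R + a (1 * r + y0)%R + b (1 * r + x0)%R + b (-1 * r + x0)%R.
have mh1 := measurableT_comp ma (measurable_affine (-1)%R y0).
have mh2 := measurableT_comp ma (measurable_affine 1%R y0).
have mh3 := measurableT_comp mb (measurable_affine 1%R x0).
have mh4 := measurableT_comp mb (measurable_affine (-1)%R x0).
have mh : measurable_fun [set: T1] h.
  by apply: emeasurable_funD => //; apply: emeasurable_funD => //; apply: emeasurable_funD.
have h0 r : 0 <= h r by exact: (adde_ge0 (adde_ge0 (adde_ge0 (a0 _) (a0 _)) (b0 _)) (b0 _)).
apply: (@le_trans _ _ (\int[leb]_(r in `[(d / 2)%R, d]) h r)).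
  apply: ge0_le_integral => //.
  - by move=> r _; rewrite lee_fin !mulr_ge0// ltW.
  - exact: measurable_funTS.
  move=> r; rewrite /= in_itv/= => rd; apply: le_trans (main r rd).
  rewrite lee_fin ler_wpM2r//; lra.
apply: (@le_trans _ _ (\int[leb]_r h r)).
  by apply: ge0_subset_integral => //; exact: mh.
rewrite ge0_integralD//; last 2 first.
- by move=> r _; exact: (adde_ge0 (adde_ge0 (a0 _) (a0 _)) (b0 _)).
- by apply: emeasurable_funD => //; apply: emeasurable_funD.
rewrite ge0_integralD//; last 2 first.
- by move=> r _; exact: (adde_ge0 (a0 _) (a0 _)).
- by apply: emeasurable_funD.
rewrite ge0_integralD//.
have a1 := ge0_integral_isometry y0 (normrN1 R) ma a0.
have a2 := ge0_integral_isometry y0 (normr1 R) ma a0.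
have b1 := ge0_integral_isometry x0 (normr1 R) mb b0.
have b2 := ge0_integral_isometry x0 (normrN1 R) mb b0.
have Ea : \int[leb]_x a x = \int[leb2]_w F w := esym (fubini_tonelli2 F mF F0).
have Eb : \int[leb]_x b x = \int[leb2]_w F w := esym (fubini_tonelli1 F mF F0).
rewrite a1 a2 b1 b2 Ea Eb [X in _ <= 4%:E * X]integral_mkcond -/F.
have I0 : 0 <= \int[leb2]_w F w by exact: integral_ge0.
move: (\int[leb2]_w F w) I0 => I I0.
by have -> : 4%:E * I = I + I + I + I by rewrite (mule_natl I 4) -!addeA.
Qed.

(** The mean value over a square of half-side comparable to [1 - |z|], raised to the power [p] by
    Hölder's inequality. The exponent is 2 for the area and [mu] for the weight, which is comparable
    to a constant on the square. *)
Lemma bergman_pointwise f p mu z : (1 < p)%R -> (0 <= mu)%R -> analytic_disc f ->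
  (normc z < 1)%R ->
  (normc (f z) `^ p * (1 - normc z) `^ (2 + mu))%:E <=
  (4 `^ (2 * p + 1) * 2 `^ mu)%:E * bergman_mass p mu f.
Proof.
move=> p1 mu0 af; case: z => x0 y0 z1.
have p0 : (0 < p)%R by apply: lt_trans p1.
(* With a quarter of the distance to the circle, points of the square have modulus at most
   [1 - 2 * d]. *)
pose d := ((1 - normc (x0 +i* y0)) / 4)%R.
have d0 : (0 < d)%R by rewrite divr_gt0// subr_gt0.
have zd : (normc (x0 +i* y0) + 2 * d < 1)%R.
  by rewrite /d; move: z1; set n := normc _; lra.
have := area_mean af d0 zd.
set S : set T2 := _ `*` _.
have mS : measurable S by apply: measurableX; exact: measurable_itv.
have mf := measurable_normc_fun af.
set N := normc (f _); set J := \int[_]_(w in S) _ => H.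
have N0 : (0 <= N)%R := normc_ge0 _.
have J0 : 0 <= J by apply: integral_ge0 => w _; rewrite lee_fin normc_ge0.
have H2 : (d ^+ 2 * N)%:E `^ p <= (4%:E * J) `^ p.
  apply: gt0_ler_poweR => //; first exact: ltW.
  - by rewrite in_itv/= leey lee_fin mulr_ge0// exprn_ge0// ltW.
  - by rewrite in_itv/= leey mule_ge0.
have := @hoelder_weight _ T2 R leb2 S (fun w => normc (f (w.1 +i* w.2))) (fun=> 1%R) p p1
  mS (measurable_funTS mf) (@measurable_cst _ _ _ _ _ _) (fun w _ => normc_ge0 _)
  (fun w _ => ltr01).
rewrite -/J.
have -> : \int[leb2]_(w in S) 1%:E = (4 * d ^+ 2)%:E.
  rewrite integral_cst// mul1e /S.
  have mI u v : measurable (`[u, v]%classic : set T1) by exact: measurable_itv.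
  have lm u : leb `[(u - d)%R, (u + d)%R]%classic = (2 * d)%:E.
    apply: etrans (lebesgue_measure_itv `[(u - d)%R, (u + d)%R]) _.
    rewrite /= lte_fin ifT; last by lra.
    by rewrite -EFinD; congr EFin; ring.
  apply: etrans (product_measure1E leb leb (mI _ _) (mI _ _)) _.
  apply: etrans (congr2 mule (lm x0) (lm y0)) _.
  by rewrite -EFinM; congr EFin; ring.
set K := \int[_]_(w in S) _ => H3.
have K0 : 0 <= K.
  by apply: integral_ge0 => w _; rewrite lee_fin mulr_ge0 ?powR_ge0.
have HK : (((2 * d) `^ mu)%:E * K <= bergman_mass p mu f).
  rewrite -ge0_integralZl; last 4 first.
  - exact: mS.
  - apply/measurable_EFinP; apply: measurable_funTS; apply: measurable_funM; last first.
      exact: measurable_cst.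
    exact: (measurableT_comp (measurable_powR _)).
  - by move=> w _; rewrite lee_fin mulr_ge0 ?powR_ge0.
  - by rewrite lee_fin powR_ge0.
  rewrite (bergman_massT _ _ af); last by rewrite gt_eqF.
  apply: (@le_trans _ _ (\int[leb2]_(w in S) (bergman_density p mu f w)%:E)).
    apply: ge0_le_integral => //.
    - by move=> w _; rewrite -EFinM lee_fin !mulr_ge0 ?powR_ge0.
    - apply/measurable_EFinP; apply: measurable_funTS; apply: measurable_funM => //.
      apply: measurable_funM => //.
      exact: (measurableT_comp (measurable_powR _)).
    - apply/measurable_EFinP; apply: measurable_funTS; exact: measurable_density.
    move=> [x y] [/= xS yS]; rewrite !in_itv/= in xS yS.
    rewrite -EFinM lee_fin /bergman_density /= powR1 mulr1 mulrC ler_wpM2l ?powR_ge0//.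
    have xy : (normc (x +i* y) <= 1 - 2 * d)%R.
      have xyr : in_rect (x0 - d) (x0 + d) (y0 - d) (y0 + d) x y by rewrite /in_rect xS.
      apply: le_trans (normc_rect xyr) _; move: zd; rewrite /d.
      by set n := normc _; lra.
    by apply: ge0_ler_powR => //; rewrite ?nnegrE; clear - xy d0; lra.
  apply: ge0_subset_integral => //.
  - by apply/measurable_EFinP; exact: measurable_density.
  - by move=> w _; rewrite lee_fin density_ge0.
have dE : (1 - normc (x0 +i* y0) = 4 * d)%R by rewrite /d; field.
rewrite dE -/N.
have d4 : (0 < 4 * d)%R by rewrite mulr_gt0.
have dn : (d != 0)%R by rewrite gt_eqF.
rewrite (@poweRM _ 4%:E J p _ J0) in H2; last by rewrite lee_fin.
have H4 := le_trans H2 (lee_wpmul2l (poweR_ge0 _ _) H3).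
rewrite !poweR_EFin in H4.
have c0 : (0 <= 16 * 4 `^ mu * d `^ (2 + mu) * (d ^+ 2) `^ (- p))%R.
  by rewrite !mulr_ge0 ?powR_ge0.
have := lee_wpmul2l (_ : 0 <= (16 * 4 `^ mu * d `^ (2 + mu) * (d ^+ 2) `^ (- p))%:E) H4.
rewrite lee_fin => /(_ c0); rewrite -EFinM => H5.
have -> : (N `^ p * (4 * d) `^ (2 + mu) =
    16 * 4 `^ mu * d `^ (2 + mu) * (d ^+ 2) `^ (- p) * (d ^+ 2 * N) `^ p)%R.
  have d20 : (0 <= d ^+ 2)%R by rewrite exprn_ge0// ltW.
  rewrite (powRM _ d20 N0) (powRM _ _ (ltW d0))// [(4 `^ (2 + mu))%R]powRD; last first.
    by rewrite (_ : (4 == 0 :> R)%R = false) ?implybT//; apply/negbTE; rewrite pnatr_eq0.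
  rewrite powRN powR_mulrn//; field.
  by rewrite gt_eqF// powR_gt0// exprn_gt0.
apply: le_trans H5 _.
have E2 : ((d ^+ 2) `^ (- p) = d `^ (- 2 * p))%R.
  by rewrite -powR_mulrn ?(ltW d0)// -powRrM mulrN mulNr.
have E3 : ((4 * d ^+ 2) `^ (p - 1) = 4 `^ (p - 1) * d `^ (2 * (p - 1)))%R.
  by rewrite powRM ?exprn_ge0 ?(ltW d0)// -powR_mulrn ?(ltW d0)// -powRrM.
rewrite E2 E3 muleA -EFinM muleA -EFinM.
have -> : (16 * 4 `^ mu * d `^ (2 + mu) * d `^ (-2 * p) * 4 `^ p *
    (4 `^ (p - 1) * d `^ (2 * (p - 1))) =
    4 `^ (2 * p + 1) * 2 `^ mu * (2 * d) `^ mu)%R.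
  have pd s t : (d `^ s * d `^ t = d `^ (s + t))%R.
    by rewrite powRD//; rewrite (negPf dn) implybT.
  have p4 s t : (4 `^ s * 4 `^ t = 4 `^ (s + t) :> R)%R.
    rewrite powRD//; rewrite (_ : (4 == 0 :> R)%R = false) ?implybT//.
    by apply/negbTE; rewrite pnatr_eq0.
  have e16 : (16 = 4 `^ 2 :> R)%R by rewrite powR_mulrn// -natrX.
  transitivity (4 `^ 2 * 4 `^ p * 4 `^ (p - 1) * 4 `^ mu *
      (d `^ (2 + mu) * d `^ (-2 * p) * d `^ (2 * (p - 1))))%R.
    by rewrite -e16; ring.
  rewrite !pd !p4 (powRM _ _ (ltW d0))//.
  have -> : (2 + mu + -2 * p + 2 * (p - 1) = mu)%R by ring.
  have -> : (2 + p + (p - 1) + mu = 2 * p + 1 + mu)%R by ring.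
  rewrite -p4 (_ : 4 `^ mu = 2 `^ mu * 2 `^ mu)%R; first by ring.
  by rewrite -powRM//; congr (_ `^ _)%R; ring.
rewrite EFinM -muleA; apply: lee_wpmul2l => //.
Qed.

End AreaMean.

(** * A Hardy-type inequality *)

Section PowR.
Variable R : realType.
Implicit Types a b s t : R.

Lemma powR_addE a s t : 0 < a -> a `^ s * a `^ t = a `^ (s + t).
Proof. by move=> a0; rewrite powRD// (gt_eqF a0) implybT. Qed.

Lemma powR_anti a b s : 0 < a -> a <= b -> 0 <= s -> b `^ (- s) <= a `^ (- s).
Proof.
move=> a0 ab s0; have b0 : 0 < b by apply: lt_le_trans ab.
rewrite !powRN lef_pV2 ?posrE ?powR_gt0//.
by apply: ge0_ler_powR => //; rewrite nnegrE ltW.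
Qed.

Lemma powR_mono a b s : 0 <= a -> a <= b -> 0 <= s -> a `^ s <= b `^ s.
Proof. by move=> a0 ab s0; apply: ge0_ler_powR => //; rewrite nnegrE// (le_trans a0). Qed.

End PowR.

(** * A singularity on the unit circle *)

Section SingularIntegral.
Variable R : realType.
Local Notation T1 := (measurableTypeR R).
Local Notation T2 := (T1 * T1)%type.
Local Notation leb := (@lebesgue_measure R).
Local Notation leb2 := ((@lebesgue_measure R) \x (@lebesgue_measure R))%E.

Lemma measurable_normc_sub (c : R) : measurable_fun [set: T2]
  (fun w : T2 => normc (c%:C - (w.1 +i* w.2))).
Proof.
have -> : (fun w : T2 => normc (c%:C - (w.1 +i* w.2))) =
    (fun w : T2 => normc (w.1 +i* w.2)) \o (fun w : T2 => (c - w.1, 0 - w.2) : T2).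
  by apply/funext => w; congr normc; apply/eqP; rewrite eq_complex /= !eqxx.
apply: measurableT_comp; first exact: measurable_normc_plane.
by apply/measurable_fun_pairP; split; exact: measurable_funB.
Qed.

Lemma measurable_disc_near (c r : R) :
  measurable [set w : T2 | normc (w.1 +i* w.2) < 1 /\ normc (c%:C - (w.1 +i* w.2)) < r].
Proof.
apply: measurableI; rewrite -[X in measurable X]setTI.
  have := @measurable_normc_plane R measurableT `]-oo, 1[%classic (measurable_itv _).
  by rewrite (_ : _ @^-1` _ = [set w : T2 | normc (w.1 +i* w.2) < 1])//; apply/seteqP; split => w; rewrite /= in_itv/=.
have := @measurable_normc_sub c measurableT `]-oo, r[%classic (measurable_itv _).
by rewrite (_ : _ @^-1` _ = [set w : T2 | normc (c%:C - (w.1 +i* w.2)) < r])//; apply/seteqP; split => w; rewrite /= in_itv/=.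
Qed.

(** The constant of [integral_abs_powR] for the exponent [1 - e / 2], that is [4 / e + 2]. *)
Definition sing_cst (e : R) : R := 2 * (1 - (1 - e / 2))^-1 + 2.

Local Open Scope ereal_scope.

(** This makes Tonelli's theorem available on the product of the line, for [t], and the plane, for
    [z]. *)
Lemma sigma_finite_plane : sigma_finite setT leb2.
Proof.
have /sigma_finiteP[F [TF ndF Foo]] := sigma_finiteT leb.
exists (fun n => F n `*` F n).
  rewrite -setXTT TF; apply/predeqP => -[x y]; split.
    move=> [/= [n _ Fnx] [k _ Fky]]; exists (maxn n k) => //; split.
    - by move: x Fnx; exact/subsetPset/ndF/leq_maxl.
    - by move: y Fky; exact/subsetPset/ndF/leq_maxr.
  by move=> [n _ []/= ? ?]; split; exists n.
move=> k; have [mFk Fk_oo] := Foo k.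
split; first exact: measurableX.
have E := product_measure1E leb leb mFk mFk.
by apply: (@le_lt_trans _ _ (leb (F k) * leb (F k))); [rewrite -E|rewrite lte_mul_pinfty// ge0_fin_numE].
Qed.

Lemma measurable_fubini_plane (G : T1 * T2 -> \bar R) :
  measurable_fun setT G -> (forall v, 0 <= G v) ->
  measurable_fun [set: T1] (fun t => \int[leb2]_w G (t, w)).
Proof.
move=> mG G0.
pose M : {sigma_finite_measure set T2 -> \bar R} :=
  HB.pack leb2 (Measure_isSigmaFinite.Build _ _ _ leb2 sigma_finite_plane).
have H := @measurable_fun_fubini_tonelli_F _ _ T1 T2 R M G mG G0.
exact: H.
Qed.

Lemma fubini_tonelli_plane (G : T1 * T2 -> \bar R) : measurable_fun setT G -> (forall v, 0 <= G v) ->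
 \int[leb]_t (\int[leb2]_w G (t, w)) = \int[leb2]_w \int[leb]_t G (t, w).
Proof.
move=> mG G0.
pose M : {sigma_finite_measure set T2 -> \bar R} :=
  HB.pack leb2 (Measure_isSigmaFinite.Build _ _ _ leb2 sigma_finite_plane).
have H := @fubini_tonelli _ _ _ _ R leb M G mG G0.
exact: H.
Qed.

(* Since [1 - |z| <= |c - z|], the integrand is at most
   [|c - z| `^ (e - 2) <= |c - x| `^ (e / 2 - 1) * |y| `^ (e / 2 - 1)]. *)
Lemma singular_integral (a mu r c : R) : (0 < mu)%R -> (a < mu)%R -> (mu <= a + 1)%R ->
  (0 < r)%R -> (`|c| = 1)%R ->
  \int[leb2]_(w in [set w : T2 | (normc (w.1 +i* w.2) < 1)%R /\
                                 (normc (c%:C - (w.1 +i* w.2)) < r)%R])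
    (normc (c%:C - (w.1 +i* w.2)) `^ (- (2 + a)) *
     (1 - normc (w.1 +i* w.2)) `^ mu)%:E <=
  (sing_cst (mu - a) ^+ 2 * r `^ (mu - a))%:E.
Proof.
move=> mu0 amu mua r0 c1; set S := [set w : T2 | _].
pose k : R := (1 - (mu - a) / 2)%R.
have k1 : (k < 1)%R by rewrite /k; lra.
have k0 : (0 <= k)%R by rewrite /k; lra.
have mS : measurable S by exact: measurable_disc_near.
pose u (b : R) (x : T1) : R := (`|x - b| `^ (- k) * \1_(`]b - r, b + r[%classic : set R) x)%R.
have mu_ b : measurable_fun [set: T1] (fun x : T1 => (u b x)%:E).
  apply/measurable_EFinP; apply: measurable_funM; last exact: measurable_indic.
  apply: (measurableT_comp (measurable_powR _)); apply: measurableT_comp => //.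
  exact: measurable_funB.
have u0 b x : (0 <= u b x)%R by rewrite mulr_ge0 ?powR_ge0 ?indicE.
have mf : measurable_fun [set: T2] (fun w : T2 => (normc (c%:C - (w.1 +i* w.2)) `^ (- (2 + a)) *
     (1 - normc (w.1 +i* w.2)) `^ mu)%:E).
  apply/measurable_EFinP; apply: measurable_funM.
    by apply: (measurableT_comp (measurable_powR _)); exact: measurable_normc_sub.
  apply: (measurableT_comp (measurable_powR _)).
  by apply: measurable_funB => //; exact: measurable_normc_plane.
(* On the real axis the factor in [y] is a negative power of 0, to which [powR] gives the value 0,
   and the majorant fails; the axis is removed as a null set. *)
pose N : set T2 := [set: T1] `*` [set 0%R].
have mN : measurable N by apply: measurableX.
have N0 : leb2 N = 0.
  apply: etrans (product_measure1E leb leb measurableT (measurable_set1 _)) _.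
  by apply: etrans (congr2 mule (erefl _) (lebesgue_measure_set1 _)) _; rewrite mule0.
pose v (w : T2) : \bar R := (u c w.1)%:E * (u 0%R w.2)%:E.
have mv : measurable_fun [set: T2] v.
  by apply: emeasurable_funM; [exact: measurableT_comp (mu_ c) measurable_fst|exact: measurableT_comp (mu_ 0%R) measurable_snd].
have v0 w : 0 <= v w by rewrite mule_ge0 ?lee_fin.
have main w : (S `\` N) w ->
    (normc (c%:C - (w.1 +i* w.2)) `^ (- (2 + a)) * (1 - normc (w.1 +i* w.2)) `^ mu)%:E <= v w.
  case: w => x y [[/= z1 zr]] wN.
  have y0 : y != 0%R by apply/eqP => y0; apply: wN; rewrite /N y0.
  have xc : x != c.
    apply/eqP => xc; have := normc_Re (x +i* y); rewrite xc c1 leNgt.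
    by move/negP; apply; rewrite -xc.
  set X : R := normc (c%:C - x +i* y)%R in zr *; set Z : R := normc (x +i* y) in z1 *.
  have XE : X = normc ((c - x)%R +i* (- y)%R).
    by congr normc; apply/eqP; rewrite eq_complex /= add0r !eqxx.
  have Xy : (`|y - 0| <= X)%R by rewrite subr0 -normrN XE; exact: (normc_Im (_ +i* _)).
  have Xx : (`|x - c| <= X)%R by rewrite distrC XE; exact: (normc_Re (_ +i* _)).
  have y00 : (0 < `|y - 0|)%R by rewrite subr0 normr_gt0.
  have x00 : (0 < `|x - c|)%R by rewrite normr_gt0 subr_eq0.
  have X0 : (0 < X)%R by exact: lt_le_trans Xx.
  have ZX : (1 - Z <= X)%R.
    have nc : normc c%:C = 1%R by rewrite normc_real.
    have := le_normcD (c%:C - (x +i* y))%R (x +i* y); rewrite subrK nc -/X -/Z; lra.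
  rewrite /v -EFinM lee_fin /u /= !indicE !mem_setE !in_itv /=.
  have -> : (c - r < x < c + r)%R.
    by have : (`|x - c| < r)%R; [exact: le_lt_trans zr|rewrite ltr_norml; lra].
  have -> : (0 - r < y < 0 + r)%R.
    by have : (`|y - 0| < r)%R; [exact: le_lt_trans zr|rewrite ltr_norml; lra].
  rewrite !mulr1; apply: (@le_trans _ _ (X `^ (- (2 + a)) * X `^ mu)%R).
    rewrite ler_wpM2l ?powR_ge0// powR_mono ?(ltW mu0)//; lra.
  rewrite powR_addE// (_ : - (2 + a) + mu = - k + - k)%R; last by rewrite /k; lra.
  by rewrite -powR_addE// ler_pM ?powR_ge0// powR_anti.
rewrite (ge0_negligible_integral mN mS _ _ N0); last 2 first.
- exact: measurable_funTS.
- by move=> w _; rewrite lee_fin mulr_ge0 ?powR_ge0.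
apply: (@le_trans _ _ (\int[leb2]_(w in S `\` N) v w)).
  apply: ge0_le_integral => //.
  - exact: measurableD.
  - by move=> w _; rewrite lee_fin mulr_ge0 ?powR_ge0.
  - exact: measurable_funTS.
  - exact: measurable_funTS.
apply: (@le_trans _ _ (\int[leb2]_w v w)).
  by apply: ge0_subset_integral => //; exact: measurableD.
rewrite fubini_tonelli1//.
have e1 b : \int[leb]_x (u b x)%:E <= (sing_cst (mu - a) * r `^ (1 - k))%:E.
  exact: integral_abs_powR.
have -> : \int[leb]_x fubini_F leb v x = (\int[leb]_x (u c x)%:E) * (\int[leb]_y (u 0%R y)%:E).
  rewrite -ge0_integralZr//; last 2 first.
  - by move=> x _; rewrite lee_fin.
  - by apply: integral_ge0 => y _; rewrite lee_fin.
  apply: eq_integral => x _; rewrite /fubini_F /v /=.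
  by rewrite ge0_integralZl ?lee_fin// => y _; rewrite lee_fin.
apply: le_trans (lee_pmul _ _ (e1 c) (e1 0%R)) _.
- by apply: integral_ge0 => y _; rewrite lee_fin.
- by apply: integral_ge0 => y _; rewrite lee_fin.
have E : (mu - a = (1 - k) + (1 - k))%R by rewrite /k; lra.
rewrite -EFinM lee_fin [X in (_ <= _ * _ `^ X)%R]E -(powR_addE (1 - k) (1 - k) r0).
by rewrite le_eqVlt; apply/orP; left; apply/eqP; ring.
Qed.

End SingularIntegral.

(** * The kernel estimate between two weights *)

Section HardyType.
Variable R : realType.
Local Notation T1 := (measurableTypeR R).
Local Notation T2 := (T1 * T1)%type.
Local Notation leb := (@lebesgue_measure R).
Local Notation leb2 := ((@lebesgue_measure R) \x (@lebesgue_measure R))%E.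
Variables (p a mu mu' : R).
Hypotheses (p1 : 1 < p) (a0 : 0 < a) (amu' : a < mu') (mumu : mu' < mu) (mua : mu <= a + 1).

Let p0 : 0 < p. Proof. exact: lt_trans p1. Qed.
Let mu'0 : 0 < mu'. Proof. exact: lt_trans amu'. Qed.
Let mu0 : 0 < mu. Proof. exact: lt_trans mumu. Qed.
Let e := (mu - mu') / p.
Let e0 : 0 < e. Proof. by rewrite divr_gt0// subr_gt0. Qed.
Let pe : p * e = mu - mu'. Proof. by rewrite /e mulrC divfK// gt_eqF. Qed.
Let e1 : e < 1.
Proof. by rewrite /e ltr_pdivrMr// mul1r; move: p1 amu' mua a0; lra. Qed.

(** A common majorant, up to constants, for the kernel [1 / |1 - t z|] of the Cesàro operator and
    the kernels [|1 - z|^(-q) |1 - t z|^(q-1)] with [q <= (2 + a) / p] of the resolvents. *)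
Definition hardy_kernel (t : R) (z : R[i]) : R :=
  Num.max 1 ((1 - t) / normc (1 - z)) `^ ((2 + a) / p) / normc (1 - t%:C * z).

Lemma hardy_kernel_ge0 t z : 0 <= hardy_kernel t z.
Proof. by rewrite divr_ge0 ?powR_ge0 ?normc_ge0. Qed.

(** The summand 4 bounds the Jacobian [t^-2] of the dilation for [t >= 1/2]; the other combines the
    constants of [bergman_pointwise] and [singular_integral]. *)
Definition slice_cst : R :=
  4 + 4 `^ (2 * p + 1) * 2 `^ mu' * sing_cst (mu - a) ^+ 2.

Lemma slice_cst_ge0 : 0 <= slice_cst.
Proof.
apply: addr_ge0 => //; apply: mulr_ge0; last exact: sqr_ge0.
by apply: mulr_ge0; exact: powR_ge0.
Qed.

Let T3 := (T1 * T2)%type.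

Lemma scale_pair (t x y : R) : t%:C * (x +i* y) = (t * x) +i* (t * y).
Proof. by apply/eqP; rewrite eq_complex /= !mul0r subr0 addr0 !eqxx. Qed.

Let ms : measurable_fun [set: T3] (fun v : T3 => (v.1 * v.2.1, v.1 * v.2.2) : T2).
Proof.
have m2 : measurable_fun [set: T3] (fun v : T3 => v.2 : T2) by exact: measurable_snd.
have m21 := measurableT_comp (@measurable_fst _ _ T1 T1) m2.
have m22 := measurableT_comp (@measurable_snd _ _ T1 T1) m2.
by apply/measurable_fun_pairP; split; apply: measurable_funM.
Qed.

Lemma measurable_hardy_kernel : measurable_fun [set: T3]
  (fun v : T3 => hardy_kernel v.1 (v.2.1 +i* v.2.2)).
Proof.
have m2 : measurable_fun [set: T3] (fun v : T3 => v.2 : T2) by exact: measurable_snd.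
have m1 : measurable_fun [set: T3] (fun v : T3 => v.1 : T1) by exact: measurable_fst.
have -> : (fun v : T3 => hardy_kernel v.1 (v.2.1 +i* v.2.2)) = (fun v : T3 =>
    Num.max 1 ((1 - v.1) * normc (1%:C - (v.2.1 +i* v.2.2)) `^ (-1)) `^ ((2 + a) / p) *
    normc (1%:C - (v.1 * v.2.1) +i* (v.1 * v.2.2)) `^ (-1)).
  apply/funext => -[t [x y]].
  by rewrite /hardy_kernel !powR_inv1 ?normc_ge0//= scale_pair.
apply: measurable_funM; last first.
  apply: (measurableT_comp (measurable_powR _)).
  exact: (measurableT_comp (measurable_normc_sub 1) ms).
apply: (measurableT_comp (measurable_powR _)); apply: measurable_maxr => //.
apply: measurable_funM; first exact: measurable_funB.
apply: (measurableT_comp (measurable_powR _)).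
exact: (measurableT_comp (measurable_normc_sub 1) m2).
Qed.

Lemma measurable_slice f : analytic_disc f -> measurable_fun [set: T3]
  (fun v : T3 => (normc (f (v.1%:C * (v.2.1 +i* v.2.2))) *
     hardy_kernel v.1 (v.2.1 +i* v.2.2))).
Proof.
move=> af; apply: measurable_funM; last exact: measurable_hardy_kernel.
have -> : (fun v : T3 => normc (f (v.1%:C * (v.2.1 +i* v.2.2)))) =
    (fun w : T2 => normc (f (w.1 +i* w.2))) \o (fun v : T3 => (v.1 * v.2.1, v.1 * v.2.2) : T2).
  by apply/funext => -[t [x y]] /=; rewrite scale_pair.
exact: (measurableT_comp (measurable_normc_fun af) ms).
Qed.

(** Here [F = |f(t z)|], [T = 1 - t], [X = |1 - z|], [Y = |1 - t z|], [Z = |z|] and [Zt = t |z|].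
    For [X >= T] the maximum is 1, and [Y^(-p)] is shared between [T] and [1 - Z]. For [X < T] the
    pointwise bound on [F] leaves the singular factor [X^(-(2+a))]. *)
Lemma slice_pointwise (F T X Y Z Zt N : R) : 0 <= F -> 0 < T -> 0 < X -> 0 < Y ->
  T <= Y -> 1 - Z <= Y -> 0 < 1 - Z -> Zt <= Z -> T <= 1 - Zt ->
  F `^ p * (1 - Zt) `^ (2 + mu') <= N ->
  (F * (Num.max 1 (T / X) `^ ((2 + a) / p) / Y)) `^ p * (1 - Z) `^ mu <=
  T `^ (mu - mu' - p) * (F `^ p * (1 - Zt) `^ mu') +
  N * T `^ (a - mu' - p) *
    (if X < T then X `^ (- (2 + a)) * (1 - Z) `^ mu else 0).
Proof.
move=> F0 T0 X0 Y0 TY ZY Z1 ZtZ TZt FN.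
have Fp0 : 0 <= F `^ p by exact: powR_ge0.
have N0 : 0 <= N by apply: le_trans FN; rewrite mulr_ge0 ?powR_ge0.
have TX0 : 0 < T / X by rewrite divr_gt0.
have -> : (F * (Num.max 1 (T / X) `^ ((2 + a) / p) / Y)) `^ p =
    F `^ p * Num.max 1 (T / X) `^ (2 + a) * Y `^ (- p).
  rewrite -(powR_inv1 (ltW Y0)) !powRM ?powR_ge0 ?mulr_ge0 ?powR_ge0//.
  by rewrite -!powRrM divfK ?gt_eqF// mulN1r mulrA.
case: ifPn => [XT|]; last first.
  rewrite -leNgt => TX; rewrite mulr0 addr0 max_l ?powR1 ?mulr1; last first.
    by rewrite ler_pdivrMr// mul1r.
  have -> : Y `^ (- p) = Y `^ (mu - mu' - p) * Y `^ (- (mu - mu')).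
    by rewrite powR_addE//; congr (_ `^ _); ring.
  apply: (@le_trans _ _
    (F `^ p * (T `^ (mu - mu' - p) * (1 - Z) `^ (- (mu - mu'))) * (1 - Z) `^ mu)).
    rewrite ler_wpM2r ?powR_ge0// ler_wpM2l// ler_pM ?powR_ge0//.
      rewrite (_ : mu - mu' - p = - (p - (mu - mu'))); last by ring.
      by apply: powR_anti => //; rewrite -pe; move: e1 p0; nra.
    by apply: powR_anti => //; rewrite subr_ge0 ltW.
  rewrite mulrCA -mulrA -[X in _ * X <= _]mulrA powR_addE//.
  rewrite (_ : - (mu - mu') + mu = mu'); last by ring.
  rewrite ler_wpM2l ?powR_ge0// ler_wpM2l//.
  by apply: powR_mono; [lra|lra|exact: ltW].
rewrite max_r ?ler_pdivlMr ?mul1r ?(ltW XT)//.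
apply: le_trans (_ : N * T `^ (a - mu' - p) * (X `^ (- (2 + a)) * (1 - Z) `^ mu) <= _); last first.
  by rewrite lerDr mulr_ge0 ?powR_ge0// mulr_ge0 ?powR_ge0.
have FT : F `^ p <= N * T `^ (- (2 + mu')).
  rewrite powRN ler_pdivlMr ?powR_gt0//; apply: le_trans FN.
  by rewrite ler_wpM2l//; apply: powR_mono; [lra|lra|rewrite addr_ge0 ?ltW].
rewrite [(T / X) `^ _]powRM ?(ltW T0)// ?invr_ge0 ?(ltW X0)//.
have -> : X^-1 `^ (2 + a) = X `^ (- (2 + a)).
  by rewrite -(powR_inv1 (ltW X0)) -powRrM mulN1r.
have -> : a - mu' - p = - (2 + mu') + ((2 + a) + - p) by ring.
rewrite -(powR_addE (- (2 + mu')) _ T0) -(powR_addE (2 + a) (- p) T0).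
have YT : Y `^ (- p) <= T `^ (- p) by apply: powR_anti => //; exact: ltW.
rewrite [leLHS](_ : _ = F `^ p * Y `^ (- p) *
  (T `^ (2 + a) * X `^ (- (2 + a)) * (1 - Z) `^ mu)); last by ring.
rewrite [leRHS](_ : _ = N * T `^ (- (2 + mu')) * T `^ (- p) *
  (T `^ (2 + a) * X `^ (- (2 + a)) * (1 - Z) `^ mu)); last by ring.
by rewrite ler_wpM2r ?mulr_ge0 ?powR_ge0// ler_pM ?powR_ge0.
Qed.

Local Open Scope ereal_scope.

(** Of the two terms of [slice_pointwise], the first becomes the mass of [f] after dilation by [t],
    and the second is the singular integral over [|1 - z| < 1 - t]. Both scale like [1 - t] to the
    power [mu - mu' - p]. *)
Lemma slice_bound f (M t : R) : analytic_disc f -> bergman_mass p mu' f <= M%:E ->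
  (2^-1 <= t)%R -> (t < 1)%R ->
  \int[leb2]_(w in @plane_disc R)
    ((normc (f (t%:C * (w.1 +i* w.2))) * hardy_kernel t (w.1 +i* w.2)) `^ p *
     (1 - normc (w.1 +i* w.2)) `^ mu)%:E <=
  (slice_cst * M * (1 - t) `^ (mu - mu' - p))%:E.
Proof.
move=> af fM t2 t1.
have t0 : (0 < t)%R by lra.
have T0 : (0 < 1 - t)%R by lra.
have M0 : (0 <= M)%R by rewrite -lee_fin; exact: le_trans (bergman_mass_ge0 _ _ _) fM.
pose c : R := (4 `^ (2 * p + 1) * 2 `^ mu')%R.
have c0 : (0 <= c)%R by rewrite mulr_ge0 ?powR_ge0.
pose S := [set w : T2 | (normc (w.1 +i* w.2) < 1)%R /\ (normc (1%:C - (w.1 +i* w.2)) < 1 - t)%R].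
have mS : measurable S by exact: measurable_disc_near.
pose g (w : T2) : R := (normc (1%:C - (w.1 +i* w.2)) `^ (- (2 + a)) * (1 - normc (w.1 +i* w.2)) `^ mu)%R.
have mg : measurable_fun [set: T2] g.
  apply: measurable_funM; apply: (measurableT_comp (measurable_powR _)).
    exact: measurable_normc_sub.
  by apply: measurable_funB => //; exact: measurable_normc_plane.
have g0 w : (0 <= g w)%R by rewrite mulr_ge0 ?powR_ge0.
pose s (w : T2) : T2 := ((t * w.1)%R, (t * w.2)%R).
have mss : measurable_fun [set: T2] s.
  by apply/measurable_fun_pairP; split; apply: measurable_funM.
pose h w := bergman_density p mu' f w.
have mh : measurable_fun [set: T2] h by exact: measurable_density.
have h0 w : (0 <= h w)%R by exact: density_ge0.
pose q := (mu - mu' - p)%R.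
pose k1 : R := ((1 - t) `^ q)%R.
pose k2 : R := (c * M * (1 - t) `^ (a - mu' - p))%R.
have k10 : (0 <= k1)%R by exact: powR_ge0.
have k20 : (0 <= k2)%R by rewrite mulr_ge0 ?powR_ge0// mulr_ge0.
pose G1 w : \bar R := (k1%:E * (h (s w))%:E).
pose G2 w : \bar R := (k2%:E * ((fun w => (g w)%:E) \_ S) w).
have G10 w : 0 <= G1 w by rewrite mule_ge0 ?lee_fin.
have G20 w : 0 <= G2 w.
  by rewrite mule_ge0 ?lee_fin// patchE; case: ifP; rewrite ?lee_fin.
have mG1 : measurable_fun [set: T2] G1.
  apply: measurable_funeM; apply/measurable_EFinP; exact: measurableT_comp mss.
have mgS : measurable_fun [set: T2] ((fun w => (g w)%:E) \_ S).
  by apply/(measurable_restrictT _ mS); apply: measurable_funTS; apply/measurable_EFinP.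
have mG2 : measurable_fun [set: T2] G2 by apply: measurable_funeM.
have mL : measurable_fun [set: T2] (fun w : T2 =>
    ((normc (f (t%:C * (w.1 +i* w.2))) * hardy_kernel t (w.1 +i* w.2)) `^ p *
     (1 - normc (w.1 +i* w.2)) `^ mu)%:E).
  apply/measurable_EFinP; apply: measurable_funM.
    apply: (measurableT_comp (measurable_powR _)).
    exact: (measurableT_comp (measurable_slice af) (measurable_pair1 t)).
  apply: (measurableT_comp (measurable_powR _)).
  by apply: measurable_funB => //; exact: measurable_normc_plane.
apply: (@le_trans _ _ (\int[leb2]_(w in @plane_disc R) (G1 w + G2 w))).
  apply: ge0_le_integral.
  - exact: measurable_plane_disc.
  - by move=> w _; rewrite lee_fin mulr_ge0 ?powR_ge0.
  - exact: measurable_funTS.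
  - by apply: measurable_funTS; exact: emeasurable_funD.
  move=> [x y]; rewrite plane_discE /= => z1.
  pose z : R[i] := (x : R) +i* (y : R); rewrite -?/z in z1 *.
  have Ztz : (normc (t%:C * z) = t * normc z)%R.
    by rewrite normcM normc_real gtr0_norm.
  have z0 := normc_ge0 z.
  have tz1 : (t * normc z < 1)%R by nra.
  have H := bergman_pointwise p1 (ltW mu'0) af (_ : (normc (t%:C * z)%R < 1)%R).
  rewrite Ztz in H; have {}H := le_trans (H tz1) (lee_wpmul2l (_ : 0 <= c%:E) fM).
  rewrite lee_fin in H; have {}H := H c0; rewrite -EFinM lee_fin in H.
  have Y1 : (1 - t * normc z <= normc (1 - t%:C * z))%R.
    by have := le_normcB 1%R (t%:C * z)%R; rewrite Ztz normc1.
  have X0 : (0 < normc (1 - z))%R.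
    by have := le_normcB 1%R z; rewrite normc1; lra.
  have -> : G2 (x, y) = (k2 * (if (normc (1 - z) < 1 - t)%R then
      normc (1 - z) `^ (- (2 + a)) * (1 - normc z) `^ mu else 0)%R)%:E.
    rewrite /G2 patchE [RHS]EFinM; congr mule.
    case: ifPn => [/set_mem[_ /= ->]//|/negP wS]; rewrite ifF//.
    by apply/negP => xt; apply: wS; rewrite inE; split.
  rewrite /G1 -EFinM -EFinD lee_fin /h /s /bergman_density /= -scale_pair -/z Ztz.
  have w1 : (t * normc z <= t)%R by rewrite ler_piMr ?(ltW t0)// ltW.
  have w2 : (t * normc z <= normc z)%R by rewrite ler_piMl// ltW.
  have w3 : (1 - t <= 1 - t * normc z)%R by rewrite lerD2l lerN2.
  have Y2 := le_trans w3 Y1; have Y0 := lt_le_trans T0 Y2.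
  have Y3 : (1 - normc z <= normc (1 - t%:C * z))%R.
    by apply: le_trans Y1; rewrite lerD2l lerN2.
  have Z1 : (0 < 1 - normc z)%R by rewrite subr_gt0.
  exact: (slice_pointwise (normc_ge0 _) T0 X0 Y0 Y2 Y3 Z1 w2 w3 H).
apply: (@le_trans _ _ (\int[leb2]_w (G1 w + G2 w))).
  apply: ge0_subset_integral => //; first exact: measurable_plane_disc.
  - exact: emeasurable_funD.
  - by move=> w _; exact: adde_ge0.
rewrite ge0_integralD//.
have E1 : \int[leb2]_w G1 w <= (4 * M * k1)%:E.
  rewrite ge0_integralZl; last 4 first.
  - exact: measurableT.
  - by apply/measurable_EFinP; exact: measurableT_comp mss.
  - by move=> w _; rewrite lee_fin.
  - by rewrite lee_fin.
  rewrite [X in _ * X](ge0_integral_dilation t0 (G := fun w => (h w)%:E)); last 2 first.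
  - exact/measurable_EFinP.
  - by move=> w; rewrite lee_fin.
  rewrite -bergman_massT ?gt_eqF//.
  rewrite (_ : 4 * M * k1 = k1 * (4 * M))%R; last by ring.
  rewrite EFinM; apply: lee_wpmul2l; first by rewrite lee_fin.
  rewrite EFinM; apply: lee_pmul => //.
  - by rewrite lee_fin invr_ge0 exprn_ge0// ltW.
  - exact: bergman_mass_ge0.
  - by rewrite lee_fin -div1r ler_pdivrMr ?exprn_gt0//; nra.
have E2 : \int[leb2]_w G2 w <= (c * sing_cst (mu - a) ^+ 2 * M * k1)%:E.
  rewrite ge0_integralZl; last 4 first.
  - exact: measurableT.
  - exact: mgS.
  - by move=> w _; rewrite patchE; case: ifP; rewrite ?lee_fin.
  - by rewrite lee_fin.
  rewrite -integral_mkcond.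
  have := singular_integral mu0 (lt_trans amu' mumu) mua T0 (normr1 R).
  move=> /(lee_wpmul2l (_ : 0 <= k2%:E)); rewrite lee_fin => /(_ k20) H.
  apply: le_trans H _; rewrite -EFinM lee_fin /k2 /k1.
  rewrite (_ : q = (a - mu' - p) + (mu - a))%R; last by rewrite /q; ring.
  rewrite -(powR_addE (a - mu' - p) (mu - a) T0).
  by rewrite le_eqVlt; apply/orP; left; apply/eqP; ring.
apply: le_trans (leeD E1 E2) _; rewrite -EFinD lee_fin /slice_cst -/c -/q -/k1.
by rewrite le_eqVlt; apply/orP; left; apply/eqP; ring.
Qed.

(** The constant of [integral_abs_powR] for the exponent [1 - e] and radius 1, that is
    [2 / e + 2]. *)
Definition kern_cst : R := (2 * (1 - (1 - e))^-1 + 2)%R.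

Lemma kern_cst_ge0 : (0 <= kern_cst)%R.
Proof.
rewrite /kern_cst (_ : 1 - (1 - e) = e)%R; last by ring.
by rewrite addr_ge0// mulr_ge0// invr_ge0 ltW.
Qed.

Lemma kern_cst_bound :
  \int[leb]_(t in `[(2^-1)%R, 1%R[) ((1 - t) `^ (e - 1))%:E <= kern_cst%:E.
Proof.
have k1 : (1 - e < 1)%R by rewrite gtrBl.
have := integral_abs_powR 1 k1 ltr01; rewrite powR1 mulr1; apply: le_trans.
rewrite integral_mkcond; apply: ge0_le_integral => //.
- by move=> t _; rewrite patchE; case: ifP => // _; rewrite lee_fin powR_ge0.
- apply/(measurable_restrictT _ (measurable_itv _)); apply: measurable_funTS.
  apply/measurable_EFinP; apply: (measurableT_comp (measurable_powR _)).
  exact: measurable_funB.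
- apply/measurable_EFinP; apply: measurable_funM; last exact: measurable_indic.
  apply: (measurableT_comp (measurable_powR _)); apply: measurableT_comp => //.
  exact: measurable_funB.
move=> t _; rewrite patchE; case: ifPn => [|_]; last first.
  by rewrite lee_fin mulr_ge0 ?powR_ge0// indicE.
rewrite inE /= in_itv/= => /andP[t2 t1].
rewrite lee_fin indicE mem_setE in_itv/= (_ : (1 - 1 < t < 1 + 1)%R = true); last first.
  by apply/andP; split; lra.
by rewrite mulr1 distrC gtr0_norm ?subr_gt0// opprB.
Qed.

Lemma poweRD_le (x y : \bar R) : 0 <= x -> 0 <= y ->
  (x + y) `^ p <= (2 `^ p)%:E * (x `^ p + y `^ p).
Proof.
wlog xy : x y / x <= y => [H x0 y0|x0 y0].
  by case: (leP x y) => [|/ltW] ?; [|rewrite addeC [X in _ * X]addeC]; exact: H.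
apply: (@le_trans _ _ ((2%:E * y) `^ p)).
  apply: gt0_ler_poweR; first exact: ltW.
  - by rewrite in_itv/= leey adde_ge0.
  - by rewrite in_itv/= leey mule_ge0.
  have -> : 2%:E = 1%:E + 1%:E :> \bar R by rewrite -EFinD.
  by rewrite ge0_muleDl ?lee_fin// !mul1e leeD2r.
rewrite poweRM// poweR_EFin lee_wpmul2l ?lee_fin ?powR_ge0//.
by rewrite leeDr// poweR_ge0.
Qed.

Definition hardy_cst : R := (2 `^ p * (sing_cst (mu - a) ^+ 2 * 2 `^ (mu - a)) +
  2 `^ p * (kern_cst `^ (p - 1) * (slice_cst * kern_cst)))%R.

Lemma hardy_cst_ge0 : (0 <= hardy_cst)%R.
Proof.
have k0 := kern_cst_ge0; have s0 := slice_cst_ge0.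
apply: addr_ge0; apply: mulr_ge0; rewrite ?powR_ge0//.
  by apply: mulr_ge0; [exact: sqr_ge0|exact: powR_ge0].
by apply: mulr_ge0; [exact: powR_ge0|exact: mulr_ge0].
Qed.

(* Hölder's inequality with the weight [(1 - t) `^ (e - 1)], where
   [p * e = mu - mu'], followed by Tonelli's theorem and [slice_bound]. *)
Lemma hardy_bound (f g : R[i] -> R[i]^o) (A B M : R) :
  analytic_disc f -> analytic_disc g -> (0 <= A)%R -> (0 <= B)%R ->
  bergman_mass p mu' f <= M%:E ->
  (forall z, (normc z < 1)%R -> (normc (g z))%:E <=
    (A * normc (1 - z)%R `^ (- ((2 + a) / p)))%:E +
    B%:E * \int[leb]_(t in `[(2^-1)%R, 1%R[)
      (normc (f (t%:C * z)%R) * hardy_kernel t z)%:E) ->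
  bergman_mass p mu g <= (hardy_cst * (A `^ p + B `^ p * M))%:E.
Proof.
move=> af ag A0 B0 fM H.
have M0 : (0 <= M)%R by rewrite -lee_fin; exact: le_trans (bergman_mass_ge0 _ _ _) fM.
have kc0 := kern_cst_ge0.
pose I : set T1 := `[(2^-1)%R, 1%R[%classic.
have mI : measurable I by exact: measurable_itv.
have mD := @measurable_plane_disc R.
pose u (v : T3) : R := (normc (f (v.1%:C * (v.2.1 +i* v.2.2))) *
     hardy_kernel v.1 (v.2.1 +i* v.2.2))%R.
have mu_ : measurable_fun [set: T3] u by exact: measurable_slice.
have u0 v : (0 <= u v)%R by rewrite mulr_ge0 ?normc_ge0 ?hardy_kernel_ge0.
pose k (t : T1) : R := ((1 - t) `^ (e - 1))%R.
have mk : measurable_fun [set: T1] k.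
  by apply: (measurableT_comp (measurable_powR _)); exact: measurable_funB.
pose rho (w : T2) : R := ((1 - normc (w.1 +i* w.2)) `^ mu)%R.
have mrho : measurable_fun [set: T2] rho.
  apply: (measurableT_comp (measurable_powR _)).
  by apply: measurable_funB => //; exact: measurable_normc_plane.
pose g1 (w : T2) : R := (normc (1%:C - (w.1 +i* w.2)) `^ (- (2 + a)) * rho w)%R.
have mg1 : measurable_fun [set: T2] g1.
  apply: measurable_funM => //; apply: (measurableT_comp (measurable_powR _)).
  exact: measurable_normc_sub.
have g10 w : (0 <= g1 w)%R by rewrite mulr_ge0 ?powR_ge0.
pose G (v : T3) : R := (u v `^ p * k v.1 `^ (1 - p) * rho v.2)%R.
have mG : measurable_fun [set: T3] G.
  apply: measurable_funM; last exact: measurableT_comp mrho measurable_snd.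
  apply: measurable_funM; first exact: (measurableT_comp (measurable_powR _)).
  apply: (measurableT_comp (measurable_powR _)).
  exact: measurableT_comp mk measurable_fst.
have G0 v : (0 <= G v)%R by rewrite !mulr_ge0 ?powR_ge0.
pose E : set T3 := I `*` (@plane_disc R).
have mE : measurable E by exact: measurableX.
(* Extension by 0 from [E] to the whole product, so that Tonelli's theorem applies without
   domains. *)
pose GG (v : T3) : \bar R := ((fun v => (G v)%:E) \_ E) v.
have mGG : measurable_fun [set: T3] GG.
  by apply/(measurable_restrictT _ mE); apply: measurable_funTS; apply/measurable_EFinP.
have GG0 v : 0 <= GG v by rewrite /GG patchE; case: ifP => // _; rewrite lee_fin.
pose h (w : T2) := \int[leb]_t GG (t, w).
have mh : measurable_fun [set: T2] h := measurable_fun_fubini_tonelli_G (m1 := leb) GG mGG GG0.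
have h0 w : 0 <= h w by exact: integral_ge0.
pose c1 : R := (2 `^ p * A `^ p)%R.
pose c2 : R := (2 `^ p * (B `^ p * kern_cst `^ (p - 1)))%R.
have c10 : (0 <= c1)%R by rewrite mulr_ge0 ?powR_ge0.
have c20 : (0 <= c2)%R by rewrite !mulr_ge0 ?powR_ge0.
have hE w : plane_disc w -> h w = \int[leb]_(t in I) (G (t, w))%:E.
  move=> wD; rewrite /h [RHS]integral_mkcond; apply: eq_integral => t _.
  rewrite /GG !patchE; congr (if _ then _ else _).
  by apply/idP/idP => [/set_mem[tI _]|/set_mem tI]; rewrite inE.
have point w : plane_disc w -> (bergman_density p mu g w)%:E <=
    c1%:E * (g1 w)%:E + c2%:E * h w.
  move=> wD; have z1 : (normc (w.1 +i* w.2) < 1)%R by move: wD; rewrite plane_discE.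
  have {}H := H _ z1; set J := \int[_]_(t in _) _ in H.
  set z : R[i] := (w.1 +i* w.2) in z1 H *.
  have J0 : 0 <= J by apply: integral_ge0 => t _; rewrite lee_fin mulr_ge0 ?normc_ge0 ?hardy_kernel_ge0.
  have X0 : (0 < normc (1 - z))%R by have := le_normcB 1%R z; rewrite normc1; lra.
  have JH : J `^ p <= (kern_cst `^ (p - 1))%:E *
      \int[leb]_(t in I) (u (t, w) `^ p * k t `^ (1 - p))%:E.
    have := @hoelder_weight _ T1 R leb I (fun t => u (t, w)) k p p1 mI _ _ _ _.
    move=> JH; apply: le_trans (JH _ _ _ _) _.
    - by apply: measurable_funTS; exact: measurableT_comp mu_ (measurable_pair2 _).
    - exact: measurable_funTS.
    - by [].
    - by move=> t; rewrite /I/= in_itv/= => /andP[_ t1]; rewrite powR_gt0// subr_gt0.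
    apply: lee_wpmul2r.
      by apply: integral_ge0 => t _; rewrite lee_fin mulr_ge0 ?powR_ge0.
    rewrite -poweR_EFin; apply: gt0_ler_poweR.
    - by rewrite subr_ge0 ltW.
    - by rewrite in_itv/= leey integral_ge0// => t _; rewrite lee_fin powR_ge0.
    - by rewrite in_itv/= leey lee_fin kc0.
    - exact: kern_cst_bound.
  have hw : h w = (rho w)%:E * \int[leb]_(t in I) (u (t, w) `^ p * k t `^ (1 - p))%:E.
    rewrite hE// -ge0_integralZl.
    - by apply: eq_integral => t _; rewrite -EFinM mulrC.
    - exact: mI.
    - apply/measurable_EFinP; apply: measurable_funTS; apply: measurable_funM.
        apply: (measurableT_comp (measurable_powR _)).
        exact: measurableT_comp mu_ (measurable_pair2 _).
      exact: (measurableT_comp (measurable_powR _)).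
    - by move=> t _; rewrite lee_fin mulr_ge0 ?powR_ge0.
    - by rewrite lee_fin powR_ge0.
  set L := \int[_]_(t in _) _ in JH hw.
  have L0 : 0 <= L.
    by apply: integral_ge0 => t _; rewrite lee_fin mulr_ge0 ?powR_ge0.
  have AX0 : (0 <= A * normc (1 - z) `^ (- ((2 + a) / p)))%R by rewrite mulr_ge0 ?powR_ge0.
  have BJ0 : 0 <= B%:E * J by rewrite mule_ge0.
  have Hp : (normc (g z) `^ p)%:E <= (2 `^ p)%:E *
      ((A `^ p * normc (1 - z) `^ (- (2 + a)))%:E + (B `^ p)%:E * ((kern_cst `^ (p - 1))%:E * L)).
    rewrite -poweR_EFin; apply: (@le_trans _ _ (_ `^ p)).
      apply: gt0_ler_poweR H; first exact: ltW.
      - by rewrite in_itv/= leey lee_fin normc_ge0.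
      - by rewrite in_itv/= leey adde_ge0// lee_fin.
    apply: le_trans (poweRD_le _ BJ0) _; first by rewrite lee_fin.
    apply: lee_wpmul2l; first by rewrite lee_fin powR_ge0.
    rewrite poweR_EFin powRM ?powR_ge0// -powRrM mulNr divfK ?gt_eqF//.
    apply: leeD => //; rewrite poweRM// poweR_EFin.
    by apply: lee_wpmul2l => //; rewrite lee_fin powR_ge0.
  have r0 : 0 <= (rho w)%:E by rewrite lee_fin powR_ge0.
  rewrite /bergman_density /= -/z EFinM muleC; apply: le_trans (lee_wpmul2l r0 Hp) _.
  rewrite hw le_eqVlt; apply/orP; left; apply/eqP.
  have K0 : 0 <= (kern_cst `^ (p - 1))%:E * L by rewrite mule_ge0// lee_fin powR_ge0.
  rewrite muleA -EFinM ge0_muleDr; last 2 first.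
  - by rewrite lee_fin mulr_ge0 ?powR_ge0.
  - by rewrite mule_ge0// lee_fin powR_ge0.
  congr (_ + _).
    by rewrite -!EFinM; congr EFin; rewrite /c1 /g1 -/z; ring.
  by rewrite !muleA -!EFinM; congr (_%:E * _); rewrite /c2; ring.
rewrite /bergman_mass; apply: (@le_trans _ _ (\int[leb2]_(w in @plane_disc R)
    (c1%:E * (g1 w)%:E + c2%:E * h w))).
  apply: ge0_le_integral => //.
  - by move=> w _; rewrite lee_fin density_ge0.
  - by apply/measurable_EFinP; apply: measurable_funTS; exact: measurable_density.
  - apply: measurable_funTS; apply: emeasurable_funD; apply: measurable_funeM => //.
    exact/measurable_EFinP.
rewrite ge0_integralD; last 5 first.
- exact: mD.
- by move=> w _; rewrite mule_ge0 ?lee_fin.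
- by apply: measurable_funTS; apply: measurable_funeM; exact/measurable_EFinP.
- by move=> w _; rewrite mule_ge0 ?lee_fin.
- by apply: measurable_funTS; apply: measurable_funeM.
rewrite ge0_integralZl; last 4 first.
- exact: mD.
- by apply: measurable_funTS; exact/measurable_EFinP.
- by move=> w _; rewrite lee_fin.
- by rewrite lee_fin.
rewrite ge0_integralZl; last 4 first.
- exact: mD.
- exact: measurable_funTS.
- by move=> w _.
- by rewrite lee_fin.
have E1 : \int[leb2]_(w in @plane_disc R) (g1 w)%:E <= (sing_cst (mu - a) ^+ 2 * 2 `^ (mu - a))%:E.
  have := singular_integral mu0 (lt_trans amu' mumu) mua (ltr0Sn R 1) (normr1 R).
  apply: le_trans; apply: ge0_subset_integral.
  - exact: mD.
  - exact: measurable_disc_near.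
  - by apply: measurable_funTS; exact/measurable_EFinP.
  - by move=> w _; rewrite lee_fin.
  move=> w; rewrite plane_discE /= => z1; split=> //.
  by apply: le_lt_trans (le_normcD _ _) _; rewrite normcN normc1; lra.
have E2 : \int[leb2]_(w in @plane_disc R) h w <= (slice_cst * M * kern_cst)%:E.
  apply: (@le_trans _ _ (\int[leb2]_w h w)).
    by apply: ge0_subset_integral => //.
  have FT : \int[leb]_t (\int[leb2]_w GG (t, w)) = \int[leb2]_w h w.
    exact: fubini_tonelli_plane.
  rewrite -FT.
  have sM : (0 <= slice_cst * M)%R.
    by rewrite mulr_ge0// slice_cst_ge0.
  apply: (@le_trans _ _ (\int[leb]_(t in I) ((slice_cst * M)%:E * (k t)%:E))); last first.
    rewrite ge0_integralZl; last 4 first.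
    - exact: mI.
    - by apply: measurable_funTS; exact/measurable_EFinP.
    - by move=> t _; rewrite lee_fin powR_ge0.
    - by rewrite lee_fin.
    rewrite [in leRHS]EFinM; apply: lee_wpmul2l; first by rewrite lee_fin.
    exact: kern_cst_bound.
  rewrite [leRHS]integral_mkcond; apply: ge0_le_integral => //.
  - by move=> t _; exact: integral_ge0.
  - exact: measurable_fubini_plane.
  - apply/(measurable_restrictT _ mI); apply: measurable_funTS.
    by apply: measurable_funeM; exact/measurable_EFinP.
  move=> t _; rewrite patchE; case: ifPn => [/set_mem tI|/negP tI]; last first.
    rewrite integral0_eq// => w _; rewrite /GG patchE ifF//.
    by apply/negP => /set_mem[/= ? _]; apply: tI; rewrite inE.
  have [t2 t1] : (2^-1 <= t)%R /\ (t < 1)%R.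
    by move: tI; rewrite /I/= in_itv/= => /andP[].
  have -> : \int[leb2]_w GG (t, w) = (k t `^ (1 - p))%:E *
      \int[leb2]_(w in @plane_disc R) (u (t, w) `^ p * rho w)%:E.
    rewrite -ge0_integralZl.
    - rewrite [RHS]integral_mkcond; apply: eq_integral => w _.
      rewrite /GG !patchE (_ : ((t, w) \in E) = (w \in @plane_disc R)); last first.
        by apply/idP/idP => [/set_mem[_ wD]|/set_mem wD]; rewrite inE.
      by case: ifP => // _; rewrite -EFinM; congr EFin; rewrite /G /=; ring.
    - exact: mD.
    - apply/measurable_EFinP; apply: measurable_funTS; apply: measurable_funM => //.
      apply: (measurableT_comp (measurable_powR _)).
      exact: measurableT_comp mu_ (measurable_pair1 _).
    - by move=> w _; rewrite lee_fin mulr_ge0 ?powR_ge0.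
    - by rewrite lee_fin powR_ge0.
  have k00 : 0 <= (k t `^ (1 - p))%:E by rewrite lee_fin powR_ge0.
  apply: le_trans (lee_wpmul2l k00 (slice_bound af fM t2 t1)) _.
  rewrite -!EFinM lee_fin /k -powRrM mulrCA powR_addE ?subr_gt0//.
  (* The weight in Hölder's inequality was chosen for this: since [p * e = mu - mu'], the total
     exponent is again [e - 1], and the remaining integral in [t] is the one bounded by
     [kern_cst]. *)
  rewrite (_ : (e - 1) * (1 - p) + (mu - mu' - p) = e - 1)%R//.
  by rewrite -pe; ring.
apply: le_trans (leeD (lee_wpmul2l (_ : 0 <= c1%:E) E1) (lee_wpmul2l (_ : 0 <= c2%:E) E2)) _.
- by rewrite lee_fin.
- by rewrite lee_fin.
rewrite -!EFinM -EFinD lee_fin /hardy_cst /c1 /c2.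
set s1 := (sing_cst _ ^+ 2 * _)%R; set s2 := (_ `^ (p - 1))%R.
have s10 : (0 <= s1)%R by rewrite mulr_ge0 ?powR_ge0 ?sqr_ge0.
have s20 : (0 <= s2)%R by exact: powR_ge0.
have s30 := slice_cst_ge0.
rewrite -subr_ge0 [leRHS](_ : _ = 2 `^ p * (s1 * (B `^ p * M)) +
  2 `^ p * (s2 * (slice_cst * kern_cst) * A `^ p))%R; last by ring.
have P0 (x y : R) : (0 <= y -> 0 <= x `^ p * y)%R by move=> y0; rewrite mulr_ge0 ?powR_ge0.
apply: addr_ge0; apply: (P0); first by rewrite mulr_ge0 ?P0.
by rewrite mulr_ge0 ?powR_ge0// (mulr_ge0 s20)// mulr_ge0.
Qed.

End HardyType.

(** * Bergman norms *)

Section BergmanNorms.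
Variable R : realType.
Implicit Types (f g : R[i] -> R[i]^o) (p mu a A B M x : R) (z : R[i]).
Local Notation T1 := (measurableTypeR R).
Local Notation T2 := (T1 * T1)%type.
Local Notation leb := (@lebesgue_measure R).
Local Notation leb2 := ((@lebesgue_measure R) \x (@lebesgue_measure R))%E.

Lemma le_bergman_norm p mu f M : 0 < p -> 0 <= M ->
  (bergman_norm p mu f <= M%:E)%E <-> (bergman_mass p mu f <= (pi * M `^ p)%:E)%E.
Proof.
move=> p0 M0; have pn : p != 0 by rewrite gt_eqF.
have pi0 : 0 < pi :> R := pi_gt0 R.
have m0 := bergman_mass_ge0 p mu f.
have n0 : (0 <= bergman_norm p mu f)%E := bergman_norm_ge0 p mu f.
have E : (bergman_norm p mu f `^ p = (pi^-1)%:E * bergman_mass p mu f)%E.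
  rewrite /bergman_norm -poweRrM mulVf// poweRe1// mule_ge0//.
  by rewrite lee_fin invr_ge0 ltW.
have -> : (bergman_mass p mu f <= (pi * M `^ p)%:E)%E =
    ((pi^-1)%:E * bergman_mass p mu f <= (M `^ p)%:E)%E.
  rewrite -[in LHS](@lee_pmul2l _ (pi^-1)%:E)// ?lte_fin ?invr_gt0//.
  by rewrite -EFinM mulrA mulVf ?gt_eqF// mul1r.
rewrite -E -poweR_EFin.
split=> H.
  by apply: gt0_ler_poweR => //; rewrite ?in_itv/= ?leey ?n0 ?lee_fin ?M0// ltW.
have H2 : ((bergman_norm p mu f `^ p) `^ p^-1 <= (M%:E `^ p) `^ p^-1)%E.
  apply: gt0_ler_poweR => //; first by rewrite invr_ge0 ltW.
  - by rewrite in_itv/= leey poweR_ge0.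
  - by rewrite in_itv/= leey lee_fin powR_ge0.
have U (x : \bar R) : (0 <= x -> (x `^ p) `^ p^-1 = x)%E.
  by move=> x0; rewrite -poweRrM mulfV// poweRe1.
by move: H2; rewrite (U _ n0) U// lee_fin.
Qed.

Lemma norm_pointwise p mu : 1 < p -> 0 <= mu ->
  exists2 C, 0 <= C & forall f M z, analytic_disc f ->
    (bergman_norm p mu f <= M%:E)%E -> normc z < 1 ->
    normc (f z) <= C * M * (1 - normc z) `^ (- ((2 + mu) / p)).
Proof.
move=> p1 mu0; have p0 : 0 < p by apply: lt_trans p1.
have pn : p != 0 by rewrite gt_eqF.
pose c : R := 4 `^ (2 * p + 1) * 2 `^ mu * pi.
have c0 : 0 <= c by rewrite !mulr_ge0 ?powR_ge0// pi_ge0.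
exists (c `^ p^-1) => [|f M z af fM z1]; first exact: powR_ge0.
have M0 : 0 <= M by rewrite -lee_fin; exact: le_trans (bergman_norm_ge0 _ _ _) fM.
have d0 : 0 < 1 - normc z by rewrite subr_gt0.
have k0 : (0 <= (4 `^ (2 * p + 1) * 2 `^ mu)%:E :> \bar R)%E.
  by rewrite lee_fin mulr_ge0 ?powR_ge0.
have H := bergman_pointwise p1 mu0 af z1.
have {}H := le_trans H (lee_wpmul2l k0 ((le_bergman_norm mu f p0 M0).1 fM)).
rewrite -EFinM lee_fin in H.
have N0 := normc_ge0 (f z).
have {}H : normc (f z) `^ p <= c * M `^ p * (1 - normc z) `^ (- (2 + mu)).
  by rewrite powRN ler_pdivlMr ?powR_gt0//; apply: le_trans H _; rewrite /c; nra.
rewrite -[leLHS](powRr1 N0) -[X in _ `^ X](mulfV pn) powRrM.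
apply: le_trans (powR_mono (powR_ge0 _ _) H _) _; first by rewrite invr_ge0 ltW.
rewrite (powRM _ (mulr_ge0 c0 (powR_ge0 _ _)) (powR_ge0 _ _)) (powRM _ c0 (powR_ge0 _ _)).
by rewrite -!powRrM mulfV// powRr1// mulNr.
Qed.

Lemma norm_disc p mu : 1 < p -> 0 <= mu ->
  exists2 C, 0 <= C & forall f M z, analytic_disc f ->
    (bergman_norm p mu f <= M%:E)%E -> normc z <= 3 / 4 -> normc (f z) <= C * M.
Proof.
move=> p1 mu0; have p0 : 0 < p by apply: lt_trans p1.
have [C C0 H] := norm_pointwise p1 mu0.
exists (C * 4^-1 `^ (- ((2 + mu) / p))) => [|f M z af fM z1].
  by rewrite mulr_ge0 ?powR_ge0.
have M0 : 0 <= M by rewrite -lee_fin; exact: le_trans (bergman_norm_ge0 _ _ _) fM.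
have z1' : normc z < 1 by apply: le_lt_trans z1 _; lra.
apply: le_trans (H f M z af fM z1') _.
rewrite mulrAC ler_wpM2r// ler_wpM2l//; apply: powR_anti.
- by rewrite invr_gt0.
- lra.
- by rewrite divr_ge0 ?addr_ge0 ?(ltW p0).
Qed.

Lemma hardy_norm p a mu mu' : 1 < p -> 0 < a -> a < mu' -> mu' < mu -> mu <= a + 1 ->
  exists2 C, 0 <= C & forall f g A B M, analytic_disc f -> analytic_disc g ->
    0 <= A -> 0 <= B -> (bergman_norm p mu' f <= M%:E)%E ->
    (forall z, normc z < 1 -> ((normc (g z))%:E <=
      (A * normc (1 - z) `^ (- ((2 + a) / p)))%:E +
      B%:E * \int[leb]_(t in `[(2^-1)%R, 1%R[)
        (normc (f (t%:C * z)) * hardy_kernel p a t z)%:E)%E) ->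
    (bergman_norm p mu g <= (C * (A + B * M))%:E)%E.
Proof.
move=> p1 a0 amu' mumu mua; have p0 : 0 < p by apply: lt_trans p1.
have pn : p != 0 by rewrite gt_eqF.
have pi0 : 0 < pi :> R := pi_gt0 R.
pose h := hardy_cst p a mu mu'.
have h0 : 0 <= h by exact: hardy_cst_ge0.
(* The factor 2 comes from [A^p + (B M)^p <= 2 (A + B M)^p]; [1 + pi] absorbs the normalization of
   the area on the given side, [pi^-1] restores it on the other. *)
pose c := pi^-1 * (h * (1 + pi) * 2).
have c0 : 0 <= c by rewrite mulr_ge0 ?invr_ge0 ?(ltW pi0)// !mulr_ge0// addr_ge0// ltW.
exists (c `^ p^-1) => [|f g A B M af ag A0 B0 fM H]; first exact: powR_ge0.
have M0 : 0 <= M by rewrite -lee_fin; exact: le_trans (bergman_norm_ge0 _ _ _) fM.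
have AB0 : 0 <= A + B * M by rewrite addr_ge0// mulr_ge0.
apply/le_bergman_norm => //; first by rewrite mulr_ge0 ?powR_ge0.
have := hardy_bound p1 a0 amu' mumu mua af ag A0 B0 ((le_bergman_norm mu' f p0 M0).1 fM) H.
move/le_trans; apply; rewrite lee_fin -/h powRM ?powR_ge0// -powRrM mulVf// powRr1//.
have cE : pi * c = h * (1 + pi) * 2 by rewrite /c mulVKf// gt_eqF.
rewrite [leRHS]mulrA cE -!mulrA.
rewrite ler_wpM2l//.
have e1 : A `^ p <= (A + B * M) `^ p.
  by apply: powR_mono; [|rewrite lerDl mulr_ge0|exact: ltW].
have e2 : B `^ p * M `^ p <= (A + B * M) `^ p.
  by rewrite -powRM//; apply: powR_mono; [exact: mulr_ge0|rewrite lerDr|exact: ltW].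
have e0 : 0 <= A `^ p by exact: powR_ge0.
have e3 : 0 <= B `^ p * M `^ p by rewrite mulr_ge0 ?powR_ge0.
nra.
Qed.

Lemma norm_mono p mu mu' f : 0 < p -> 0 <= mu' -> mu' <= mu -> analytic_disc f ->
  (bergman_norm p mu f <= bergman_norm p mu' f)%E.
Proof.
move=> p0 m0 mm af; rewrite /bergman_norm.
have pi0 : 0 <= pi^-1 :> R by rewrite invr_ge0 pi_ge0.
apply: gt0_ler_poweR; first by rewrite invr_ge0 ltW.
- by rewrite in_itv/= leey mule_ge0 ?lee_fin// bergman_mass_ge0.
- by rewrite in_itv/= leey mule_ge0 ?lee_fin// bergman_mass_ge0.
apply: lee_wpmul2l; first by rewrite lee_fin.
apply: ge0_le_integral => //.
- exact: measurable_plane_disc.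
- by move=> w _; rewrite lee_fin density_ge0.
- by apply/measurable_EFinP; apply: measurable_funTS; exact: measurable_density.
- by apply/measurable_EFinP; apply: measurable_funTS; exact: measurable_density.
move=> w; rewrite plane_discE /= => z1; rewrite lee_fin /bergman_density.
rewrite ler_wpM2l ?powR_ge0//; apply: ger_powR => //.
by rewrite subr_gt0 z1 gerBl normc_ge0.
Qed.

Lemma norm_singular p a mu (c A : R) f : 1 < p -> 0 < a -> a < mu -> `|c| = 1 ->
  analytic_disc f -> 0 <= A ->
  (forall z, normc z < 1 -> normc (f z) <= A * normc (c%:C - z) `^ (- ((2 + a) / p))) ->
  (bergman_norm p mu f < +oo)%E.
Proof.
move=> p1 a0 amu c1 af A0 H; have p0 : 0 < p by apply: lt_trans p1.
wlog mua : mu amu / mu <= a + 1 => [W|].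
  have [mua|mua] := leP mu (a + 1); first exact: W.
  apply: le_lt_trans (norm_mono p0 _ (ltW mua) af) (W (a + 1) _ _) => //.
    by rewrite addr_ge0// ltW.
  by rewrite ltrDl.
have mu0 : 0 < mu by apply: lt_trans amu.
suff : (bergman_mass p mu f < +oo)%E.
  move=> H2; rewrite /bergman_norm poweR_lty// lte_mul_pinfty//.
  by rewrite lee_fin invr_ge0 pi_ge0.
have S := singular_integral mu0 amu mua (ltr0Sn R 1) c1.
have Ap0 : 0 <= A `^ p by exact: powR_ge0.
apply: (@le_lt_trans _ _ ((A `^ p)%:E * (sing_cst (mu - a) ^+ 2 * 2 `^ (mu - a))%:E)%E); last first.
  by rewrite -EFinM ltry.
apply: le_trans (lee_wpmul2l (_ : 0 <= (A `^ p)%:E)%E S); last by rewrite lee_fin.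
have mg : measurable_fun [set: T2] (fun w : T2 =>
    (normc (c%:C - (w.1 +i* w.2)) `^ (- (2 + a)) * (1 - normc (w.1 +i* w.2)) `^ mu)%:E).
  apply/measurable_EFinP; apply: measurable_funM; apply: (measurableT_comp (measurable_powR _)).
    exact: measurable_normc_sub.
  by apply: measurable_funB => //; exact: measurable_normc_plane.
rewrite -ge0_integralZl; last 4 first.
- exact: measurable_disc_near.
- exact: measurable_funTS.
- by move=> w _; rewrite lee_fin mulr_ge0 ?powR_ge0.
- by rewrite lee_fin.
have -> : [set w : T2 | normc (w.1 +i* w.2) < 1 /\ normc (c%:C - (w.1 +i* w.2)) < 2] =
    @plane_disc R.
  rewrite plane_discE; apply/seteqP; split => w /=; first by case.
  move=> z1; split=> //; apply: le_lt_trans (le_normcD _ _) _.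
  by rewrite normcN normc_real c1; lra.
apply: ge0_le_integral => //.
- exact: measurable_plane_disc.
- by move=> w _; rewrite lee_fin density_ge0.
- by apply/measurable_EFinP; apply: measurable_funTS; exact: measurable_density.
- by apply: measurable_funTS; exact: measurable_funeM.
move=> w; rewrite plane_discE /= => /H Hw; rewrite -EFinM lee_fin /bergman_density /= mulrA.
rewrite ler_wpM2r ?powR_ge0//.
apply: le_trans (powR_mono (normc_ge0 _) Hw (ltW p0)) _.
by rewrite powRM ?powR_ge0// -powRrM mulNr divfK// gt_eqF.
Qed.

Lemma norm_bounded p mu A f : 1 < p -> 0 < mu -> analytic_disc f -> 0 <= A ->
  (forall z, normc z < 1 -> normc (f z) <= A) -> (bergman_norm p mu f < +oo)%E.
Proof.
move=> p1 mu0 af A0 H; have p0 : 0 < p by apply: lt_trans p1.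
(* Any positive exponent below [mu] serves: as [|1 - z| <= 2], a bounded function is dominated by a
   singular one. *)
pose a := mu / 2; have a0 : 0 < a by rewrite divr_gt0.
have amu : a < mu by rewrite /a; lra.
pose r := (2 + a) / p; have r0 : 0 <= r by rewrite divr_ge0 ?addr_ge0 ?ltW.
apply: (@norm_singular p a mu 1 (A * 2 `^ r)) => //; first exact: normr1.
  by rewrite mulr_ge0 ?powR_ge0.
move=> z z1; apply: le_trans (H z z1) _; rewrite -mulrA -[leLHS]mulr1 ler_wpM2l//.
have X0 : 0 < normc (1%:C - z).
  by have := le_normcB 1%:C z; rewrite normc_real normr1; lra.
rewrite powRN ler_pdivlMr ?powR_gt0// mul1r; apply: powR_mono => //; first exact: ltW.
by apply: le_trans (le_normcD _ _) _; rewrite normcN normc_real normr1; lra.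
Qed.

(** Growth of order [m] along a radius contradicts [norm_pointwise] near the circle as soon as some
    [mu > a] satisfies [(2 + mu) / p < m]. *)
Lemma bergman_growth p a (x0 A m : R) (e : R[i]) f : 1 < p -> 0 < a -> bergman_plus p a f ->
  normc e = 1 -> 0 < A -> 0 <= x0 -> x0 < 1 ->
  (forall x, x0 <= x -> x < 1 -> A * (1 - x) `^ (- m) <= normc (f (x%:C * e))) ->
  m <= (2 + a) / p.
Proof.
move=> p1 a0 fX e1 A0 x00 x01 H; have p0 : 0 < p by apply: lt_trans p1.
rewrite leNgt; apply/negP => rm.
(* [2 + mu] is the midpoint of [2 + a] and [m * p]. *)
pose mu := a + (m * p - (2 + a)) / 2.
have amu : a < mu.
  rewrite /mu ltrDl divr_gt0// subr_gt0; move: rm; rewrite ltr_pdivrMr//.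
have mu0 : 0 < mu by apply: lt_trans amu.
have [af fin] := fX mu amu.
have [C C0 HC] := norm_pointwise p1 (ltW mu0).
have n0 := bergman_norm_ge0 p mu f.
pose M := fine (bergman_norm p mu f).
have ME : (bergman_norm p mu f <= M%:E)%E by rewrite /M fineK// ge0_fin_numE.
have M0 : 0 <= M by rewrite fine_ge0.
pose q := m - (2 + mu) / p.
have q0 : 0 < q.
  rewrite /q subr_gt0 ltr_pdivrMr// /mu; move: rm; rewrite ltr_pdivrMr//; lra.
have K x : x0 <= x -> x < 1 -> A <= C * M * (1 - x) `^ q.
  move=> xx x1; have d0 : 0 < 1 - x by rewrite subr_gt0.
  have nx : normc (x%:C * e) = x.
    by rewrite normcM e1 mulr1 normc_real ger0_norm// (le_trans x00).
  have := HC f M (x%:C * e) af ME; rewrite nx => /(_ x1) H1.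
  have := le_trans (H x xx x1) H1.
  rewrite -ler_pdivlMr; last by rewrite powR_gt0.
  move/le_trans; apply; rewrite -[leLHS]mulrA; apply: ler_wpM2l; first exact: mulr_ge0.
  rewrite -powRN opprK powR_addE// le_eqVlt; apply/orP; left; apply/eqP.
  by congr (_ `^ _); rewrite /q addrC.
have CM0 : 0 < C * M.
  rewrite lt_neqAle mulr_ge0// andbT; apply/eqP => CM; have := K x0 (lexx _) x01.
  by rewrite -CM mul0r leNgt A0.
(* At [x = 1 - d] the upper bound is at most [A / 2], less than the lower bound [A]. *)
pose d := Num.min (1 - x0) ((A / (2 * (C * M))) `^ q^-1).
have d0 : 0 < d by rewrite lt_min subr_gt0 x01 powR_gt0// divr_gt0// mulr_gt0.
have := K (1 - d) _ _; rewrite opprB addrCA subrr addr0.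
have dx : d <= 1 - x0 by rewrite ge_min lexx.
have dA : d <= (A / (2 * (C * M))) `^ q^-1 by rewrite ge_min lexx orbT.
have t1 : x0 <= 1 - d by lra.
have t2 : 1 - d < 1 by lra.
move/(_ t1 t2).
have : d `^ q <= A / (2 * (C * M)).
  apply: le_trans (powR_mono (ltW d0) dA (ltW q0)) _.
  rewrite -powRrM mulVf ?gt_eqF// powRr1//.
  by apply: ltW; rewrite divr_gt0// mulr_gt0.
move=> /(ler_wpM2l (ltW CM0)).
have E (k : R) : 0 < k -> k * (A / (2 * k)) = A / 2 by move=> k0; field; rewrite gt_eqF.
rewrite E//; lra.
Qed.

End BergmanNorms.

(** * The Cesàro operator *)

Section Cesaro.
Variable R : realType.
Implicit Types (f g H k y : R[i] -> R[i]) (p mu a A B M x t : R).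
Implicit Types (z w c l : R[i]) (K F : R -> R[i]).
Local Notation leb := (@lebesgue_measure R).
(* Not the theorem of that name on the means of a sequence. *)
Local Notation cesaro := (@Defs.cesaro R).

Lemma analytic_disc_eq f g : analytic_disc f -> analytic_disc g ->
  (forall z, normc z < 1 -> f z = g z) -> f = g.
Proof.
move=> af ag fg; apply/funext => z; have [/fg//|z1] := ltP (normc z) 1.
by rewrite (analytic_disc0r af)// (analytic_disc0r ag).
Qed.

Lemma radial_eq K H1 H2 z : (forall w, normc w < 1 -> H1 w = H2 w) -> normc z < 1 ->
  radial K H1 z = radial K H2 z.
Proof.
move=> H12 z1; apply: cint_eq => t t01; rewrite H12//; exact: ray_disc.
Qed.

Lemma hol_ccont_ray f z : hol f -> normc z < 1 -> ccont 0 1 (fun t => f (t%:C * z)).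
Proof. by move=> hf z1; apply: ccont_ray => // w w1; exact: hol_continuous. Qed.

Lemma cesaroE f z : hol f -> normc z < 1 ->
  cesaro f z = radial (fun=> 1) (fun w => f w / (1 - w)) z.
Proof.
move=> hf z1; rewrite /cesaro normr_normc -[X in _ < X]/(1%:C) ltcR z1.
have hg : hol (fun w => f w / (1 - w)) by apply: holM => //; exact: hol_inv1B.
case: eqP => [->|/eqP z0].
  rewrite /radial (@cint_eq _ _ _ _ (fun=> f 0)); last first.
    by move=> t _; rewrite mulr0 subr0 divr1 mul1r.
  by rewrite cint_cst// subr0 mul1r.
have cr : ccont 0 1 (fun t => f (t%:C * z) / (1 - t%:C * z)).
  exact: (hol_ccont_ray hg z1).
have -> : segment_integral (fun w => f w / (1 - w)) z =
    cint 0 1 (fun t => z * (f (t%:C * z) / (1 - t%:C * z))).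
  by apply: cint_eq => t _; rewrite mulrC.
rewrite cintZ// mulKf//.
by apply: cint_eq => t _; rewrite mul1r.
Qed.

Lemma hol_cesaro_aux f : hol f ->
  hol (radial (fun=> 1) (fun w => f w / (1 - w))).
Proof.
move=> hf; apply: hol_radial; first exact: (@ccont_cst _ 0 1 1).
by apply: holM => //; exact: hol_inv1B.
Qed.

Lemma cesaro_analytic f : hol f -> analytic_disc (cesaro f).
Proof.
move=> hf; have := hol_analytic_disc (hol_cesaro_aux hf).
congr analytic_disc; apply/funext => z; case: ifPn => z1; first by rewrite cesaroE.
by rewrite /cesaro normr_normc -[X in _ < X]/(1%:C) ltcR (negbTE z1).
Qed.

Lemma cD_eq H1 H2 z : (forall w, normc w < 1 -> H1 w = H2 w) -> hol H1 ->
  normc z < 1 -> cD H1 z = cD H2 z.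
Proof.
move=> H12 h1 z1; apply/esym/cDP.
have d0 : 0 < 1 - normc z by rewrite subr_gt0.
apply: (cderiv_near d0 _ (hol_cD h1 z1)) => h hz; apply: H12.
by apply: le_lt_trans (le_normcD _ _) _; rewrite addrC -ltrBrDr.
Qed.

(* [k] is the Cesàro transform of [f] iff [(z k)' = f / (1 - z)]. *)
Lemma cesaro_euler f k : hol f -> hol k ->
  (forall z, normc z < 1 -> cesaro f z = k z) <->
  (forall z, normc z < 1 -> z * cD k z + k z = f z / (1 - z)).
Proof.
move=> hf hk; have hg : hol (fun w => f w / (1 - w)).
  by apply: holM => //; exact: hol_inv1B.
split=> E z z1.
  have Er w : normc w < 1 -> radial (fun=> 1) (fun w => f w / (1 - w)) w = k w.
    by move=> w1; rewrite -cesaroE// E.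
  have := radial_solves (@euler_kernel1 R) hg z1.
  by rewrite (cD_eq Er (hol_cesaro_aux hf) z1) Er// mul1r.
rewrite cesaroE// -(radial_euler (@euler_kernel1 R) hk z1).
by apply: radial_eq => // w w1; rewrite -E// mul1r.
Qed.

Lemma cDZB c H1 H2 z : hol H1 -> hol H2 -> normc z < 1 ->
  cD (fun w => c * H1 w - H2 w) z = c * cD H1 z - cD H2 z.
Proof. by move=> h1 h2 z1; apply/cDP/cderivB; [apply/cderivZ|]; exact: hol_cD. Qed.

(** The equation says that the Cesàro transform of [f] is [l f - g], to which [cesaro_euler]
    applies. *)
Lemma resolvent_eqP l f g : analytic_disc f -> analytic_disc g ->
  l *: (f : R[i] -> R[i]^o) - cesaro f = g <->
  (forall z, normc z < 1 ->
    z * (l * cD f z - cD g z) + (l * f z - g z) = f z / (1 - z)).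
Proof.
move=> af ag; have hf := analytic_disc_hol af; have hg := analytic_disc_hol ag.
have hk : hol (fun z => l * f z - g z).
  by apply: holB => //; apply: holM => //; exact: hol_cst.
have {}P := cesaro_euler hf hk.
split=> [E z z1|E].
  rewrite -cDZB//; apply: (P.1 _ z z1) => w _.
  by rewrite -E /= opprB addrC subrK.
apply: analytic_disc_eq ag _.
  by apply: analytic_discD; [exact: analytic_discZ|rewrite -scaleN1r; apply: analytic_discZ; exact: cesaro_analytic].
move=> z z1; rewrite -[LHS]/(l * f z - cesaro f z) (P.2 _ z z1).
  by rewrite opprB addrC subrK.
by move=> w w1; rewrite cDZB// E.
Qed.

(** Both sides are identified through the linear differential equation that characterizes the Cesàro
    transform. *)
Lemma cesaro_linear c (f g : R[i] -> R[i]^o) : analytic_disc f -> analytic_disc g ->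
  cesaro (c *: f + g) = c *: cesaro f + cesaro g.
Proof.
move=> af ag; have hf := analytic_disc_hol af; have hg := analytic_disc_hol ag.
have afg : analytic_disc (c *: f + g) := analytic_discD (analytic_discZ c af) ag.
have cf := cesaro_analytic hf; have cg := cesaro_analytic hg.
have hcf := analytic_disc_hol cf; have hcg := analytic_disc_hol cg.
have hk : hol (fun z => c * cesaro f z + cesaro g z).
  by apply: holD => //; apply: holM => //; exact: hol_cst.
apply: analytic_disc_eq.
- exact: cesaro_analytic (analytic_disc_hol afg).
- exact: (analytic_discD (analytic_discZ c cf) cg).
apply/(cesaro_euler (analytic_disc_hol afg) hk) => z z1.
have -> : cD (fun z => c * cesaro f z + cesaro g z) z = c * cD (cesaro f) z + cD (cesaro g) z.
  by apply/cDP/cderivD; [apply/cderivZ|]; exact: hol_cD.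
have e1 := (cesaro_euler hf hcf).1 (fun _ _ => erefl) z z1.
have e2 := (cesaro_euler hg hcg).1 (fun _ _ => erefl) z z1.
rewrite -[(c *: f + g) z]/((c * f z + g z)%R : R[i]) mulrDl -mulrA -e1 -e2.
by rewrite mulrDr mulrDr (mulrCA z) addrACA.
Qed.

(** Brings a radial integral into the form required by [hardy_norm]: the half near 0 is bounded by a
    number, the half near 1 by the kernel integral. *)
Lemma cint_half F (u : R -> R) A B : 0 <= A -> 0 <= B -> ccont 0 1 F ->
  measurable_fun [set: measurableTypeR R] (u : measurableTypeR R -> R) ->
  (forall t, 0 <= u t) ->
  (forall t, 0 <= t <= 2^-1 -> normc (F t) <= A) ->
  (forall t, 2^-1 <= t < 1 -> normc (F t) <= B * u t) ->
  ((normc (cint 0 1 F))%:E <=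
   A%:E + B%:E * \int[leb]_(t in `[(2^-1)%R, 1%R[) (u t)%:E)%E.
Proof.
move=> A0 B0 cF mu u0 H1 H2.
have h2 : 2^-1 <= 1 :> R by lra.
have h0 : 0 <= 2^-1 :> R by lra.
rewrite (cint_split h0 h2 cF).
have c1 : ccont 0 2^-1 F by apply: ccont_sub cF.
have c2 : ccont 2^-1 1 F by apply: ccont_sub cF.
apply: (@le_trans _ _ ((normc (cint 0 2^-1 F))%:E + (normc (cint 2^-1 1 F))%:E)%E).
  by rewrite -EFinD lee_fin; exact: le_normcD.
apply: leeD.
  rewrite lee_fin; apply: le_trans (normc_cint_bound h0 c1 H1) _; lra.
apply: (@le_trans _ _ (\int[leb]_(t in `[2^-1, 1]) normc (F t))%:E).
  by rewrite lee_fin; exact: le_normc_cint.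
have mN : measurable_fun (`[2^-1, 1[%classic : set (measurableTypeR R))
    (fun t => (normc (F t))%:E).
  have /integrableP[mN _] := within_integrable (ccont_normc c2).
  by apply: measurable_funS mN => // t; rewrite /= !in_itv/= => /andP[-> /ltW].
rewrite /Rintegral fineK; last first.
  by apply: integrable_fin_num; [exact: measurable_itv|exact: within_integrable (ccont_normc c2)].
rewrite -(@integral_itv_bndo_bndc _ (BLeft (2^-1 : R)) 1)//.
rewrite -ge0_integralZl; last 4 first.
- exact: measurable_itv.
- by apply: measurable_funTS; exact/measurable_EFinP.
- by move=> t _; rewrite lee_fin.
- by rewrite lee_fin.
apply: ge0_le_integral => //.
- by move=> t _; rewrite lee_fin normc_ge0.
by apply: measurable_funTS; apply: measurable_funeM; exact/measurable_EFinP.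
Qed.

Lemma measurable_hardy p a f z : analytic_disc f ->
  measurable_fun [set: measurableTypeR R]
    (fun t : measurableTypeR R => normc (f (t%:C * z)) * hardy_kernel p a t z).
Proof.
case: z => x y af.
exact: (measurableT_comp (measurable_slice p a af) (measurable_pair2 (x, y))).
Qed.

Lemma normc_1B_le2 z : normc z < 1 -> normc (1 - z) <= 2.
Proof. by move=> z1; apply: le_trans (le_normcD _ _) _; rewrite normcN normc1; lra. Qed.

Lemma normc_1B_gt0 z : normc z < 1 -> 0 < normc (1 - z).
Proof. by move=> z1; have := le_normcB 1 z; rewrite normc1; lra. Qed.

(** For [t <= 1/2] both [f] and [1 / (1 - t z)] are bounded on the ray, and a constant is a multiple
    of [|1 - z|^(-r)] because [|1 - z| <= 2]. For [t >= 1/2] the Cesàro kernel is at most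
    [hardy_kernel]. *)
Lemma cesaro_bound p a mu mu' : 1 < p -> 0 < a -> a < mu' -> mu' < mu -> mu <= a + 1 ->
  exists2 C, 0 <= C & forall f M, analytic_disc f ->
    (bergman_norm p mu' f <= M%:E)%E -> (bergman_norm p mu (cesaro f) <= (C * M)%:E)%E.
Proof.
move=> p1 a0 amu' mumu mua; have p0 : 0 < p by apply: lt_trans p1.
have mu'0 : 0 < mu' by apply: lt_trans amu'.
have [C1 C10 H1] := hardy_norm p1 a0 amu' mumu mua.
have [C2 C20 H2] := norm_disc p1 (ltW mu'0).
pose r := (2 + a) / p; have r0 : 0 <= r by rewrite divr_ge0 ?addr_ge0 ?ltW.
exists (C1 * (C2 * 2 * 2 `^ r + 1)) => [|f M af fM].
  by rewrite mulr_ge0// addr_ge0// !mulr_ge0// powR_ge0.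
have M0 : 0 <= M by rewrite -lee_fin; exact: le_trans (bergman_norm_ge0 _ _ _) fM.
have hf := analytic_disc_hol af.
rewrite -mulrA mulrDl; apply: (H1 f) => //.
- exact: cesaro_analytic.
- by rewrite mulr_ge0// !mulr_ge0// powR_ge0.
move=> z z1; rewrite cesaroE//.
have hg : hol (fun w => f w / (1 - w)) by apply: holM => //; exact: hol_inv1B.
have cr : ccont 0 1 (fun t => 1 * (f (t%:C * z) / (1 - t%:C * z))).
  apply: (@ccont_eq _ 0 1 (fun t => f (t%:C * z) / (1 - t%:C * z))) => [t _|].
    by rewrite mul1r.
  exact: (hol_ccont_ray hg z1).
have X2 := normc_1B_le2 z1; have X0 := normc_1B_gt0 z1.
have E1 : C2 * M * 2 <= C2 * 2 * 2 `^ r * M * normc (1 - z) `^ (- r).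
  rewrite [leRHS](_ : _ = C2 * M * 2 * (2 `^ r * normc (1 - z) `^ (- r))); last by ring.
  rewrite -[leLHS]mulr1 ler_wpM2l ?mulr_ge0// powRN ler_pdivlMr ?powR_gt0// mul1r.
  by apply: powR_mono => //; exact: ltW.
have hM : measurable_fun [set: measurableTypeR R] (fun t : measurableTypeR R =>
   normc (f (t%:C * z)) * hardy_kernel p a t z) := measurable_hardy p a z af.
apply: le_trans (cint_half (A := C2 * M * 2) _ ler01 cr hM _ _ _) _.
- by rewrite !mulr_ge0.
- by move=> t; rewrite mulr_ge0 ?normc_ge0 ?hardy_kernel_ge0.
- move=> t /andP[t0 t2].
  have tz : normc (t%:C * z) <= 2^-1.
    by rewrite normcM normc_real ger0_norm//; have := normc_ge0 z; nra.
  rewrite mul1r normcM normcV.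
  have w2 : 2^-1 <= normc (1 - t%:C * z).
    by have := le_normcB 1 (t%:C * z); rewrite normc1; lra.
  have wV : (normc (1 - t%:C * z))^-1 <= 2.
    by rewrite -[leRHS]invrK lef_pV2 ?posrE ?invr_gt0//; apply: lt_le_trans w2; lra.
  apply: ler_pM => //; rewrite ?normc_ge0 ?invr_ge0 ?normc_ge0//.
  by apply: H2 => //; lra.
- move=> t /andP[t2 t1]; rewrite !mul1r normcM ler_wpM2l ?normc_ge0//.
  rewrite /hardy_kernel normcV -[leLHS]mul1r ler_wpM2r ?invr_ge0 ?normc_ge0//.
  apply: (@le_trans _ _ (1 `^ r)); first by rewrite powR1.
  by apply: powR_mono => //; rewrite le_max lexx.
by rewrite mul1e; apply: leeD => //; rewrite lee_fin.
Qed.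

End Cesaro.

(** * The resolvent on functions vanishing to high order *)

Section HighOrder.
Variable R : realType.
Implicit Types (f g H k y h : R[i] -> R[i]) (p mu a A B M x t q u S G : R).
Implicit Types (z w c l s : R[i]) (K F : R -> R[i]).
Local Notation leb := (@lebesgue_measure R).
Local Notation cesaro := (@Defs.cesaro R).

Lemma powR_le2 x q u : 2^-1 <= x -> x <= 2 -> `|q| <= u -> x `^ q <= 2 `^ u.
Proof.
move=> x1 x2 qu; have x0 : 0 < x by lra.
have [q0|q0] := leP 0 q.
  apply: le_trans (powR_mono (ltW x0) x2 q0) _.
  by apply: ler_powR; [lra|rewrite -(ger0_norm q0)].
rewrite -[q]opprK; apply: le_trans (powR_anti _ x1 _) _.
- by rewrite invr_gt0.
- by rewrite oppr_ge0 ltW.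
rewrite opprK -[2^-1]powR_inv1// -powRrM mulN1r.
by apply: ler_powR; [lra|rewrite -(ltr0_norm q0)].
Qed.

Lemma powR_ge1 x u : 1 <= x -> 0 <= u -> 1 <= x `^ u.
Proof. by move=> x1 u0; have := powR_mono ler01 x1 u0; rewrite powR1. Qed.

Lemma powR2_mono x u : x <= u -> 2 `^ x <= 2 `^ u.
Proof. by apply: ler_powR; rewrite ler1n. Qed.

(** Put [X = |1 - z|], [Y = |1 - t z|], [m = max 1 ((1 - t) / X)]. For [q >= 0],
    [Y <= X + (1 - t) <= 2 m X]. For [q < 0], [X <= Y + (1 - t) <= 2 Y], because [1 - t <= Y]. *)
Lemma quotient_bound x0 q t z : normc z < 1 -> 0 <= t < 1 -> q <= x0 -> 0 <= x0 ->
  normc (1 - z) `^ (- q) * normc (1 - t%:C * z) `^ q <=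
  2 `^ (x0 + `|q|) * Num.max 1 ((1 - t) / normc (1 - z)) `^ x0.
Proof.
move=> z1 /andP[t0 t1] qx x00.
have tz1 : normc (t%:C * z) < 1 by apply: ray_disc => //; rewrite t0 ltW.
have X0 := normc_1B_gt0 z1; have Y0 := normc_1B_gt0 tz1.
have zt : normc ((1 - t)%:C * z) <= 1 - t.
  rewrite normcM normc_real gtr0_norm ?subr_gt0//.
  by have := normc_ge0 z; nra.
have E : 1 - t%:C * z = (1 - z) + (1 - t)%:C * z by rewrite rmorphB rmorph1 /=; ring.
have YX : normc (1 - t%:C * z) <= normc (1 - z) + (1 - t).
  by rewrite E; apply: le_trans (le_normcD _ _) _; rewrite lerD2l.
have XY : normc (1 - z) <= normc (1 - t%:C * z) + (1 - t).
  have -> : 1 - z = (1 - t%:C * z) - (1 - t)%:C * z by rewrite E addrK.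
  by apply: le_trans (le_normcD _ _) _; rewrite normcN lerD2l.
have tY : 1 - t <= normc (1 - t%:C * z).
  have := le_normcB 1 (t%:C * z); rewrite normc1 normcM normc_real ger0_norm//.
  by have := normc_ge0 z; nra.
set X := normc (1 - z) in X0 YX XY *; set Y := normc (1 - t%:C * z) in Y0 YX XY tY *.
set m := Num.max 1 _.
have m1 : 1 <= m by rewrite le_max lexx.
have mX : 1 - t <= m * X by rewrite -ler_pdivrMr// le_max lexx orbT.
have Ym : Y <= (2 * m) * X by nra.
have mp : 1 <= m `^ x0 by exact: powR_ge1.
have [q0|q0] := leP 0 q.
  rewrite powRN mulrC ler_pdivrMr ?powR_gt0//.
  apply: le_trans (powR_mono (ltW Y0) Ym q0) _.
  rewrite powRM//; [|lra|exact: ltW].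
  rewrite ler_wpM2r ?powR_ge0//; apply: (@le_trans _ _ ((2 * m) `^ x0)).
    by apply: ler_powR => //; lra.
  rewrite powRM//; last lra.
  by rewrite ler_wpM2r ?powR_ge0//; apply: ler_powR; [lra|rewrite lerDl].
rewrite -[X in _ * _ `^ X <= _]opprK [_ `^ (- - q)]powRN ler_pdivrMr ?powR_gt0//.
have q1 : 0 <= - q by rewrite oppr_ge0 ltW.
apply: le_trans (powR_mono (ltW X0) (_ : X <= 2 * Y) q1) _; first by lra.
rewrite powRM//; last exact: ltW.
rewrite ler_wpM2r ?powR_ge0//.
apply: (@le_trans _ _ (2 `^ (x0 + `|q|) * 1)).
  by rewrite mulr1 (ltr0_norm q0); apply: ler_powR; lra.
by rewrite ler_wpM2l ?powR_ge0.
Qed.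

(** Where [1/4 <= |z| <= 3/4], division by [z^N] costs at most [4^N]. The points with [|z| < 1/4]
    are reached by [sq_max] on the square of half-side 1/2 around 0, whose boundary lies in that
    ring. *)
Lemma hol_divided_bound (N : nat) h G : hol h ->
  (forall z, normc z <= 3 / 4 -> normc (z ^+ N * h z) <= G) ->
  forall w, normc w <= 2^-1 -> normc (h w) <= 8 * (4 ^+ N * G).
Proof.
move=> hh HG w w2.
have G0 : 0 <= G by apply: le_trans (HG 0 _); rewrite ?normc_ge0// normc0; lra.
have far (u : R[i]) : 4^-1 <= normc u -> normc u <= 3 / 4 -> normc (h u) <= 4 ^+ N * G.
  move=> u1 u2; have := HG u u2; rewrite normcM normcX => H.
  have u0 : 0 < normc u ^+ N by rewrite exprn_gt0//; lra.
  have : 1 <= 4 ^+ N * normc u ^+ N.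
    by rewrite -exprMn exprn_ege1//; lra.
  have n4 : 0 <= 4 ^+ N :> R by rewrite exprn_ge0.
  have := normc_ge0 (h u); move: (normc u ^+ N) (4 ^+ N : R) u0 n4 H => X Y; nra.
have K0 : 0 <= 4 ^+ N * G by rewrite mulr_ge0// exprn_ge0.
have [w4|w4] := leP 4^-1 (normc w).
  by apply: le_trans (far w w4 _) _; lra.
have d0 : 0 < 2^-1 :> R by rewrite invr_gt0.
have disc (x y : R) : in_rect (0 - 2^-1) (0 + 2^-1) (0 - 2^-1) (0 + 2^-1) x y ->
    normc (x +i* y) <= 3 / 4.
  rewrite /in_rect => /andP[/andP[x1 x2] /andP[y1 y2]].
  have xx : x ^+ 2 <= 4^-1 by rewrite expr2; nra.
  have yy : y ^+ 2 <= 4^-1 by rewrite expr2; nra.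
  have := normcE (x +i* y); rewrite /= => E.
  rewrite leNgt; apply/negP => H.
  have : (3 / 4) ^+ 2 < normc (x +i* y) ^+ 2.
    by rewrite ltrXn2r ?nnegrE ?normc_ge0//; lra.
  by rewrite E expr2; lra.
have dh (x y : R) : in_rect (0 - 2^-1) (0 + 2^-1) (0 - 2^-1) (0 + 2^-1) x y ->
    exists l, cderiv h (x +i* y) l.
  by move=> /disc xy; apply: hh; apply: le_lt_trans xy _; lra.
have -> : w = (0 +i* 0 + w) by rewrite -[0 +i* 0]/(0 : R[i]) add0r.
apply: (sq_max d0 dh); first by lra.
move=> x y xy.
have /andP[e1 _] := sq_bd d0 xy.
apply: far.
  by move: e1; rewrite -[0 +i* 0]/(0 : R[i]) subr0; lra.
by apply: disc; move: xy => /andP[].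
Qed.

Lemma normc_pow1B_bound s S z : normc z < 1 -> `|complex.Im s| <= S ->
  normc (pow1B s z) <= expR (S * (pi / 2)) * normc (1 - z) `^ complex.Re s.
Proof.
move=> z1 sS; apply: le_trans (normc_pow1B_le s z1) _.
by rewrite ler_wpM2r ?powR_ge0// ler_expR ler_wpM2r// divr_ge0// pi_ge0.
Qed.

Section Solution.
Variables (N : nat) (s : R[i]) (g h : R[i] -> R[i]).
Hypothesis Ns : complex.Re s < N%:R.
Hypotheses (hh : hol h) (hg : hol g) (gE : forall z, normc z < 1 -> g z = z ^+ N * h z).

Let c : R[i] := N%:R + 1 - s.
Let rho := radial (pow_kernel c) (fun w => pow1B (s - 1) w * h w).

(** Variation of constants: [rho] solves [z rho' + c rho = (1 - z)^(s-1) h], with [c = N + 1 - s] so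
    that the kernel is [t^(N-s)]. The solution of the resolvent equation is [s g] plus [s^2] times
    this function. *)
Definition variation z : R[i] := z ^+ N * (pow1B (- s) z * rho z).

Lemma Re_c : complex.Re c = N%:R + 1 - complex.Re s.
Proof.
rewrite /c; have -> : N%:R = (N%:R : R)%:C :> R[i] by rewrite rmorph_nat.
by case: s.
Qed.

Let c1 : 1 < complex.Re c. Proof. rewrite Re_c; move: Ns; lra. Qed.
Let ek := euler_pow_kernel c1.

Lemma hol_kernel_arg : hol (fun w => pow1B (s - 1) w * h w).
Proof. by apply: holM => //; exact: hol_pow1B. Qed.

Lemma hol_variation : hol variation.
Proof.
have [ck _ _] := ek.
apply: holM; first exact: holX.
by apply: holM; [exact: hol_pow1B|exact: hol_radial hol_kernel_arg].
Qed.

(** For [f = s g + s^2 y] and [l s = 1] the resolvent equation reduces to this equation for [y]. *)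
Lemma variation_euler z : normc z < 1 ->
  z * cD variation z + variation z = (s * variation z + g z) / (1 - z).
Proof.
move=> z1; have [ck _ _] := ek.
have hr : hol rho by exact: hol_radial hol_kernel_arg.
have d := cderivM (cderivX N z) (cderivM (cderiv_pow1B (- s) z1) (hol_cD hr z1)).
rewrite (cDP d) /variation gE//.
have E := radial_solves ek hol_kernel_arg z1; rewrite -/rho in E.
have z10 := normc_lt1_1B z1.
have PP : pow1B (- s) z * pow1B (s - 1) z = (1 - z)^-1.
  by rewrite -pow1BD addKr pow1BN pow1B1.
have zN : z * (N%:R * z ^+ N.-1) = N%:R * z ^+ N.
  case: (N) => [|n]; first by rewrite !mul0r mulr0.
  by rewrite /= exprS mulrCA.
have {}E : z * cD rho z = pow1B (s - 1) z * h z - c * rho z by rewrite -E addrK.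
set P := pow1B _ z in PP *; set Q := rho z in E *.
transitivity ((N%:R * z ^+ N) * (P * Q) + z ^+ N * (s * z * (1 - z)^-1 * (P * Q)) +
    z ^+ N * (P * (z * cD rho z)) + z ^+ N * (P * Q)).
  by rewrite -zN; ring.
rewrite E.
transitivity ((N%:R * z ^+ N) * (P * Q) + z ^+ N * (s * z * (1 - z)^-1 * (P * Q)) +
    z ^+ N * ((P * pow1B (s - 1) z) * h z - c * (P * Q)) + z ^+ N * (P * Q)).
  by ring.
by rewrite PP /c; field.
Qed.

End Solution.

(** A sufficiently high order [N] of vanishing makes [t^(N-s)] continuous at 0 for every [s] in
    question. The constant depends on [s] only through the bound [S] on its modulus. *)
Lemma resolvent_high p a mu mu' (N : nat) S : 1 < p -> 0 < a -> a < mu' -> mu' < mu ->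
  mu <= a + 1 -> (2 + a) / p < N%:R -> 0 <= S ->
  exists2 C, 0 <= C & forall l s h g M, l * s = 1 -> normc s <= S ->
    complex.Re s <= (2 + a) / p -> hol h -> analytic_disc g ->
    (forall z, normc z < 1 -> g z = z ^+ N * h z) ->
    (bergman_norm p mu' g <= M%:E)%E ->
    exists f, [/\ analytic_disc f, l *: (f : R[i] -> R[i]^o) - cesaro f = g &
      (bergman_norm p mu f <= (C * M)%:E)%E].
Proof.
move=> p1 a0 amu' mumu mua rN S0; have p0 : 0 < p by apply: lt_trans p1.
have mu'0 : 0 < mu' by apply: lt_trans amu'.
have [C1 C10 H1] := hardy_norm p1 a0 amu' mumu mua.
have [C2 C20 H2] := norm_disc p1 (ltW mu'0).
pose r := (2 + a) / p; have r0 : 0 <= r by rewrite divr_ge0 ?addr_ge0 ?ltW.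
(* [E] bounds the factor that the imaginary part of [s] contributes to [|(1 - z)^s|]. *)
pose E := expR (S * (pi / 2)).
have E0 : 0 <= E by exact: expR_ge0.
(* [Ca] belongs to [t <= 1/2], where [h] is bounded by [hol_divided_bound]. [Cb] belongs to
   [t >= 1/2], where [t^N z^N h(t z)] is recombined into [g(t z)] and the remaining power of [t] is
   at most [2^S]. *)
pose Ca := S ^+ 2 * E ^+ 2 * 2 `^ (r + S) * 2 `^ (S + 1) * (8 * (4 ^+ N * C2)).
pose Cb := S ^+ 2 * E ^+ 2 * 2 `^ S * 2 `^ (r + S).
have S20 : 0 <= S ^+ 2 * E ^+ 2 by rewrite mulr_ge0// sqr_ge0.
have Cb0 : 0 <= Cb by rewrite /Cb mulr_ge0 ?powR_ge0// mulr_ge0 ?powR_ge0.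
have n40 : 0 <= 4 ^+ N :> R by rewrite exprn_ge0.
have Ca0 : 0 <= Ca.
  rewrite /Ca mulr_ge0//; last by rewrite !mulr_ge0.
  by rewrite mulr_ge0 ?powR_ge0// mulr_ge0 ?powR_ge0.
exists (S + C1 * (Ca + Cb)) => [|l s h g M ls sS sr hh ag gE gM].
  by rewrite addr_ge0// mulr_ge0// addr_ge0.
have M0 : 0 <= M by rewrite -lee_fin; exact: le_trans (bergman_norm_ge0 _ _ _) gM.
have hg := analytic_disc_hol ag.
have sN : complex.Re s < N%:R by apply: le_lt_trans rN.
pose y := variation N s h.
have hy : hol y := hol_variation sN hh.
pose v z := if normc z < 1 then s ^+ 2 * y z else 0.
have av : analytic_disc v.
  by apply: hol_analytic_disc; apply: holM => //; exact: hol_cst.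
pose f : R[i] -> R[i]^o := s *: (g : R[i] -> R[i]^o) + (v : R[i] -> R[i]^o).
have af : analytic_disc f := analytic_discD (analytic_discZ s ag) av.
have fE z : normc z < 1 -> f z = s * g z + s ^+ 2 * y z.
  by move=> z1; rewrite /f -[LHS]/(s * g z + v z) /v z1.
exists f; split=> //.
- apply/resolvent_eqP => // z z1.
  have -> : cD f z = s * cD g z + s ^+ 2 * cD y z.
    rewrite (cD_eq fE (analytic_disc_hol af) z1).
    by apply/cDP/cderivD; apply/cderivZ; exact: hol_cD.
  rewrite fE//.
  have -> : z * (l * (s * cD g z + s ^+ 2 * cD y z) - cD g z) + (l * (s * g z + s ^+ 2 * y z) - g z) =
     (l * s) * (z * cD g z + g z + s * (z * cD y z + y z)) - (z * cD g z + g z) by ring.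
  rewrite ls mul1r addrAC subrr add0r (variation_euler sN hh gE z1).
  by rewrite -/y; ring.
have vM : (bergman_norm p mu v <= (C1 * (Ca * M + Cb * M))%:E)%E.
  apply: (H1 g) => //; first by rewrite mulr_ge0.
  move=> z z1; rewrite /v z1.
  pose c : R[i] := N%:R + 1 - s.
  have cE : complex.Re c = N%:R + 1 - complex.Re s := Re_c N s.
  have [ck _ _] : euler_kernel c (pow_kernel c).
    by apply: euler_pow_kernel; rewrite cE; clear - sN; lra.
  pose F t := pow_kernel c t * (pow1B (s - 1) (t%:C * z) * h (t%:C * z)).
  have cF : ccont 0 1 F := ccontM ck (hol_ccont_ray (hol_kernel_arg s hh) z1).
  pose k := s ^+ 2 * z ^+ N * pow1B (- s) z.
  have cck : ccont 0 1 (fun=> k) := @ccont_cst _ 0 1 k.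
  have -> : s ^+ 2 * y z = cint 0 1 (fun t => k * F t).
    by rewrite (cintZ _ cF) /y /variation /k !mulrA.
  have hM : measurable_fun [set: measurableTypeR R] (fun t : measurableTypeR R =>
    normc (g (t%:C * z)) * hardy_kernel p a t z) := measurable_hardy p a z ag.
  set q := complex.Re s in sr sN cE.
  have qS : `|q| <= S by apply: le_trans sS; exact: normc_Re.
  have iS : `|complex.Im s| <= S by apply: le_trans sS; exact: normc_Im.
  have X2 := normc_1B_le2 z1; have X0 := normc_1B_gt0 z1.
  have Pz : normc (pow1B (- s) z) <= E * normc (1 - z) `^ (- q).
    have -> : - q = complex.Re (- s) by rewrite /q; case: (s).
    apply: normc_pow1B_bound => //.
    by rewrite (_ : complex.Im (- s) = - complex.Im s) ?normrN//; case: (s).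
  have Pt t : 0 <= t < 1 -> normc (pow1B (s - 1) (t%:C * z)) <=
      E * normc (1 - t%:C * z) `^ (q - 1).
    move=> /andP[t0 t1]; have -> : q - 1 = complex.Re (s - 1) by rewrite /q; case: (s).
    apply: normc_pow1B_bound; first by apply: ray_disc => //; rewrite t0 ltW.
    by rewrite (_ : complex.Im (s - 1) = complex.Im s)//; case: (s) => ? ? /=; rewrite subr0.
  have zN : normc (z ^+ N) <= 1.
    by rewrite normcX exprn_ile1 ?normc_ge0// ltW.
  have kS : normc k <= S ^+ 2 * (E * normc (1 - z) `^ (- q)).
    rewrite /k (normcM _ (pow1B _ _)) (normcM (s ^+ 2)).
    apply: ler_pM => //; rewrite ?mulr_ge0 ?normc_ge0//.
    rewrite -[leRHS]mulr1; apply: ler_pM => //; rewrite ?normc_ge0//.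
    by rewrite normcX lerXn2r ?nnegrE ?normc_ge0.
  have Xr : normc (1 - z) `^ (- q) <= 2 `^ (r + S) * normc (1 - z) `^ (- r).
    have -> : - q = (r - q) + - r by ring.
    rewrite -(powR_addE _ _ X0) ler_wpM2r ?powR_ge0//.
    apply: le_trans (powR_mono (ltW X0) X2 _) _; first by rewrite subr_ge0.
    by apply: powR2_mono; move: qS; rewrite ler_norml => /andP[qS _]; clear - qS; lra.
  have hb : forall w, normc w <= 2^-1 -> normc (h w) <= 8 * (4 ^+ N * (C2 * M)).
    apply: hol_divided_bound => // w w1; rewrite -gE; first exact: H2.
    by apply: le_lt_trans w1 _; clear; lra.
  have E1 : S ^+ 2 * (E * normc (1 - z) `^ (- q)) *
      (E * 2 `^ (S + 1) * (8 * (4 ^+ N * (C2 * M)))) <= Ca * M * normc (1 - z) `^ (- r).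
    rewrite [leRHS](_ : _ = S ^+ 2 * (E * (2 `^ (r + S) * normc (1 - z) `^ (- r))) *
      (E * 2 `^ (S + 1) * (8 * (4 ^+ N * (C2 * M))))); last by rewrite /Ca; ring.
    rewrite ler_wpM2r//; first by rewrite !mulr_ge0 ?powR_ge0.
    by rewrite ler_wpM2l ?sqr_ge0// ler_wpM2l.
  apply: le_trans (cint_half (A := S ^+ 2 * (E * normc (1 - z) `^ (- q)) *
      (E * 2 `^ (S + 1) * (8 * (4 ^+ N * (C2 * M))))) (B := Cb) _ Cb0 (ccontM cck cF) hM _ _ _) _.
  - by rewrite !mulr_ge0 ?powR_ge0 ?sqr_ge0.
  - by move=> t; rewrite mulr_ge0 ?normc_ge0 ?hardy_kernel_ge0.
  - move=> t /andP[t0 t2]; rewrite normcM; apply: ler_pM => //; rewrite ?normc_ge0//.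
    have tz : normc (t%:C * z) <= 2^-1.
      by rewrite normcM normc_real ger0_norm//; have := normc_ge0 z; clear - t0 t2 z1; nra.
    rewrite /F !normcM -[leRHS]mul1r; apply: ler_pM; rewrite ?mulr_ge0 ?normc_ge0//.
      have [->|t00] := eqVneq t 0; first by rewrite /pow_kernel ltxx normc0.
      have tt : 0 < t by rewrite lt_neqAle eq_sym t00.
      rewrite normc_pow_kernel// cE -[leRHS](powRr0 t) ; apply: ger_powR; last by clear - sN; lra.
      by rewrite tt; clear - t2; lra.
    apply: ler_pM; rewrite ?normc_ge0 ?hb//.
    have t01 : 0 <= t < 1 by rewrite t0; clear - t2; lra.
    apply: le_trans (Pt t t01) _; rewrite ler_wpM2l//; apply: powR_le2.
    - by have := le_normcB 1 (t%:C * z); rewrite normc1; clear - tz; lra.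
    - by apply: normc_1B_le2; apply: le_lt_trans tz _; clear; lra.
    - by apply: le_trans (ler_normB _ _) _; rewrite normr1 lerD2r.
  - move=> t /andP[t2 t1]; have t0 : 0 < t by clear - t2; lra.
    have t01 : 0 <= t < 1 by rewrite t1 ltW.
    have tz1 : normc (t%:C * z) < 1 by apply: ray_disc => //; rewrite !ltW.
    have Y0 := normc_1B_gt0 tz1.
    have ht0 := normc_ge0 (h (t%:C * z)).
    have gt : normc (g (t%:C * z)) = t `^ N%:R * normc (z ^+ N) * normc (h (t%:C * z)).
      rewrite gE// exprMn !normcM; congr (_ * _ * _).
      by rewrite normcX normc_real gtr0_norm// powR_mulrn// ltW.
    have tq : t `^ (- q) <= 2 `^ S.
      by apply: powR_le2; [exact: t2|apply: (le_trans (ltW t1)); rewrite ler1n|rewrite normrN].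
    have Q := quotient_bound z1 t01 sr r0; rewrite -/r in Q.
    have Qm : 2 `^ (r + `|q|) <= 2 `^ (r + S) by apply: powR2_mono; rewrite lerD2l.
    rewrite /k /F !normcM normc_pow_kernel// cE.
    have -> : N%:R + 1 - q - 1 = N%:R + - q by ring.
    rewrite -(powR_addE _ _ t0) gt.
    set T := t `^ N%:R; set H := normc (h _) in ht0 *; set Zn := normc (z ^+ N).
    have T0 : 0 <= T by exact: powR_ge0.
    have Zn0 : 0 <= Zn by exact: normc_ge0.
    rewrite [leLHS](_ : _ = (normc s ^+ 2 * t `^ (- q)) *
      (normc (pow1B (- s) z) * normc (pow1B (s - 1) (t%:C * z))) * (T * Zn * H)); last by ring.
    rewrite /hardy_kernel -/r; set m := Num.max _ _ `^ r in Q *; set Y := normc (1 - t%:C * z) in Q Y0 Pt *.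
    rewrite [leRHS](_ : _ = (S ^+ 2 * 2 `^ S) * (E * E * (2 `^ (r + S) * m / Y)) * (T * Zn * H)); last first.
      by rewrite /Cb; ring.
    rewrite ler_wpM2r ?mulr_ge0//; apply: ler_pM; rewrite ?mulr_ge0 ?normc_ge0 ?powR_ge0//.
      by apply: ler_pM => //; rewrite ?powR_ge0 ?sqr_ge0// lerXn2r ?nnegrE ?normc_ge0.
    have Pt' := Pt t t01; rewrite -/Y in Pt'.
    apply: (@le_trans _ _ ((E * normc (1 - z) `^ (- q)) * (E * Y `^ (q - 1)))).
      by apply: ler_pM; rewrite ?normc_ge0.
    rewrite -(powR_addE _ _ Y0) powR_inv1 ?(ltW Y0)//.
    rewrite [leLHS](_ : _ = E * E * (normc (1 - z) `^ (- q) * Y `^ q / Y)); last by ring.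
    rewrite ler_wpM2l ?mulr_ge0// ler_wpM2r ?invr_ge0 ?(ltW Y0)//.
    by apply: le_trans Q _; rewrite ler_wpM2r// powR_ge0.
  by apply: leeD => //; rewrite lee_fin.
have gmu : (bergman_norm p mu g <= M%:E)%E.
  by apply: le_trans (norm_mono p0 (ltW mu'0) (ltW mumu) ag) gM.
apply: le_trans (bergman_normD mu (ltW p1) (analytic_discZ s ag) av) _.
rewrite (bergman_normZ mu (ltW p1) s ag) mulrDl EFinD; apply: leeD.
  by rewrite EFinM; apply: lee_pmul; rewrite ?lee_fin ?normc_ge0 ?bergman_norm_ge0.
by rewrite -mulrA mulrDl.
Qed.

End HighOrder.

(** * The resolvent on all functions *)

Section Descent.
Variable R : realType.
Implicit Types (f g H y h q : R[i] -> R[i]) (k n : nat) (mu M t : R).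
Implicit Types (z w c l s b : R[i]).
Local Notation cesaro := (@Defs.cesaro R).

Definition monomial (k : nat) : R[i] -> R[i]^o := fun z => if normc z < 1 then z ^+ k else 0.

Lemma analytic_monomial k : analytic_disc (monomial k).
Proof. by apply: hol_analytic_disc; exact: holX. Qed.

Lemma Re_natr (n : nat) : complex.Re (n%:R : R[i]) = n%:R.
Proof. by have -> : n%:R = (n%:R : R)%:C :> R[i] by rewrite rmorph_nat. Qed.

Lemma normc_natr_inv (n : nat) : normc ((n.+1%:R)^-1 : R[i]) = n.+1%:R^-1.
Proof.
have -> : n.+1%:R = (n.+1%:R : R)%:C :> R[i] by rewrite rmorph_nat.
by rewrite normcV normc_real ger0_norm.
Qed.

Lemma euler_solution (n : nat) H : hol H -> exists2 q, hol q &
  forall z, normc z < 1 -> z * cD q z + n.+1%:R * q z = H z.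
Proof.
(* The exponent 1 is on the boundary of the range of [pow_kernel] and takes the constant kernel. *)
move=> hH; case: n => [|n].
  exists (radial (fun=> 1) H).
    by apply: hol_radial => //; exact: (@ccont_cst _ 0 1 1).
  by move=> z z1; rewrite -(radial_solves (@euler_kernel1 R) hH z1).
have c1 : 1 < complex.Re (n.+2%:R : R[i]) by rewrite Re_natr ltr1n.
have ek := euler_pow_kernel c1; have [ck _ _] := ek.
exists (radial (pow_kernel n.+2%:R) H); first exact: hol_radial.
by move=> z z1; exact: radial_solves.
Qed.

(** The operator preserves the order of vanishing and acts on the leading coefficient of order [k]
    by [1/(k+1)]; this triangular structure drives the descent. *)
Lemma cesaro_monomial (k : nat) : exists q, [/\ hol q, q 0 = k.+1%:R^-1 &
  forall z, normc z < 1 -> cesaro (monomial k) z = z ^+ k * q z].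
Proof.
have [q hq E] := @euler_solution k _ (@hol_inv1B R).
have k0 : k.+1%:R != 0 :> R[i] by rewrite pnatr_eq0.
exists q; split=> //.
  have := E 0; rewrite normc0 => /(_ ltr01); rewrite mul0r add0r subr0 invr1 => E0.
  by rewrite -[LHS](mulKf k0) E0 mulr1.
have hm := analytic_disc_hol (analytic_monomial k).
have hy : hol (fun z => z ^+ k * q z) by apply: holM => //; exact: holX.
apply/(cesaro_euler hm hy) => z z1.
rewrite (cDP (cderivM (cderivX k z) (hol_cD hq z1))) /monomial z1 -E//.
have zk : z * (k%:R * z ^+ k.-1) = k%:R * z ^+ k.
  case: (k) => [|n]; first by rewrite !mul0r mulr0.
  by rewrite /= exprS mulrCA.
rewrite mulrDr mulrA zk -addn1 natrD; ring.
Qed.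

Variables (p a S d : R).
Hypotheses (p1 : 1 < p) (a0 : 0 < a) (S0 : 0 <= S) (d0 : 0 < d).
Local Notation r := ((2 + a) / p).

(** [s] is the inverse of [l]. The parameters make the estimates uniform: [S] keeps [l] away from 0,
    [d] keeps it away from the points [1/(j+1)], and the bound on the real part of [s] keeps it
    outside the tangent disc. *)
Definition admissible l s := [/\ l * s = 1, normc s <= S, complex.Re s <= r &
  forall j : nat, d <= normc (l - j.+1%:R^-1)].

(** The statement carried by the descent on the order [k] of vanishing. It quantifies over all pairs
    of weights because each step spends part of the gap between them. *)
Definition solvable_at (k : nat) := forall mu' mu, a < mu' -> mu' < mu -> mu <= a + 1 ->
  exists2 C, 0 <= C & forall l s h g M, admissible l s -> hol h -> analytic_disc g ->
    (forall z, normc z < 1 -> g z = z ^+ k * h z) ->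
    (bergman_norm p mu' g <= M%:E)%E ->
    exists f, [/\ analytic_disc f, l *: (f : R[i] -> R[i]^o) - cesaro f = g &
      (bergman_norm p mu f <= (C * M)%:E)%E].

Let p0 : 0 < p. Proof. exact: lt_trans p1. Qed.

Lemma norm_scale_le mu c (f : R[i] -> R[i]^o) (A N : R) : analytic_disc f -> normc c <= A ->
  (bergman_norm p mu f <= N%:E)%E -> (bergman_norm p mu (c *: f) <= (A * N)%:E)%E.
Proof.
move=> af cA fN; rewrite (bergman_normZ mu (ltW p1) c af) EFinM.
by apply: lee_pmul; rewrite ?lee_fin ?normc_ge0 ?bergman_norm_ge0.
Qed.

Lemma norm_fine_le mu (f : R[i] -> R[i]^o) : (bergman_norm p mu f < +oo)%E ->
  exists2 N, 0 <= N & (bergman_norm p mu f <= N%:E)%E.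
Proof.
move=> ff; exists (fine (bergman_norm p mu f)); first by rewrite fine_ge0// bergman_norm_ge0.
by rewrite fineK// ge0_fin_numE// bergman_norm_ge0.
Qed.

Lemma norm_monomial mu k : 0 < mu ->
  exists2 N, 0 <= N & (bergman_norm p mu (monomial k) <= N%:E)%E.
Proof.
move=> mu0; apply: norm_fine_le; apply: (norm_bounded p1 mu0 (analytic_monomial k) ler01).
by move=> z z1; rewrite /monomial z1 normcX exprn_ile1 ?normc_ge0// ltW.
Qed.

(** The image of [be z^k] under [l - C] is subtracted from [g], with [be] chosen to cancel the
    coefficient of order [k]. What remains vanishes to order [k + 1] and is solved by hypothesis. *)
Lemma solvable_step k : solvable_at k.+1 -> solvable_at k.
Proof.
move=> IH mu' mu amu' mumu mua.
(* The Cesàro transform of the monomial is estimated from [mu'] to [nu], and the hypothesis is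
   applied from [nu] to [mu]. *)
pose nu := (mu' + mu) / 2.
have nu1 : mu' < nu by rewrite /nu; lra.
have nu2 : nu < mu by rewrite /nu; lra.
have anu : a < nu by apply: lt_trans nu1.
have mu'0 : 0 < mu' by apply: lt_trans amu'.
have nu0 : 0 < nu by apply: lt_trans nu1.
have [C C0 HC] := IH nu mu anu nu2 mua.
have [C2 C20 H2] := norm_disc p1 (ltW mu'0).
have [C3 C30 H3] := cesaro_bound p1 a0 amu' nu1 (le_trans (ltW nu2) mua).
have [N1 N10 HN1] := norm_monomial k mu'0.
have HN2 := H3 _ _ (analytic_monomial k) HN1.
have am := analytic_monomial k.
have acm := cesaro_analytic (analytic_disc_hol am).
have [q [hq q0 qE]] := cesaro_monomial k.
pose B := 8 * (4 ^+ k * C2).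
have B0 : 0 <= B by rewrite !mulr_ge0// exprn_ge0.
have di0 : 0 <= d^-1 by rewrite invr_ge0 ltW.
pose G := 1 + (B * (1 + d^-1) * N1 + B * d^-1 * (C3 * N1)).
have G0 : 0 <= G by rewrite /G !addr_ge0// !mulr_ge0// addr_ge0.
exists (C * G + B * d^-1 * N1) => [|l s h g M ls hh ag gE gM].
  by rewrite addr_ge0// !mulr_ge0.
have M0 : 0 <= M by rewrite -lee_fin; exact: le_trans (bergman_norm_ge0 _ _ _) gM.
pose b := h 0.
have bB : normc b <= B * M.
  rewrite /B -!mulrA; apply: (hol_divided_bound (N := k) hh) => [z z1|]; last first.
    by rewrite normc0 invr_ge0.
  by rewrite -gE ?(le_lt_trans z1)//; [exact: H2|lra].
have [_ _ _ /(_ k) dk] := ls.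
pose lk : R[i] := k.+1%:R^-1.
have lk0 : 0 < normc (l - lk) by apply: lt_le_trans dk.
have lkn : l - lk != 0 by rewrite -normc_gt0.
(* [l - C] multiplies the coefficient of order [k] by [l - 1/(k+1)], which is at least [d] in
   modulus. *)
pose be := b / (l - lk).
have beB : normc be <= B * M * d^-1.
  rewrite normcM normcV; apply: ler_pM; rewrite ?invr_ge0 ?normc_ge0//.
  by rewrite lef_pV2 ?posrE.
have bK : be * (l - lk) = b by exact: divfK.
(* [admissible] bounds [|l|] from below and not from above; eliminating [l] in this way bounds the
   product by [b] and [be]. *)
have beE : - (be * l) = - (b + be * lk) by rewrite -bK; ring.
have belB : normc (- (be * l)) <= B * M * (1 + d^-1).
  rewrite beE normcN mulrDr mulr1; apply: le_trans (le_normcD _ _) _; apply: lerD => //.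
  apply: le_trans beB; rewrite normcM -[leRHS]mulr1 ler_wpM2l ?normc_ge0//.
  by rewrite /lk normc_natr_inv invf_le1// ler1n.
pose m := monomial k.
pose g' : R[i] -> R[i]^o := (g : R[i] -> R[i]^o) + (- (be * l) *: m + be *: cesaro m).
have am1 : analytic_disc (- (be * l) *: m) by exact: analytic_discZ.
have am2 : analytic_disc (be *: cesaro m) by exact: analytic_discZ.
have am3 : analytic_disc (- (be * l) *: m + be *: cesaro m) by exact: analytic_discD.
have ag' : analytic_disc g' by exact: analytic_discD.
pose v z := h z - be * l + be * q z.
have hv : hol v.
  apply: holD; first by apply: holB => //; exact: hol_cst.
  by apply: holM => //; exact: hol_cst.
have v0 : v 0 = 0 by rewrite /v q0 -/b -/lk -bK; ring.
have [h' hh' h'E] := hol_div hv.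
have g'E z : normc z < 1 -> g' z = z ^+ k.+1 * h' z.
  move=> z1; rewrite exprSr -mulrA -[z * h' z]add0r -v0 -h'E//.
  rewrite /g' -[LHS]/(g z + (- (be * l) * m z + be * cesaro m z)) gE// qE// /m /monomial z1 /v.
  by ring.
have mono f : analytic_disc f -> (bergman_norm p nu f <= bergman_norm p mu' f)%E.
  by move=> af; apply: norm_mono => //; exact: ltW.
have g'M : (bergman_norm p nu g' <= (G * M)%:E)%E.
  apply: le_trans (bergman_normD nu (ltW p1) ag am3) _.
  rewrite /G mulrDl mul1r EFinD; apply: leeD; first exact: le_trans (mono _ ag) gM.
  apply: le_trans (bergman_normD nu (ltW p1) am1 am2) _.
  rewrite mulrDl EFinD; apply: leeD.
    apply: le_trans (norm_scale_le am belB (le_trans (mono _ am) HN1)) _.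
    by rewrite lee_fin le_eqVlt; apply/orP; left; apply/eqP; ring.
  apply: le_trans (norm_scale_le acm beB HN2) _.
  by rewrite lee_fin le_eqVlt; apply/orP; left; apply/eqP; ring.
have [f' [af' f'E f'M]] := HC l s h' g' (G * M) ls hh' ag' g'E g'M.
pose f : R[i] -> R[i]^o := be *: m + (f' : R[i] -> R[i]^o).
have amb : analytic_disc (be *: m) by exact: analytic_discZ.
exists f; split; first exact: analytic_discD.
  rewrite (cesaro_linear be am af') scalerDr opprD addrACA f'E /g' scalerA.
  rewrite (mulrC l be) scaleNr addrCA [X in _ + X = _]addrCA.
  by rewrite -/m subrK addNr addr0.
apply: le_trans (bergman_normD mu (ltW p1) amb af') _.
rewrite addeC mulrDl EFinD; apply: leeD; first by rewrite -mulrA.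
have HN3 : (bergman_norm p mu m <= N1%:E)%E.
  by apply: le_trans HN1; apply: norm_mono => //; exact: ltW.
apply: le_trans (norm_scale_le am beB HN3) _.
by rewrite lee_fin le_eqVlt; apply/orP; left; apply/eqP; ring.
Qed.

(** Descent from an integer [N] above [(2 + a) / p]. The number of steps is the same for every [l],
    so the constant stays uniform. *)
Lemma solvable0 : solvable_at 0.
Proof.
have r0 : 0 <= r by rewrite divr_ge0 ?addr_ge0 ?ltW.
have rN := archi_boundP r0; set N := Num.bound _ in rN.
suff : forall k, (k <= N)%N -> solvable_at (N - k) by move=> /(_ N (leqnn N)); rewrite subnn.
elim=> [_|k IH kN].
  rewrite subn0 => mu' mu amu' mumu mua.
  have [C C0 H] := resolvent_high p1 a0 amu' mumu mua rN S0.
  exists C => // l s h g M [ls sS sr _] hh ag gE gM.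
  exact: (H l s h g M).
apply: solvable_step; rewrite -subSn// subSS; exact: IH (ltnW kN).
Qed.

(* The constant is uniform over all the admissible [l]: this is what gives
   equicontinuity of the resolvents. *)
Lemma resolvent_bound mu' mu : a < mu' -> mu' < mu -> mu <= a + 1 ->
  exists2 C, 0 <= C & forall l s g M, admissible l s -> analytic_disc g ->
    (bergman_norm p mu' g <= M%:E)%E ->
    exists f, [/\ analytic_disc f, l *: (f : R[i] -> R[i]^o) - cesaro f = g &
      (bergman_norm p mu f <= (C * M)%:E)%E].
Proof.
move=> amu' mumu mua; have [C C0 H] := solvable0 amu' mumu mua.
exists C => // l s g M ls ag gM; apply: (H l s g) => //; first exact: analytic_disc_hol.
by move=> z _; rewrite expr0 mul1r.
Qed.

End Descent.

(** * Uniqueness and eigenfunctions *)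

Section Uniqueness.
Variable R : realType.
Implicit Types (f g H y h q u v : R[i] -> R[i]) (k n j m : nat) (t x : R).
Implicit Types (z w c l s b : R[i]).
Local Notation cesaro := (@Defs.cesaro R).

Lemma continuous_eq_at0 u v :
  {for 0, continuous (u : R[i]^o -> R[i]^o)} -> {for 0, continuous (v : R[i]^o -> R[i]^o)} ->
  (forall z, z != 0 -> normc z < 1 -> u z = v z) -> u 0 = v 0.
Proof.
move=> /cvgC_epsP cu /cvgC_epsP cv uv; apply/eqP; rewrite -subr_eq0 -normc_eq0.
apply/negPn/negP => n0.
have e0 : 0 < normc (u 0 - v 0) / 2 by rewrite divr_gt0// lt_neqAle eq_sym n0 normc_ge0.
have [d1 d10 H1] := cu _ e0; have [d2 d20 H2] := cv _ e0.
pose d := Num.min (Num.min d1 d2) 1 / 2.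
have d0 : 0 < d by rewrite divr_gt0// !lt_min d10 d20 ltr01.
have [dd1 dd2 dd] : [/\ d < d1, d < d2 & d < 1].
  have e1 : Num.min (Num.min d1 d2) 1 <= d1 by rewrite !ge_min lexx.
  have e2 : Num.min (Num.min d1 d2) 1 <= d2 by rewrite !ge_min lexx orbT.
  have e3 : Num.min (Num.min d1 d2) 1 <= 1 by rewrite ge_min lexx orbT.
  by rewrite /d; split; lra.
have nd : normc d%:C = d by rewrite normc_real gtr0_norm.
have dn : d%:C != 0 :> R[i] by rewrite -normc_eq0 nd gt_eqF.
have := H1 d%:C; have := H2 d%:C; rewrite !add0r nd => /(_ dd2) h2 /(_ dd1) h1.
have E := uv d%:C dn; rewrite nd in E.
have D : normc (u 0 - v 0) <= normc (u d%:C - u 0) + normc (v d%:C - v 0).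
  rewrite -(normcB (u 0)); have -> : u 0 - v 0 = (u 0 - u d%:C) + (v d%:C - v 0).
    by rewrite E//; ring.
  exact: le_normcD.
lra.
Qed.

Lemma cderiv_eq_continuous f : hol f ->
  {for 0, continuous ((fun z => z * cD f z) : R[i]^o -> R[i]^o)}.
Proof.
move=> hf; have n0 : normc (0 : R[i]) < 1 by rewrite normc0.
apply: continuousCM; last exact: cD_continuous.
exact: (hol_continuous (@hol_id R) n0).
Qed.

(* Repeatedly dividing by [z] raises the order of vanishing at [0] as long as
   the exponent [c] is not the current order. *)
Lemma euler_factor c n y u : hol y -> hol u ->
  (forall z, normc z < 1 -> z * cD y z = c * y z + z ^+ n * u z) ->
  forall j, (j <= n)%N -> (forall i, (i < j)%N -> c != i%:R) ->
  exists2 h, hol h & (forall z, normc z < 1 -> y z = z ^+ j * h z) /\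
    (forall z, normc z < 1 -> z * cD h z = (c - j%:R) * h z + z ^+ (n - j) * u z).
Proof.
move=> hy hu E; have n0 : normc (0 : R[i]) < 1 by rewrite normc0.
elim=> [_ _|j IH jn cj].
  exists y => //; split=> z z1; first by rewrite expr0 mul1r.
  by rewrite subr0 subn0 E.
have [h hh [yE hE]] := IH (ltnW jn) (fun i ij => cj i (ltn_trans ij (ltnSn j))).
have h0 : h 0 = 0.
  have := hE 0 n0; rewrite mul0r expr0n subn_eq0 leqNgt jn /= mul0r addr0 => /esym/eqP.
  by rewrite mulf_eq0 subr_eq0 (negPf (cj j (ltnSn j))) => /eqP.
have [h1 hh1 h1E] := hol_div hh; rewrite h0 in h1E.
exists h1 => //; split=> z z1; first by rewrite yE// h1E// add0r exprSr mulrA.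
have hr : hol (fun z => (c - j.+1%:R) * h1 z + z ^+ (n - j.+1) * u z).
  by apply: holD; apply: holM => //; [exact: hol_cst|exact: holX].
have off w : w != 0 -> normc w < 1 ->
    w * cD h1 w = (c - j.+1%:R) * h1 w + w ^+ (n - j.+1) * u w.
  move=> w0 w1; have := hE w w1.
  have -> : cD h w = h1 w + w * cD h1 w.
    have e1 (x : R[i]) : normc x < 1 -> h x = x * h1 x by move=> x1; rewrite h1E// add0r.
    rewrite (cD_eq e1 hh w1) (cDP (cderivM (cderiv_id w) (hol_cD hh1 w1))).
    by rewrite mul1r.
  rewrite h1E// add0r -(subnSK jn) exprS => K; apply: (mulfI w0).
  rewrite (_ : j.+1%:R = j%:R + 1); last by rewrite -addn1 natrD.
  transitivity (w * (h1 w + w * cD h1 w) - w * h1 w); first by ring.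
  by rewrite K; ring.
have [->|z0] := eqVneq z 0; last exact: off.
apply: (continuous_eq_at0 (cderiv_eq_continuous hh1) (hol_continuous hr n0) off).
Qed.

(** A solution is divisible by every [z^N]. For [N] large the quotient [h] satisfies
    [z h' + (N - c) h = 0] with real part of [N - c] above 1, and [radial_euler] represents [h] as
    the integral of 0. *)
Lemma euler_homogeneous c y : hol y ->
  (forall z, normc z < 1 -> z * cD y z = c * y z) -> (forall n, c != n%:R) ->
  forall z, normc z < 1 -> y z = 0.
Proof.
move=> hy E cn z z1.
have r0 : 0 <= `|complex.Re c| + 1 by rewrite addr_ge0.
have rN := archi_boundP r0; set N := Num.bound _ in rN.
have E0 w : normc w < 1 -> w * cD y w = c * y w + w ^+ N * 0.
  by move=> w1; rewrite mulr0 addr0 E.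
have [h hh [yE hE]] := euler_factor hy (@hol_cst R 0) E0 (leqnn N) (fun i _ => cn i).
rewrite yE//.
have c1 : 1 < complex.Re (N%:R - c).
  have -> : complex.Re (N%:R - c) = N%:R - complex.Re c.
    have -> : N%:R = (N%:R : R)%:C :> R[i] by rewrite rmorph_nat.
    by case: (c).
  by have := ler_norm (complex.Re c); lra.
rewrite -(radial_euler (euler_pow_kernel c1) hh z1).
rewrite (@radial_eq _ _ _ (fun=> 0) _ _ z1) => [|w w1]; last first.
  by rewrite hE// mulr0 addr0; ring.
rewrite /radial (@cint_eq _ _ _ _ (fun=> 0)) => [|t _]; last by rewrite mulr0.
by rewrite cint_cst// !mulr0.
Qed.

(** The division stops at the resonant order [n], where the quotient satisfies [z h' = 0] and is
    therefore constant. *)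
Lemma euler_homogeneous_nat n y : hol y ->
  (forall z, normc z < 1 -> z * cD y z = n%:R * y z) ->
  exists b, forall z, normc z < 1 -> y z = b * z ^+ n.
Proof.
move=> hy E.
have E0 w : normc w < 1 -> w * cD y w = n%:R * y w + w ^+ n * 0.
  by move=> w1; rewrite mulr0 addr0 E.
have ni i : (i < n)%N -> n%:R != i%:R :> R[i] by move=> i_n; rewrite eqr_nat gtn_eqF.
have [h hh [yE hE]] := euler_factor hy (@hol_cst R 0) E0 (leqnn n) ni.
have n0 : normc (0 : R[i]) < 1 by rewrite normc0.
have off w : w != 0 -> normc w < 1 -> cD h w = 0.
  move=> w0 w1; have := hE w w1; rewrite subrr mul0r mulr0 addr0 => /eqP.
  by rewrite mulf_eq0 (negPf w0) => /eqP.
have D0 w : normc w < 1 -> cD h w = 0.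
  move=> w1; have [->|w0] := eqVneq w 0; last exact: off.
  exact: (continuous_eq_at0 (cD_continuous hh n0) (hol_continuous (@hol_cst R 0) n0) off).
by exists (h 0) => z z1; rewrite yE// (hol_const hh D0 z1) mulrC.
Qed.

Lemma cD_cst c z : cD (fun=> c) z = 0.
Proof. exact/cDP/cderiv_cst. Qed.

(* Multiplying by [(1 - z) `^ (1 / l)] turns the resolvent equation into an
   equation of Euler type. *)
Lemma resolvent_euler l s f g : l * s = 1 -> analytic_disc f -> analytic_disc g ->
  l *: (f : R[i] -> R[i]^o) - cesaro f = g -> forall z, normc z < 1 ->
  z * cD (fun w => f w * pow1B s w) z =
  (s - 1) * (f z * pow1B s z) + s * (z * cD g z + g z) * pow1B s z.
Proof.
move=> ls af ag /(resolvent_eqP l af ag) E z z1; have {}E := E z z1.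
have hf := analytic_disc_hol af; have z10 := normc_lt1_1B z1.
rewrite (cDP (cderivM (hol_cD hf z1) (cderiv_pow1B s z1))).
have K : z * cD f z = s * (f z / (1 - z)) - f z + s * (z * cD g z + g z).
  by rewrite -E; transitivity ((l * s) * (z * cD f z)); [rewrite ls mul1r|
    transitivity ((l * s) * (z * cD f z + f z) - f z); [rewrite ls; ring|ring]].
transitivity ((z * cD f z) * pow1B s z - s * (z / (1 - z)) * f z * pow1B s z); first by ring.
by rewrite K; field.
Qed.

Lemma cesaro_kernel0 f : analytic_disc f ->
  (0 : R[i]) *: (f : R[i] -> R[i]^o) - cesaro f = 0 -> f = (fun=> 0).
Proof.
move=> af E; have a0 := @analytic_disc0 R.
apply: analytic_disc_eq => // z z1.
have := (resolvent_eqP 0 af a0).1 E z z1.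
rewrite (_ : cD 0 z = 0); last exact: cD_cst.
rewrite !mul0r !subr0 mulr0 addr0 => /esym/eqP.
by rewrite mulf_eq0 invr_eq0 (negPf (normc_lt1_1B z1)) orbF => /eqP.
Qed.

Lemma kernel_euler l s f : l * s = 1 -> analytic_disc f ->
  l *: (f : R[i] -> R[i]^o) - cesaro f = 0 -> forall z, normc z < 1 ->
  z * cD (fun w => f w * pow1B s w) z = (s - 1) * (f z * pow1B s z).
Proof.
move=> ls af E z z1; rewrite (resolvent_euler ls af (@analytic_disc0 R) E z1).
rewrite (_ : cD 0 z = 0); last exact: cD_cst.
by rewrite mulr0 addr0 mulr0 mul0r addr0.
Qed.

Lemma cesaro_injective l f : (forall m : nat, l != m.+1%:R^-1) -> analytic_disc f ->
  l *: (f : R[i] -> R[i]^o) - cesaro f = 0 -> f = (fun=> 0).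
Proof.
move=> lm af E; have [l0|l0] := eqVneq l 0.
  by apply: cesaro_kernel0 => //; rewrite -[RHS]E l0.
have ls : l * l^-1 = 1 by rewrite mulfV.
have hf := analytic_disc_hol af.
have hy : hol (fun w => f w * pow1B l^-1 w) by apply: holM => //; exact: hol_pow1B.
have a0 := @analytic_disc0 R.
apply: analytic_disc_eq => // z z1.
have cn n : l^-1 - 1 != n%:R.
  apply/eqP => ln; have /negP := lm n; apply; apply/eqP.
  by rewrite -[LHS]invrK -addn1 natrD -ln subrK.
have /eqP := euler_homogeneous hy (kernel_euler ls af E) cn z1.
by rewrite mulf_eq0 (negPf (pow1B_neq0 _ _)) orbF => /eqP.
Qed.

Lemma cesaro_unique l (f g : R[i] -> R[i]^o) : (forall m : nat, l != m.+1%:R^-1) ->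
  analytic_disc f -> analytic_disc g ->
  l *: f - cesaro f = l *: g - cesaro g -> f = g.
Proof.
move=> lm af ag E.
have afd : analytic_disc ((-1 : R[i]) *: g + f) := analytic_discD (analytic_discZ (-1) ag) af.
have K : l *: ((-1 : R[i]) *: g + f) - cesaro ((-1 : R[i]) *: g + f) = 0.
  rewrite (cesaro_linear (-1) ag af) scalerDr scalerA mulrN1 !scaleN1r scaleNr.
  by rewrite opprD opprK addrACA E addrACA addNr add0r subrr.
have E0 := cesaro_injective lm afd K.
apply/funext => z; have := congr1 (fun u => u z) E0.
rewrite -[((-1 : R[i]) *: g + f) z]/(-1 * g z + f z) mulN1r => /eqP.
by rewrite addrC subr_eq0 => /eqP.
Qed.

Lemma cesaro_eigenspace m f : analytic_disc f ->
  (m.+1%:R^-1 : R[i]) *: (f : R[i] -> R[i]^o) - cesaro f = 0 ->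
  exists b, forall z, normc z < 1 -> f z = b * z ^+ m * pow1B (- m.+1%:R) z.
Proof.
move=> af E; have m0 : m.+1%:R != 0 :> R[i] by rewrite pnatr_eq0.
have ls : m.+1%:R^-1 * m.+1%:R = 1 :> R[i] by rewrite mulVf.
have hy : hol (fun w => f w * pow1B m.+1%:R w).
  by apply: holM; [exact: analytic_disc_hol|exact: hol_pow1B].
have K z : normc z < 1 -> z * cD (fun w => f w * pow1B m.+1%:R w) z =
    m%:R * (f z * pow1B m.+1%:R z).
  by move=> z1; rewrite (kernel_euler ls af E z1) -addn1 natrD addrK.
have [b bE] := euler_homogeneous_nat hy K.
by exists b => z z1; rewrite -bE// pow1BN mulfK// pow1B_neq0.
Qed.

Definition eigenfunction m : R[i] -> R[i]^o :=
  fun z => if normc z < 1 then z ^+ m * pow1B (- m.+1%:R) z else 0.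

Lemma hol_eigen m : hol (fun z => z ^+ m * pow1B (- m.+1%:R) z : R[i]).
Proof. by apply: holM; [exact: holX|exact: hol_pow1B]. Qed.

Lemma analytic_eigenfunction m : analytic_disc (eigenfunction m).
Proof. exact/hol_analytic_disc/hol_eigen. Qed.

Lemma cesaro_eigenfunction m :
  (m.+1%:R^-1 : R[i]) *: eigenfunction m - cesaro (eigenfunction m) = 0.
Proof.
have ae := analytic_eigenfunction m.
apply/(resolvent_eqP _ ae (@analytic_disc0 R)) => z z1.
rewrite (_ : cD 0 z = 0); last exact: cD_cst.
rewrite !subr0.
have eE w : normc w < 1 -> eigenfunction m w = w ^+ m * pow1B (- m.+1%:R) w.
  by rewrite /eigenfunction => ->.
rewrite (cD_eq eE (analytic_disc_hol ae) z1) eE//.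
rewrite (cDP (cderivM (cderivX m z) (cderiv_pow1B (- m.+1%:R) z1))).
have z10 := normc_lt1_1B z1; have m0 : m.+1%:R != 0 :> R[i] by rewrite pnatr_eq0.
have zN : z * (m%:R * z ^+ m.-1) = m%:R * z ^+ m.
  case: (m) => [|n]; first by rewrite !mul0r mulr0.
  by rewrite /= exprS mulrCA.
set P := pow1B _ z.
transitivity (m.+1%:R^-1 * ((z * (m%:R * z ^+ m.-1)) * P +
  z ^+ m * (m.+1%:R * (z / (1 - z)) * P) + z ^+ m * P)); first by ring.
have mE : m.+1%:R = m%:R + 1 :> R[i] by rewrite -addn1 natrD.
rewrite zN; move: m0; rewrite mE => m0; field.
by rewrite m0 z10.
Qed.

Lemma pow1B_le_real (q x0 : R) z : normc z < 1 -> q <= x0 ->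
  normc (1 - z) `^ (- q) <= 2 `^ (x0 - q) * normc (1 - z) `^ (- x0).
Proof.
move=> z1 qx; have X0 := normc_1B_gt0 z1.
rewrite [X in _ `^ X <= _](_ : - q = (x0 - q) + - x0); last by ring.
rewrite -(powR_addE _ _ X0) ler_wpM2r ?powR_ge0//.
by apply: powR_mono; [exact: ltW|exact: normc_1B_le2|rewrite subr_ge0].
Qed.

Lemma eigenfunction_bergman p a m : 1 < p -> 0 < a -> m.+1%:R <= (2 + a) / p ->
  bergman_plus p a (eigenfunction m).
Proof.
move=> p1 a0 mr mu /= amu; split; first exact: analytic_eigenfunction.
pose E : R := expR (`|complex.Im (- m.+1%:R : R[i])| * (pi / 2)).
have E0 : 0 <= E by exact: expR_ge0.
apply: (@norm_singular R p a mu 1 (E * 2 `^ ((2 + a) / p - m.+1%:R))) => //.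
- exact: normr1.
- exact: analytic_eigenfunction.
- by rewrite mulr_ge0 ?powR_ge0.
move=> z z1; rewrite /eigenfunction z1 normcM.
apply: (@le_trans _ _ (1 * (E * normc (1 - z) `^ (- m.+1%:R)))).
  apply: ler_pM; rewrite ?normc_ge0//.
    by rewrite normcX exprn_ile1 ?normc_ge0// ltW.
  have -> : - m.+1%:R = complex.Re (- m.+1%:R : R[i]).
    have -> : m.+1%:R = (m.+1%:R : R)%:C :> R[i] by rewrite rmorph_nat.
    by [].
  exact: normc_pow1B_le.
by rewrite mul1r -mulrA ler_wpM2l//; exact: pow1B_le_real.
Qed.

Lemma eigenfunction_growth p a m f : 1 < p -> 0 < a -> bergman_plus p a f ->
  (m.+1%:R^-1 : R[i]) *: (f : R[i] -> R[i]^o) - cesaro f = 0 -> f <> (fun=> 0) ->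
  m.+1%:R <= (2 + a) / p.
Proof.
move=> p1 a0 fX fE f0.
have [af _] : bergman p (a + 1) f by apply: fX; rewrite /= ltrDl.
have [b bE] := cesaro_eigenspace af fE.
have b0 : b != 0.
  have a00 := @analytic_disc0 R.
  apply/eqP => b0; apply: f0; apply: analytic_disc_eq => // z z1.
  by rewrite bE// b0 !mul0r.
pose E : R := expR (- (`|complex.Im (- m.+1%:R : R[i])| * (pi / 2))).
have E0 : 0 < E by exact: expR_gt0.
(* On [[1/2, 1[] the factor [z ^+ m] is at least [2^-m], so the growth is that of
   [(1 - x)^(-m-1)]. *)
apply: (@bergman_growth R p a 2^-1 (normc b * 2^-1 ^+ m * E) _ 1 f) => //.
- by rewrite normc1.
- by rewrite mulr_gt0// mulr_gt0 ?normc_gt0// exprn_gt0// invr_gt0.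
- lra.
move=> x x2 x1; rewrite mulr1.
have nx : normc (x%:C : R[i]) = x by rewrite normc_real ger0_norm//; lra.
have x1' : normc (x%:C : R[i]) < 1 by rewrite nx.
rewrite bE// !normcM -[leLHS]mulrA; apply: ler_pM.
- by rewrite mulr_ge0 ?normc_ge0// exprn_ge0// invr_ge0.
- by rewrite mulr_ge0 ?powR_ge0// ltW.
- rewrite ler_wpM2l ?normc_ge0// normcX nx lerXn2r// ?nnegrE ?invr_ge0//; lra.
have := normc_pow1B_ge (- m.+1%:R) x1'.
have -> : complex.Re (- m.+1%:R : R[i]) = - m.+1%:R.
  have -> : m.+1%:R = (m.+1%:R : R)%:C :> R[i] by rewrite rmorph_nat.
  by [].
suff -> : normc (1 - x%:C : R[i]) = 1 - x by [].
by rewrite -[1]/(1%:C) -rmorphB normc_real gtr0_norm// subr_gt0.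
Qed.

End Uniqueness.

(** * Functions outside the range *)

Section Range.
Variable R : realType.
Implicit Types (f g H y h u v : R[i] -> R[i]) (k n j m : nat) (t x : R).
Implicit Types (z w c l s b : R[i]).
Local Notation cesaro := (@Defs.cesaro R).

Lemma normc_pow1B_real q z : normc z < 1 -> normc (pow1B q%:C z) = normc (1 - z) `^ q.
Proof.
move=> z1; apply/eqP; rewrite eq_le.
have := normc_pow1B_ge q%:C z1; have := normc_pow1B_le q%:C z1.
by rewrite /= normr0 mul0r oppr0 expR0 !mul1r => -> ->.
Qed.

Lemma bounded_bergman p a (A : R) f : 1 < p -> 0 < a -> analytic_disc f -> 0 <= A ->
  (forall z, normc z < 1 -> normc (f z) <= A) -> bergman_plus p a f.
Proof.
move=> p1 a0 af A0 fA mu /= amu; split=> //.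
exact: (norm_bounded p1 (lt_trans a0 amu) af A0 fA).
Qed.

Lemma bergman_plus_analytic p a f : bergman_plus p a f -> analytic_disc f.
Proof. by move=> /(_ (a + 1)); rewrite /= ltrDl ltr01 => /(_ isT)[]. Qed.

(* [(1 + z) `^ (- r)], with [r = (2 + a) / p], belongs to the space, but its
   preimage [(1 - z) (z g)'] is of size [|1 + z| `^ (- r - 1)] at [-1]. *)
Lemma cesaro_not_surjective p a : 1 < p -> 0 < a -> exists2 g : R[i] -> R[i]^o,
  bergman_plus p a g & forall f : R[i] -> R[i]^o, bergman_plus p a f -> (0 : R[i]) *: f - cesaro f <> g.
Proof.
move=> p1 a0; have p0 : 0 < p by apply: lt_trans p1.
have [r rE] : exists r, r = (2 + a) / p by exists ((2 + a) / p).
have r0 : 0 < r by rewrite rE divr_gt0// addr_gt0.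
pose s : R[i] := (- r)%:C.
pose g0 z := pow1B s (- z).
have dg z : normc z < 1 -> cderiv g0 z (- 1 * (- s * (1 - - z)^-1 * pow1B s (- z))).
  move=> z1; apply: (cderiv_comp (cderivN (cderiv_id z))).
  by apply: cderiv_pow1B; rewrite normcN.
have hg0 : hol g0 by move=> z z1; eexists; exact: dg.
pose g : R[i] -> R[i]^o := fun z => if normc z < 1 then g0 z else 0.
have ag : analytic_disc g := hol_analytic_disc hg0.
have gE z : normc z < 1 -> g z = g0 z by rewrite /g => ->.
exists g.
  move=> mu /= amu; split=> //.
  apply: (@norm_singular R p a mu (-1) 1) => //; first by rewrite normrN1.
  move=> z z1; rewrite gE// mul1r /g0 normc_pow1B_real ?normcN// -rE.
  have -> : (-1)%:C - z = - (1 - - z) by rewrite rmorphN rmorph1 /=; ring.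
  by rewrite normcN.
move=> f fX /(resolvent_eqP 0 (bergman_plus_analytic fX) ag) E.
have hg := analytic_disc_hol ag.
have fE z : normc z < 1 -> f z = - ((1 - z) * (z * cD g z + g z)).
  move=> z1; have z10 := normc_lt1_1B z1.
  have := E z z1; rewrite !mul0r !sub0r mulrN -opprD => K.
  by rewrite -mulrN K mulrC divfK.
suff : r + 1 <= (2 + a) / p by rewrite -rE; lra.
apply: (@bergman_growth R p a 2^-1 (r / 2) _ (-1) f) => //; rewrite ?normcN ?normc1//.
- by rewrite divr_gt0.
- lra.
move=> x x2 x1; rewrite mulrN1.
have nx : normc (- x%:C : R[i]) < 1 by rewrite normcN normc_real ger0_norm//; lra.
have d0 : 0 < 1 - x by rewrite subr_gt0.
rewrite fE// (cD_eq gE hg nx) (cDP (dg _ nx)) gE// /g0 opprK.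
have E1 : 1 - x%:C = (1 - x)%:C :> R[i] by rewrite rmorphB rmorph1.
have xn : (1 - x)%:C != 0 :> R[i] by rewrite -normc_eq0 normc_real gtr0_norm// gt_eqF.
have -> : (1 + x%:C) * (- x%:C * (-1 * (- s * (1 - x%:C)^-1 * pow1B s x%:C)) + pow1B s x%:C) =
    (((1 + x) * (1 - x + r * x)) / (1 - x))%:C * pow1B s x%:C.
  rewrite /s rmorphM fmorphV rmorphM !rmorphD /= !rmorphN rmorphM !rmorph1 /=.
  move: xn; rewrite rmorphB rmorph1 /= => xn; field; exact: xn.
rewrite normcN normcM normc_real normc_pow1B_real; last by rewrite -normcN.
rewrite E1 normc_real (gtr0_norm d0).
have -> : - (r + 1) = - r + -1 by ring.
rewrite -powR_addE// powR_inv1 ?(ltW d0)//.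
have rx : r / 2 <= (1 + x) * (1 - x + r * x) by nra.
have rx0 : 0 <= (1 + x) * (1 - x + r * x) by apply: le_trans rx; rewrite divr_ge0 ?ltW.
rewrite ger0_norm; last by rewrite divr_ge0// ltW.
rewrite [leRHS](_ : _ = (1 + x) * (1 - x + r * x) * ((1 - x) `^ (- r) / (1 - x))); last by ring.
by rewrite ler_wpM2r// divr_ge0 ?powR_ge0 ?ltW.
Qed.

(** Resonance: after multiplication by [(1 - z)^(m+1)] the exponent of the Euler equation is the
    order [m] of its right side. Divided by [z^m], the equation at 0 reads [0 = (m+1)^2]. This
    settles the points [1/(m+1)] of the tangent disc. *)
Lemma monomial_not_range m f : analytic_disc f ->
  (m.+1%:R^-1 : R[i]) *: (f : R[i] -> R[i]^o) - cesaro f <> @monomial R m.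
Proof.
move=> af E; have n0 : normc (0 : R[i]) < 1 by rewrite normc0.
have m0 : m.+1%:R != 0 :> R[i] by rewrite pnatr_eq0.
have ls : m.+1%:R^-1 * m.+1%:R = 1 :> R[i] by rewrite mulVf.
have am := @analytic_monomial R m.
pose u z := m.+1%:R ^+ 2 * pow1B m.+1%:R z.
have hu : hol u by apply: holM; [exact: hol_cst|exact: hol_pow1B].
have hy : hol (fun w => f w * pow1B m.+1%:R w).
  by apply: holM; [exact: analytic_disc_hol|exact: hol_pow1B].
have mE w : normc w < 1 -> @monomial R m w = w ^+ m by rewrite /monomial => ->.
have K z : normc z < 1 -> z * cD (fun w => f w * pow1B m.+1%:R w) z =
    m%:R * (f z * pow1B m.+1%:R z) + z ^+ m * u z.
  move=> z1; rewrite (resolvent_euler ls af am E z1) (cD_eq mE (analytic_disc_hol am) z1) mE//.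
  have zN : z * (m%:R * z ^+ m.-1) = m%:R * z ^+ m.
    case: (m) => [|n]; first by rewrite !mul0r mulr0.
    by rewrite /= exprS mulrCA.
  rewrite (cDP (cderivX m z)) zN /u (_ : m.+1%:R = m%:R + 1); last by rewrite -addn1 natrD.
  by ring.
have mi i : (i < m)%N -> m%:R != i%:R :> R[i] by move=> im; rewrite eqr_nat gtn_eqF.
have [h hh [_ hE]] := euler_factor hy hu K (leqnn m) mi.
have := hE 0 n0; rewrite mul0r subrr mul0r add0r subnn expr0 mul1r /u pow1B_at0 mulr1.
by move/esym/eqP; rewrite expf_eq0 /= (negPf m0).
Qed.

(* The recursion [q_{k+1,c} = q_{k,c} - z q_{k,c+1}] solves
   [z q' + c q = (1 - z)^k] and yields [q_{k,c}(1) = k! / (c (c+1) ... (c+k))]. *)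
Lemma euler_power_solution k c : (forall n, c + n%:R != 0) ->
  exists q : R[i] -> R[i], [/\ forall z, exists l, cderiv q z l,
    forall z, z * cD q z + c * q z = (1 - z) ^+ k &
    q 1 = k`!%:R / \prod_(j < k.+1) (c + j%:R)].
Proof.
elim: k c => [|k IH] c cn.
  have c0 : c != 0 by rewrite -[c]addr0 (cn 0%N).
  exists (fun=> c^-1); split=> [z|z|].
  - by exists 0; exact: cderiv_cst.
  - by rewrite cD_cst mulr0 add0r mulfV.
  - by rewrite big_ord_recl big_ord0 mulr1 addr0 mul1r.
have [q1 [d1 e1 v1]] := IH c cn.
have cn1 n : c + 1 + n%:R != 0.
  have -> : c + 1 + n%:R = c + n.+1%:R by rewrite -addn1 natrD; ring.
  exact: cn.
have [q2 [d2 e2 v2]] := IH (c + 1) cn1.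
have D z : cderiv (fun w => q1 w - w * q2 w) z (cD q1 z - (1 * q2 z + z * cD q2 z)).
  have [l1 l1E] := d1 z; have [l2 l2E] := d2 z.
  by rewrite (cDP l1E) (cDP l2E); apply: cderivB => //; apply: cderivM => //; exact: cderiv_id.
exists (fun w => q1 w - w * q2 w); split=> [z|z|].
- by eexists; exact: D.
- rewrite (cDP (D z)) exprS mulrBl mul1r -{1}(e1 z) -(e2 z); ring.
rewrite v1 v2 mul1r.
pose A : R[i] := \prod_(j < k) (c + 1 + j%:R).
have shift n : \prod_(j < n.+1) (c + j%:R) = c * \prod_(j < n) (c + 1 + j%:R).
  rewrite big_ord_recl addr0; congr (_ * _); apply: eq_bigr => j _.
  by rewrite /= /bump /= natrD addrA.
rewrite !shift big_ord_recr /= -/A.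
have A0 : A != 0 by apply/prodf_neq0 => j _; exact: cn1.
have c0 : c != 0 by rewrite -[c]addr0 (cn 0%N).
have ck := cn1 k.
rewrite factS natrM (_ : k.+1%:R = k%:R + 1); last by rewrite -addn1 natrD.
by field; rewrite c0 A0 ck.
Qed.

Lemma cderiv_continuous_near q b : {for b, continuous (q : R[i]^o -> R[i]^o)} -> q b != 0 ->
  exists2 d : R, 0 < d &
    forall z, normc z < d -> normc (q b) / 2 <= normc (q (b + z)).
Proof.
move=> /cvgC_epsP cq qb; have e0 : 0 < normc (q b) / 2 by rewrite divr_gt0// normc_gt0.
have [d d0 H] := cq _ e0; exists d => // z /H hd.
by have := le_normcB (q b) (q b - q (b + z)); rewrite opprB addrCA subrr addr0 normcB; lra.
Qed.

(** The right side is determined by [(z g)' = l (1 - z)^(k-s)], which turns the equation for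
    [f = (1 - z)^(-s) q] into [z q' + (1 - s) q = (1 - z)^k]. Uniqueness of the preimage among
    analytic functions transfers the growth of this [f] to any solution in the space. *)
Lemma cesaro_not_surjective_disc p a l s : 1 < p -> 0 < a -> l * s = 1 ->
  (forall m : nat, l != m.+1%:R^-1) -> (2 + a) / p < complex.Re s ->
  exists2 g : R[i] -> R[i]^o, bergman_plus p a g &
    forall f : R[i] -> R[i]^o, bergman_plus p a f -> l *: f - cesaro f <> g.
Proof.
move=> p1 a0 ls lm rs; have p0 : 0 < p by apply: lt_trans p1.
have s0 : s != 0 by apply/eqP => s0; move/eqP: ls; rewrite s0 mulr0 eq_sym oner_eq0.
have k0 : 0 <= `|complex.Re s| by [].
have kN := archi_boundP k0; set k := Num.bound _ in kN.
(* This makes [(1 - z)^(k-s)], and with it [g], bounded. *)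
have sk : complex.Re s < k%:R by apply: le_lt_trans kN; exact: ler_norm.
have cn n : 1 - s + n%:R != 0.
  apply/eqP => E; have /negP := lm n; apply.
  have -> : n.+1%:R = s by rewrite -addn1 natrD -[RHS](subrK (1 + n%:R)) -[s - _]opprB -[LHS]add0r -oppr0 -E; ring.
  by rewrite -[l]mulr1 -(mulfV s0) mulrA ls mul1r.
have [q [dq qE q1E]] := euler_power_solution k cn.
have q1n : q 1 != 0.
  rewrite q1E; apply: mulf_neq0; first by rewrite pnatr_eq0 -lt0n fact_gt0.
  by rewrite invr_eq0; apply/prodf_neq0 => j _; exact: cn.
have hq : hol q by move=> z _; exact: dq.
pose F z := pow1B (- s) z * q z.
have hF : hol F by apply: holM => //; exact: hol_pow1B.
pose f1 : R[i] -> R[i]^o := fun z => if normc z < 1 then F z else 0.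
have af1 : analytic_disc f1 := hol_analytic_disc hF.
have f1E z : normc z < 1 -> f1 z = F z by rewrite /f1 => ->.
(* [W] is the prescribed value of [(z g)']; the radial integral with constant kernel recovers [g]
   from it. *)
pose W z := l * pow1B (k%:R - s) z.
have hW : hol W by apply: holM; [exact: hol_cst|exact: hol_pow1B].
have [ck _ _] := @euler_kernel1 R.
pose G := radial (fun=> 1) W.
have hG : hol G by exact: hol_radial.
pose g : R[i] -> R[i]^o := fun z => if normc z < 1 then G z else 0.
have ag : analytic_disc g := hol_analytic_disc hG.
have gE z : normc z < 1 -> g z = G z by rewrite /g => ->.
have f1g : l *: f1 - cesaro f1 = g.
  apply/resolvent_eqP => // z z1; have z10 := normc_lt1_1B z1.
  have dF := cderivM (cderiv_pow1B (- s) z1) (hol_cD hq z1).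
  rewrite (cD_eq f1E (analytic_disc_hol af1) z1) (cD_eq gE (analytic_disc_hol ag) z1).
  rewrite (cDP dF) f1E// gE//.
  have KG := radial_solves (@euler_kernel1 R) hW z1; rewrite -/G mul1r in KG.
  have KW : W z = l * ((1 - z) ^+ k * pow1B (- s) z) by rewrite /W pow1BnD.
  have Kq : z * cD q z = (1 - z) ^+ k - (1 - s) * q z by rewrite -(qE z) addrK.
  rewrite /F; set P := pow1B _ z in KW *.
  transitivity (l * (s * (z / (1 - z)) * P * q z + P * (z * cD q z) + P * q z) -
    (z * cD G z + G z)); first by ring.
  rewrite KG KW Kq.
  transitivity ((l * s) * ((z / (1 - z) + 1) * P * q z)); first by ring.
  by rewrite ls mul1r; field.
have gX : bergman_plus p a g.
  pose E := expR (`|complex.Im (k%:R - s)| * (pi / 2)) * 2 `^ complex.Re (k%:R - s).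
  have E0 : 0 <= normc l * E by rewrite mulr_ge0 ?normc_ge0// mulr_ge0 ?powR_ge0// expR_ge0.
  apply: (bounded_bergman p1 a0 ag E0) => z z1; rewrite gE// /G /radial.
  have cW : ccont 0 1 (fun t => 1 * W (t%:C * z)) := ccontM ck (hol_ccont_ray hW z1).
  apply: le_trans (normc_cint_bound ler01 cW (M := normc l * E) _) _; last first.
    by rewrite subr0 mul1r.
  move=> t t01; have tz1 := ray_disc t01 z1.
  rewrite mul1r /W normcM ler_wpM2l ?normc_ge0//.
  apply: le_trans (normc_pow1B_le _ tz1) _; rewrite ler_wpM2l ?expR_ge0//.
  apply: powR_mono; [exact: normc_ge0|exact: normc_1B_le2|].
  have -> : complex.Re (k%:R - s) = k%:R - complex.Re s.
    have -> : k%:R = (k%:R : R)%:C :> R[i] by rewrite rmorph_nat.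
    by case: (s).
  by rewrite subr_ge0 ltW.
exists g => // f fX fg.
have af := bergman_plus_analytic fX.
have ff1 : f = f1 := cesaro_unique lm af af1 (etrans fg (esym f1g)).
have dq1 : {for 1, continuous (q : R[i]^o -> R[i]^o)}.
  by have [l1 l1E] := dq 1; exact: cderiv_continuous l1E.
have [d d0 Hd] := cderiv_continuous_near dq1 q1n.
(* Beyond [x0] the point [x] is within [d] of 1, so [|q x|] is at least [|q 1| / 2]. *)
pose x0 := Num.max 0 (1 - d / 2).
have x01 : x0 < 1 by rewrite gt_max ltr01 /=; lra.
have x00 : 0 <= x0 by rewrite le_max lexx.
pose E := expR (- (`|complex.Im (- s)| * (pi / 2))).
have E0 : 0 < E by exact: expR_gt0.
suff : complex.Re s <= (2 + a) / p by lra.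
apply: (@bergman_growth R p a x0 (E * (normc (q 1) / 2)) _ 1 f) => //.
- by rewrite normc1.
- by rewrite mulr_gt0// divr_gt0// normc_gt0.
move=> x xx x1; rewrite mulr1 ff1.
have xd : 1 - d / 2 <= x by apply: le_trans xx; rewrite le_max lexx orbT.
have x0' : 0 <= x by apply: le_trans xx.
have nx : normc (x%:C : R[i]) < 1 by rewrite normc_real ger0_norm.
rewrite f1E// /F normcM mulrAC; apply: ler_pM.
- by rewrite mulr_ge0 ?powR_ge0// ltW.
- by rewrite divr_ge0 ?normc_ge0.
- have := normc_pow1B_ge (- s) nx.
  have -> : complex.Re (- s) = - complex.Re s by case: (s).
  suff -> : normc (1 - x%:C : R[i]) = 1 - x by [].
  by rewrite -[1]/(1%:C) -rmorphB normc_real gtr0_norm// subr_gt0.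
have := Hd (x%:C - 1); rewrite [1 + _]addrC subrK; apply.
by rewrite normcB -[1]/(1%:C) -rmorphB normc_real gtr0_norm; lra.
Qed.

End Range.

(** * Spectra *)

Section Spectrum.
Variables (R : realType) (p a : R) (p1 : 1 < p).
Hypothesis a0 : 0 < a.
Local Notation X := (bergman_space a p1).
Local Notation T := (@cesaro_op R p a p1 : X -> X).
Local Notation cesaro := (@Defs.cesaro R).
Local Notation r := ((2 + a) / p).
Local Notation q := (@bergman_seminorm R p a p1).
Implicit Types (l s : R[i]) (x y g : X).

Let p0 : 0 < p. Proof. exact: lt_trans p1. Qed.
Let r0 : 0 < r. Proof. by rewrite divr_gt0// addr_gt0. Qed.
Let idx (n : nat) : R := a + n.+1%:R^-1.

Let a_idx n : a < idx n. Proof. by rewrite /idx ltrDl invr_gt0. Qed.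
Let idxS n : idx n.+1 < idx n.
Proof. by rewrite /idx ltrD2l ltf_pV2 ?posrE// ltr_nat. Qed.
Let idx1 n : idx n <= a + 1.
Proof. by rewrite /idx lerD2l invf_le1// ler1n. Qed.

Lemma bergman_spaceP x : bergman_plus p a (bergman_fun x).
Proof. by have := bergman_funP x; rewrite inE. Qed.

Lemma bergman_space_analytic x : analytic_disc (bergman_fun x).
Proof. exact: bergman_plus_analytic (bergman_spaceP x). Qed.

Lemma bergman_seminormE n x : bergman_norm p (a + n.+1%:R^-1) (bergman_fun x) = (q n x)%:E.
Proof.
rewrite /bergman_seminorm fineK// ge0_fin_numE ?bergman_norm_ge0//.
by have [] := bergman_spaceP x (a_idx n).
Qed.

Lemma bergman_plusI (f : R[i] -> R[i]^o) : analytic_disc f ->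
  (forall mu, a < mu -> mu <= a + 1 -> (bergman_norm p mu f < +oo)%E) ->
  bergman_plus p a f.
Proof.
move=> af H mu /= amu; split=> //; have [mua|mua] := leP mu (a + 1); first exact: H.
apply: le_lt_trans (norm_mono p0 _ (ltW mua) af) (H (a + 1) _ _) => //.
  by rewrite addr_ge0// ltW.
by rewrite ltrDl.
Qed.

Lemma cesaro_bergman_plus (f : R[i] -> R[i]^o) : bergman_plus p a f -> bergman_plus p a (cesaro f).
Proof.
move=> fX; have af := bergman_plus_analytic fX.
apply: bergman_plusI; first exact: cesaro_analytic (analytic_disc_hol af).
move=> mu amu mua; pose mu' := (a + mu) / 2.
have m1 : a < mu' by rewrite /mu'; lra.
have m2 : mu' < mu by rewrite /mu'; lra.
have [C C0 H] := cesaro_bound p1 a0 m1 m2 mua.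
have [M M0 fM] := norm_fine_le (proj2 (fX _ m1)).
by apply: le_lt_trans (H f M af fM) _; rewrite ltry.
Qed.

Lemma cesaro_opE x : bergman_fun (T x) = cesaro (bergman_fun x).
Proof.
rewrite /cesaro_op /insubd insubT.
  by rewrite inE; exact: cesaro_bergman_plus (bergman_spaceP x).
by [].
Qed.

Lemma bergman_fun_inj x y : bergman_fun x = bergman_fun y -> x = y.
Proof. exact: val_inj. Qed.

Lemma resolvent_opE l x :
  bergman_fun (l *: x - T x) = l *: bergman_fun x - cesaro (bergman_fun x).
Proof. by rewrite -cesaro_opE. Qed.

Lemma cesaro_op_linear : linear T.
Proof.
move=> c x y; apply: bergman_fun_inj.
rewrite cesaro_opE -[bergman_fun (c *: x + y)]/(c *: bergman_fun x + bergman_fun y).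
rewrite cesaro_linear; [|exact: bergman_space_analytic|exact: bergman_space_analytic].
by rewrite -!cesaro_opE.
Qed.

Definition to_space (f : R[i] -> R[i]^o) (fX : bergman_plus p a f) : X :=
  BergmanSpace p1 (mem_set fX).

Lemma to_spaceE f fX : bergman_fun (@to_space f fX) = f.
Proof. by []. Qed.

(** Estimates that lose one index still control the seminorms up to [n] by those up to [n.+1]. The
    radius depends only on the constants, so the same lemma gives continuity of one operator and
    equicontinuity of a family. *)
Lemma seminorm_dominated (C : nat -> R) (n : nat) (e : R) : (forall i, 0 <= C i) -> 0 < e ->
  exists2 d, 0 < d & forall x y, (forall i, (i <= n.+1)%N -> q i x < d) ->
    (forall i, q i y <= C i * q i.+1 x) -> forall i, (i <= n)%N -> q i y < e.
Proof.
move=> C0 e0; pose K := \sum_(i < n.+1) C i + 1.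
have K0 : 0 < K by rewrite ltr_wpDl// sumr_ge0.
exists (e / K); first by rewrite divr_gt0.
move=> x y xd yC i i_n; apply: le_lt_trans (yC i) _.
have CK : C i < K.
  rewrite /K (bigD1 (Ordinal (i_n : (i < n.+1)%N)))//= -addrA ltrDl.
  by rewrite ltr_wpDl// sumr_ge0.
have q0 := @seminorm_ge0 R X q (@bergman_seminormD R p a p1) (@bergman_seminormZ R p a p1) i.+1 x.
have xi := xd i.+1 (i_n : (i.+1 <= n.+1)%N).
apply: (@le_lt_trans _ _ (K * q i.+1 x)); first by rewrite ler_wpM2r// ltW.
by rewrite mulrC -ltr_pdivlMr.
Qed.

Lemma linear_subE (S : X -> X) : linear S -> forall x y, S x - S y = S (x - y).
Proof.
move=> lS x y; have -> : x - y = (-1 : R[i]) *: y + x by rewrite scaleN1r addrC.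
by rewrite lS scaleN1r addrC.
Qed.

Lemma dominated_continuous (S : X -> X) (C : nat -> R) : linear S -> (forall i, 0 <= C i) ->
  (forall x i, q i (S x) <= C i * q i.+1 x) -> continuous S.
Proof.
move=> lS C0 SC x A [n [e [e0 xA]]].
have [d d0 H] := seminorm_dominated n C0 e0.
exists n.+1, d; split=> // y xy; apply: xA => i i_n.
have -> : S y - S x = S (y - x) := linear_subE lS y x.
exact: (H (y - x)).
Qed.

(** * Resolvents with uniform estimates *)

Section Admissible.
Variables (S d : R).
Hypotheses (S0 : 0 <= S) (d0 : 0 < d).

Lemma admissible_neq l s : admissible p a S d l s -> forall m : nat, l != m.+1%:R^-1.
Proof.
move=> [_ _ _ H] m; apply/eqP => lm; have := H m.
by rewrite lm subrr normc0 leNgt d0.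
Qed.

(** For each exponent [mu] the estimate yields a solution of finite norm; all these solutions
    coincide by uniqueness among analytic functions, so the common one belongs to the intersection
    of the spaces. *)
Lemma resolvent_solves l s g : admissible p a S d l s -> exists x, l *: x - T x = g.
Proof.
move=> ls; have lm := admissible_neq ls; have ag := bergman_space_analytic g.
have sol mu : a < mu -> mu <= a + 1 -> exists f : R[i] -> R[i]^o, [/\ analytic_disc f,
    l *: f - cesaro f = bergman_fun g & (bergman_norm p mu f < +oo)%E].
  move=> amu mua; pose mu' := (a + mu) / 2.
  have m1 : a < mu' by rewrite /mu'; lra.
  have m2 : mu' < mu by rewrite /mu'; lra.
  have [C C0 H] := resolvent_bound p1 a0 S0 d0 m1 m2 mua.
  have [M M0 gM] := norm_fine_le (proj2 (bergman_spaceP g m1)).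
  have [f [af fg fM]] := H l s (bergman_fun g) M ls ag gM.
  by exists f; split=> //; apply: le_lt_trans fM _; rewrite ltry.
have aa1 : a < a + 1 by rewrite ltrDl.
have [f [af fg _]] := sol (a + 1) aa1 (lexx _).
have fX : bergman_plus p a f.
  apply: bergman_plusI => // mu amu mua; have [f' [af' fg' fM']] := sol mu amu mua.
  by have -> := cesaro_unique lm af af' (etrans fg (esym fg')).
by exists (to_space fX); apply: bergman_fun_inj; rewrite resolvent_opE.
Qed.

(** The loss from [mu'] to [mu] is the passage from one exponent [a + 1/(n+1)] to the preceding one.
    The constants are chosen before [l], uniformly over the admissible points. *)
Lemma resolvent_seminorm : exists C : nat -> R, (forall i, 0 <= C i) /\
  forall l s x g, admissible p a S d l s -> l *: x - T x = g ->
  forall i, q i x <= C i * q i.+1 g.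
Proof.
have H i : exists C : R, 0 <= C /\ forall l s x g, admissible p a S d l s ->
    l *: x - T x = g -> q i x <= C * q i.+1 g.
  have [C C0 H] := resolvent_bound p1 a0 S0 d0 (a_idx i.+1) (idxS i) (idx1 i).
  exists C; split=> // l s x g ls xg.
  have ax := bergman_space_analytic x; have ag := bergman_space_analytic g.
  have gM : (bergman_norm p (idx i.+1) (bergman_fun g) <= (q i.+1 g)%:E)%E.
    by rewrite bergman_seminormE.
  have [f [af fg fM]] := H l s (bergman_fun g) _ ls ag gM.
  rewrite -lee_fin -bergman_seminormE.
  have E : l *: bergman_fun x - cesaro (bergman_fun x) = l *: f - cesaro f.
    by rewrite -resolvent_opE xg fg.
  by have -> := cesaro_unique (admissible_neq ls) ax af E.
have [C HC] := choice H.
exists C; split=> [i|l s x g ls xg i]; first by have [] := HC i.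
by have [_ HCi] := HC i; exact: (HCi l s x g ls xg).
Qed.

Lemma admissible_resolvent l s : admissible p a S d l s -> resolvent_set T l.
Proof.
move=> ls; have lm := admissible_neq ls.
pose U g := projT1 (cid (resolvent_solves g ls)).
have UE g : l *: U g - T (U g) = g by rewrite /U; case: cid.
have inj x y : l *: x - T x = l *: y - T y -> x = y.
  move=> xy; apply: bergman_fun_inj; apply: (cesaro_unique lm).
  - exact: bergman_space_analytic.
  - exact: bergman_space_analytic.
  - by rewrite -!resolvent_opE xy.
have lU : linear U.
  move=> c x y; apply: inj; rewrite UE cesaro_op_linear scalerDr opprD addrACA.
  by rewrite scalerA mulrC -scalerA -scalerBr !UE.
have [C [C0 HC]] := resolvent_seminorm.
exists U; split=> //; last by move=> x; apply: inj; rewrite UE.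
by split=> //; apply: (dominated_continuous lU C0) => x i; exact: (HC l s).
Qed.

Lemma admissible_equicontinuous (P : R[i] -> Prop) :
  (forall l, P l -> exists s, admissible p a S d l s) ->
  equicontinuous_set [set U | exists2 l, P l & is_resolvent T l U].
Proof.
move=> PH x E [V [[n [e [e0 eV]]] VE]].
have [C [C0 HC]] := resolvent_seminorm.
have [e' e'0 H] := seminorm_dominated n C0 e0.
exists n.+1, e'; split=> // y xy U [l lP [[lU _] UE _]].
have [s ls] := PH l lP.
apply: set_mem; apply: VE; apply: mem_set; apply: eV => i i_n /=.
have -> : U x - U y - 0 = U (x - y) := etrans (subr0 _) (linear_subE lU x y).
apply: (H (x - y) _ _ _ i i_n) => [j jn|j].
  by rewrite -[x - y]opprB (seminormN (@bergman_seminormZ R p a p1)); exact: xy.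
exact: (HC l s).
Qed.

End Admissible.

Lemma eigen_not_injective (m : nat) : m.+1%:R <= r -> point_spectrum T (m.+1%:R^-1 : R[i]).
Proof.
move=> mr inj; have eX := eigenfunction_bergman p1 a0 mr.
pose x := to_space eX.
have T0 : T 0 = 0.
  by have := linear_subE cesaro_op_linear 0 0; rewrite !subrr.
have E0 : (m.+1%:R^-1 : R[i]) *: (0 : X) - T 0 = 0 by rewrite T0 scaler0 subr0.
have E1 : (m.+1%:R^-1 : R[i]) *: x - T x = 0.
  apply: bergman_fun_inj; rewrite resolvent_opE.
  have -> : bergman_fun x = @eigenfunction R m by [].
  transitivity (0 : R[i] -> R[i]^o); last by [].
  exact: cesaro_eigenfunction.
(* The eigenfunction is nonzero at 1/2; at 0 it would vanish for [m > 0]. *)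
have := congr1 (fun u : X => bergman_fun u (2^-1)%:C) (inj _ _ (etrans E1 (esym E0))).
rewrite to_spaceE /eigenfunction.
have n2 : normc ((2^-1)%:C : R[i]) = 2^-1 by rewrite normc_real ger0_norm// invr_ge0.
rewrite n2 ifT; last by lra.
move/eqP; rewrite -[bergman_fun 0 _]/(0 : R[i]) mulf_eq0 (negPf (pow1B_neq0 _ _)) orbF.
by rewrite expf_eq0 -normc_eq0 n2 invr_eq0 pnatr_eq0 andbF.
Qed.

Lemma point_spectrum_eigen l : point_spectrum T l ->
  exists2 m : nat, m.+1%:R <= r & l = m.+1%:R^-1.
Proof.
move=> ninj; apply: contrapT => H; apply: ninj => x y xy.
pose f := bergman_fun (x - y).
have af : analytic_disc f by exact: bergman_space_analytic.
have fE : l *: f - cesaro f = 0.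
  rewrite /f -resolvent_opE.
  have -> : l *: (x - y) - T (x - y) = (l *: x - T x) - (l *: y - T y).
    by rewrite -(linear_subE cesaro_op_linear) scalerBr !opprD !opprK addrACA.
  by rewrite xy subrr.
have f0 : f = (fun=> 0).
  have [lm|] := pselect (forall m : nat, l != m.+1%:R^-1); first exact: cesaro_injective fE.
  move=> /existsNP[m /negP]; rewrite negbK => /eqP lm.
  have [f0|f0] := pselect (f = (fun=> 0)); first exact: f0.
  exfalso; apply: H; exists m; last exact: lm.
  rewrite lm in fE.
  exact: (eigenfunction_growth p1 a0 (bergman_spaceP (x - y)) fE f0).
by apply/subr0_eq/bergman_fun_inj.
Qed.

(** Inversion sends the disc to a half-plane: squared and expanded, the condition reads
    [r |l|^2 < Re l], where [Re l / |l|^2] is the real part of [1 / l]. *)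
Lemma tangent_discE l : l != 0 -> tangent_disc r l <-> r < complex.Re l^-1.
Proof.
move=> l0; pose k := (2 * r)^-1.
have k0 : 0 < k by rewrite invr_gt0 mulr_gt0.
have -> : tangent_disc r l <-> normc (l - k%:C) < k.
  by rewrite /tangent_disc /= normr_normc ltcR.
have N0 : 0 < normc l ^+ 2 by rewrite exprn_gt0// normc_gt0.
have -> : (normc (l - k%:C) < k) = (normc (l - k%:C) ^+ 2 < k ^+ 2).
  by rewrite ltr_pXn2r// nnegrE ?normc_ge0// ltW.
move: N0; case: (l) => x y.
rewrite (_ : x +i* y - k%:C = (x - k) +i* y); last by simpc.
rewrite !normcE /= => N0; rewrite (ltr_pdivlMr _ x N0).
have kr : k * (2 * r) = 1 by rewrite /k mulVf// gt_eqF// mulr_gt0.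
have -> : ((x - k) ^+ 2 + y ^+ 2 < k ^+ 2) = (x ^+ 2 + y ^+ 2 < k * (2 * x)).
  by apply/idP/idP; rewrite !expr2; lra.
have -> : (x ^+ 2 + y ^+ 2 < k * (2 * x)) = (2 * r * (x ^+ 2 + y ^+ 2) < 2 * r * (k * (2 * x))).
  by rewrite ltr_pM2l// mulr_gt0.
have -> : 2 * r * (k * (2 * x)) = 2 * x by rewrite mulrCA [LHS]mulrA kr mul1r.
by split; lra.
Qed.

Lemma zero_notin_tangent_disc : ~ tangent_disc r 0.
Proof.
rewrite /tangent_disc /= sub0r normrN normr_normc normc_real.
by rewrite ger0_norm ?ltxx// invr_ge0 mulr_ge0// ltW.
Qed.

(** All but finitely many [1/(j+1)] are at most [|l| / 2], hence at distance at least [|l| / 2] from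
    [l]; the others contribute a finite minimum. *)
Lemma inverse_naturals_far l : l != 0 -> (forall m : nat, l != m.+1%:R^-1) ->
  exists2 d : R, 0 < d & forall j : nat, d <= normc (l - j.+1%:R^-1).
Proof.
move=> l0 lm; have nl : 0 < normc l by rewrite normc_gt0.
have h0 : 0 <= 2 / normc l by rewrite divr_ge0// ltW.
have hN := archi_boundP h0; set N := Num.bound _ in hN.
pose D (j : 'I_N) := normc (l - j.+1%:R^-1).
exists (\big[Num.min/(normc l / 2)]_(j < N) D j).
  apply: lt_bigmin => [|j _]; first by rewrite divr_gt0.
  by rewrite /D normc_gt0 subr_eq0.
move=> j; have [jN|Nj] := ltnP j N.
  exact: (bigmin_le (normc l / 2) (Ordinal jN) D).
apply: (@le_trans _ _ (normc l / 2)); first exact: bigmin_le_id.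
have jl : j.+1%:R^-1 <= normc l / 2.
  rewrite -[leRHS]invrK lef_pV2 ?posrE ?invr_gt0 ?divr_gt0// invf_div.
  apply: le_trans (ltW hN) _; rewrite ler_nat; exact: leq_trans Nj (leqnSn j).
apply: le_trans (le_normcB _ _); rewrite normc_natr_inv lerBrDr.
by rewrite [leRHS]splitr lerD2l.
Qed.

Lemma spectrum_sub : spectrum T `<=` [set 0] `|` tangent_disc r `|` point_spectrum T.
Proof.
move=> l lT; apply: contrapT => H; apply: lT.
have l0 : l != 0 by apply/eqP => l0; apply: H; left; left.
have lr : complex.Re l^-1 <= r.
  by rewrite leNgt; apply/negP => /(tangent_discE l0).2 lD; apply: H; left; right.
have ls : l * l^-1 = 1 by rewrite mulfV.
have lm (m : nat) : l != m.+1%:R^-1.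
  apply/eqP => lm; apply: H; right; rewrite lm; apply: eigen_not_injective.
  by move: lr; rewrite lm invrK Re_natr.
have [d d0 Hd] := inverse_naturals_far l0 lm.
exact: (@admissible_resolvent (normc l^-1) d (normc_ge0 _) d0 l l^-1).
Qed.

Lemma not_surjective_spectrum l (g : R[i] -> R[i]^o) : bergman_plus p a g ->
  (forall f : R[i] -> R[i]^o, bergman_plus p a f -> l *: f - cesaro f <> g) -> spectrum T l.
Proof.
move=> gX H [U [_ UE _]]; apply: (H _ (bergman_spaceP (U (to_space gX)))).
by rewrite -resolvent_opE UE.
Qed.

Lemma zero_spectrum : spectrum T 0.
Proof.
have [g gX H] := cesaro_not_surjective p1 a0.
exact: not_surjective_spectrum gX H.
Qed.

Lemma tangent_disc_spectrum l : tangent_disc r l -> spectrum T l.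
Proof.
move=> lD; have l0 : l != 0.
  by apply/eqP => l0; apply: zero_notin_tangent_disc; rewrite -l0.
have ls : l * l^-1 = 1 by rewrite mulfV.
have lr := (tangent_discE l0).1 lD.
have [lm|] := pselect (forall m : nat, l != m.+1%:R^-1).
  have [g gX H] := cesaro_not_surjective_disc p1 a0 ls lm lr.
  exact: not_surjective_spectrum gX H.
move=> /existsNP[m /negP]; rewrite negbK => /eqP lm; rewrite lm.
have mX : bergman_plus p a (@monomial R m).
  refine (bounded_bergman p1 a0 (@analytic_monomial R m) ler01 _) => z z1.
  by rewrite /monomial z1 normcX exprn_ile1 ?normc_ge0// ltW.
apply: (not_surjective_spectrum mX) => f fX.
exact: monomial_not_range (bergman_plus_analytic fX).
Qed.

Lemma point_spectrum_spectrum : point_spectrum T `<=` spectrum T.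
Proof.
move=> l ninj [U [_ _ UE]]; apply: ninj => x y xy.
exact: etrans (esym (UE x)) (etrans (congr1 U xy) (UE y)).
Qed.

Lemma spectrumE : spectrum T = [set 0] `|` tangent_disc r `|` point_spectrum T.
Proof.
apply/seteqP; split; first exact: spectrum_sub.
move=> l [[->|]|]; [exact: zero_spectrum|exact: tangent_disc_spectrum|].
exact: point_spectrum_spectrum.
Qed.

(** [1/(m+1)] is an eigenvalue if [m + 1 <= r] and lies in the tangent disc otherwise. Distance from
    the spectrum therefore bounds the distance from all these points. *)
Lemma inverse_natural_spectrum (m : nat) : spectrum T (m.+1%:R^-1 : R[i]).
Proof.
have [mr|rm] := leP (m.+1%:R : R) r.
  exact/point_spectrum_spectrum/eigen_not_injective.
apply: tangent_disc_spectrum; apply/tangent_discE; first by rewrite invr_eq0 pnatr_eq0.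
by rewrite invrK Re_natr.
Qed.

(** * The Waelbroeck spectrum *)

Lemma ballE (l m : R[i]) (d : R) : ball (l : R[i]^o) d%:C m <-> normc (l - m) < d.
Proof. by rewrite -ball_normE /= normr_normc ltcR. Qed.

(** Around a point outside the closure, 0, the tangent disc and all [1/(j+1)] stay at a positive
    distance because they belong to the spectrum. A whole ball is then admissible with common
    parameters. Conversely, a ball of resolvent points does not meet the spectrum. *)
Lemma waelbroeck_spectrumE : waelbroeck_spectrum T = closure (spectrum T).
Proof.
apply/seteqP; split=> l.
  move=> lW; apply: contrapT => /existsNP[A /not_implyP[/nbhs_ballP[e /= e0 eA] nA]].
  apply: lW.
  have eE : e = (complex.Re e)%:C by rewrite RRe_real// gtr0_real.
  set e1 := complex.Re e in eE; rewrite eE ltcR in e0.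
  have far m : spectrum T m -> e1 <= normc (l - m).
    move=> mT; rewrite leNgt; apply/negP => lm; apply: nA; exists m; split=> //.
    by apply: eA; rewrite eE; apply/ballE.
  (* The ball of radius [e1] misses the spectrum; in the ball of half the radius the distance to the
     spectrum is at least [e1 / 2]. *)
  have e20 : 0 < e1 / 2 by rewrite divr_gt0.
  have adm m : ball (l : R[i]^o) (e1 / 2)%:C m ->
      admissible p a (e1 / 2)^-1 (e1 / 2) m m^-1.
    move=> /ballE lm.
    have far2 k : spectrum T k -> e1 / 2 <= normc (m - k).
      move=> /far lk; have := le_normcD (l - m) (m - k).
      by rewrite addrA subrK; lra.
    have m0 : m != 0.
      apply/eqP => m0; have := far2 0 zero_spectrum.
      by rewrite m0 subrr normc0 leNgt e20.
    split.
    - by rewrite mulfV.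
    - rewrite normcV lef_pV2 ?posrE ?normc_gt0//.
      by have := far2 0 zero_spectrum; rewrite subr0.
    - rewrite leNgt; apply/negP => /(tangent_discE m0).2/tangent_disc_spectrum/far2.
      by rewrite subrr normc0 leNgt e20.
    - by move=> j; exact/far2/inverse_natural_spectrum.
  have S0 : 0 <= (e1 / 2)^-1 by rewrite invr_ge0 ltW.
  exists (e1 / 2); split=> //.
    by move=> m /adm; exact: admissible_resolvent.
  by apply: (admissible_equicontinuous S0 e20) => m /adm ma; exists m^-1.
move=> lC [d [d0 dr _]].
have : nbhs (l : R[i]^o) (ball (l : R[i]^o) d%:C) by apply: nbhsx_ballx; rewrite ltcR.
by move=> /lC[m [mT /dr]].
Qed.

End Spectrum.

Theorem theorem2p5 (R : realType) (p alpha : R)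
    (p1 : 1 < p) (alpha0 : 0 < alpha) :
  let C : bergman_space alpha p1 -> bergman_space alpha p1 :=
    @cesaro_op R p alpha p1 in
  [/\ [set l : R[i]^o | exists m : nat,
        [/\ (0 < m)%N, m%:R < (2 + alpha) / p & l = m%:R^-1]]
        `<=` point_spectrum C,
      point_spectrum C `<=`
        [set l : R[i]^o | exists m : nat,
          [/\ (0 < m)%N, m%:R <= (2 + alpha) / p & l = m%:R^-1]],
      spectrum C =
        [set 0] `|` tangent_disc ((2 + alpha) / p) `|` point_spectrum C &
      waelbroeck_spectrum C = closure (spectrum C)].
Proof.
move=> C; split.
- move=> l [[|m] [//_ mr ->]].
  by apply: eigen_not_injective => //; exact: ltW.
- move=> l /(point_spectrum_eigen alpha0)[m mr ->]; exists m.+1; by split.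
- exact: spectrumE.
- exact: waelbroeck_spectrumE.
Qed.
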